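(* Let $\eta<\xi$ be real numbers, $I=[\eta,\xi]$, and let $f:I\to\mathbb{R}$ be twice differentiable with $f''$ continuous and bounded away from $0$ on $I$. Suppose $0<\theta<1$ and $f''\in \mathrm{Lip}_\theta([\eta,\xi])$. Fix $\varepsilon>0$. For $Q\ge 1$ and $0<\delta<1/2$ define $$N(Q,\delta) := \#\{ (a,q)\in\mathbb{Z}\times\mathbb{N} : 1\le q\le Q,\ \eta q<a\le \xi q,\ \|qf(a/q)\|<\delta\}.$$ Then for $Q$ sufficiently large and all $\delta$ with $Q^{-\frac{1+\theta}{3-\theta}+\varepsilon}\le \delta<1/2$, $$N(Q,\delta)=(\xi-\eta)\delta Q^2+F(Q,\delta),$$ where, writing $T(Q)=Q^{\frac{1-2\theta}{2-\theta}}(\log Q)^{-\frac{5-\theta}{2-\theta}}$, $$F(Q,\delta)\ll \begin{cases} \delta^{2/3}Q^{5/3}(\log Q)^{2/3} & \text{if } \delta\gg T(Q),\\ \delta^{\frac{2}{5-\theta}}Q^{\frac{3(3-\theta)}{5-\theta}} & \text{if } \delta\ll T(Q),\end{cases}$$ with implied constants depending only on $f,\eta,\xi,\theta,\varepsilon$.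
   Context: For real $x$, $\|x\|=\min_{m\in\mathbb{Z}}|x-m|$. $f''\in\mathrm{Lip}_\theta([\eta,\xi])$ means there is a constant $C$ with $|f''(x)-f''(y)|\le C|x-y|^\theta$ for all $x,y\in[\eta,\xi]$. The notation $A\ll B$ (equivalently $B\gg A$) means $|A|\le cB$ for a constant $c>0$. *)

(* Defs.v *)
From HB Require Import structures.
From mathcomp Require Import all_boot all_order all_algebra.
From mathcomp Require Import finmap.
From mathcomp Require Import all_classical all_reals all_analysis.
Set Implicit Arguments.
Unset Strict Implicit.
Unset Printing Implicit Defensive.
Import Order.TTheory GRing.Theory Num.Theory.
Import numFieldNormedType.Exports.
Local Open Scope classical_set_scope.
Local Open Scope ring_scope.

(* [inf] is the minimum here: see [dist_int_min] below. *)
Definition dist_int (R : realType) (x : R) : R :=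
  inf (range (fun m : int => `|x - m%:~R|)).

(* The difference quotient only sees points of [D], so at an endpoint of a
   closed interval this is the one-sided derivative, and the values of [f]
   outside [D] play no role. *)
Definition is_derivative_on (R : realType) (D : set R) (f f' : R -> R) : Prop :=
  forall x, D x ->
    (f y - f x) / (y - x) @[y --> within D (dnbhs x)] --> f' x.

Definition Lip (R : realType) (theta : R) (D : set R) (g : R -> R) : Prop :=
  exists C : R, forall x y, D x -> D y -> `|g x - g y| <= C * `|x - y| `^ theta.

Definition bounded_away_from0 (R : realType) (D : set R) (g : R -> R) : Prop :=
  exists2 m : R, 0 < m & forall x, D x -> m <= `|g x|.

Definition near_curve (R : realType) (eta xi : R) (f : R -> R) (Q delta : R) :
    set (int * nat) :=
  [set p | let a : R := p.1%:~R in let q : R := p.2%:R in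
    [/\ (1 <= p.2)%N, q <= Q, eta * q < a, a <= xi * q
      & dist_int (q * f (a / q)) < delta]].

(* [fset_set] is meaningful because of [finite_near_curve] below. *)
Definition count_near_curve (R : realType) (eta xi : R) (f : R -> R)
    (Q delta : R) : nat :=
  #|` fset_set (near_curve eta xi f Q delta) |%fset.

Definition error_near_curve (R : realType) (eta xi : R) (f : R -> R)
    (Q delta : R) : R :=
  (count_near_curve eta xi f Q delta)%:R - (xi - eta) * delta * Q ^+ 2.

Definition threshold (R : realType) (theta Q : R) : R :=
  Q `^ ((1 - 2 * theta) / (2 - theta))
    * ln Q `^ (- ((5 - theta) / (2 - theta))).

Lemma dist_int_min (R : realType) (x : R) :
  (exists m : int, dist_int x = `|x - m%:~R|)
  /\ (forall m : int, dist_int x <= `|x - m%:~R|).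
Proof.
have lb : has_lbound (range (fun m : int => `|x - m%:~R|)).
  by exists 0 => _ [m _ <-].
have le m : dist_int x <= `|x - m%:~R| by apply: ge_inf => //; exists m.
split => //.
pose k := Num.floor x.
have [k1 k2] : k%:~R <= x /\ x < k%:~R + 1.
  by split; [exact: floor_le | rewrite -intrD1 floorD1_gt].
have [r rE] : exists r : int, forall m : int, `|x - r%:~R| <= `|x - m%:~R|.
  have far (m : int) : x - k%:~R <= `|x - m%:~R| \/ k%:~R + 1 - x <= `|x - m%:~R|.
    have [mk|km] := leP m k.
      left; apply: le_trans (ler_norm _).
      by rewrite lerB// ler_int.
    right; rewrite distrC; apply: le_trans (ler_norm _).
    by rewrite lerB// -intrD1 ler_int lezD1.
  have e1 : `|x - k%:~R| = x - k%:~R by rewrite ger0_norm// subr_ge0.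
  have e2 : `|x - (k + 1)%:~R| = k%:~R + 1 - x.
    by rewrite distrC intrD ger0_norm// subr_ge0 ltW.
  have [c|c] := leP (x - k%:~R) (k%:~R + 1 - x).
    exists k => m; rewrite e1; case: (far m) => // h; exact: le_trans c h.
  exists (k + 1) => m; rewrite e2; case: (far m) => // h.
  exact: le_trans (ltW c) h.
exists r; apply/eqP; rewrite eq_le le /=.
apply: lb_le_inf; first by exists `|x - 0%:~R|, 0.
by move=> _ [m _ <-].
Qed.

Lemma finite_near_curve (R : realType) (eta xi : R) (f : R -> R) (Q delta : R) :
  finite_set (near_curve eta xi f Q delta).
Proof.
pose n := Num.bound Q; pose m := Num.bound ((`|eta| + `|xi|) * `|Q|).
apply: (@sub_finite_set _ _
  (((Posz @` `I_m) `|` ((fun i => - Posz i) @` `I_m)) `*` `I_n)); last first.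
  apply: finite_setX => //.
  by rewrite finite_setU; split; apply: finite_image; exact: finite_II.
case=> a q [/= q1 qQ ea ax _].
have Q0 : 0 <= Q by apply: le_trans qQ.
have qn : (q < n)%N.
  by rewrite -(ltr_nat R); apply: (le_lt_trans qQ); exact: archi_boundP.
have aB : `|a%:~R| <= (`|eta| + `|xi|) * `|Q| :> R.
  apply: (@le_trans _ _ ((`|eta| + `|xi|) * q%:R)); last first.
    by rewrite ler_wpM2l ?addr_ge0// (le_trans qQ)// ler_norm.
  rewrite ler_norml; apply/andP; split.
    apply: le_trans (ltW ea); rewrite -mulNr ler_wpM2r//.
    by rewrite lerNl (@le_trans _ _ `|eta|) ?lerDl// -normrN ler_norm.
  apply: (le_trans ax); rewrite ler_wpM2r//.
  by rewrite (le_trans (ler_norm _))// lerDr.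
have am : (absz a < m)%N.
  rewrite -(ltr_nat R) natr_absz intr_norm.
  by apply: (le_lt_trans aB); apply: archi_boundP; rewrite mulr_ge0 ?addr_ge0.
split => //=.
have [a0|a0] := leP 0 a.
  by left; exists (absz a) => //=; rewrite gez0_abs.
by right; exists (absz a) => //=; rewrite ltz0_abs// opprK.
Qed.

(* Main.v *)
Require Import Defs.
From HB Require Import structures.
From mathcomp Require Import all_boot all_order all_algebra.
From mathcomp Require Import finmap.
From mathcomp Require Import all_classical all_reals all_analysis.
From mathcomp Require Import ring lra zify.
Set Implicit Arguments.
Unset Strict Implicit.
Unset Printing Implicit Defensive.
Import Order.TTheory GRing.Theory Num.Theory.
Import numFieldNormedType.Exports.
Local Open Scope classical_set_scope.
Local Open Scope ring_scope.

(** Call q f(a/q) the height of the pair (a, q). There are P pairs with q <= Q and a/q in (eta, xi],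
    where P is about (xi - eta) Q^2 / 2, and N(Q, delta) counts the heights within delta of an
    integer. The expected number is 2 delta P, which is the main term, so the theorem is a
    discrepancy estimate for the heights.

    Discrepancy. Smoothing the indicator with a Jackson kernel of degree about 2J
    ([discrepancy_bound]) bounds the error by P / J plus delta times the sum over 1 <= j < 2J of
    |[cossum] j|, where [cossum] j is the sum of cos(2 pi j q f(a/q)).

    Exponential sums. Poisson summation in a produces the phases j f(x) - l x. Away from the
    stationary point x = G(l/j) one integrates by parts, near it one estimates trivially, and the
    sum over q is carried out inside. The result ([expsum_bound]) is sqrt(Q/j) times the sum of
    min(Q, 1/||j F(l/j)||) over the relevant l, plus Q sqrt(Q/j) + Q log Q, where F is the Legendre
    transform of f and G = F' inverts f'. All of this takes place on a finite mesh: sums replace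
    integrals, and the mesh is refined until its error is negligible. What remains is to count
    fractions l/j whose dual height j F(l/j) is close to an integer.

    Counting at very small distance. If D H^(1+c) is small, then O(H log H) fractions of denominator
    at most H have height within D of an integer ([small_count]). Three rational points close
    together near a curve lie on a line. A rational line with two such points on the same side of
    its tangency abscissa is itself a rational point very near the dual curve, of smaller
    denominator. An induction over dyadic denominators, alternating between a curve and its dual,
    then closes ([prim_count_ex]).

    Counting in general. For every gam > 0 the number is O(D H^2 + H^(1+gam)) ([pair_bound_ex]), by
    strong induction on H. The discrepancy and exponential sum bounds, applied at scale H with J
    about 1/(2D), involve only dual denominators below H, and the exponent improves from 1 + gam to
    1 + 3 gam / 4, which absorbs the constants. Both counts together show that the weights min(Q,
    1/||j F(l/j)||), summed over denominators up to h <= Q^(1-c), amount to O(h Q log Q)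
    ([weight_linear]).

    Conclusion. The error becomes Q^2 / J + delta Q^(3/2) log Q sqrt J up to smaller terms. Taking J
    = Q^(1/3) (delta log Q)^(-2/3) yields delta^(2/3) Q^(5/3) (log Q)^(2/3) as soon as delta >=
    Q^(al-1) for a fixed al > 0 ([core_bound]). The range of the theorem is of this kind because
    (1+theta)/(3-theta) < 1. At delta = T(Q) the two expressions of the theorem coincide, and for
    delta at most a multiple of T(Q) the first is at most a multiple of the second
    ([threshold_case]).

    The function lives on a closed interval; up to sign it is convex there, and it is extended by
    parabolas to the whole line and paired with its Legendre transform ([curve_of_lip]). *)

Section DistInt.

(** * Distance to the nearest integer *)

Variable R : realType.
Implicit Types x y : R.

Lemma dist_int_le x (m : int) : dist_int x <= `|x - m%:~R|.
Proof. by case: (dist_int_min x). Qed.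

Lemma dist_int_ex x : exists m : int, dist_int x = `|x - m%:~R|.
Proof. by case: (dist_int_min x). Qed.

Lemma dist_int_ge0 x : 0 <= dist_int x.
Proof. by have [m ->] := dist_int_ex x. Qed.

Lemma dist_int_le_half x : dist_int x <= 1 / 2.
Proof.
have := dist_int_le x (Num.floor x).
have := dist_int_le x (Num.floor x + 1).
have := floor_le x; have := floorD1_gt x.
rewrite intrD; set z := (Num.floor x)%:~R => h1 h2.
by rewrite ler0_norm ?ger0_norm; lra.
Qed.

Lemma dist_int_lip x y : dist_int x <= dist_int y + `|x - y|.
Proof.
have [m ->] := dist_int_ex y; apply: le_trans (dist_int_le x m) _.
have -> : x - m%:~R = (y - m%:~R) + (x - y) by ring.
exact: ler_normD.
Qed.

Lemma dist_intN x : dist_int (- x) = dist_int x.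
Proof.
suff H y : dist_int (- y) <= dist_int y.
  by apply/le_anti; rewrite H -{1}[x]opprK H.
have [m ->] := dist_int_ex y.
by apply: le_trans (dist_int_le _ (- m)) _; rewrite rmorphN -opprD normrN.
Qed.

Lemma dist_intDz x (m : int) : dist_int (x + m%:~R) = dist_int x.
Proof.
suff H y n : dist_int (y + n%:~R) <= dist_int y.
  apply/le_anti; rewrite H /= -{1}[x](addrK m%:~R) -mulrNz; exact: H.
have [k ->] := dist_int_ex y.
apply: le_trans (dist_int_le _ (k + n)) _.
by rewrite intrD opprD addrACA subrr addr0.
Qed.

(** On the circle, a shortest arc from [a] to [b] leaves the arc [-d, d] through one of its two
    ends; [s] is that end, and distances add along the arc. *)
Lemma dist_int_cross (d a b : R) : dist_int a <= d -> d <= dist_int b ->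
  exists2 s, s = d \/ s = - d &
    dist_int (a - s) + dist_int (b - s) <= dist_int (a - b).
Proof.
have [m em] := dist_int_ex a; have [n en] := dist_int_ex (a - b).
set a' := a - m%:~R in em; set b' := b - (m - n)%:~R.
have eab : dist_int (a - b) = `|a' - b'|.
  by rewrite en /a' /b' intrD mulrNz; congr `| _ |; ring.
have db : dist_int b <= `|b'| by exact: dist_int_le.
rewrite em eab ler_norml => /andP[h1 h2] h3.
have ha s : dist_int (a - s) <= `|a' - s|.
  apply: le_trans (dist_int_le _ m) _; rewrite /a'.
  by rewrite addrAC.
have hb s : dist_int (b - s) <= `|b' - s|.
  by apply: le_trans (dist_int_le _ (m - n)) _; rewrite /b' addrAC.
have {}h3 := le_trans h3 db.
have d0 : 0 <= d by lra.
have [b0|b0] := leP 0 b'.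
  rewrite ger0_norm// in h3.
  exists d; first by left.
  apply: le_trans (lerD (ha d) (hb d)) _.
  by rewrite (@ler0_norm _ (a' - d))// ?(@ger0_norm _ (b' - d))// ?ler0_norm; lra.
rewrite ltr0_norm// in h3.
exists (- d); first by right.
apply: le_trans (lerD (ha _) (hb _)) _.
by rewrite (@ger0_norm _ (a' - - d))// ?(@ler0_norm _ (b' - - d))// ?ger0_norm; lra.
Qed.

Lemma int_leq1_dist (x y : int) : x != y -> 1 <= `|x%:~R - y%:~R| :> R.
Proof.
move=> xy; rewrite -intrB -intr_norm -[1]/(1%:~R) ler_int.
rewrite -gtz0_ge1 normr_gt0 subr_eq0 //.
Qed.

End DistInt.

(** * Comparison of sin(pi x) with the distance to the nearest integer *)

Section Trig.
Variable R : realType.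
Implicit Types x y : R.

Lemma sin_piDz x (m : int) : `|sin (pi * (x + m%:~R))| = `|sin (pi * x)|.
Proof.
have H y : `|sin (pi * (y + 1))| = `|sin (pi * y)|.
  by rewrite mulrDr mulr1 sinDpi normrN.
case: m => n.
  elim: n x => [|n IH] x; first by rewrite addr0.
  by rewrite -addn1 PoszD intrD addrA H IH.
rewrite NegzE mulrNz.
elim: n x => [|n IH] x; first by rewrite -H subrK.
have e : n.+2%:~R = n.+1%:~R + 1 :> R by rewrite -!pmulrn mulrSr.
rewrite -[RHS]IH -[LHS]H e; set z := n.+1%:~R.
by have -> : x - (z + 1) + 1 = x - z by ring.
Qed.

Lemma sin_MVT x y : x < y ->
  exists2 c, c \in `]x, y[ & sin y - sin x = cos c * (y - x).
Proof.
move=> xy; apply: MVT => //.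
by apply: continuous_subspaceT; exact: continuous_sin.
Qed.

Lemma sin_le_id x : 0 <= x -> sin x <= x.
Proof.
rewrite le_eqVlt => /predU1P[<-|x0]; first by rewrite sin0.
have [c _] := sin_MVT x0.
rewrite sin0 !subr0 => ->.
by rewrite ler_piMl ?cos_le1 // ltW.
Qed.

(** Duplication: with y = x/2 at most pi/4, sin x = 2 sin y cos y and sin y = y cos c for some c in
    (0, y); both cosines are at least cos(pi/4). *)
Lemma sin_ge_half x : 0 <= x -> x <= pi / 2 -> x / 2 <= sin x.
Proof.
move=> x0 xp.
have pi0 := pi_gt0 R.
have [->|xn0] := eqVneq x 0; first by rewrite mul0r sin0.
have xpos : 0 < x by rewrite lt_neqAle eq_sym xn0.
set y := x / 2.
have y0 : 0 < y by rewrite /y; lra.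
have yp : y <= pi / 4 by rewrite /y; lra.
have cd : {in `[0, pi] &, {mono cos : a b /~ a <= b :> R}}.
  by move=> a b ha hb; rewrite !leNgt ltr_cos.
have hc c : 0 <= c -> c <= y -> cos y <= cos c.
  move=> c0 cy; rewrite cd// in_itv /=; apply/andP; split; lra.
have [c /[!in_itv]/= /andP[c0 cy]] := sin_MVT y0.
rewrite sin0 !subr0 => e.
have c4 : cos (pi / 4) <= cos y :> R.
  rewrite cd// in_itv /=; apply/andP; split; lra.
have e4 : 2 * cos (pi / 4) ^+ 2 = 1 :> R.
  have := @cosD R (pi/4) (pi/4).
  have -> : pi / 4 + pi / 4 = pi / 2 :> R by lra.
  rewrite cos_pihalf => /esym h.
  have := cos2Dsin2 (pi/4 : R); rewrite !expr2; lra.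
have p4 : 0 <= cos (pi / 4) :> R.
  apply: cos_ge0_pihalf; rewrite ?in_itv /=; apply/andP; split; lra.
have -> : x = y + y by rewrite /y; lra.
rewrite sinD e.
have hcc := hc c (ltW c0) (ltW cy).
have : cos (pi/4) ^+ 2 <= cos c * cos y :> R.
  by rewrite expr2 ler_pM//; apply: le_trans hcc.
nra.
Qed.

Lemma dist_int_le_sin x : dist_int x <= `|sin (pi * x)|.
Proof.
have [m e] := dist_int_ex x; rewrite e.
have -> : x = (x - m%:~R) + m%:~R by rewrite subrK.
rewrite sin_piDz addrK.
have h : `|x - m%:~R| <= 1 / 2 by rewrite -e dist_int_le_half.
move: (x - m%:~R) h => y h.
have p2 : 2 <= pi :> R by exact: pi_ge2.
have aux (z : R) : 0 <= z -> z <= 1 / 2 -> z <= sin (pi * z).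
  move=> z0 z1; have : pi * z / 2 <= sin (pi * z) by apply: sin_ge_half; nra.
  by move=> h'; nra.
have [y0|y0] := leP 0 y.
  rewrite ger0_norm// in h *; apply: le_trans (aux _ y0 h) _; exact: ler_norm.
rewrite ltr0_norm// in h *; rewrite -normrN -sinN -mulrN.
by apply: le_trans (aux _ _ h) (ler_norm _); lra.
Qed.

Lemma sin_le_dist_int x : `|sin (pi * x)| <= pi * dist_int x.
Proof.
have [m e] := dist_int_ex x; rewrite e.
have -> : x = (x - m%:~R) + m%:~R by rewrite subrK.
rewrite sin_piDz addrK.
move: (x - m%:~R) => y {e}.
have p0 := pi_gt0 R.
have ys : `|sin (pi * y)| = `|sin (pi * `|y|)|.
  by have [y0|y0] := leP 0 y;
     [rewrite (ger0_norm y0)|rewrite (ltr0_norm y0) mulrN sinN normrN].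
rewrite ys.
have q0 : 0 <= pi * `|y| by rewrite mulr_ge0// ltW.
rewrite ler_norml; apply/andP; split; last exact: sin_le_id.
have [small|big] := leP (pi * `|y|) pi.
  by apply: le_trans (@sin_ge0_pi _ _ _); rewrite ?in_itv/= ?q0//; lra.
by have := sin_geN1 (pi * `|y|); have := pi_ge2 R; lra.
Qed.

End Trig.

(** * Sums of cosines along arithmetic progressions *)

Section CosSums.
Variable R : realType.
Implicit Types u y p : R.

Lemma sum_cos_telescope u p a b : (a <= b)%N ->
  2 * sin (pi * u) * (\sum_(a <= q < b) cos (2 * pi * q%:R * u + p)) =
  sin (2 * pi * b%:R * u - pi * u + p) - sin (2 * pi * a%:R * u - pi * u + p).
Proof.
move=> ab.
rewrite mulr_sumr -(telescope_sumr (fun q : nat => sin (2 * pi * q%:R * u - pi * u + p)))//.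
apply: eq_bigr => q _.
have -> : 2 * pi * q.+1%:R * u - pi * u + p = (2 * pi * q%:R * u + p) + pi * u.
  by rewrite -natr1; ring.
have -> : 2 * pi * q%:R * u - pi * u + p = (2 * pi * q%:R * u + p) - pi * u by ring.
by rewrite sinD sinB; ring.
Qed.

(** The telescoped sum is at most 1/|sin(pi u)|. The product form covers integral [u], where no such
    bound exists. *)
Lemma sum_cos_dist u p a b :
  `|\sum_(a <= q < b) cos (2 * pi * q%:R * u + p)| * dist_int u <= 1.
Proof.
have [ab|ba] := leqP a b; last by rewrite big_geq ?normr0 ?mul0r// ltnW.
have := congr1 (fun x => `|x|) (@sum_cos_telescope u p a b ab).
set S := \sum_(_ <= q < _) _; rewrite !normrM (@ger0_norm _ 2)// => e.
have : `|sin (2 * pi * b%:R * u - pi * u + p) - sin (2 * pi * a%:R * u - pi * u + p)| <= 2.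
  apply: le_trans (ler_normB _ _) _.
  by rewrite (_ : 2 = 1 + 1)// lerD// ler_norml sin_geN1 sin_le1.
rewrite -e => h.
have := dist_int_le_sin u; have := normr_ge0 S; have := dist_int_ge0 u.
nra.
Qed.

Lemma sum_cos_triv u p a b :
  `|\sum_(a <= q < b) cos (2 * pi * q%:R * u + p)| <= (b - a)%:R.
Proof.
apply: le_trans (ler_norm_sum _ _ _) _.
apply: (@le_trans _ _ (\sum_(a <= q < b) 1)).
  by apply: ler_sum => q _; rewrite ler_norml cos_geN1 cos_le1.
by rewrite big_const_nat iter_addr addr0.
Qed.

End CosSums.

(** * The Fejer kernel *)

Section Fejer.
Variable R : realType.
Implicit Types y w s : R.

(** The unnormalised Fejer kernel (sin(pi J y) / sin(pi y))^2, written as a sum of Dirichlet kernels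
    so that it also makes sense at integers. *)
Definition fejer (J : nat) y : R :=
  \sum_(i < J) (1 + 2 * \sum_(1 <= l < i.+1) cos (2 * pi * l%:R * y)).

Lemma fejer_closed J y :
  fejer J y * sin (pi * y) ^+ 2 = sin (pi * J%:R * y) ^+ 2.
Proof.
rewrite /fejer; elim: J => [|J IH].
  by rewrite big_ord0 mulr0 !mul0r sin0 expr0n.
rewrite big_ord_recr /= mulrDl IH.
have e := @sum_cos_telescope R y 0 1 J.+1 isT.
rewrite (eq_bigr (fun q : nat => cos (2 * pi * q%:R * y))) in e; last first.
  by move=> q _; rewrite addr0.
move: e; set S := \sum_(_ <= _ < _) _ => e.
have e1 : (1 + 2 * S) * sin (pi * y) = sin (pi * J%:R * y + pi * J.+1%:R * y).
  rewrite mulrDl mul1r mulrAC e !addr0.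
  have -> : 2 * pi * 1%:R * y - pi * y = pi * y by ring.
  by rewrite addrC subrK; congr sin; rewrite -natr1; ring.
have e2 : sin (pi * y) = sin (pi * J.+1%:R * y - pi * J%:R * y).
  by congr sin; rewrite -natr1; ring.
rewrite expr2 mulrA e1 e2 sinD sinB.
have := cos2Dsin2 (pi * J%:R * y); have := cos2Dsin2 (pi * J.+1%:R * y).
set c := cos _; set s := sin _; set c' := cos _; set s' := sin _ => h h'.
have ec : c ^+ 2 = 1 - s ^+ 2 by lra.
have ec' : c' ^+ 2 = 1 - s' ^+ 2 by lra.
have -> : s' * s' + (s' * c + c' * s) * (s * c' - c * s') =
  s' ^+ 2 + s ^+ 2 * c' ^+ 2 - c ^+ 2 * s' ^+ 2 by ring.
by rewrite ec ec'; ring.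
Qed.

Definition fejer_coef (J l : nat) : R :=
  if l == 0%N then J%:R else 2 * (J - l)%:R.

Lemma fejer_coefE J y :
  fejer J y = \sum_(l < J) fejer_coef J l * cos (2 * pi * l%:R * y).
Proof.
suff e n : fejer n y = n%:R + 2 * \sum_(1 <= l < n) (n - l)%:R * cos (2 * pi * l%:R * y).
  case: J => [|J]; first by rewrite /fejer !big_ord0.
  rewrite e -(big_mkord xpredT (fun l => fejer_coef J.+1 l * cos (2 * pi * l%:R * y))).
  rewrite big_ltn// mulr0 mul0r cos0 mulr1 {1}/fejer_coef /=; congr (_ + _).
  rewrite mulr_sumr !big_nat; apply: eq_bigr => l /andP[l1 _].
  by rewrite /fejer_coef; case: l l1 => // l _; rewrite mulrA.
elim: n => [|n IH]; first by rewrite /fejer big_ord0 big_geq// mulr0 addr0.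
rewrite /fejer big_ord_recr /= -/(fejer n y) IH.
case: n {IH} => [|n].
  by rewrite !big_geq//; ring.
rewrite [X in _ = _ + 2 * X]big_nat_recr//= [X in _ + (1 + 2 * X) = _]big_nat_recr//=.
have -> : \sum_(1 <= l < n.+1) (n.+2 - l)%:R * cos (2 * pi * l%:R * y) =
   \sum_(1 <= l < n.+1) (n.+1 - l)%:R * cos (2 * pi * l%:R * y) +
   \sum_(1 <= l < n.+1) cos (2 * pi * l%:R * y).
  rewrite -big_split /= !big_nat; apply: eq_bigr => l /andP[_ ln].
  by rewrite subSn 1?ltnW// -natr1 mulrDl mul1r.
by rewrite subSnn -(natr1 n.+1); ring.
Qed.

Lemma fejer_coef_ge0 J l : 0 <= fejer_coef J l.
Proof. by rewrite /fejer_coef; case: ifP => _; rewrite ?mulr_ge0. Qed.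

Lemma fejer_coef_le J l : fejer_coef J l <= 2 * J%:R.
Proof.
rewrite /fejer_coef; case: ifP => _; first by have := ler0n R J; lra.
by rewrite ler_pM2l// ler_nat leq_subr.
Qed.

Lemma sum_fejer_coef J : \sum_(l < J) fejer_coef J l = J%:R ^+ 2.
Proof.
have := fejer_coefE J 0.
under [in RHS]eq_bigr do rewrite mulr0 cos0 mulr1.
move=> <-; rewrite /fejer.
under eq_bigr => i _.
  under eq_bigr do rewrite mulr0 cos0.
  rewrite big_const_nat iter_addr addr0 subn1 /=.
  over.
elim: J => [|J IH]; first by rewrite big_ord0 expr0n.
by rewrite big_ord_recr /= IH -(natr1 J); ring.
Qed.

Lemma fejer_le J y : fejer J y <= J%:R ^+ 2.
Proof.
rewrite fejer_coefE -sum_fejer_coef; apply: ler_sum => l _.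
by rewrite ler_piMr ?fejer_coef_ge0// cos_le1.
Qed.

Lemma fejer_int J (m : int) : fejer J m%:~R = J%:R ^+ 2.
Proof.
rewrite fejer_coefE -sum_fejer_coef; apply: eq_bigr => l _.
suff -> : cos (2 * pi * l%:R * m%:~R) = 1 :> R by rewrite mulr1.
have -> : 2 * pi * l%:R * m%:~R = 2 * (pi * (l%:R * m%:~R)) :> R by ring.
rewrite mulr_natl mulr2n cosD.
have := cos2Dsin2 (pi * (l%:R * m%:~R) : R).
have := sin_piDz (0 : R) (l%:Z * m).
rewrite add0r intrM mulr0 sin0 normr0 => /eqP; rewrite normr_eq0 => /eqP ->.
by rewrite !expr2; lra.
Qed.

Lemma fejer_ge0 J y : 0 <= fejer J y.
Proof.
have [e|ne] := eqVneq (sin (pi * y)) 0.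
  have := dist_int_le_sin y; rewrite e normr0 => h.
  have [m em] := dist_int_ex y; rewrite em in h.
  have : `|y - m%:~R| = 0 by apply/le_anti; rewrite h normr_ge0.
  move/eqP; rewrite normr_eq0 subr_eq0 => /eqP ->.
  by rewrite fejer_int sqr_ge0.
have := fejer_closed J y; have s0 : 0 < sin (pi * y) ^+ 2 by rewrite exprn_even_gt0.
by move=> e; rewrite -(pmulr_lge0 _ s0) e sqr_ge0.
Qed.

Lemma fejer_dist J y : fejer J y * dist_int y ^+ 2 <= 1.
Proof.
apply: (@le_trans _ _ (fejer J y * sin (pi * y) ^+ 2)).
  rewrite ler_wpM2l ?fejer_ge0// -(real_normK (num_real (sin _))) lerXn2r ?nnegrE ?dist_int_ge0//.
  exact: dist_int_le_sin.
rewrite fejer_closed.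
by have := cos2Dsin2 (pi * J%:R * y); have := sqr_ge0 (cos (pi * J%:R * y)); lra.
Qed.

(* [fejer J w] vanishes at the nonzero multiples of [1 / J]; the translate
   compensates, since the numerators become [sin ^ 2] and [cos ^ 2]. *)
Lemma fejer_pair_ge J w : (0 < J)%N ->
  J%:R ^+ 2 / (J%:R * dist_int w + 1 / 2) ^+ 2
    <= pi ^+ 2 * (fejer J w + fejer J (w - (2 * J%:R)^-1)).
Proof.
move=> J0.
have J0' : 0 < J%:R :> R by rewrite ltr0n.
set h := (2 * J%:R)^-1; have h0 : 0 < h by rewrite invr_gt0 mulr_gt0.
set d := dist_int w; have d0 : 0 <= d by exact: dist_int_ge0.
have Jh : J%:R * h = 1 / 2 by rewrite /h; field; rewrite gt_eqF.
have -> : J%:R * d + 1 / 2 = J%:R * (d + h) by rewrite mulrDr Jh.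
rewrite exprMn invfM mulrA divff ?mul1r; last by rewrite expf_neq0// gt_eqF.
rewrite -[X in X <= _]mul1r ler_pdivrMr; last by rewrite exprn_gt0// ltr_wpDl.
have c1 := fejer_closed J w; have c2 := fejer_closed J (w - h).
have e : pi * J%:R * (w - h) = pi * J%:R * w - pi / 2.
  by rewrite mulrBr -(mulrA pi J%:R h) Jh; ring.
rewrite e sinB cos_pihalf sin_pihalf mulr0 mulr1 sub0r sqrrN in c2.
have s := cos2Dsin2 (pi * J%:R * w).
have p0 := pi_gt0 R.
have q0 : 0 <= pi * (d + h) by apply: mulr_ge0; lra.
have b1 : sin (pi * w) ^+ 2 <= (pi * (d + h)) ^+ 2.
  rewrite -(real_normK (num_real (sin _))) lerXn2r ?nnegrE//.
  by apply: le_trans (sin_le_dist_int w) _; rewrite ler_pM2l// lerDl ltW.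
have b2 : sin (pi * (w - h)) ^+ 2 <= (pi * (d + h)) ^+ 2.
  rewrite -(real_normK (num_real (sin _))) lerXn2r ?nnegrE//.
  apply: le_trans (sin_le_dist_int _) _; rewrite ler_pM2l//.
  apply: le_trans (dist_int_lip _ w) _.
  by rewrite lerD2l addrAC subrr add0r normrN gtr0_norm.
have f1 := ler_wpM2l (fejer_ge0 J w) b1; have f2 := ler_wpM2l (fejer_ge0 J (w - h)) b2.
move: f1 f2; rewrite c1 c2 exprMn.
move: s; nra.
Qed.

End Fejer.

(** * Cosine polynomials, mesh averages and the Jackson kernel *)

Section CosPoly.
Variable R : realType.
Implicit Types (y w s : R) (e : nat -> R).

Definition cospoly (N : nat) e y : R := \sum_(l < N) e l * cos (2 * pi * l%:R * y).

Lemma mesh_orth (M l : nat) w : (0 < l < M)%N ->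
  \sum_(m < M) cos (2 * pi * l%:R * (w - m%:R / M%:R)) = 0 :> R.
Proof.
move=> /andP[l0 lM].
have M0 : 0 < M%:R :> R by rewrite ltr0n (leq_trans _ lM).
set u : R := l%:R / M%:R.
have u01 : 0 < u < 1.
  apply/andP; split; first by apply: divr_gt0 => //; rewrite ltr0n.
  by rewrite /u ltr_pdivrMr// mul1r ltr_nat.
have Mu : M%:R * u = l%:R by rewrite /u mulrC divfK ?gt_eqF.
have s0 : sin (pi * u) != 0.
  apply: lt0r_neq0; apply: sin_gt0_pi; have := pi_gt0 R; case/andP: u01 => *.
  by apply/andP; split; nra.
have := @sum_cos_telescope R u (- (2 * pi * l%:R * w)) 0 M isT.
have -> : sin (2 * pi * M%:R * u - pi * u - 2 * pi * l%:R * w) =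
    sin (2 * pi * 0%:R * u - pi * u - 2 * pi * l%:R * w).
  have -> : 2 * pi * M%:R * u - pi * u - 2 * pi * l%:R * w =
    (2 * pi * 0%:R * u - pi * u - 2 * pi * l%:R * w) + (pi *+ 2) *+ l.
    have -> : pi *+ 2 *+ l = 2 * pi * l%:R :> R by rewrite -(mulr_natr (pi *+ 2)) -(mulr_natl pi).
    by rewrite -(mulrA (2 * pi) M%:R) Mu; ring.
  by have := periodicn (@sinD2pi R) l; apply.
rewrite subrr => /eqP; rewrite mulf_eq0 mulf_eq0 pnatr_eq0 (negbTE s0) /= => /eqP h.
rewrite -[RHS]h big_mkord; apply: eq_bigr => m _.
rewrite -cosN; congr cos; rewrite /u; field; rewrite gt_eqF//.
Qed.

(** Averaging over M >= N equispaced translates annihilates every frequency 0 < l < N. This plays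
    the role of integration over the circle. *)
Lemma cospoly_mesh (N M : nat) e w : (N <= M)%N -> (0 < N)%N ->
  \sum_(m < M) cospoly N e (w - m%:R / M%:R) = M%:R * e 0%N.
Proof.
move=> NM N0; rewrite /cospoly exchange_big /=.
case: N N0 NM => // N _ NM.
rewrite big_ord_recl /= [X in _ + X]big1 ?addr0.
  under eq_bigr do rewrite mulr0 mul0r cos0 mulr1.
  by rewrite sumr_const card_ord mulr_natl.
move=> l _; rewrite -mulr_sumr mesh_orth ?mulr0// /bump /=.
by have := ltn_ord l; lia.
Qed.

Definition cossum (ys : seq R) (l : nat) : R :=
  \sum_(y <- ys) cos (2 * pi * l%:R * y).

Lemma cossum0 ys : cossum ys 0 = (size ys)%:R.
Proof.
rewrite /cossum; under eq_bigr do rewrite mulr0 mul0r cos0.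
by rewrite big_const_seq count_predT iter_addr addr0.
Qed.

Lemma cospoly_sum N e s (ys : seq R) :
  \sum_(y <- ys) (cospoly N e (y - s) + cospoly N e (- y - s)) =
  2 * \sum_(l < N) e l * cos (2 * pi * l%:R * s) * cossum ys l.
Proof.
rewrite mulr_sumr.
transitivity (\sum_(y <- ys) \sum_(l < N)
    2 * (e l * cos (2 * pi * l%:R * s) * cos (2 * pi * l%:R * y))).
  apply: eq_bigr => y _; rewrite /cospoly -big_split; apply: eq_bigr => l _ /=.
  rewrite mulrBr cosB.
  have -> : 2 * pi * l%:R * (- y - s) = - (2 * pi * l%:R * y + 2 * pi * l%:R * s) by ring.
  by rewrite cosN cosD; ring.
rewrite exchange_big; apply: eq_bigr => l _ /=.
by rewrite /cossum !mulr_sumr; apply: eq_bigr => y _; ring.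
Qed.

Lemma cos_distn (a b : nat) y : cos (2 * pi * (`|a - b|%N)%:R * y) =
  cos (2 * pi * a%:R * y - 2 * pi * b%:R * y) :> R.
Proof.
wlog ab : a b / (b <= a)%N => [H|].
  have [h|h] := leqP b a; first exact: H.
  by rewrite distnC (H b a (ltnW h)) -cosN opprB.
by rewrite distnEl// natrB// mulrBr mulrBl.
Qed.

(** Coefficients of the Jackson kernel, the square of the Fejer kernel: by the product-to-sum
    formula, frequencies i and j feed i + j and |i - j| equally. *)
Definition jackson_coef (J l : nat) : R :=
  \sum_(i < J) \sum_(j < J) fejer_coef R J i * fejer_coef R J j *
    ((((i + j)%N == l)%:R + (`|i - j|%N == l)%:R) / 2).

Lemma jackson_coefE J y : fejer J y ^+ 2 = cospoly (2 * J) (jackson_coef J) y.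
Proof.
rewrite /cospoly /jackson_coef.
transitivity (\sum_(i < J) \sum_(j < J) \sum_(l < 2 * J)
   fejer_coef R J i * fejer_coef R J j *
    ((((i + j)%N == l)%:R + (`|i - j|%N == l)%:R) / 2) * cos (2 * pi * l%:R * y)); last first.
  transitivity (\sum_(i < J) \sum_(l < 2 * J) \sum_(j < J)
   fejer_coef R J i * fejer_coef R J j *
    ((((i + j)%N == l)%:R + (`|i - j|%N == l)%:R) / 2) * cos (2 * pi * l%:R * y)).
    by apply: eq_bigr => i _; rewrite exchange_big.
  rewrite exchange_big; apply: eq_bigr => l _ /=.
  by rewrite mulr_suml; apply: eq_bigr => i _; rewrite mulr_suml.
rewrite expr2 !fejer_coefE mulr_suml; apply: eq_bigr => i _.
rewrite mulr_sumr; apply: eq_bigr => j _.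
have pick (x : nat) : (x < 2 * J)%N ->
    \sum_(l < 2 * J) (x == l)%:R * cos (2 * pi * l%:R * y) = cos (2 * pi * x%:R * y).
  move=> xJ; rewrite (bigD1 (Ordinal xJ)) //= eqxx mul1r big1 ?addr0// => l lx.
  by rewrite (_ : (x == l) = false) ?mul0r//; apply: contra_neqF lx => /eqP xl; apply/val_inj.
have ij : (i + j < 2 * J)%N by have := ltn_ord i; have := ltn_ord j; lia.
have ij' : (`|i - j| < 2 * J)%N by have := ltn_ord i; have := ltn_ord j; lia.
have -> : \sum_(l < 2 * J) fejer_coef R J i * fejer_coef R J j *
    ((((i + j)%N == l)%:R + (`|i - j|%N == l)%:R) / 2) * cos (2 * pi * l%:R * y) =
  fejer_coef R J i * fejer_coef R J j / 2 *
    (\sum_(l < 2 * J) ((i + j)%N == l)%:R * cos (2 * pi * l%:R * y) +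
     \sum_(l < 2 * J) (`|i - j|%N == l)%:R * cos (2 * pi * l%:R * y)).
  by rewrite -big_split mulr_sumr; apply: eq_bigr => l _ /=; ring.
rewrite !pick//.
rewrite cos_distn.
have -> : 2 * pi * (i + j)%:R * y = 2 * pi * i%:R * y + 2 * pi * j%:R * y.
  by rewrite natrD; ring.
by rewrite cosD cosB; field.
Qed.

Lemma jackson_coef_ge0 J l : 0 <= jackson_coef J l.
Proof.
apply: sumr_ge0 => i _; apply: sumr_ge0 => j _.
by rewrite !mulr_ge0 ?fejer_coef_ge0// addr_ge0.
Qed.

(** For fixed l and i at most three j contribute, namely l - i, i + l and i - l, each with at most 2
    J^2. *)
Lemma jackson_coef_le J l : jackson_coef J l <= 6 * J%:R ^+ 3.
Proof.
apply: (@le_trans _ _ (\sum_(i < J) 6 * J%:R ^+ 2)); last first.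
  by rewrite sumr_const card_ord -mulr_natr; rewrite le_eqVlt; apply/orP; left; apply/eqP; ring.
apply: ler_sum => i _.
have pick (x : nat) : \sum_(j < J) (nat_of_ord j == x)%:R <= 1 :> R.
  have [xJ|Jx] := ltnP x J.
    by rewrite (bigD1 (Ordinal xJ))//= eqxx big1 ?addr0// => j; rewrite -val_eqE /= => /negbTE ->.
  by rewrite big1// => j _; rewrite (_ : (_ == _) = false)//; have := ltn_ord j; lia.
apply: (@le_trans _ _ (\sum_(j < J) 2 * J%:R ^+ 2 * ((nat_of_ord j == (l - i)%N)%:R +
   ((nat_of_ord j == (i + l)%N)%:R + (nat_of_ord j == (i - l)%N)%:R)))).
  apply: ler_sum => j _.
  have c : fejer_coef R J i * fejer_coef R J j <= 4 * J%:R ^+ 2.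
    have -> : 4 * J%:R ^+ 2 = (2 * J%:R) * (2 * J%:R) :> R by ring.
    by rewrite ler_pM ?fejer_coef_ge0// fejer_coef_le.
  have -> : 2 * J%:R ^+ 2 = 4 * J%:R ^+ 2 / 2 :> R by lra.
  rewrite -[X in _ <= X]mulrA [X in _ <= _ * X]mulrC.
  apply: ler_pM; rewrite ?mulr_ge0 ?fejer_coef_ge0 ?addr_ge0//.
  rewrite ler_pM2r ?invr_gt0//; apply: lerD; rewrite -?natrD ler_nat.
    by case: eqP => //= h; rewrite (_ : (_ == _) = true) //; apply/eqP; lia.
  case: eqP => //= h.
  by have [|] := leqP i j => ?; [rewrite (_ : (nat_of_ord j == (i + l)%N) = true)|
     rewrite (_ : (nat_of_ord j == (i - l)%N) = true) ?addn1//]; apply/eqP; lia.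
rewrite -mulr_sumr !big_split /=.
have := pick (l - i)%N; have := pick (i + l)%N; have := pick (i - l)%N.
have := sqr_ge0 (J%:R : R).
set a := \sum_(_ < _) _; set b := \sum_(_ < _) _; set c := \sum_(_ < _) _; nra.
Qed.

(** The diagonal i = j already gives half the sum of squares of the Fejer coefficients. Their mean
    is J, so by nonnegativity of the variance the squares sum to at least J^3. *)
Lemma jackson_coef0_ge J : J%:R ^+ 3 / 2 <= jackson_coef J 0.
Proof.
apply: (@le_trans _ _ (\sum_(i < J) fejer_coef R J i ^+ 2 / 2)).
  rewrite -mulr_suml ler_pM2r ?invr_gt0//.
  have : 0 <= \sum_(i < J) (fejer_coef R J i - J%:R) ^+ 2.
    by apply: sumr_ge0 => i _; rewrite sqr_ge0.
  have -> : \sum_(i < J) (fejer_coef R J i - J%:R) ^+ 2 =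
     \sum_(i < J) fejer_coef R J i ^+ 2 - 2 * J%:R * (\sum_(i < J) fejer_coef R J i)
       + J%:R * J%:R ^+ 2.
    rewrite mulr_sumr -sumrB.
    have -> : J%:R * J%:R ^+ 2 = \sum_(i < J) (J%:R ^+ 2 : R).
      by rewrite sumr_const card_ord mulr_natl.
    by rewrite -big_split; apply: eq_bigr => i _ /=; ring.
  rewrite sum_fejer_coef; have -> : J%:R ^+ 3 = J%:R * J%:R ^+ 2 :> R by ring.
  lra.
apply: ler_sum => i _; rewrite (bigD1 i)//= distnn eqxx.
rewrite -[X in X <= _]addr0; apply: lerD.
  rewrite expr2 -mulrA -[X in _ <= X]mulrA ler_wpM2l ?fejer_coef_ge0//.
  have b0 : 0 <= ((i + i)%N == 0%N)%:R :> R by [].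
  rewrite (_ : true%:R = 1 :> R)//.
  have := fejer_coef_ge0 R J i; move: b0; set b := _%:R; set c := fejer_coef _ _ _; nra.
apply: sumr_ge0 => j _.
by rewrite !mulr_ge0 ?fejer_coef_ge0// addr_ge0.
Qed.

End CosPoly.

(** * Smoothing the indicator of a short arc *)

Section Discrepancy.
Variable R : realType.
Implicit Types (y z w s d a b : R) (ys : seq R).

(** A positive decreasing function of the distance, which majorises the Fejer kernel divided by J^2
    and, up to a constant, is majorised by two translates of it; unlike the kernel it never
    vanishes. *)
Definition bump (J : nat) w : R := ((J%:R * dist_int w + 1 / 2) ^+ 2)^-1.

Lemma bump_base_gt0 (J : nat) w : 0 < J%:R * dist_int w + 1 / 2.
Proof. by rewrite ltr_wpDl// mulr_ge0// dist_int_ge0. Qed.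

Lemma bump_gt0 J w : 0 < bump J w.
Proof. by rewrite invr_gt0 exprn_gt0// bump_base_gt0. Qed.

Lemma bumpN J w : bump J (- w) = bump J w.
Proof. by rewrite /bump dist_intN. Qed.

Lemma fejer_le_bump J w : fejer J w <= 3 * J%:R ^+ 2 * bump J w.
Proof.
rewrite ler_pdivlMr; last by rewrite exprn_gt0// bump_base_gt0.
have := fejer_le J w; have := fejer_dist J w; have := fejer_ge0 J w.
have := dist_int_ge0 w; have := ler0n R J.
set F := fejer _ _; set D := dist_int _; set j := J%:R => j0 D0 F0 h1 h2.
have : (j * D + 1 / 2) ^+ 2 <= 2 * (j ^+ 2 * D ^+ 2) + 1 / 2.
  have := sqr_ge0 (j * D - 1 / 2); nra.
move=> h3; apply: le_trans (ler_wpM2l F0 h3) _.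
have : F * D ^+ 2 * j ^+ 2 <= 1 * j ^+ 2 by rewrite ler_wpM2r ?sqr_ge0.
nra.
Qed.

Lemma bump_le_fejer J w : (0 < J)%N ->
  bump J w <= pi ^+ 2 / J%:R ^+ 2 * (fejer J w + fejer J (w - (2 * J%:R)^-1)).
Proof.
move=> J0; have := fejer_pair_ge w J0.
have j0 : 0 < J%:R ^+ 2 :> R by rewrite exprn_gt0// ltr0n.
rewrite -/(bump J w) mulrC => h.
by rewrite mulrAC ler_pdivlMr.
Qed.

Lemma fejer_mesh J z : (0 < J)%N ->
  \sum_(m < 2 * J) fejer J (z - m%:R / (2 * J)%:R) = 2 * J%:R ^+ 2.
Proof.
move=> J0.
under eq_bigr do rewrite fejer_coefE.
by rewrite [LHS](@cospoly_mesh R J)//= ?leq_pmull// /fejer_coef eqxx natrM; ring.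
Qed.

Lemma bump_mesh J z : (0 < J)%N ->
  \sum_(m < 2 * J) bump J (z - m%:R / (2 * J)%:R) <= 4 * pi ^+ 2.
Proof.
move=> J0; have j0 : J%:R ^+ 2 != 0 :> R by rewrite expf_neq0// pnatr_eq0 -lt0n.
apply: le_trans (ler_sum _ (fun m _ => bump_le_fejer _ J0)) _.
rewrite -mulr_sumr big_split /= fejer_mesh//.
under eq_bigr do rewrite addrAC.
rewrite fejer_mesh// le_eqVlt; apply/orP; left; apply/eqP.
move: (J%:R ^+ 2) j0 => j j0.
have -> : pi ^+ 2 / j * (2 * j + 2 * j) = 4 * pi ^+ 2 * (j^-1 * j) :> R by ring.
by rewrite mulVf// mulr1.
Qed.

(** The Jackson kernel normalised so that its translates along the mesh of step 1/(2J) add up to 1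
    ([kern_mesh]). *)
Definition kern (J : nat) w : R := fejer J w ^+ 2 / ((2 * J)%:R * jackson_coef R J 0).

Lemma kern_norm_ge (J : nat) : J%:R ^+ 4 <= (2 * J)%:R * jackson_coef R J 0.
Proof.
have := @jackson_coef0_ge R J; rewrite natrM; have := ler0n R J.
have -> : J%:R ^+ 4 = J%:R * J%:R ^+ 3 :> R by ring.
set j := J%:R; set c := jackson_coef _ _ _; nra.
Qed.

Lemma kern_norm_gt0 J : (0 < J)%N -> 0 < (2 * J)%:R * jackson_coef R J 0.
Proof.
move=> J0; apply: lt_le_trans (kern_norm_ge J).
by rewrite exprn_gt0// ltr0n.
Qed.

Lemma kern_ge0 J w : 0 <= kern J w.
Proof. by rewrite divr_ge0 ?sqr_ge0 ?mulr_ge0 ?jackson_coef_ge0. Qed.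

Lemma kern_mesh J z : (0 < J)%N -> \sum_(m < 2 * J) kern J (z - m%:R / (2 * J)%:R) = 1.
Proof.
move=> J0; rewrite /kern -mulr_suml.
under eq_bigr do rewrite jackson_coefE.
by rewrite cospoly_mesh// ?muln_gt0 ?J0// divff// gt_eqF// kern_norm_gt0.
Qed.

Lemma kern_le_bump J w : (0 < J)%N -> kern J w <= 9 * bump J w ^+ 2.
Proof.
move=> J0; rewrite ler_pdivrMr ?kern_norm_gt0//.
have h := fejer_le_bump J w; have b0 := bump_gt0 J w; have f0 := fejer_ge0 J w.
apply: (@le_trans _ _ ((3 * J%:R ^+ 2 * bump J w) ^+ 2)).
  by rewrite lerXn2r ?nnegrE// (le_trans f0).
have -> : (3 * J%:R ^+ 2 * bump J w) ^+ 2 = 9 * bump J w ^+ 2 * J%:R ^+ 4 by ring.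
by rewrite ler_wpM2l ?kern_norm_ge// mulr_ge0 ?sqr_ge0.
Qed.

(** Between a point inside [-d, d] and one outside, the arc passes an end [s], and both partial
    distances are at most the total one. Since [kern] decays like [bump] squared, one factor can be
    spent on each of them. *)
Lemma kern_cross J d a b : (0 < J)%N -> dist_int a <= d -> d <= dist_int b ->
  kern J (a - b) <=
    9 * (bump J (a - d) * bump J (d - b) + bump J (a + d) * bump J (- d - b)).
Proof.
move=> J0 da db; have [s hs cr] := dist_int_cross da db.
apply: le_trans (kern_le_bump _ J0) _; rewrite ler_pM2l//.
have H : bump J (a - b) ^+ 2 <= bump J (a - s) * bump J (s - b).
  rewrite -(bumpN J (s - b)) opprB.
  have j0 : 0 <= J%:R :> R by [].
  have h1 := dist_int_ge0 (a - s); have h2 := dist_int_ge0 (b - s).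
  rewrite expr2 ler_pM ?(ltW (bump_gt0 _ _))// /bump lef_pV2 ?posrE ?exprn_gt0 ?bump_base_gt0//.
    by rewrite lerXn2r ?nnegrE ?(ltW (bump_base_gt0 _ _))// lerD2r ler_wpM2l//; lra.
  by rewrite lerXn2r ?nnegrE ?(ltW (bump_base_gt0 _ _))// lerD2r ler_wpM2l//; lra.
have p x z := mulr_ge0 (ltW (bump_gt0 J x)) (ltW (bump_gt0 J z)).
case: hs => e; subst s; apply: le_trans H _.
  by rewrite lerDl p.
by rewrite opprK lerDr p.
Qed.

(** The kernels of all mesh points add up to 1 at [y], so the error is the mass of the mesh points
    on the wrong side of the ends of [-d, d]. By [kern_cross] each of them costs a bump at distance
    from [y] to an end, times a bump that is summable over the mesh. *)
Lemma indicator_approx J d y (r : nat) : (0 < J)%N ->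
  r%:R / (2 * J)%:R <= d -> d < r.+1%:R / (2 * J)%:R -> (r < J)%N ->
  `| (dist_int y < d)%R%:R -
     \sum_(m < 2 * J | (m < (2 * r).+1)%N) kern J (y + r%:R / (2 * J)%:R - m%:R / (2 * J)%:R) |
  <= 36 * pi ^+ 2 * (bump J (y - d) + bump J (y + d)).
Proof.
move=> J0 rd dr rJ; set M := (2 * J)%N.
have M0 : 0 < M%:R :> R by rewrite ltr0n /M; lia.
(* Mesh points recentred at 0: the first 2r + 1 fill [-r/M, r/M], which are exactly those within [d]
   of 0 because r/M <= d < (r+1)/M. *)
pose s (m : nat) : R := m%:R / M%:R - r%:R / M%:R.
pose T (m : nat) := 9 * (bump J (y - d) * bump J (d - s m) + bump J (y + d) * bump J (- d - s m)).
have T0 m : 0 <= T m.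
  by rewrite mulr_ge0// addr_ge0// mulr_ge0// ltW// bump_gt0.
have eT : \sum_(m < M) T m <= 36 * pi ^+ 2 * (bump J (y - d) + bump J (y + d)).
  rewrite -mulr_sumr big_split /= -!mulr_sumr.
  have h1 : \sum_(m < M) bump J (d - s m) <= 4 * pi ^+ 2.
    apply: le_trans (bump_mesh (d + r%:R / M%:R) J0).
    rewrite le_eqVlt; apply/orP; left; apply/eqP; apply: eq_bigr => m _.
    by congr bump; rewrite /s -/M; ring.
  have h2 : \sum_(m < M) bump J (- d - s m) <= 4 * pi ^+ 2.
    apply: le_trans (bump_mesh (- d + r%:R / M%:R) J0).
    rewrite le_eqVlt; apply/orP; left; apply/eqP; apply: eq_bigr => m _.
    by congr bump; rewrite /s -/M; ring.
  have g1 := ler_wpM2l (ltW (bump_gt0 J (y - d))) h1.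
  have g2 := ler_wpM2l (ltW (bump_gt0 J (y + d))) h2.
  move: g1 g2; lra.
have ks (m : nat) : kern J (y + r%:R / M%:R - m%:R / M%:R) = kern J (y - s m).
  by rewrite /s; congr kern; ring.
have tot : \sum_(m < M) kern J (y + r%:R / M%:R - m%:R / M%:R) = 1 by exact: kern_mesh.
have sin_ (m : nat) : (m < (2 * r).+1)%N -> dist_int (s m) <= d.
  move=> mr; apply: le_trans (dist_int_le _ 0) _; rewrite subr0.
  apply: le_trans rd; rewrite /s -mulrBl normrM (gtr0_norm (x := _^-1)) ?invr_gt0//.
  rewrite ler_pM2r ?invr_gt0//; rewrite ler_norml.
  have : m%:R <= (2 * r)%:R :> R by rewrite ler_nat.
  rewrite natrM; have := ler0n R m; move=> ? ?; apply/andP; split; lra.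
have sout (m : nat) : ((2 * r).+1 <= m)%N -> (m < M)%N -> d <= dist_int (s m).
  move=> rm mM; apply: le_trans (ltW dr) _.
  have [n ->] := dist_int_ex (s m).
  have sE : s m = (m%:R - r%:R) / M%:R by rewrite /s mulrBl.
  have h1 : r.+1%:R / M%:R <= s m.
    rewrite sE ler_pM2r ?invr_gt0// lerBrDr -natrD ler_nat; lia.
  have h2 : s m <= 1 - r.+1%:R / M%:R.
    have -> : 1 - r.+1%:R / M%:R = (M%:R - r.+1%:R) / M%:R :> R.
      by rewrite mulrBl divff// gt_eqF.
    rewrite sE ler_pM2r ?invr_gt0//.
    have : (m + r.+1 <= M + r)%N by lia.
    by rewrite -(ler_nat R) !natrD; lra.
  have [n0|n0] := leP n 0.
    apply: le_trans (ler_norm _); have : n%:~R <= 0 :> R by rewrite -[0]/(0%:~R) ler_int.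
    by rewrite -/M; lra.
  rewrite distrC; apply: le_trans (ler_norm _).
  have : 1 <= n%:~R :> R by rewrite -[1]/(1%:~R) ler_int.
  by rewrite -/M; lra.
have [yd|yd] := ltP (dist_int y) d.
  move: tot; rewrite (bigID (fun m : 'I_M => (m < (2 * r).+1)%N)) /=.
  set A := \sum_(_ < _ | _) _ => /eqP; rewrite eq_sym addrC -subr_eq => /eqP ->.
  rewrite ger0_norm; last by apply: sumr_ge0 => m _; exact: kern_ge0.
  apply: le_trans eT; rewrite [X in _ <= X](bigID (fun m : 'I_M => (m < (2 * r).+1)%N)) /=.
  rewrite -[X in X <= _]add0r; apply: lerD; first by apply: sumr_ge0 => m _; exact: T0.
  apply: ler_sum => m; rewrite -leqNgt => rm; rewrite ks.
  by apply: kern_cross => //; [exact: ltW|apply: sout].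
rewrite sub0r normrN ger0_norm; last by apply: sumr_ge0 => m _; exact: kern_ge0.
apply: le_trans eT; rewrite [X in _ <= X](bigID (fun m : 'I_M => (m < (2 * r).+1)%N)) /=.
rewrite -[X in X <= _]addr0; apply: lerD; last by apply: sumr_ge0 => m _; exact: T0.
apply: ler_sum => m mr; rewrite ks.
have -> : kern J (y - s m) = kern J (s m - y).
  rewrite /kern; congr (_ ^+ 2 / _); rewrite !fejer_coefE; apply: eq_bigr => l _.
  by rewrite -cosN; congr (_ * cos _); ring.
have := @kern_cross J d (s m) y J0 (sin_ _ mr) yd.
rewrite -(bumpN J (d - y)) -(bumpN J (- d - y)) -(bumpN J (s m - d)) -(bumpN J (s m + d)).
have -> : - (d - y) = y - d by ring.
have -> : - (- d - y) = y + d by ring.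
have -> : - (s m - d) = d - s m by ring.
have -> : - (s m + d) = - d - s m by ring.
by move/le_trans; apply; rewrite /T ler_pM2l// lerD// mulrC.
Qed.

End Discrepancy.

(** * Discrepancy in terms of cosine sums *)

Section DiscrepancyBound.
Variable R : realType.
Implicit Types (y z w s d a b : R) (ys : seq R).

Lemma cospoly_sum_bound N (e : nat -> R) (B : R) s ys : (0 < N)%N ->
  (forall l, (0 < l < N)%N -> `|e l| <= B) ->
  `|\sum_(y <- ys) (cospoly N e (y - s) + cospoly N e (- y - s)) - 2 * e 0%N * (size ys)%:R|
  <= 2 * B * \sum_(1 <= l < N) `|cossum ys l|.
Proof.
move=> N0 eB; rewrite cospoly_sum.
rewrite -(big_mkord xpredT (fun l => e l * cos (2 * pi * l%:R * s) * cossum ys l)).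
rewrite big_ltn// mulr0 mul0r cos0 mulr1 cossum0.
set T := \sum_(_ <= _ < _) _ * _.
have -> : 2 * (e 0%N * (size ys)%:R + T) - 2 * e 0%N * (size ys)%:R = 2 * T by ring.
rewrite -mulrA normrM (@ger0_norm _ 2)// ler_pM2l// mulr_sumr.
apply: le_trans (ler_norm_sum _ _ _) _; rewrite !big_nat; apply: ler_sum => l lN.
rewrite normrM ler_wpM2r// normrM.
rewrite -[X in _ <= X]mulr1; apply: ler_pM => //; first exact: eB.
by rewrite ler_norml cos_geN1 cos_le1.
Qed.

Lemma kern_cospoly J w : kern J w =
  cospoly (2 * J) (fun l => jackson_coef R J l / ((2 * J)%:R * jackson_coef R J 0)) w.
Proof.
rewrite /kern jackson_coefE /cospoly mulr_suml; apply: eq_bigr => l _.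
by rewrite mulrAC.
Qed.

Lemma fejer_sum_sym J s ys : (0 < J)%N ->
  \sum_(y <- ys) (fejer J (y - s) + fejer J (- y - s)) <=
  2 * J%:R * (size ys)%:R + 4 * J%:R * \sum_(1 <= l < 2 * J) `|cossum ys l|.
Proof.
move=> J0.
under eq_bigr do rewrite !fejer_coefE.
have := @cospoly_sum_bound J (fejer_coef R J) (2 * J%:R) s ys J0.
have -> : fejer_coef R J 0 = J%:R by [].
move=> /(_ _)/wrap[].
  by move=> l _; rewrite ger0_norm ?fejer_coef_ge0 ?fejer_coef_le.
move=> /(le_trans (ler_norm _)); rewrite lerBlDl => /le_trans; apply.
rewrite lerD2l; have -> : 2 * (2 * J%:R) = 4 * J%:R :> R by ring.
rewrite ler_wpM2l ?mulr_ge0// [X in _ <= X](@big_cat_nat _ _ _ J)//=; last by lia.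
by rewrite lerDl sumr_ge0.
Qed.

Definition discrepancy_const : R := 288 * pi ^+ 4 + 31.

(* The sequence is symmetrised, [y] and [- y] being counted together, so that
   only cosine sums occur. *)
Lemma discrepancy_bound ys J d : (0 < J)%N -> J%:R^-1 <= d -> d < 2^-1 ->
  `|(count (fun y => dist_int y < d) ys)%:R - 2 * d * (size ys)%:R| <=
  discrepancy_const * ((size ys)%:R / J%:R + d * \sum_(1 <= l < 2 * J) `|cossum ys l|).
Proof.
move=> J0 Jd d2.
have aux (a b : nat) : (a < b)%N -> ((2 * a).+1 <= 2 * b)%N by clear; lia.
set M := (2 * J)%N; set P : R := (size ys)%:R.
set S := \sum_(_ <= _ < _) _.
have j0 : 0 < J%:R :> R by rewrite ltr0n.
have M0 : 0 < M%:R :> R by rewrite ltr0n /M; lia.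
have MJ : M%:R = 2 * J%:R :> R by rewrite /M natrM.
have d0 : 0 < d by apply: lt_le_trans Jd; rewrite invr_gt0.
have S0 : 0 <= S by apply: sumr_ge0.
have P0 : 0 <= P by [].
set r := Num.truncn (d * M%:R).
have /andP[r1 r2] : r%:R <= d * M%:R < r.+1%:R by apply: truncn_itv; rewrite mulr_ge0 ?ltW.
have rJ : (r < J)%N.
  rewrite -(ltr_nat R); apply: le_lt_trans r1 _; rewrite MJ; nra.
pose G y := \sum_(m < M | (m < (2 * r).+1)%N) kern J (y + r%:R / M%:R - m%:R / M%:R).
have ap y : `|(dist_int y < d)%R%:R - G y| <= 36 * pi ^+ 2 * (bump J (y - d) + bump J (y + d)).
  by apply: indicator_approx => //; rewrite ?ler_pdivrMr ?ltr_pdivlMr.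
have cnt : 2 * (count (fun y => dist_int y < d) ys)%:R =
    \sum_(y <- ys) ((dist_int y < d)%R%:R + (dist_int (- y) < d)%R%:R) :> R.
  rewrite -sum1_count natr_sum mulr_sumr big_mkcond /=; apply: eq_bigr => y _.
  by rewrite dist_intN; case: ifP => _ //=; lra.
have b36 : 0 <= 36 * pi ^+ 2 :> R by rewrite mulr_ge0// sqr_ge0.
have jj : 0 < J%:R ^+ 2 :> R by rewrite exprn_gt0.
(* Cost of smoothing: bumps around d and -d, each majorised by a pair of Fejer kernels, hence four
   symmetrised Fejer sums. *)
have E1 : `|2 * (count (fun y => dist_int y < d) ys)%:R - \sum_(y <- ys) (G y + G (- y))|
    <= 36 * pi ^+ 2 * (pi ^+ 2 / J%:R ^+ 2 * (8 * J%:R * P + 16 * J%:R * S)).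
  rewrite cnt -sumrB; apply: le_trans (ler_norm_sum _ _ _) _.
  apply: (@le_trans _ _ (36 * pi ^+ 2 * (pi ^+ 2 / J%:R ^+ 2 *
    (\sum_(y <- ys) (fejer J (y - d) + fejer J (- y - d)) +
     \sum_(y <- ys) (fejer J (y - - d) + fejer J (- y - - d)) +
     \sum_(y <- ys) (fejer J (y - (d + (2 * J%:R)^-1)) + fejer J (- y - (d + (2 * J%:R)^-1))) +
     \sum_(y <- ys) (fejer J (y - (- d + (2 * J%:R)^-1)) + fejer J (- y - (- d + (2 * J%:R)^-1))))))).
    rewrite -!big_split /= !mulr_sumr; apply: ler_sum => y _.
    have -> : (dist_int y < d)%R%:R + (dist_int (- y) < d)%R%:R - (G y + G (- y)) =
      ((dist_int y < d)%R%:R - G y) + ((dist_int (- y) < d)%R%:R - G (- y)) by ring.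
    apply: le_trans (ler_normD _ _) _.
    apply: le_trans (lerD (ap _) (ap _)) _.
    rewrite -mulrDr ler_wpM2l//.
    have H1 := lerD (bump_le_fejer (y - d) J0) (bump_le_fejer (y + d) J0).
    have H2 := lerD (bump_le_fejer (- y - d) J0) (bump_le_fejer (- y + d) J0).
    apply: le_trans (lerD H1 H2) _.
    rewrite !opprK.
    have -> : y - (d + (2 * J%:R)^-1) = y - d - (2 * J%:R)^-1 by ring.
    have -> : - y - (d + (2 * J%:R)^-1) = - y - d - (2 * J%:R)^-1 by ring.
    have -> : y - (- d + (2 * J%:R)^-1) = y + d - (2 * J%:R)^-1 by ring.
    have -> : - y - (- d + (2 * J%:R)^-1) = - y + d - (2 * J%:R)^-1 by ring.
    rewrite le_eqVlt; apply/orP; left; apply/eqP; ring.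
  rewrite ler_wpM2l// ler_wpM2l ?divr_ge0 ?sqr_ge0//.
  have F s := fejer_sum_sym s ys J0.
  have := F d; have := F (- d).
  have := F (d + (2 * J%:R)^-1); have := F (- d + (2 * J%:R)^-1).
  rewrite -/S -/P.
  by move=> *; lra.
set n0 := (2 * J)%:R * jackson_coef R J 0.
have n00 : 0 < n0 by exact: kern_norm_gt0.
(* Each of the 2r + 1 kernels has mean 1/M, and its other coefficients are at most 6 J^3 / J^4 =
   6/J. *)
have E2 : `|\sum_(y <- ys) (G y + G (- y)) - (2 * r).+1%:R * (2 * M%:R^-1 * P)| <=
   (2 * r).+1%:R * (2 * (6 / J%:R) * S).
  have rM : ((2 * r).+1 <= M)%N by exact: aux.
  have -> : \sum_(y <- ys) (G y + G (- y)) =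
    \sum_(m < M | (m < (2 * r).+1)%N) \sum_(y <- ys)
     (kern J (y - (m%:R / M%:R - r%:R / M%:R)) + kern J (- y - (m%:R / M%:R - r%:R / M%:R))).
    rewrite exchange_big /=; apply: eq_bigr => y _; rewrite /G -big_split /=.
    by apply: eq_bigr => m _; congr (kern _ _ + kern _ _); ring.
  have cst (x : R) : (2 * r).+1%:R * x = \sum_(m < M | (m < (2 * r).+1)%N) x.
    by rewrite -(big_ord_widen M (fun=> x) rM) sumr_const card_ord mulr_natl.
  rewrite !cst -sumrB; apply: le_trans (ler_norm_sum _ _ _) _; apply: ler_sum => m _.
  under eq_bigr do rewrite !kern_cospoly.
  have := @cospoly_sum_bound (2 * J) (fun l => jackson_coef R J l / n0) (6 / J%:R)
     (m%:R / M%:R - r%:R / M%:R) ys.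
  have -> : jackson_coef R J 0 / n0 = M%:R^-1.
    rewrite /n0 -/M invfM mulrCA divff ?mulr1//.
    apply: lt0r_neq0; apply: lt_le_trans (jackson_coef0_ge R J).
    by rewrite divr_gt0// exprn_gt0.
  apply; first by rewrite muln_gt0 J0.
  move=> l _; rewrite ger0_norm ?divr_ge0 ?jackson_coef_ge0 ?(ltW n00)//.
  rewrite ler_pdivrMr//; apply: le_trans (jackson_coef_le R J l) _.
  have := kern_norm_ge R J; rewrite -/n0 => h.
  apply: le_trans (ler_wpM2l _ h); last by rewrite divr_ge0.
  have -> : J%:R ^+ 4 = J%:R * J%:R ^+ 3 :> R by ring.
  have -> : 6 / J%:R * (J%:R * J%:R ^+ 3) = 6 * (J%:R^-1 * J%:R) * J%:R ^+ 3 :> R by ring.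
  by rewrite mulVf ?gt_eqF// mulr1.
have rr : (2 * r).+1%:R = 2 * r%:R + 1 :> R by rewrite -natr1 natrM.
have r2' : d * M%:R < r%:R + 1 by rewrite natr1.
have iM : M%:R^-1 = J%:R^-1 / 2 :> R by rewrite MJ invfM mulrC.
(* Rounding: 2r + 1 differs from 2 d M by at most 1. *)
have E3 : `|(2 * r).+1%:R * (2 * M%:R^-1 * P) - 2 * (2 * d * P)| <= J%:R^-1 * P.
  have -> : (2 * r).+1%:R * (2 * M%:R^-1 * P) - 2 * (2 * d * P) =
     (2 * (r%:R - d * M%:R) + 1) * (J%:R^-1 * P).
    rewrite rr iM MJ.
    have -> : (2 * (r%:R - d * (2 * J%:R)) + 1) * (J%:R^-1 * P) =
      (2 * r%:R + 1) * (J%:R^-1 * P) - 4 * d * (J%:R * J%:R^-1) * P by ring.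
    by rewrite mulfV ?gt_eqF//; field; rewrite gt_eqF.
  have iP : 0 <= J%:R^-1 * P by rewrite mulr_ge0// invr_ge0 ltW.
  rewrite normrM [X in _ * X <= _]ger0_norm//.
  rewrite -[X in _ <= X]mul1r ler_wpM2r//.
  rewrite ler_norml; apply/andP; split; lra.
have i0 : 0 < J%:R^-1 :> R by rewrite invr_gt0.
have E4 : (2 * r).+1%:R * (2 * (6 / J%:R) * S) <= 60 * d * S.
  have : (2 * r).+1%:R * J%:R^-1 <= 5 * d.
    rewrite rr.
    have : (2 * r%:R + 1) <= 4 * d * J%:R + 1 by rewrite MJ in r1; lra.
    move=> h; apply: le_trans (ler_wpM2r (ltW i0) h) _.
    have -> : (4 * d * J%:R + 1) / J%:R = 4 * d * (J%:R * J%:R^-1) + J%:R^-1 by ring.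
    by rewrite mulfV ?gt_eqF//; lra.
  move=> h; have := ler_wpM2r S0 h; nra.
have E5 : 36 * pi ^+ 2 * (pi ^+ 2 / J%:R ^+ 2 * (8 * J%:R * P + 16 * J%:R * S)) <=
   2 * (288 * pi ^+ 4) * (P / J%:R + d * S).
  have -> : 36 * pi ^+ 2 * (pi ^+ 2 / J%:R ^+ 2 * (8 * J%:R * P + 16 * J%:R * S)) =
    (288 * pi ^+ 4) * (J%:R^-1 * P + 2 * J%:R^-1 * S) :> R.
    by field; rewrite gt_eqF.
  have p4 : 0 <= 288 * pi ^+ 4 :> R by apply: mulr_ge0; [exact: ler0n|apply: exprn_ge0; exact: pi_ge0].
  move: (288 * pi ^+ 4) p4 => p p4.
  rewrite (mulrC 2 p) -[X in _ <= X]mulrA; apply: ler_wpM2l => //.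
  have := ler_wpM2r S0 Jd; have := mulr_ge0 (ltW i0) P0; nra.
rewrite /discrepancy_const.
set N := (count _ _)%:R in E1 *.
set g := \sum_(_ <- _) _ in E1 E2.
have : `|2 * N - 2 * (2 * d * P)| <= 2 * (288 * pi ^+ 4) * (P / J%:R + d * S) + 60 * d * S + J%:R^-1 * P.
  have -> : 2 * N - 2 * (2 * d * P) = (2 * N - g) + (g - (2 * r).+1%:R * (2 * M%:R^-1 * P))
     + ((2 * r).+1%:R * (2 * M%:R^-1 * P) - 2 * (2 * d * P)) by ring.
  apply: le_trans (ler_normD _ _) _; apply: lerD => //.
  apply: le_trans (ler_normD _ _) _; apply: lerD; first exact: le_trans E1 E5.
  exact: le_trans E2 E4.
rewrite -mulrBr normrM (@ger0_norm _ 2)//.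
have := mulr_ge0 (ltW d0) S0; have := mulr_ge0 (ltW i0) P0.
move: (pi ^+ 4 : R) => p; set x := `|_|; clear; lra.
Qed.

End DiscrepancyBound.

(** * The weight min(Q, 1/||u||) *)

Section Cut.
Variable R : realType.
Implicit Types Q u w X c : R.

(** This is min(Q, 1/||u||). Testing the product gives the value Q at integers, where the inverse of
    0 would be 0. *)
Definition cutinv Q u : R := if Q * dist_int u <= 1 then Q else (dist_int u)^-1.

Lemma cutinv_ge Q u X : X <= Q -> X * dist_int u <= 1 -> X <= cutinv Q u.
Proof.
rewrite /cutinv => XQ h2; case: (leP (Q * dist_int u) 1) => // h.
have d0 : 0 < dist_int u.
  rewrite lt_neqAle dist_int_ge0 andbT eq_sym; apply/eqP => e.
  by move: h; rewrite e mulr0 ltNge ler01.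
by rewrite -[_^-1]mul1r ler_pdivlMr.
Qed.

Lemma cutinv_le Q u : 0 <= Q -> cutinv Q u <= Q.
Proof.
move=> Q0; rewrite /cutinv; case: (leP (Q * dist_int u) 1) => // h.
have d0 : 0 < dist_int u.
  rewrite lt_neqAle dist_int_ge0 andbT eq_sym; apply/eqP => e.
  by move: h; rewrite e mulr0 ltNge ler01.
by rewrite -[_^-1]mul1r ler_pdivrMr// ltW.
Qed.

Lemma cutinv_dist Q u : cutinv Q u * dist_int u <= 1.
Proof.
rewrite /cutinv; case: (leP (Q * dist_int u) 1) => // h.
have [->|e] := eqVneq (dist_int u) 0; first by rewrite mulr0.
by rewrite mulVf.
Qed.

Lemma cutinv_ge0 Q u : 0 <= Q -> 0 <= cutinv Q u.
Proof. by move=> Q0; apply: cutinv_ge; rewrite ?mul0r. Qed.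

Lemma cutinv_ge1 Q u : 1 <= Q -> 1 <= cutinv Q u.
Proof.
by move=> Q1; apply: cutinv_ge => //; rewrite mul1r; have := dist_int_le_half u; lra.
Qed.

(** The weight varies by a bounded factor over distances O(1/Q), the scale at which it saturates. *)
Lemma cutinv_close Q u w c : 0 < Q -> 0 <= c -> `|u - w| <= c / Q ->
  cutinv Q u <= (1 + c) * cutinv Q w.
Proof.
move=> Q0 c0 uw; have c1 : 0 < 1 + c by lra.
rewrite mulrC -ler_pdivrMr//.
have h1 := cutinv_le u (ltW Q0); have h2 := cutinv_dist Q u; have h3 := cutinv_ge0 u (ltW Q0).
have d := dist_int_lip w u; rewrite distrC in d.
apply: cutinv_ge; rewrite ?ler_pdivrMr// ?mulrDr ?mulr1.
  by rewrite (le_trans h1)// lerDl mulr_ge0// ltW.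
rewrite mulrAC ler_pdivrMr// mul1r.
apply: le_trans (ler_wpM2l h3 d) _; rewrite mulrDr lerD//.
apply: le_trans (ler_pM _ _ h1 uw) _ => //.
by rewrite mulrC divfK// gt_eqF.
Qed.

Lemma sum_cos_cut (n a b : nat) u p : (1 <= a)%N -> (b <= n.+1)%N ->
  `|\sum_(a <= q < b) cos (2 * pi * q%:R * u + p)| <= cutinv n%:R u.
Proof.
move=> a1 bn; apply: cutinv_ge; last exact: sum_cos_dist.
by apply: le_trans (sum_cos_triv _ _ _ _) _; rewrite ler_nat; lia.
Qed.

Lemma sum_sin_cut (n a b : nat) u : (1 <= a)%N -> (b <= n.+1)%N ->
  `|\sum_(a <= q < b) sin (2 * pi * q%:R * u)| <= cutinv n%:R u.
Proof.
move=> a1 bn.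
have -> : \sum_(a <= q < b) sin (2 * pi * q%:R * u) =
    \sum_(a <= q < b) cos (2 * pi * q%:R * u + - (pi / 2)).
  by apply: eq_bigr => q _; rewrite cosB cos_pihalf sin_pihalf mulr0 mulr1 add0r.
exact: sum_cos_cut.
Qed.

Lemma sum_weight_tails (n : nat) (c : nat -> R) :
  \sum_(1 <= q < n.+1) q%:R * c q = \sum_(1 <= m < n.+1) \sum_(m <= q < n.+1) c q.
Proof.
elim: n => [|n IH]; first by rewrite !big_geq.
rewrite big_nat_recr//= IH [RHS]big_nat_recr//= big_nat1.
rewrite (_ : \sum_(1 <= m < n.+1) \sum_(m <= q < n.+2) c q =
   \sum_(1 <= m < n.+1) (\sum_(m <= q < n.+1) c q + c n.+1)).
  rewrite big_split /= big_const_nat iter_addr addr0 subn1 /= -addrA; congr (_ + _).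
  by rewrite -natr1 mulrDl mul1r mulr_natl.
by rewrite !big_nat; apply: eq_bigr => m /andP[m1 mn]; rewrite big_nat_recr//= ltnW.
Qed.

(** The factor q counts the m <= q, so the weighted sum is a sum of n tails, each bounded by
    [sum_cos_cut]. *)
Lemma sum_qcos_cut (n : nat) u :
  `|\sum_(1 <= q < n.+1) q%:R * cos (2 * pi * q%:R * u)| <= n%:R * cutinv n%:R u.
Proof.
have -> : \sum_(1 <= q < n.+1) q%:R * cos (2 * pi * q%:R * u) =
   \sum_(1 <= m < n.+1) \sum_(m <= q < n.+1) cos (2 * pi * q%:R * u + 0).
  rewrite (sum_weight_tails n (fun q => cos (2 * pi * q%:R * u))).
  by apply: eq_bigr => m _; apply: eq_bigr => q _; rewrite addr0.
apply: le_trans (ler_norm_sum _ _ _) _.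
apply: (@le_trans _ _ (\sum_(1 <= m < n.+1) cutinv n%:R u)).
  by rewrite !big_nat; apply: ler_sum => m /andP[m1 _]; apply: sum_cos_cut.
by rewrite big_const_nat iter_addr addr0 subn1 mulr_natl.
Qed.

End Cut.

Lemma mono_split (P : pred nat) n : (forall i, (i.+1 < n)%N -> P i.+1 -> P i) ->
  exists m, [/\ (m <= n)%N, forall i, (i < m)%N -> P i
    & forall i, (m <= i < n)%N -> ~~ P i].
Proof.
elim: n => [|n IH] H; first by exists 0%N; split => // i /andP[]; lia.
have [|m [mn m1 m2]] := IH; first by move=> i ?; apply: H; lia.
have [Pn|Pn] := boolP (P n).
  have all_ k : (k <= n)%N -> P (n - k)%N.
    elim: k => [|k IHk] kn; first by rewrite subn0.
    by apply: H; [lia|rewrite (_ : (n - k.+1).+1 = n - k)%N; [apply: IHk; lia|lia]].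
  exists n.+1; split => //; last by move=> i /andP[]; lia.
  by move=> i ?; rewrite (_ : i = n - (n - i))%N; [apply: all_; lia|lia].
exists m; split => // [|i /andP[mi]]; first lia.
rewrite ltnS leq_eqVlt => /predU1P[->//|i_n].
by apply: m2; rewrite mi.
Qed.

(** * A potential whose increments dominate the weight *)

Section SqrtPotential.
Variable R : realType.
Implicit Types u Q x y : R.

(* A primitive of [1/2 (r^{-1/2} + (1 - r)^{-1/2})], where [r] is the
   fractional part; its derivative dominates [dist_int ^ (-1/2)] although it is
   only 1/2-Hoelder continuous. *)
Definition sqrt_pot u : R :=
  let n : R := (Num.floor u)%:~R in
  2 * n + Num.sqrt (u - n) - Num.sqrt (1 - (u - n)).

Lemma sqrtD_le x y : 0 <= x -> 0 <= y -> Num.sqrt (x + y) <= Num.sqrt x + Num.sqrt y :> R.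
Proof.
move=> x0 y0; have a := sqrtr_ge0 x; have b := sqrtr_ge0 y.
rewrite -(@ler_pXn2r _ 2)// ?nnegrE ?sqrtr_ge0 ?addr_ge0//.
rewrite sqr_sqrtr ?addr_ge0// sqrrD !sqr_sqrtr//.
have := mulr_ge0 a b; rewrite mulr2n; lra.
Qed.

Lemma sqrt_pot_floor u : let n : R := (Num.floor u)%:~R in
  [/\ 0 <= u - n, u - n < 1 & sqrt_pot u = 2 * n + Num.sqrt (u - n) - Num.sqrt (1 - (u - n))].
Proof.
by split => //; have := floor_le u; have := floorD1_gt u; rewrite intrD; lra.
Qed.

(** Either both points lie in one unit cell, or the way from [u] to [u'] consists of a final piece
    [a], an initial piece [b] and [k] full cells, each full cell adding 2 to the potential. *)
Lemma sqrt_pot_lb u (u' : R) : u <= u' ->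
  ((Num.floor u = Num.floor u') /\ forall (n := (Num.floor u)%:~R : R),
     sqrt_pot u' - sqrt_pot u = (Num.sqrt (u' - n) - Num.sqrt (u - n)) +
       (Num.sqrt (1 - (u - n)) - Num.sqrt (1 - (u' - n)))) \/
  (exists a b k : R, [/\ 0 <= a, 0 < b & b <= 1] /\ [/\ a < 1, k = 0 \/ 1 <= k & u' - u = k + a + b] /\
     sqrt_pot u' - sqrt_pot u = 2 * k + (1 + Num.sqrt a - Num.sqrt (1 - a)) +
        (1 + Num.sqrt b - Num.sqrt (1 - b)) /\ a = u' - (Num.floor u')%:~R).
Proof.
move=> uu'; have [h1 h2 e] := sqrt_pot_floor u; have [h1' h2' e'] := sqrt_pot_floor u'.
have := le_floor uu'; rewrite le_eqVlt => /predU1P[f|f].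
  left; split => // n; rewrite e e' -f -/n; ring.
right; move: e e'; set n := (Num.floor u)%:~R in h1 h2 *.
set n' := (Num.floor u')%:~R in h1' h2' *.
have nn : n + 1 <= n' by rewrite -intrD1 ler_int lezD1.
move=> e e'; exists (u' - n'), (1 - (u - n)), (n' - n - 1).
split; first by split; lra.
split.
  split; [lra| |ring].
  move: nn; rewrite /n /n' -intrD1 ler_int le_eqVlt => /predU1P[<-|h]; [left|right].
    by rewrite intrD; ring.
  have : (Num.floor u + 1 + 1)%:~R <= (Num.floor u')%:~R :> R by rewrite ler_int lezD1.
  by rewrite !intrD; lra.
split => //; rewrite e e' (_ : 1 - (1 - (u - n)) = u - n); last by ring.
ring.
Qed.

Lemma sqrt_conj x : 0 <= x -> x <= 1 -> Num.sqrt (1 - x) <= 1 /\ 1 <= Num.sqrt x + Num.sqrt (1 - x) :> R.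
Proof.
move=> x0 x1; split; first by rewrite -[X in _ <= X]sqrtr1; apply: ler_wsqrtr; lra.
by rewrite -{1}[1]sqrtr1 -{1}(subrK x 1) [X in Num.sqrt X]addrC; apply: sqrtD_le; lra.
Qed.

Lemma sqrtB_le x y : 0 <= x -> x <= y -> Num.sqrt y - Num.sqrt x <= Num.sqrt (y - x) :> R.
Proof.
move=> x0 xy; rewrite lerBlDr -{1}(subrK x y); apply: sqrtD_le; lra.
Qed.

Lemma sqrt_pot_incr u (u' : R) : u <= u' ->
  0 <= sqrt_pot u' - sqrt_pot u <= 4 * (Num.sqrt (u' - u) + (u' - u)).
Proof.
move=> uu'; have s0 := sqrtr_ge0 (u' - u).
have [[f] e|[a [b [k [[a0 b0 b1] [[a1 k0 d] [e _]]]]]]] := sqrt_pot_lb uu'.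
  have [h1 h2 _] := sqrt_pot_floor u; have [h1' h2' _] := sqrt_pot_floor u'.
  rewrite -f in h1' h2'; rewrite e; set n := _%:~R in h1 h2 h1' h2' *.
  have p1 : Num.sqrt (u - n) <= Num.sqrt (u' - n) by apply: ler_wsqrtr; lra.
  have p2 : Num.sqrt (1 - (u' - n)) <= Num.sqrt (1 - (u - n)) by apply: ler_wsqrtr; lra.
  have q1 := @sqrtB_le (u - n) (u' - n) h1 ltac:(lra).
  have q2 := @sqrtB_le (1 - (u' - n)) (1 - (u - n)) ltac:(lra) ltac:(lra).
  have e1 : u' - n - (u - n) = u' - u by ring.
  have e2 : 1 - (u - n) - (1 - (u' - n)) = u' - u by ring.
  rewrite e1 in q1; rewrite e2 in q2.
  by apply/andP; split; lra.
rewrite e; have [x1 x2] := sqrt_conj a0 (ltW a1); have [y1 y2] := sqrt_conj (ltW b0) b1.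
have sa : Num.sqrt a <= Num.sqrt (u' - u) by apply: ler_wsqrtr; lra.
have sb : Num.sqrt b <= Num.sqrt (u' - u) by apply: ler_wsqrtr; lra.
have := sqrtr_ge0 a; have := sqrtr_ge0 b.
by move=> *; apply/andP; split; lra.
Qed.

Lemma cutinv_sqrt Q u : 0 < Q -> cutinv Q u * Num.sqrt (dist_int u + Q^-1) <= 2 * Num.sqrt Q.
Proof.
move=> Q0; have i0 : 0 < Q^-1 by rewrite invr_gt0.
have c0 := cutinv_ge0 u (ltW Q0); have d0 := dist_int_ge0 u.
rewrite -(@ler_pXn2r _ 2)// ?nnegrE ?mulr_ge0 ?sqrtr_ge0//.
rewrite !exprMn !sqr_sqrtr ?(ltW Q0) ?addr_ge0 ?(ltW i0)//.
have h1 := cutinv_le u (ltW Q0); have h2 := cutinv_dist Q u.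
have h3 : cutinv Q u * Q^-1 <= 1 by rewrite -[Q^-1]mul1r mulrA mulr1 ler_pdivrMr// mul1r.
have : cutinv Q u * (dist_int u + Q^-1) <= 2 by rewrite mulrDr; lra.
nra.
Qed.

(** The weight is at most 2 sqrt Q / sqrt(||u|| + 1/Q), and the potential grows at rate at least a
    constant times ||u||^(-1/2). The shift by 1/Q allows for the length of the step. *)
Lemma cutinv_sqrt_pot Q u (u' : R) : 1 <= Q -> u <= u' -> u' - u <= Q^-1 ->
  (u' - u) * cutinv Q u' <= 4 * Num.sqrt Q * (sqrt_pot u' - sqrt_pot u).
Proof.
move=> Q1 uu' uQ; have Q0 : 0 < Q by lra.
have i0 : 0 < Q^-1 by rewrite invr_gt0.
have i1 : Q^-1 <= 1 by rewrite invf_le1.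
have s0 := sqrtr_ge0 Q.
have [[f] e|[a [b [k [[a0 b0 b1] [[a1 k0 d] [e ea]]]]]]] := sqrt_pot_lb uu'.
  have [h1 h2 _] := sqrt_pot_floor u; have [h1' h2' _] := sqrt_pot_floor u'.
  rewrite -f in h1' h2'; rewrite e; set n := _%:~R in h1 h2 h1' h2' *.
  have dd : dist_int u' = u' - n \/ dist_int u' = 1 - (u' - n).
    have [r|r] := leP (u' - n) (1 / 2); [left|right]; apply/le_anti/andP; split.
    - by apply: le_trans (dist_int_le _ (Num.floor u)) _; rewrite -/n ger0_norm.
    - have [m ->] := dist_int_ex u'.
      have [mn|mn] := leP m (Num.floor u).
        by apply: le_trans (ler_norm _); have : m%:~R <= n by [rewrite ler_int]; lra.
      rewrite distrC; apply: le_trans (ler_norm _).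
      by have : n + 1 <= m%:~R by [rewrite /n -intrD1 ler_int lezD1]; lra.
    - apply: le_trans (dist_int_le _ (Num.floor u + 1)) _.
      by rewrite intrD -/n ler0_norm; lra.
    - have [m ->] := dist_int_ex u'.
      have [mn|mn] := leP m (Num.floor u).
        by apply: le_trans (ler_norm _); have : m%:~R <= n by [rewrite ler_int]; lra.
      rewrite distrC; apply: le_trans (ler_norm _).
      by have : n + 1 <= m%:~R by [rewrite /n -intrD1 ler_int lezD1]; lra.
  have cs := cutinv_sqrt u' Q0.
  set w := Num.sqrt (dist_int u' + Q^-1) in cs.
  have p1 : Num.sqrt (u - n) <= Num.sqrt (u' - n) by apply: ler_wsqrtr; lra.
  have p2 : Num.sqrt (1 - (u' - n)) <= Num.sqrt (1 - (u - n)) by apply: ler_wsqrtr; lra.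
  have w0 : 0 < w by rewrite sqrtr_gt0 ltr_wpDl ?dist_int_ge0.
  have key x y : 0 <= x -> x <= y -> y <= dist_int u' + Q^-1 -> y - x = u' - u ->
      u' - u <= 2 * w * (Num.sqrt y - Num.sqrt x).
    move=> x0 xy yw yx.
    have a1 : Num.sqrt y <= w by apply: ler_wsqrtr.
    have a2 : Num.sqrt x <= Num.sqrt y by apply: ler_wsqrtr.
    have a3 := sqr_sqrtr x0; have a4 := @sqr_sqrtr _ y ltac:(lra).
    have a5 := sqrtr_ge0 x.
    rewrite -yx; move: a1 a2 a3 a4 a5.
    move: (Num.sqrt x) (Num.sqrt y) => a b a1 a2 a3 a4 a5.
    have -> : y - x = (b + a) * (b - a) by rewrite -a3 -a4; ring.
    by apply: ler_wpM2r; lra.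
  (* Within a cell, the square root attached to the integer nearest [u'] supplies the increment; the
     other one is monotone in the right direction. *)
  have main : u' - u <= 2 * w * (Num.sqrt (u' - n) - Num.sqrt (u - n) +
       (Num.sqrt (1 - (u - n)) - Num.sqrt (1 - (u' - n)))).
    case: dd => dd.
      have := @key (u - n) (u' - n) h1 ltac:(lra) ltac:(lra) ltac:(ring).
      nra.
    have := @key (1 - (u' - n)) (1 - (u - n)) ltac:(lra) ltac:(lra) ltac:(lra) ltac:(ring).
    nra.
  move: main; set P := _ + _; have P0 : 0 <= P by rewrite /P; lra.
  have c0 := cutinv_ge0 u' (ltW Q0).
  move=> main; apply: le_trans (ler_wpM2r c0 main) _.
  nra.
rewrite e; have [x1 x2] := sqrt_conj a0 (ltW a1); have [y1 y2] := sqrt_conj (ltW b0) b1.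
have sa := sqrtr_ge0 a; have sb := sqrtr_ge0 b.
have ssd : Num.sqrt (u' - u) * Num.sqrt (u' - u) = u' - u by rewrite -expr2 sqr_sqrtr; lra.
have sdQ : Num.sqrt (u' - u) * Num.sqrt Q <= 1.
  rewrite -sqrtrM; last lra.
  by rewrite -[X in _ <= X]sqrtr1; apply: ler_wsqrtr; rewrite -(@mulVf _ Q) ?gt_eqF// ler_wpM2r// ltW.
have sQ : Num.sqrt Q * Num.sqrt Q = Q by rewrite -expr2 sqr_sqrtr// ltW.
have sd : Num.sqrt (u' - u) <= Num.sqrt k + Num.sqrt a + Num.sqrt b.
  have kk : 0 <= k by case: k0 => [->|]; lra.
  rewrite d; apply: le_trans (sqrtD_le (addr_ge0 kk a0) (ltW b0)) _.
  by rewrite lerD2r; apply: sqrtD_le.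
have k00 : k = 0 by case: k0 => // k1; lra.
have P0 : Num.sqrt (u' - u) <= 4 * (2 * k + (1 + Num.sqrt a - Num.sqrt (1 - a)) +
        (1 + Num.sqrt b - Num.sqrt (1 - b))).
  by move: sd; rewrite k00 sqrtr0; lra.
have c1 := cutinv_le u' (ltW Q0).
have du : 0 <= u' - u by lra.
apply: le_trans (ler_wpM2l du c1) _.
move: P0; set P := 2 * k + _ + _ => P0.
have -> : (u' - u) * Q = (Num.sqrt (u' - u) * Num.sqrt Q) * (Num.sqrt (u' - u) * Num.sqrt Q).
  by rewrite -{1}ssd -{1}sQ; ring.
have t0 : 0 <= Num.sqrt (u' - u) by exact: sqrtr_ge0.
apply: (@le_trans _ _ (1 * (Num.sqrt (u' - u) * Num.sqrt Q))).
  by apply: ler_wpM2r => //; exact: mulr_ge0.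
by have := ler_wpM2r s0 P0; lra.
Qed.

End SqrtPotential.

(** * Riemann sums of the weight against z^(-3/2) *)

Section RiemannSum.
Variable R : realType.

(** Summation by parts: against a nonnegative decreasing weight, increments may be replaced by those
    of a majorant, up to a boundary term. *)
Lemma abel_majorize (g a b : nat -> R) m n : (m <= n)%N ->
  (forall i, (m <= i <= n)%N -> 0 <= g i) ->
  (forall i, (m <= i < n)%N -> g i.+1 <= g i) ->
  (forall i, (m <= i <= n)%N -> a i <= b i) ->
  \sum_(m <= i < n) g i * (a i.+1 - a i) <=
  \sum_(m <= i < n) g i * (b i.+1 - b i) + g m * (b m - a m).
Proof.
move=> mn g0 gd ab.
suff H : g n * (b n - a n) - g m * (b m - a m) <=
    \sum_(m <= i < n) g i * ((b i.+1 - a i.+1) - (b i - a i)).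
  have -> : \sum_(m <= i < n) g i * (b i.+1 - b i) =
     \sum_(m <= i < n) g i * ((b i.+1 - a i.+1) - (b i - a i)) +
     \sum_(m <= i < n) g i * (a i.+1 - a i).
    by rewrite -big_split; apply: eq_bigr => i _ /=; ring.
  have : 0 <= g n * (b n - a n).
    by rewrite mulr_ge0 ?subr_ge0 ?g0 ?ab ?mn ?leqnn.
  by lra.
elim: n mn g0 gd ab => [|n IH] mn g0 gd ab.
  have -> : m = 0%N by lia.
  by rewrite big_geq// subrr.
have [e|mn'] := eqVneq m n.+1; first by rewrite e big_geq// subrr.
have {}mn : (m <= n)%N by lia.
rewrite big_nat_recr//=.
have {}IH : g n * (b n - a n) - g m * (b m - a m) <=
    \sum_(m <= i < n) g i * ((b i.+1 - a i.+1) - (b i - a i)).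
  by apply: IH => // i ?; [apply: g0|apply: gd|apply: ab]; lia.
have h1 : g n.+1 <= g n by apply: gd; lia.
have h2 : a n.+1 <= b n.+1 by apply: ab; lia.
have h3 : 0 <= b n.+1 - a n.+1 by lra.
have := ler_wpM2r h3 h1; lra.
Qed.

(** With s = sqrt z, these are the discrete primitives of z^(-3/2) dz and of z^(-3/2) d(sqrt z); s'
    <= 2 s keeps the loss to a constant. *)
Lemma incr_over_cube (s s' : R) : 0 < s -> s <= s' -> s' <= 2 * s ->
  (s' ^+ 2 - s ^+ 2) / s ^+ 3 <= 6 * (s^-1 - s'^-1) /\
  (s' - s) / s ^+ 3 <= 2 * ((s ^+ 2)^-1 - (s' ^+ 2)^-1).
Proof.
move=> s0 ss s2; have s0' : 0 < s' by lra.
have e1 : s^-1 - s'^-1 = (s' - s) / (s * s') by field; rewrite !gt_eqF.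
have e2 : (s ^+ 2)^-1 - (s' ^+ 2)^-1 = (s' - s) * (s' + s) / (s * s') ^+ 2.
  by field; rewrite !gt_eqF.
have p3 : 0 < s ^+ 3 by rewrite exprn_gt0.
have p1 : 0 < s * s' by rewrite mulr_gt0.
split.
  rewrite e1 mulrA ler_pdivrMr// -mulrAC ler_pdivlMr//.
  have -> : (s' ^+ 2 - s ^+ 2) * (s * s') = ((s' - s) * s) * ((s' + s) * s') by ring.
  have -> : 6 * (s' - s) * s ^+ 3 = ((s' - s) * s) * (6 * s ^+ 2) by ring.
  rewrite ler_wpM2l//; last nra.
  by rewrite mulr_ge0; lra.
rewrite e2 mulrA ler_pdivrMr// -mulrAC ler_pdivlMr ?exprn_gt0//.
have -> : (s' - s) * (s * s') ^+ 2 = ((s' - s) * s ^+ 2 * s') * s' by ring.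
have -> : 2 * ((s' - s) * (s' + s)) * s ^+ 3 = ((s' - s) * s ^+ 2) * (2 * s * (s' + s)) by ring.
rewrite -[X in X <= _]mulrA ler_wpM2l//; last nra.
by rewrite mulr_ge0 ?sqr_ge0//; lra.
Qed.

(* Discrete form of [\int z^(-3/2) min(Q, 1/||u + z||) dz << sqrt Q min(Q, 1/||u||)],
   the integral being over [z >= 1/Q]. *)
Lemma riemann_sum_cut (k Q u : R) (z : nat -> R) n : 1 <= k -> 1 <= Q ->
  1 / (k * Q) <= z 0%N ->
  (forall i, (i < n)%N -> z i <= z i.+1 <= z i + 1 / (k * Q)) ->
  \sum_(0 <= i < n) (z i.+1 - z i) / Num.sqrt (z i) ^+ 3 * cutinv Q (u + z i.+1) <=
  1000 * (k * Num.sqrt Q * cutinv Q u).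
Proof.
move=> k1 Q1 z0 zi.
have Q0 : 0 < Q by lra.
have kQ : 0 < k * Q by apply: mulr_gt0; lra.
have ikQ : 1 / (k * Q) <= Q^-1.
  by rewrite mul1r lef_pV2 ?posrE// -[X in X <= _]mul1r ler_wpM2r// ltW.
have ikQ0 : 0 < 1 / (k * Q) by rewrite mul1r invr_gt0.
have zlb i : (i <= n)%N -> 1 / (k * Q) <= z i.
  elim: i => // i IH ni; apply: le_trans (IH (ltnW ni)) _.
  by have /andP[] := zi i ni.
have zmono i j : (i <= j <= n)%N -> z i <= z j.
  move=> /andP[]; elim: j => [|j IH]; first by rewrite leqn0 => /eqP ->.
  rewrite leq_eqVlt => /predU1P[->//|ij] jn.
  by apply: le_trans (IH _ _) _; [lia|lia|have /andP[] := zi j jn].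
pose s i := Num.sqrt (z i).
have sgt i : (i <= n)%N -> 0 < s i by move=> ni; rewrite sqrtr_gt0; have := zlb i ni; lra.
have ssq i : (i <= n)%N -> s i ^+ 2 = z i.
  by move=> ni; rewrite sqr_sqrtr//; have := zlb i ni; lra.
have sinc i : (i < n)%N -> s i <= s i.+1.
  by move=> ni; apply: ler_wsqrtr; have /andP[] := zi i ni.
have sdbl i : (i < n)%N -> s i.+1 <= 2 * s i.
  move=> ni; have := ssq _ (ltnW ni); have := ssq _ ni; have := sgt _ (ltnW ni).
  have := sgt _ ni; have /andP[_] := zi i ni; have := zlb _ (ltnW ni); nra.
have ic i (ni : (i < n)%N) := incr_over_cube (sgt _ (ltnW ni)) (sinc _ ni) (sdbl _ ni).
set c := cutinv Q u.
have c1 : 1 <= c by exact: cutinv_ge1.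
have cQ : forall X, X <= k * Q -> X * dist_int u <= 4 -> X <= 4 * k * c.
  move=> X h1 h2; have k4 : 0 < 4 * k by lra.
  rewrite mulrC -ler_pdivrMr//; apply: cutinv_ge.
    by rewrite ler_pdivrMr// (le_trans h1)//; nra.
  by rewrite mulrAC ler_pdivrMr//; lra.
have sQ0 : 0 < Num.sqrt Q by rewrite sqrtr_gt0.
pose T i := (z i.+1 - z i) / s i ^+ 3.
have T0 i : (i < n)%N -> 0 <= T i.
  move=> ni; rewrite divr_ge0 ?exprn_ge0 ?(ltW (sgt _ (ltnW ni)))// subr_ge0.
  by have /andP[] := zi i ni.
(* While z <= ||u|| / 2, the point u + z is about as far from the integers as u, and the weight is
   comparable with its value at u. Afterwards z is at least ||u|| / 4, and the potential takes
   over. *)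
have [|m [mn m1 m2]] := @mono_split (fun i => z i.+1 <= dist_int u / 2) n.
  by move=> i ni; apply: le_trans; apply: zmono; rewrite leqnSn.
have W0 : 0 <= k * Num.sqrt Q * c.
  by apply: mulr_ge0; [apply: mulr_ge0; [lra|exact: ltW]|lra].
have A1 : \sum_(0 <= i < m) T i * cutinv Q (u + z i.+1) <= 12 * (k * Num.sqrt Q * c).
  apply: (@le_trans _ _ (\sum_(0 <= i < m) (2 * c) * (6 * ((s i)^-1 - (s i.+1)^-1)))).
    rewrite !big_nat; apply: ler_sum => i /andP[_ im].
    have ni : (i < n)%N by exact: leq_trans im mn.
    rewrite mulrC; apply: ler_pM; rewrite ?cutinv_ge0 ?T0 ?(ltW Q0)//; last first.
      by have [+ _] := ic i ni; rewrite !ssq// ltnW.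
    have h := m1 _ im; have zp := zlb _ ni.
    have h1 := cutinv_le (u + z i.+1) (ltW Q0); have h2 := cutinv_dist Q (u + z i.+1).
    have h3 := cutinv_ge0 (u + z i.+1) (ltW Q0).
    have dd := dist_int_lip u (u + z i.+1).
    rewrite opprD addrA subrr sub0r normrN ger0_norm in dd; last exact: le_trans (ltW ikQ0) zp.
    rewrite mulrC -ler_pdivrMr//; apply: cutinv_ge; first lra.
    move: h1 h2 h3 dd; set x := cutinv _ _; set y := dist_int (_ + _) => h1 h2 h3 dd.
    have : x * dist_int u <= x * (y + dist_int u / 2).
      by apply: ler_wpM2l => //; lra.
    nra.
  rewrite -mulr_sumr -mulr_sumr -[X in _ * (_ * X) <= _]opprK -sumrN.
  under eq_bigr do rewrite opprB.
  rewrite telescope_sumr// opprB.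
  have sm : 0 < (s m)^-1 by rewrite invr_gt0 sgt.
  have s00 : (s 0%N)^-1 <= k * Num.sqrt Q.
    have -> : k * Num.sqrt Q = (1 / (k * Num.sqrt Q))^-1.
      by rewrite mul1r invrK.
    have kq : 0 < k * Num.sqrt Q by apply: mulr_gt0; lra.
    rewrite lef_pV2 ?posrE ?sgt//; last by rewrite mul1r invr_gt0.
    rewrite -(@ler_pXn2r _ 2)// ?nnegrE; [|by rewrite mul1r invr_ge0 ltW|by rewrite ltW// sgt].
    rewrite ssq//; apply: le_trans z0; rewrite expr_div_n expr1n.
    rewrite exprMn sqr_sqrtr ?(ltW Q0)// !mul1r lef_pV2 ?posrE//; last first.
      by apply: mulr_gt0 => //; apply: exprn_gt0; lra.
    by rewrite ler_wpM2r ?(ltW Q0)//; nra.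
  have e12 : 12 * (k * Num.sqrt Q * c) = 2 * c * (6 * (k * Num.sqrt Q)) by ring.
  rewrite e12; apply: ler_wpM2l; lra.
have A2 : \sum_(m <= i < n) T i * cutinv Q (u + z i.+1) <= 900 * (k * Num.sqrt Q * c).
  have [e|mn'] := eqVneq m n.
    rewrite e big_geq; [by move: W0; clear; lra|exact: leqnn].
  have {}mn' : (m < n)%N by rewrite ltn_neqAle mn'.
  have zm : dist_int u / 4 <= z m.
    have := m2 m; rewrite leqnn mn' -ltNge => /(_ isT) h.
    have /andP[_ h'] := zi _ mn'; move: h h' (zlb _ mn) (dist_int_ge0 u); clear.
    by move: (1 / (k * Q)) (dist_int u) (z m) (z m.+1) => *; lra.
  have zmp : 0 < z m by have := zlb _ mn; lra.
  have izm : (z m)^-1 <= 4 * k * c.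
    apply: cQ; last by rewrite mulrC ler_pdivrMr//; lra.
    rewrite -[k * Q]invrK lef_pV2 ?posrE ?invr_gt0//.
    by have := zlb _ mn; rewrite mul1r.
  (* [a] is the growth of the potential and [b] its Hoelder majorant; [abel_majorize] trades one for
     the other against the weight z^(-3/2). *)
  pose a i := sqrt_pot (u + z i) - sqrt_pot (u + z m).
  pose b i := 4 * (s i + z i).
  apply: (@le_trans _ _ (4 * Num.sqrt Q * \sum_(m <= i < n) (s i ^+ 3)^-1 * (a i.+1 - a i))).
    rewrite mulr_sumr !big_nat; apply: ler_sum => i /andP[im ni].
    have /andP[q1 q2] := zi i ni.
    have := @cutinv_sqrt_pot _ Q (u + z i) (u + z i.+1) Q1 ltac:(lra) ltac:(lra).
    have -> : u + z i.+1 - (u + z i) = z i.+1 - z i by ring.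
    have -> : a i.+1 - a i = sqrt_pot (u + z i.+1) - sqrt_pot (u + z i).
      by rewrite /a; ring.
    have p3 : 0 <= (s i ^+ 3)^-1 by rewrite invr_ge0 exprn_ge0// ltW// sgt// ltnW.
    move=> h; have := ler_wpM2l p3 h.
    rewrite /T => h'; rewrite mulrAC mulrC (_ : 4 * Num.sqrt Q * _ = (s i ^+ 3)^-1 * (4 * Num.sqrt Q *
       (sqrt_pot (u + z i.+1) - sqrt_pot (u + z i)))) //; ring.
  have maj := @abel_majorize (fun i => (s i ^+ 3)^-1) a b m n mn.
  have {}maj : \sum_(m <= i < n) (s i ^+ 3)^-1 * (a i.+1 - a i) <=
     \sum_(m <= i < n) (s i ^+ 3)^-1 * (b i.+1 - b i) + (s m ^+ 3)^-1 * (b m - a m).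
    apply: maj => i /andP[im ni].
    - by rewrite invr_ge0 exprn_ge0// ltW// sgt.
    - by rewrite lef_pV2 ?posrE ?exprn_gt0 ?sgt ?(ltnW ni)// lerXn2r ?nnegrE ?(ltW (sgt _ _))// ?sinc// ltnW.
    have zz : z m <= z i by apply: zmono; rewrite im.
    have /andP[_] := @sqrt_pot_incr _ (u + z m) (u + z i) ltac:(lra).
    have -> : u + z i - (u + z m) = z i - z m by ring.
    move/le_trans; apply; rewrite /b.
    have : Num.sqrt (z i - z m) <= s i by apply: ler_wsqrtr; lra.
    lra.
  have am : a m = 0 by rewrite /a subrr.
  have B1 : \sum_(m <= i < n) (s i ^+ 3)^-1 * (b i.+1 - b i) <=
     8 * (z m)^-1 + 24 * (s m)^-1.
    apply: (@le_trans _ _ (\sum_(m <= i < n) ((- (8 * (z i.+1)^-1 + 24 * (s i.+1)^-1)) -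
        (- (8 * (z i)^-1 + 24 * (s i)^-1))))).
      rewrite !big_nat; apply: ler_sum => i /andP[im ni].
      have [+ +] := ic _ ni; rewrite !ssq// 1?ltnW//.
      have -> : (s i ^+ 3)^-1 * (b i.+1 - b i) =
        4 * ((s i.+1 - s i) / s i ^+ 3) + 4 * ((z i.+1 - z i) / s i ^+ 3).
        by rewrite /b; ring.
      by move=> ? ?; lra.
    rewrite telescope_sumr//.
    have : 0 < (z n)^-1 by rewrite invr_gt0; have := zlb _ (leqnn n); lra.
    have : 0 < (s n)^-1 by rewrite invr_gt0 sgt.
    lra.
  have sm0 := sgt _ mn.
  have B2 : (s m ^+ 3)^-1 * (b m - a m) = 4 * (z m)^-1 + 4 * (s m)^-1.
    by rewrite am /b subr0 -(ssq _ mn); field; rewrite gt_eqF.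
  have ism : (s m)^-1 <= 1 + (z m)^-1.
    rewrite -(ssq _ mn) -exprVn; have : 0 < (s m)^-1 by rewrite invr_gt0.
    nra.
  have tot : \sum_(m <= i < n) (s i ^+ 3)^-1 * (a i.+1 - a i) <= 220 * k * c.
    rewrite B2 in maj; have kc : 1 <= k * c by nra.
    have : 4 * k * c = 4 * (k * c) by ring.
    have -> : 220 * k * c = 220 * (k * c) by ring.
    move=> e4; rewrite e4 in izm; lra.
  have -> : 900 * (k * Num.sqrt Q * c) = 4 * Num.sqrt Q * (225 * k * c) by ring.
  apply: ler_wpM2l; first lra.
  apply: le_trans tot _; apply: ler_wpM2r; lra.
rewrite (@big_cat_nat _ _ _ m)//=.
have := lerD A1 A2; rewrite -/T; move: W0; clear; lra.
Qed.

End RiemannSum.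

(** * Discrete integration by parts away from the stationary point *)

Section FarSum.
Variable R : realType.

Lemma cos_lip (a b : R) : `|cos b - cos a| <= `|b - a|.
Proof.
wlog ab : a b / a < b => [H|].
  have [/H//|/H|->] := ltgtP a b; last by rewrite !subrr normr0.
  by rewrite distrC (distrC a).
have [c _ ->] : exists2 c, c \in `]a, b[ & cos b - cos a = - sin c * (b - a).
  apply: MVT => //; by apply: continuous_subspaceT; exact: continuous_cos.
rewrite normrM normrN ler_piMl//.
by rewrite ler_norml sin_geN1 sin_le1.
Qed.

Lemma sin_taylor (a b : R) : a <= b -> `|sin b - sin a - (b - a) * cos a| <= (b - a) ^+ 2.
Proof.
rewrite le_eqVlt => /predU1P[->|ab].
  by rewrite !subrr mul0r subr0 normr0 expr2 mul0r.
have [c /[!in_itv]/= /andP[ac cb] ->] := sin_MVT ab.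
rewrite [X in X - _]mulrC -mulrBr normrM gtr0_norm ?subr_gt0// expr2 ler_pM2l ?subr_gt0//.
apply: le_trans (cos_lip _ _) _.
by rewrite ger0_norm; lra.
Qed.

Lemma abel_diff (b P : nat -> R) n : (0 < n)%N ->
  \sum_(0 <= i < n) b i * (P i.+1 - P i) =
  b n.-1 * P n - b 0%N * P 0%N - \sum_(1 <= i < n) (b i - b i.-1) * P i.
Proof.
case: n => // n _ /=; elim: n => [|n IH].
  by rewrite big_nat1 big_geq//; ring.
rewrite big_nat_recr//= IH [X in _ = _ - X]big_nat_recr//=; ring.
Qed.

Variables (k : R) (Q j : nat) (h ub : R) (t u : nat -> R) (n : nat).
Hypotheses (k1 : 1 <= k) (Q1 : (0 < Q)%N) (j1 : (0 < j)%N) (h0 : 0 < h) (n0 : (0 < n)%N).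
Hypotheses (t0 : 0 < t 0%N) (tS : forall i, t i.+1 = t i + h).
Hypothesis uincr : forall i, (i < n)%N ->
  2 * j%:R / k * t i * h <= u i.+1 - u i.
Hypothesis usnd : forall i, (0 < i < n)%N ->
  `|(u i.+1 - u i) - (u i - u i.-1)| <= 2 * j%:R * k * h ^+ 2.

(** Up to the factor 2 pi, the sum of q cos(2 pi q u) is the derivative of the sine sum in u. Hence
    [S] is a Riemann sum for the integral of d(Psi) / (2 pi u'), where [D] is h u' and [b] is 1/(2
    pi u'). *)
Let Psi i := \sum_(1 <= q < Q.+1) sin (2 * pi * q%:R * u i).
Let S := h * \sum_(0 <= i < n) \sum_(1 <= q < Q.+1) q%:R * cos (2 * pi * q%:R * u i).
Let D i := u i.+1 - u i.
Let b i := h / (2 * pi * D i).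

Let j0 : 0 < j%:R :> R. Proof. by rewrite ltr0n. Qed.
Let k0 : 0 < k. Proof. exact: lt_le_trans ltr01 k1. Qed.
Let Q0 : 0 < Q%:R :> R. Proof. by rewrite ltr0n. Qed.

Lemma far_t_gt0 i : 0 < t i.
Proof. by elim: i => // i IH; rewrite tS addr_gt0. Qed.

Lemma far_D_gt0 i : (i < n)%N -> 0 < D i.
Proof.
move=> ni; apply: lt_le_trans (uincr ni).
by rewrite !mulr_gt0 ?invr_gt0 ?far_t_gt0.
Qed.

Lemma far_hD i : (i < n)%N -> h / D i <= k / (2 * j%:R * t i).
Proof.
move=> ni; have tp := far_t_gt0 i.
rewrite ler_pdivrMr ?far_D_gt0// mulrAC ler_pdivlMr ?mulr_gt0//.
have := uincr ni; rewrite -(ler_pM2l k0).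
have -> : k * (2 * j%:R / k * t i * h) = h * (2 * j%:R * t i) * (k / k) by ring.
by rewrite divff ?mulr1// gt_eqF.
Qed.

Lemma far_b_le i : (i < n)%N -> 0 <= b i <= k / (j%:R * t i).
Proof.
move=> ni; have tp := far_t_gt0 i; have Dp := far_D_gt0 ni.
have p2 := pi_ge2 R; have bE : b i = h / D i / (2 * pi).
  by rewrite /b; field; rewrite !gt_eqF//; lra.
have hD0 : 0 < h / D i by rewrite divr_gt0.
apply/andP; split; first by rewrite bE divr_ge0 ?(ltW hD0)//; lra.
rewrite bE ler_pdivrMr; last lra.
apply: le_trans (far_hD ni) _.
have -> : k / (2 * j%:R * t i) = k / (j%:R * t i) / 2.
  by field; rewrite !gt_eqF.
have : 0 <= k / (j%:R * t i) by rewrite divr_ge0 ?mulr_ge0 ?ltW.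
by move: (k / _) => x x0; nra.
Qed.

(** A discrete derivative of 1/u': the second difference of [u] divided by the square of u', with u'
    at least of size j t. *)
Lemma far_b_diff i : (0 < i < n)%N ->
  `|b i - b i.-1| <= k ^+ 3 * h / (8 * j%:R * t i.-1 * t i).
Proof.
move=> /andP[i0 ni]; have ni' : (i.-1 < n)%N by lia.
have iE : i.-1.+1 = i by lia.
have tp := far_t_gt0 i; have Dp := far_D_gt0 ni.
have tp' := far_t_gt0 i.-1; have Dp' := far_D_gt0 ni'.
have p2 := pi_ge2 R; have pp := pi_gt0 R.
have -> : b i - b i.-1 = - ((h / D i) * (h / D i.-1) * ((D i - D i.-1) / (2 * pi * h))).
  rewrite /b; move: Dp Dp' pp; move: (D i) (D i.-1) (@pi R) => x y p x0 y0 p0.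
  field.
  by rewrite !gt_eqF.
rewrite normrN normrM [X in X * _]ger0_norm; last by rewrite !mulr_ge0 ?invr_ge0 ?ltW.
have h1 := far_hD ni; have h2 := far_hD ni'.
have h3 : `|(D i - D i.-1) / (2 * pi * h)| <= j%:R * k * h / 2.
  rewrite normrM [X in _ * X]ger0_norm; last by rewrite invr_ge0 !mulr_ge0 ?ltW.
  rewrite ler_pdivrMr ?mulr_gt0//.
  have := usnd (i := i); rewrite i0 ni => /(_ isT); rewrite /D iE => /le_trans; apply.
  have : 0 <= j%:R * k * h ^+ 2 by rewrite !mulr_ge0 ?ltW// exprn_gt0.
  have -> : j%:R * k * h / 2 * (2 * pi * h) = (j%:R * k * h ^+ 2) * pi by field.
  have -> : 2 * j%:R * k * h ^+ 2 = (j%:R * k * h ^+ 2) * 2 by ring.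
  by move=> x0; apply: ler_wpM2l.
have -> : k ^+ 3 * h / (8 * j%:R * t i.-1 * t i) =
    (k / (2 * j%:R * t i)) * (k / (2 * j%:R * t i.-1)) * (j%:R * k * h / 2).
  by field; rewrite !gt_eqF.
apply: ler_pM => //; first by rewrite !mulr_ge0 ?invr_ge0 ?ltW.
by apply: ler_pM => //; rewrite ltW// divr_gt0.
Qed.

(** Integration by parts in discrete form. The last term is the second-order error in replacing sine
    increments by cosines; it carries a factor [h] and disappears for a fine mesh. *)
Lemma far_abel : `|S| <= b 0%N * `|Psi 0%N| + b n.-1 * `|Psi n| +
  \sum_(1 <= i < n) k ^+ 3 * h / (8 * j%:R * t i.-1 * t i) * `|Psi i| +
  2 * pi * Q%:R ^+ 3 * h * (u n - u 0%N).
Proof.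
have pp := pi_gt0 R.
have n0' : (n.-1 < n)%N by lia.
have approx : `|S - \sum_(0 <= i < n) b i * (Psi i.+1 - Psi i)| <=
    2 * pi * Q%:R ^+ 3 * h * (u n - u 0%N).
  rewrite -telescope_sumr// /S mulr_sumr -sumrB mulr_sumr.
  apply: le_trans (ler_norm_sum _ _ _) _; rewrite !big_nat; apply: ler_sum => i /andP[_ ni].
  have Dp := far_D_gt0 ni.
  rewrite /Psi -sumrB !mulr_sumr -sumrB.
  apply: le_trans (ler_norm_sum _ _ _) _.
  apply: (@le_trans _ _ (\sum_(1 <= q < Q.+1) 2 * pi * Q%:R ^+ 2 * h * D i)); last first.
    rewrite big_const_nat iter_addr addr0 subn1 /= -mulr_natr -/(D i).
    by rewrite le_eqVlt; apply/orP; left; apply/eqP; ring.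
  rewrite !big_nat; apply: ler_sum => q /andP[q1 qQ].
  have q0 : 0 < q%:R :> R by rewrite ltr0n.
  have qQ' : q%:R <= Q%:R :> R by rewrite ler_nat.
  have ab : 2 * pi * q%:R * u i <= 2 * pi * q%:R * u i.+1.
    by apply: ler_wpM2l; [rewrite !mulr_ge0 ?ltW|rewrite -subr_ge0 ltW].
  have -> : h * (q%:R * cos (2 * pi * q%:R * u i)) -
    b i * (sin (2 * pi * q%:R * u i.+1) - sin (2 * pi * q%:R * u i)) =
    - (b i * (sin (2 * pi * q%:R * u i.+1) - sin (2 * pi * q%:R * u i) -
     (2 * pi * q%:R * u i.+1 - 2 * pi * q%:R * u i) * cos (2 * pi * q%:R * u i))).
    have e : b i * (2 * pi * q%:R * u i.+1 - 2 * pi * q%:R * u i) = h * q%:R.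
      rewrite -mulrBr -/(D i) /b; move: pp Dp; move: (@pi R) (D i) => p x p0 x0.
      by field; rewrite !gt_eqF.
    by rewrite [in RHS]mulrBr [X in _ = - (_ - X)]mulrA e; ring.
  have /andP[b0 _] := far_b_le ni.
  rewrite normrN normrM ger0_norm//.
  apply: le_trans (ler_wpM2l b0 (sin_taylor ab)) _.
  have -> : b i * (2 * pi * q%:R * u i.+1 - 2 * pi * q%:R * u i) ^+ 2 =
     2 * pi * q%:R ^+ 2 * h * D i.
    rewrite -mulrBr -/(D i) /b; move: pp Dp; move: (@pi R) (D i) => p x p0 x0.
    by field; rewrite !gt_eqF.
  do 2 (apply: ler_wpM2r; first exact: ltW).
  apply: ler_wpM2l; first by rewrite mulr_ge0 ?ltW.
  by rewrite lerXn2r ?nnegrE.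
rewrite abel_diff// in approx.
have /andP[b00 _] := far_b_le n0; have /andP[bn0 _] := far_b_le n0'.
set X := _ - \sum_(_ <= _ < _) _ in approx.
have -> : S = X + (S - X) by ring.
apply: le_trans (ler_normD _ _) _; apply: lerD => //.
rewrite /X; apply: le_trans (ler_normB _ _) _; apply: lerD.
  apply: le_trans (ler_normB _ _) _; rewrite (normrM (b n.-1)) (normrM (b 0%N)).
  by rewrite (ger0_norm b00) (ger0_norm bn0) addrC.
apply: le_trans (ler_norm_sum _ _ _) _; rewrite !big_nat; apply: ler_sum => i ni.
by rewrite normrM; apply: ler_wpM2r => //; exact: far_b_diff.
Qed.

Lemma far_Psi i : `|Psi i| <= cutinv Q%:R (u i).
Proof. exact: sum_sin_cut. Qed.

(** Uses only |Psi| <= Q; the variation of [b] telescopes to 1/(j t 0). *)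
Lemma far_triv : `|S| <= 3 * k ^+ 3 * Q%:R / (j%:R * t 0%N) +
  2 * pi * Q%:R ^+ 3 * h * (u n - u 0%N).
Proof.
have tn0 : t 0%N <= t n.-1.
  by elim: (n.-1) => // i; rewrite tS => /le_trans; apply; rewrite lerDl ltW.
have n0' : (n.-1 < n)%N by lia.
have kk : k <= k ^+ 3 by rewrite -{1}(expr1 k) ler_weXn2l.
have PQ i : `|Psi i| <= Q%:R.
  by apply: le_trans (far_Psi i) (cutinv_le _ _).
apply: le_trans far_abel _; rewrite lerD2r.
have T : 0 < j%:R * t 0%N by apply: mulr_gt0.
have e : forall i, (i < n)%N -> t 0%N <= t i -> b i * `|Psi i.+1| <= k ^+ 3 * Q%:R / (j%:R * t 0%N) /\
   b i * `|Psi i| <= k ^+ 3 * Q%:R / (j%:R * t 0%N).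
  move=> i ni ti; have /andP[bi0 bi] := far_b_le ni.
  have bb : b i <= k ^+ 3 / (j%:R * t 0%N).
    apply: le_trans bi _; apply: ler_pM => //; [exact: ltW|by rewrite invr_ge0 mulr_ge0 ?ltW ?far_t_gt0|].
    by rewrite lef_pV2 ?posrE ?mulr_gt0 ?far_t_gt0// ler_pM2l.
  have -> : k ^+ 3 * Q%:R / (j%:R * t 0%N) = k ^+ 3 / (j%:R * t 0%N) * Q%:R by rewrite mulrAC.
  by split; apply: ler_pM.
have [_ e0] := e _ n0 (lexx _).
have [en _] := e _ n0' tn0; rewrite (prednK n0) in en.
have e3 : \sum_(1 <= i < n) k ^+ 3 * h / (8 * j%:R * t i.-1 * t i) * `|Psi i| <=
   k ^+ 3 * Q%:R / (j%:R * t 0%N).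
  apply: (@le_trans _ _ (\sum_(1 <= i < n) k ^+ 3 * Q%:R / j%:R * ((t i.-1)^-1 - (t i)^-1))).
    rewrite !big_nat; apply: ler_sum => i /andP[i1 ni].
    have iE : i.-1.+1 = i by exact: prednK i1.
    have tp := far_t_gt0 i; have tp' := far_t_gt0 i.-1.
    have -> : k ^+ 3 * Q%:R / j%:R * ((t i.-1)^-1 - (t i)^-1) =
       k ^+ 3 * h / (j%:R * t i.-1 * t i) * Q%:R.
      have -> : (t i.-1)^-1 - (t i)^-1 = h / (t i.-1 * t i).
        have hE : h = t i - t i.-1 by rewrite -{1}iE tS; ring.
        by rewrite hE mulrBl mulrC invfM divfK ?mulrA ?mulfV ?mul1r ?gt_eqF// -mulrA mulVf ?mulr1// gt_eqF.
      by rewrite !invfM; ring.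
    apply: ler_pM => //.
      by rewrite divr_ge0 ?mulr_ge0 ?exprn_ge0 ?ltW.
    apply: ler_wpM2l; first by rewrite mulr_ge0 ?exprn_ge0 ?ltW.
    rewrite lef_pV2 ?posrE ?mulr_gt0// -!(mulrA _ (t _)) ler_pM2r ?mulr_gt0//.
    by rewrite ler_peMl ?ler1n// ltW.
  rewrite -mulr_sumr.
  have -> : \sum_(1 <= i < n) ((t i.-1)^-1 - (t i)^-1) = (t 0%N)^-1 - (t n.-1)^-1.
    case: (n) n0 => // m _ /=; elim: m => [|m IH]; first by rewrite big_geq// subrr.
    by rewrite big_nat_recr//= IH; ring.
  rewrite mulrBr invfM mulrA lerBlDr lerDl.
  by rewrite !mulr_ge0 ?exprn_ge0 ?invr_ge0 ?ltW ?far_t_gt0.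
have e4 : 3 * k ^+ 3 * Q%:R / (j%:R * t 0%N) = 3 * (k ^+ 3 * Q%:R / (j%:R * t 0%N)) by ring.
rewrite e4; move: e0 en e3; lra.
Qed.

Hypothesis usize : forall i, (i <= n)%N ->
  j%:R / k * t i ^+ 2 <= u i - ub <= j%:R * k * t i ^+ 2.
Hypothesis tL : 1 <= j%:R * Q%:R * t 0%N ^+ 2.
Hypothesis hsmall : forall i, (i < n)%N -> u i.+1 - u i <= 1 / (k * Q%:R).

(** Uses |Psi| <= min(Q, 1/||u||). In the variable z = u - ub, of size j t^2, the measure dt / (j
    t^2) becomes dz / (sqrt j z^(3/2)) up to constants, and [riemann_sum_cut] bounds the sum by the
    weight at the critical value [ub]. *)
Lemma far_fine : `|S| <= k / (j%:R * t 0%N) * cutinv Q%:R (u 0%N) + k * Q%:R / (j%:R * t n.-1) +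
  200 * (k ^+ 8 * Num.sqrt (Q%:R / j%:R) * cutinv Q%:R ub) +
  2 * pi * Q%:R ^+ 3 * h * (u n - u 0%N).
Proof.
have n0' : (n.-1 < n)%N by lia.
apply: le_trans far_abel _; rewrite lerD2r.
have /andP[b00 b0l] := far_b_le n0; have /andP[bn0 bnl] := far_b_le n0'.
apply: lerD; first apply: lerD.
- by apply: ler_pM => //; exact: far_Psi.
- have -> : k * Q%:R / (j%:R * t n.-1) = k / (j%:R * t n.-1) * Q%:R by rewrite mulrAC.
  apply: ler_pM => //.
  by apply: le_trans (far_Psi _) (cutinv_le _ _).
pose z i := u i - ub.
have zp i : (i <= n)%N -> 0 < z i.
  move=> ni; have /andP[h1 _] := usize ni; apply: lt_le_trans h1.
  by rewrite mulr_gt0 ?divr_gt0// exprn_gt0// far_t_gt0.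
have Q1' : 1 <= Q%:R :> R by rewrite ler1n.
have rs := @riemann_sum_cut R k Q%:R ub z n k1 Q1'.
have {}rs : \sum_(0 <= i < n) (z i.+1 - z i) / Num.sqrt (z i) ^+ 3 * cutinv Q%:R (u i.+1) <=
  1000 * (k * Num.sqrt Q%:R * cutinv Q%:R ub).
  have e : \sum_(0 <= i < n) (z i.+1 - z i) / Num.sqrt (z i) ^+ 3 * cutinv Q%:R (u i.+1) =
    \sum_(0 <= i < n) (z i.+1 - z i) / Num.sqrt (z i) ^+ 3 * cutinv Q%:R (ub + z i.+1).
    by apply: eq_bigr => i _; congr (_ * cutinv _ _); rewrite /z; ring.
  rewrite e; apply: rs.
    have /andP[h1 _] := usize (leq0n n); apply: le_trans h1.
    rewrite ler_pdivrMr ?mulr_gt0//.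
    have -> : j%:R / k * t 0%N ^+ 2 * (k * Q%:R) = (j%:R * Q%:R * t 0%N ^+ 2) * (k / k) by ring.
    by rewrite divff ?mulr1 ?gt_eqF.
  move=> i ni; have := hsmall ni; have := far_D_gt0 ni; rewrite /D /z => h1 h2.
  by apply/andP; split; lra.
have sj0 : 0 < Num.sqrt (j%:R : R) by rewrite sqrtr_gt0.
have sjj : Num.sqrt (j%:R : R) ^+ 2 = j%:R by rewrite sqr_sqrtr ?ltW.
set sj := Num.sqrt j%:R in sj0 sjj.
apply: (@le_trans _ _ (\sum_(1 <= i < n) k ^+ 7 / (16 * sj) *
   ((z i - z i.-1) / Num.sqrt (z i.-1) ^+ 3 * cutinv Q%:R (u i)))).
  rewrite !big_nat; apply: ler_sum => i /andP[i1 ni].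
  have iE : i.-1.+1 = i by exact: prednK i1.
  have ni' : (i.-1 < n)%N by exact: leq_ltn_trans (leq_pred i) ni.
  rewrite mulrA; apply: ler_pM => //; last exact: far_Psi.
    by rewrite divr_ge0 ?mulr_ge0 ?exprn_ge0 ?ltW ?far_t_gt0.
  have tp := far_t_gt0 i; have tp' := far_t_gt0 i.-1.
  have tt : t i.-1 <= t i by rewrite -{2}iE tS lerDl ltW.
  have dz : z i - z i.-1 = D i.-1 by rewrite /z /D iE; ring.
  have Dp := far_D_gt0 ni'.
  have zp' := zp _ (ltnW ni').
  set s := Num.sqrt (z i.-1).
  have s0 : 0 < s by rewrite sqrtr_gt0.
  have ssz : s ^+ 2 = z i.-1 by rewrite sqr_sqrtr ?ltW.
  have hD := far_hD ni'.
  (* sizes: h <= k D / (2 j t) and t >= s / (k sqrt j) *)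
  have ts : s <= k * sj * t i.-1.
    have K0 : 0 <= k * sj * t i.-1 by rewrite !mulr_ge0 ?ltW.
    rewrite -(@ler_pXn2r _ 2)// ?nnegrE ?(ltW s0)// ssz !exprMn sjj.
    have /andP[_ h2] := usize (ltnW ni'); apply: le_trans h2 _.
    rewrite -mulrA [X in _ <= X * _]mulrC -mulrA ler_pM2l//.
    by rewrite ler_pM2r ?exprn_gt0// -{1}(expr1 k) ler_weXn2l.
  apply: (@le_trans _ _ (k ^+ 3 * h / (8 * j%:R * t i.-1 * t i.-1))).
    apply: ler_wpM2l; first by rewrite mulr_ge0 ?exprn_ge0 ?ltW.
    by rewrite lef_pV2 ?posrE ?mulr_gt0// ler_pM2l ?mulr_gt0.
  rewrite dz.
  have hD' : h <= k / (2 * j%:R * t i.-1) * D i.-1 by rewrite -ler_pdivrMr.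
  apply: (@le_trans _ _ (k ^+ 3 * (k / (2 * j%:R * t i.-1) * D i.-1) / (8 * j%:R * t i.-1 * t i.-1))).
    apply: ler_wpM2r; first by rewrite invr_ge0 !mulr_ge0 ?ltW.
    by apply: ler_wpM2l => //; rewrite exprn_ge0 ?ltW.
  have -> : k ^+ 3 * (k / (2 * j%:R * t i.-1) * D i.-1) / (8 * j%:R * t i.-1 * t i.-1) =
     k ^+ 4 * D i.-1 / 16 * (sj ^+ 4 * t i.-1 ^+ 3)^-1.
    have -> : sj ^+ 4 = j%:R ^+ 2 by rewrite -sjj; ring.
    by field; rewrite !gt_eqF.
  have -> : k ^+ 7 / (16 * sj) * (D i.-1 / s ^+ 3) =
     k ^+ 4 * D i.-1 / 16 * (k ^+ 3 / (sj * s ^+ 3)).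
    by field; rewrite !gt_eqF.
  apply: ler_wpM2l; first by rewrite divr_ge0 ?mulr_ge0 ?exprn_ge0 ?ltW.
  rewrite -[X in X <= _]mul1r ler_pdivrMr; last by rewrite !mulr_gt0 ?exprn_gt0.
  rewrite mulrAC ler_pdivlMr; last by rewrite !mulr_gt0 ?exprn_gt0.
  rewrite mul1r.
  have s3 : s ^+ 3 <= (k * sj * t i.-1) ^+ 3.
    by rewrite lerXn2r// nnegrE ?(ltW s0)// (le_trans (ltW s0)).
  rewrite mulrC; apply: le_trans (ler_wpM2r (ltW sj0) s3) _.
  by rewrite le_eqVlt; apply/orP; left; apply/eqP; ring.
rewrite -mulr_sumr.
have nn : \sum_(1 <= i < n) (z i - z i.-1) / Num.sqrt (z i.-1) ^+ 3 * cutinv Q%:R (u i) <=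
   \sum_(0 <= i < n) (z i.+1 - z i) / Num.sqrt (z i) ^+ 3 * cutinv Q%:R (u i.+1).
  rewrite big_add1 /= [X in _ <= X](@big_cat_nat _ _ _ n.-1)//= ?leq_pred// lerDl.
  rewrite !big_nat; apply: sumr_ge0 => i /andP[_ ni].
  have Dp := far_D_gt0 ni.
  rewrite mulr_ge0 ?cutinv_ge0 ?divr_ge0 ?exprn_ge0 ?sqrtr_ge0//.
  by move: Dp; rewrite /D /z; lra.
have k7 : 0 <= k ^+ 7 / (16 * sj) by rewrite divr_ge0 ?mulr_ge0 ?exprn_ge0 ?ltW.
apply: le_trans (ler_wpM2l k7 (le_trans nn rs)) _.
have sQj : Num.sqrt (Q%:R / j%:R) = Num.sqrt Q%:R / sj :> R.
  by rewrite sqrtrM ?ltW// sqrtrV ?ltW.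
rewrite sQj.
have -> : k ^+ 7 / (16 * sj) * (1000 * (k * Num.sqrt Q%:R * cutinv Q%:R ub)) =
   1000 / 16 * (k ^+ 8 * (Num.sqrt Q%:R / sj) * cutinv Q%:R ub).
  by field; rewrite gt_eqF.
have : 0 <= k ^+ 8 * (Num.sqrt Q%:R / sj) * cutinv Q%:R ub.
  by rewrite !mulr_ge0 ?exprn_ge0 ?invr_ge0 ?sqrtr_ge0 ?cutinv_ge0 ?ltW.
lra.
Qed.

End FarSum.

(** * Convex curves paired with their Legendre transforms *)

Section Curve.
Variable R : realType.

(** A convex f with derivative g and Legendre transform F with derivative G. Curvature is expressed
    by two-sided quadratic Taylor bounds with one constant k for both functions, so that exchanging
    the pairs preserves [k] ([curve_dual]) and inductions can alternate between them. Living on the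
    whole line avoids boundary cases. *)
Record curve (k : R) (f g F G : R -> R) : Prop := Curve {
  curve_k1 : 1 <= k;
  curve_f : forall x y, (y - x) ^+ 2 / k <= f y - f x - g x * (y - x) <= k * (y - x) ^+ 2;
  curve_F : forall x y, (y - x) ^+ 2 / k <= F y - F x - G x * (y - x) <= k * (y - x) ^+ 2;
  curve_gK : cancel g G;
  curve_GK : cancel G g;
  curve_legendre : forall x, F (g x) = x * g x - f x }.

Variables (k : R) (f g F G : R -> R).
Hypothesis cv : curve k f g F G.

Lemma curve_dual : curve k F G f g.
Proof.
case: cv => k1 hf hF gK GK leg; split => // s.
by have := leg (G s); rewrite GK mulrC => ->; ring.
Qed.

Lemma curve_k_gt0 : 0 < k.
Proof. exact: lt_le_trans ltr01 (curve_k1 cv). Qed.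

Lemma curve_g_mono x y : 2 / k * (y - x) ^+ 2 <= (g y - g x) * (y - x) <= 2 * k * (y - x) ^+ 2.
Proof.
have /andP[a1 a2] := curve_f cv x y; have /andP[b1 b2] := curve_f cv y x.
have e : (g y - g x) * (y - x) = (f y - f x - g x * (y - x)) + (f x - f y - g y * (x - y)) by ring.
have e2 : (x - y) ^+ 2 = (y - x) ^+ 2 by ring.
rewrite e2 in b1 b2; rewrite e.
have -> : 2 / k * (y - x) ^+ 2 = 2 * ((y - x) ^+ 2 / k) by ring.
by apply/andP; split; lra.
Qed.

Lemma curve_g_incr x y : x <= y -> 2 / k * (y - x) <= g y - g x <= 2 * k * (y - x).
Proof.
rewrite le_eqVlt => /predU1P[->|xy]; first by rewrite !subrr !mulr0 lexx.
have d : 0 < y - x by rewrite subr_gt0.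
have /andP[h1 h2] := curve_g_mono x y.
rewrite expr2 !mulrA !ler_pM2r// in h1 h2.
by rewrite h1.
Qed.

Lemma curve_g_le x y : (g x <= g y) = (x <= y).
Proof.
have k0 := curve_k_gt0; have ik : 0 < 2 / k by rewrite divr_gt0.
apply/idP/idP => [gg|xy].
  rewrite leNgt; apply/negP => yx.
  have /andP[h _] := curve_g_incr (ltW yx).
  have : 0 < 2 / k * (x - y) by rewrite mulr_gt0// subr_gt0.
  by lra.
have /andP[h _] := curve_g_incr xy.
have : 0 <= 2 / k * (y - x) by rewrite mulr_ge0 ?subr_ge0// ltW.
by lra.
Qed.

End Curve.

(** * One frequency on one side of its critical point *)

Section Segment.
Variable R : realType.
Variables (k : R) (f g F G : R -> R) (Q j : nat) (y h T e p : R).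
Hypotheses (cv : curve k f g F G) (Q1 : (0 < Q)%N) (j1 : (0 < j)%N) (h0 : 0 < h) (h1 : h <= 1).
Hypothesis pE : j%:R * g p = y.
Hypotheses (T0 : 0 <= T) (e0 : 0 < e) (e1 : e <= 1)
  (hT : h * (16 * j%:R * k ^+ 2 * Q%:R ^+ 3 * (T + 1) ^+ 2) <= e).

Let U x := j%:R * f x - y * x.
Let ub := U p.
Let k1 : 1 <= k. Proof. exact: curve_k1 cv. Qed.
Let k0 : 0 < k. Proof. exact: curve_k_gt0 cv. Qed.
Let j0 : 0 < j%:R :> R. Proof. by rewrite ltr0n. Qed.
Let Q0 : 0 < Q%:R :> R. Proof. by rewrite ltr0n. Qed.

Let cossumq x : R := \sum_(1 <= q < Q.+1) q%:R * cos (2 * pi * q%:R * U x).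

(** Since j g(p) = y, the linear term of the phase at [p] vanishes, and only the Taylor remainder of
    f is left. *)
Lemma curve_U x : j%:R / k * (x - p) ^+ 2 <= U x - ub <= j%:R * k * (x - p) ^+ 2.
Proof.
have /andP[a b] := curve_f cv p x.
have -> : U x - ub = j%:R * (f x - f p - g p * (x - p)) by rewrite /ub /U -pE; ring.
apply/andP; split.
  have -> : j%:R / k * (x - p) ^+ 2 = j%:R * ((x - p) ^+ 2 / k) by ring.
  by rewrite ler_pM2l.
by rewrite -mulrA ler_pM2l.
Qed.

Variables (sg : R) (a : R) (n : nat).
Hypotheses (sg1 : sg ^+ 2 = 1) (a0 : 0 < a) (n0 : (0 < n)%N) (aT : a + n%:R * h <= T).
Let t i := a + i%:R * h.
Let u i := U (p + sg * t i).

Let tS i : t i.+1 = t i + h.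
Proof. by rewrite /t -natr1; ring. Qed.

Let t_gt0 i : 0 < t i.
Proof. by rewrite /t ltr_wpDr// mulr_ge0// ltW. Qed.

Let uincr i : 2 * j%:R / k * t i * h <= u i.+1 - u i.
Proof.
rewrite /u tS; set x := p + sg * t i.
have -> : p + sg * (t i + h) = x + sg * h by rewrite /x; ring.
have -> : U (x + sg * h) - U x = j%:R * (f (x + sg * h) - f x - g x * (x + sg * h - x)
   + (g x - g p) * (sg * h)) by rewrite /U -pE; ring.
have /andP[b1 _] := curve_f cv x (x + sg * h).
have /andP[b2 _] := curve_g_mono cv p x.
have xp : x - p = sg * t i by rewrite /x; ring.
rewrite xp exprMn sg1 mul1r expr2 !mulrA ler_pM2r// in b2.
have b3 : 2 / k * t i * h <= (g x - g p) * (sg * h) by rewrite mulrA ler_pM2r.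
have b4 : 0 <= (x + sg * h - x) ^+ 2 / k by rewrite divr_ge0 ?sqr_ge0 ?ltW.
have -> : 2 * j%:R / k * t i * h = j%:R * (2 / k * t i * h) by ring.
rewrite ler_pM2l//; move: b1 b3 b4; lra.
Qed.

Let usnd i : (0 < i < n)%N -> `|(u i.+1 - u i) - (u i - u i.-1)| <= 2 * j%:R * k * h ^+ 2.
Proof.
case: i => // i _ /=; rewrite /u (tS i.+1); set x := p + sg * t i.+1.
have -> : p + sg * (t i.+1 + h) = x + sg * h by rewrite /x; ring.
have -> : p + sg * t i = x - sg * h by rewrite /x tS; ring.
have /andP[a1 a2] := curve_f cv x (x + sg * h).
have /andP[b1 b2] := curve_f cv x (x - sg * h).
have -> : U (x + sg * h) - U x - (U x - U (x - sg * h)) =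
   j%:R * ((f (x + sg * h) - f x - g x * (x + sg * h - x)) +
    (f (x - sg * h) - f x - g x * (x - sg * h - x))) by rewrite /U; ring.
have ea : (x + sg * h - x) ^+ 2 = h ^+ 2 by rewrite addrAC subrr add0r exprMn sg1 mul1r.
have eb : (x - sg * h - x) ^+ 2 = h ^+ 2 by rewrite addrAC subrr add0r sqrrN exprMn sg1 mul1r.
rewrite ea in a1 a2; rewrite eb in b1 b2.
have hk : 0 <= h ^+ 2 / k by rewrite divr_ge0 ?sqr_ge0 ?ltW.
rewrite normrM (gtr0_norm j0) ger0_norm; last lra.
have -> : 2 * j%:R * k * h ^+ 2 = j%:R * (2 * (k * h ^+ 2)) by ring.
by rewrite ler_pM2l//; move: a2 b2; lra.
Qed.

Let usize i : j%:R / k * t i ^+ 2 <= u i - ub <= j%:R * k * t i ^+ 2.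
Proof.
have := curve_U (p + sg * t i).
by rewrite addrAC subrr add0r exprMn sg1 mul1r.
Qed.

Let tT i : (i <= n)%N -> t i <= T.
Proof.
move=> ni; apply: le_trans aT; rewrite lerD2l ler_pM2r// ler_nat//.
Qed.

Let hsmall i : (i < n)%N -> u i.+1 - u i <= 1 / (k * Q%:R).
Proof.
move=> ni; rewrite /u tS; set x := p + sg * t i.
have -> : p + sg * (t i + h) = x + sg * h by rewrite /x; ring.
have -> : U (x + sg * h) - U x = j%:R * (f (x + sg * h) - f x - g x * (x + sg * h - x)
   + (g x - g p) * (sg * h)) by rewrite /U -pE; ring.
have /andP[_ b1] := curve_f cv x (x + sg * h).
have /andP[_ b2] := curve_g_mono cv p x.
have xp : x - p = sg * t i by rewrite /x; ring.
rewrite xp exprMn sg1 mul1r expr2 !mulrA ler_pM2r// in b2.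
have b3 : (g x - g p) * (sg * h) <= 2 * k * t i * h by rewrite mulrA ler_pM2r.
have ea : (x + sg * h - x) ^+ 2 = h ^+ 2 by rewrite addrAC subrr add0r exprMn sg1 mul1r.
rewrite ea in b1.
have tp := t_gt0 i; have tT' := tT (ltnW ni).
apply: (@le_trans _ _ (j%:R * (2 * k * h * (T + 1)))).
  rewrite ler_pM2l//.
  have q1 : k * h ^+ 2 <= k * h * 1 by rewrite expr2 mulrA ler_pM2l ?mulr_gt0.
  have q2 : 2 * k * t i * h <= 2 * k * h * T.
    by rewrite mulrAC ler_pM2l ?mulr_gt0.
  have q3 : 0 <= k * h by rewrite mulr_ge0 ?ltW.
  move: b1 b3 q1 q2 q3; rewrite [2 * k * h * (T + 1)]mulrDr mulr1; lra.
rewrite ler_pdivlMr ?mulr_gt0//.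
apply: (@le_trans _ _ (h * (16 * j%:R * k ^+ 2 * Q%:R ^+ 3 * (T + 1) ^+ 2))); last exact: le_trans hT e1.
have -> : j%:R * (2 * k * h * (T + 1)) * (k * Q%:R) = (2 * h * j%:R * k ^+ 2) * (Q%:R * (T + 1)) by ring.
have -> : h * (16 * j%:R * k ^+ 2 * Q%:R ^+ 3 * (T + 1) ^+ 2) =
   (2 * h * j%:R * k ^+ 2) * (8 * Q%:R ^+ 3 * (T + 1) ^+ 2) by ring.
apply: ler_wpM2l; first by rewrite !mulr_ge0 ?sqr_ge0 ?ltW.
have T1 : 1 <= T + 1 by lra.
have Q1' : 1 <= Q%:R :> R by rewrite ler1n.
have q3 : Q%:R <= Q%:R ^+ 3 :> R by rewrite -{1}(expr1 Q%:R) ler_weXn2l.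
have t2 : T + 1 <= (T + 1) ^+ 2 by rewrite -{1}(expr1 (T + 1)) ler_weXn2l.
have := ler_pM (ltW Q0) (le_trans ler01 T1) q3 t2.
have : 0 <= Q%:R ^+ 3 * (T + 1) ^+ 2 by rewrite mulr_ge0 ?sqr_ge0// exprn_ge0 ?ltW.
rewrite -mulrA; lra.
Qed.

(** The step size in [hT] is chosen to make the second-order error of [far_abel] at most [e]. *)
Let tiny : 2 * pi * Q%:R ^+ 3 * h * (u n - u 0%N) <= e.
Proof.
apply: le_trans hT.
have /andP[a1 _] := usize 0; have /andP[_ b2] := usize n.
have z0 : 0 <= j%:R / k * t 0%N ^+ 2 by rewrite mulr_ge0 ?sqr_ge0// divr_ge0 ?ltW.
have un : u n - u 0%N <= j%:R * k * t n ^+ 2 by move: a1 b2 z0; lra.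
have p4 : pi <= 4 :> R by have := pihalf_lt2 R; rewrite ltr_pdivrMr//; lra.
have pp := pi_gt0 R.
have tn : t n ^+ 2 <= (T + 1) ^+ 2.
  have tn' := tT (leqnn n); have T1 : 0 <= T + 1 by move: T0; lra.
  by rewrite lerXn2r ?nnegrE ?(ltW (t_gt0 _))//; move: tn'; lra.
have un' : u n - u 0%N <= j%:R * k ^+ 2 * (T + 1) ^+ 2.
  apply: le_trans un _; apply: ler_pM; rewrite ?sqr_ge0 ?mulr_ge0 ?(ltW k0)//.
  by rewrite ler_pM2l// -{1}(expr1 k) ler_weXn2l.
have -> : h * (16 * j%:R * k ^+ 2 * Q%:R ^+ 3 * (T + 1) ^+ 2) =
   (16 * Q%:R ^+ 3 * h) * (j%:R * k ^+ 2 * (T + 1) ^+ 2) by ring.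
have c0 : 0 <= 2 * pi * Q%:R ^+ 3 * h by rewrite !mulr_ge0 ?exprn_ge0 ?ltW.
apply: le_trans (ler_wpM2l c0 un') _.
apply: ler_wpM2r; first by apply: mulr_ge0; [apply: mulr_ge0|]; rewrite ?sqr_ge0.
apply: ler_wpM2r; first exact: ltW.
by apply: ler_wpM2r; [rewrite exprn_ge0 ?ltW|lra].
Qed.

Lemma seg_triv : `|h * \sum_(0 <= i < n) cossumq (p + sg * t i)| <=
  3 * k ^+ 3 * Q%:R / (j%:R * a) + e.
Proof.
have := @far_triv R k Q j h t u n k1 Q1 j1 h0 n0 (t_gt0 0) tS (fun i _ => uincr i) usnd.
rewrite {1}/t mul0r addr0 => /le_trans; apply; rewrite lerD2l; exact: tiny.
Qed.

Lemma seg_fine : 1 <= j%:R * Q%:R * a ^+ 2 ->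
  `|h * \sum_(0 <= i < n) cossumq (p + sg * t i)| <=
  k / (j%:R * a) * cutinv Q%:R (U (p + sg * a)) + k * Q%:R / (j%:R * t n.-1) +
  200 * (k ^+ 8 * Num.sqrt (Q%:R / j%:R) * cutinv Q%:R ub) + e.
Proof.
move=> aL.
have := @far_fine R k Q j h ub t u n k1 Q1 j1 h0 n0 (t_gt0 0) tS (fun i _ => uincr i) usnd (fun i _ => usize i).
rewrite /u /t mul0r addr0 => /(_ aL hsmall) /le_trans; apply; rewrite lerD2l.
by have := tiny; rewrite /u /t mul0r addr0.
Qed.

End Segment.

(** * One frequency on the whole interval *)

Section Frequency.
Variable R : realType.
Variables (k : R) (f g F G : R -> R) (Q j : nat) (y h T e p eta xi x0 : R) (N : nat).
Hypotheses (cv : curve k f g F G) (Q1 : (0 < Q)%N) (j1 : (0 < j)%N) (h0 : 0 < h) (h1 : h <= 1).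
Hypothesis pE : j%:R * g p = y.
Hypotheses (e0 : 0 < e) (e1 : e <= 1)
  (hT : h * (16 * j%:R * k ^+ 2 * Q%:R ^+ 3 * (T + 1) ^+ 2) <= e).
Hypotheses (Teta : `|eta - p| + 2 <= T) (Txi : `|xi - p| + 2 <= T).
Hypotheses (x0l : eta <= x0) (x0r : x0 <= eta + h) (N0 : (0 < N)%N)
  (xNl : x0 + N.-1%:R * h <= xi) (xNr : xi <= x0 + N%:R * h).

(** Radius of the stationary zone: within (j Q)^(-1/2) of [p] the phase moves by O(1/Q), so no q <=
    Q sees it oscillate. *)
Definition crit_len : R := (Num.sqrt (j%:R * Q%:R))^-1.
Local Notation L := crit_len.
(** Size of the boundary term of the integration by parts at the end [v], where u' is about j |p -
    v| and |Psi| <= Q, capped at the stationary radius. *)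
Definition end_weight v : R := Q%:R / (j%:R * Num.max L `|p - v|).
Local Notation W := end_weight.
Hypothesis hL : h <= L.

Let U x := j%:R * f x - y * x.
Let k1 : 1 <= k. Proof. exact: curve_k1 cv. Qed.
Let k0 : 0 < k. Proof. exact: curve_k_gt0 cv. Qed.
Let j0 : 0 < j%:R :> R. Proof. by rewrite ltr0n. Qed.
Let Q0 : 0 < Q%:R :> R. Proof. by rewrite ltr0n. Qed.
Let r : R := Num.sqrt (Q%:R / j%:R).
Let c : R := cutinv Q%:R (U p).
Let cossumq x : R := \sum_(1 <= q < Q.+1) q%:R * cos (2 * pi * q%:R * U x).

Let T2 : 2 <= T.
Proof. by apply: le_trans Teta; rewrite lerDr. Qed.

Let T0 : 0 <= T. Proof. by apply: le_trans T2. Qed.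

Lemma crit_len_gt0 : 0 < L.
Proof. by rewrite invr_gt0 sqrtr_gt0 mulr_gt0. Qed.
Let L0 := crit_len_gt0.

Lemma crit_len_sq : j%:R * Q%:R * L ^+ 2 = 1.
Proof.
by rewrite exprVn sqr_sqrtr ?mulr_ge0 ?ler0n// mulfV// gt_eqF// mulr_gt0.
Qed.

Lemma crit_len_le1 : L <= 1.
Proof.
have h2 : 1 <= j%:R * Q%:R :> R by rewrite -natrM ler1n muln_gt0 j1.
rewrite leNgt; apply/negP => L1.
have : 1 < L ^+ 2 by rewrite exprn_egt1.
have := crit_len_sq; nra.
Qed.

Let rE : r = Q%:R * L.
Proof.
have s0 : 0 < Num.sqrt (j%:R : R) by rewrite sqrtr_gt0.
have q0 : 0 < Num.sqrt (Q%:R : R) by rewrite sqrtr_gt0.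
rewrite /r /crit_len sqrtrM ?ltW// sqrtrM ?ltW// sqrtrV ?ltW//.
have qq : Q%:R = Num.sqrt Q%:R ^+ 2 :> R by rewrite sqr_sqrtr ?ltW.
by rewrite {2}qq; field; rewrite !gt_eqF.
Qed.

Let jLr : (j%:R * L)^-1 = r.
Proof.
rewrite rE; have := crit_len_sq => e2.
have jL : j%:R * L != 0 by rewrite gt_eqF// mulr_gt0.
by apply: (mulfI jL); rewrite mulfV// -[LHS]e2; ring.
Qed.

Let r0 : 0 < r. Proof. by rewrite -jLr invr_gt0 mulr_gt0. Qed.
Let c0 : 0 <= c. Proof. exact: cutinv_ge0. Qed.

Lemma end_weight_ge0 v : 0 <= W v.
Proof. by rewrite divr_ge0// mulr_ge0// ?ltW// lt_max L0. Qed.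

Lemma end_weight_ge v a : L <= a -> `|p - v| <= 2 * a -> Q%:R / (j%:R * a) <= 2 * W v.
Proof.
move=> La pv; have a0 : 0 < a by exact: lt_le_trans La.
have m0 : 0 < Num.max L `|p - v| by rewrite lt_max L0.
rewrite /end_weight mulrCA ler_pM2l// -[2]invrK -invfM lef_pV2 ?posrE ?mulr_gt0//.
rewrite mulrCA ler_pM2l//.
have : Num.max L `|p - v| <= 2 * a by rewrite ge_max pv andbT; move: La a0; lra.
by move: (Num.max _ _) => z; lra.
Qed.

Let kpow n : k ^+ n <= k ^+ 8 \/ (8 < n)%N.
Proof.
by have [n8|n8] := leqP n 8; [left; rewrite ler_weXn2l|right].
Qed.

Let k8 : 1 <= k ^+ 8. Proof. by rewrite exprn_ege1. Qed.
Let k80 : 0 <= k ^+ 8. Proof. exact: le_trans k8. Qed.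

(** A side piece starts either at an end of the interval, where its boundary term is an
    [end_weight], or within 2L of [p], where the phase is within O(1/Q) of its minimum and the
    boundary term is at most of size r * c. *)
Lemma side_bound (sg a vs ve : R) (n : nat) : sg ^+ 2 = 1 -> L <= a -> (0 < n)%N ->
  a + n%:R * h <= T -> `|p - vs| <= 2 * a \/ a <= 2 * L ->
  `|p - ve| <= 2 * (a + n.-1%:R * h) ->
  `|h * \sum_(0 <= i < n) cossumq (p + sg * (a + i%:R * h))| <=
  205 * (k ^+ 8 * (r * c + W vs + W ve)) + e.
Proof.
move=> sg1 La n0 aT hs he.
have a0 : 0 < a by exact: lt_le_trans La.
have aL : 1 <= j%:R * Q%:R * a ^+ 2.
  rewrite -[X in X <= _]crit_len_sq; apply: ler_wpM2l; first by rewrite mulr_ge0 ?ltW.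
  by rewrite lerXn2r ?nnegrE ?(ltW L0)// (ltW a0).
have := @seg_fine R k f g F G Q j y h T e p cv Q1 j1 h0 h1 pE T0 e1 hT sg a n sg1 a0 n0 aT aL.
move=> /le_trans; apply; rewrite lerD2r -/(U (p + sg * a)) -/(U p) -/c -/r.
have ta : a <= a + n.-1%:R * h by rewrite lerDl mulr_ge0// ltW.
have w0s := end_weight_ge0 vs; have w0e := end_weight_ge0 ve.
have kk8 : k <= k ^+ 8 by rewrite -{1}(expr1 k) ler_weXn2l.
have kk2 : k ^+ 2 <= k ^+ 8 by rewrite ler_weXn2l.
have B1 : k / (j%:R * a) * cutinv Q%:R (U (p + sg * a)) <= 5 * (k ^+ 8 * (r * c + W vs)).
  case: hs => hs.
    apply: (@le_trans _ _ (k * (Q%:R / (j%:R * a)))).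
      have -> : k * (Q%:R / (j%:R * a)) = k / (j%:R * a) * Q%:R by ring.
      apply: ler_wpM2l; last by rewrite cutinv_le.
      by rewrite divr_ge0 ?mulr_ge0 ?ltW.
    have B := end_weight_ge La hs.
    have rc : 0 <= r * c by rewrite mulr_ge0 ?(ltW r0).
    apply: (@le_trans _ _ (k ^+ 8 * (2 * W vs))).
      by apply: ler_pM => //; [exact: ltW|by rewrite divr_ge0 ?mulr_ge0 ?ltW].
    have -> : 5 * (k ^+ 8 * (r * c + W vs)) = k ^+ 8 * (5 * (r * c + W vs)) by ring.
    by apply: ler_wpM2l; [exact: le_trans k8|move: rc w0s; lra].
  have cc : cutinv Q%:R (U (p + sg * a)) <= (1 + 4 * k) * c.
    apply: cutinv_close => //; first by rewrite mulr_ge0 ?ltW.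
    have /andP[u1 u2] := curve_U cv j1 pE (p + sg * a).
    rewrite -/U in u1 u2; rewrite addrAC subrr add0r exprMn sg1 mul1r in u1 u2.
    have u0 : 0 <= U (p + sg * a) - U p.
      by apply: le_trans u1; rewrite mulr_ge0 ?sqr_ge0// divr_ge0 ?ltW.
    rewrite ger0_norm//; apply: le_trans u2 _.
    rewrite ler_pdivlMr//.
    have a2 : a ^+ 2 <= 4 * L ^+ 2.
      have -> : 4 * L ^+ 2 = (2 * L) ^+ 2 by ring.
      by rewrite lerXn2r// nnegrE ?(ltW a0)// mulr_ge0// ltW.
    have : j%:R * k * a ^+ 2 * Q%:R <= j%:R * k * (4 * L ^+ 2) * Q%:R.
      by rewrite ler_pM2r// ler_pM2l// mulr_gt0.
    have -> : j%:R * k * (4 * L ^+ 2) * Q%:R = 4 * k * (j%:R * Q%:R * L ^+ 2) by ring.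
    by rewrite crit_len_sq mulr1.
  apply: (@le_trans _ _ (k * r * ((1 + 4 * k) * c))).
    apply: ler_pM => //; first by rewrite divr_ge0 ?mulr_ge0 ?ltW.
      exact: cutinv_ge0.
    by rewrite ler_pM2l// -jLr lef_pV2 ?posrE ?mulr_gt0// ler_pM2l.
  have -> : k * r * ((1 + 4 * k) * c) = (k + 4 * k ^+ 2) * (r * c) by ring.
  have -> : 5 * (k ^+ 8 * (r * c + W vs)) = (5 * k ^+ 8) * (r * c + W vs) by ring.
  apply: ler_pM; rewrite ?(mulr_ge0 (ltW r0) c0)//; first by rewrite addr_ge0 ?(ltW k0)// mulr_ge0// sqr_ge0.
    by move: kk8 kk2; lra.
  by rewrite lerDl.
have B2 : k * Q%:R / (j%:R * (a + n.-1%:R * h)) <= 2 * (k ^+ 8 * W ve).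
  have B := end_weight_ge (le_trans La ta) he.
  have -> : 2 * (k ^+ 8 * W ve) = k ^+ 8 * (2 * W ve) by ring.
  rewrite -mulrA; apply: ler_pM => //; first exact: ltW.
  by rewrite divr_ge0// mulr_ge0// ltW// (lt_le_trans a0).
have B3 : k ^+ 8 * r * c = k ^+ 8 * (r * c) by ring.
rewrite B3.
have rc : 0 <= r * c by rewrite mulr_ge0 ?(ltW r0).
have z1 : 0 <= k ^+ 8 * (r * c) by exact: mulr_ge0.
have z2 : 0 <= k ^+ 8 * W vs by exact: mulr_ge0.
have z3 : 0 <= k ^+ 8 * W ve by exact: mulr_ge0.
move: B1 B2; move: z1 z2 z3; lra.
Qed.

Lemma side_far (sg a vs : R) (n : nat) : sg ^+ 2 = 1 -> L <= a -> (0 < n)%N ->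
  a + n%:R * h <= T -> `|p - vs| <= 2 * a ->
  `|h * \sum_(0 <= i < n) cossumq (p + sg * (a + i%:R * h))| <=
  6 * (k ^+ 8 * W vs) + e.
Proof.
move=> sg1 La n0 aT hs.
have a0 : 0 < a by exact: lt_le_trans La.
have := @seg_triv R k f g F G Q j y h T e p cv Q1 j1 h0 pE T0 hT sg a n sg1 a0 n0 aT.
move=> /le_trans; apply; rewrite lerD2r.
have B := end_weight_ge La hs.
have w0 := end_weight_ge0 vs.
have -> : 3 * k ^+ 3 * Q%:R / (j%:R * a) = 3 * (k ^+ 3 * (Q%:R / (j%:R * a))) by ring.
have : k ^+ 3 * (Q%:R / (j%:R * a)) <= k ^+ 8 * (2 * W vs).
  apply: ler_pM => //; first by rewrite exprn_ge0 ?ltW.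
    by rewrite divr_ge0 ?mulr_ge0 ?ltW.
  by rewrite ler_weXn2l.
lra.
Qed.

Let x (i : nat) := x0 + i%:R * h.

Let x_eta i : eta <= x i.
Proof. by apply: le_trans x0l _; rewrite lerDl mulr_ge0// ltW. Qed.

Let x_xi i : (i < N)%N -> x i <= xi.
Proof.
move=> iN; apply: le_trans xNl; rewrite lerD2l ler_pM2r// ler_nat.
by rewrite -ltnS prednK.
Qed.

Let xNr' : xi <= x0 + N.-1%:R * h + h.
Proof.
have N1 : N%:R = N.-1%:R + 1 :> R by rewrite -{1}(prednK N0) natr1.
by apply: le_trans xNr _; rewrite N1 mulrDl mul1r addrA.
Qed.

Lemma right_part m : (m < N)%N -> L <= x m - p -> m = 0%N \/ x m - p <= 2 * L ->
  `|h * \sum_(m <= i < N) cossumq (x i)| <=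
  205 * (k ^+ 8 * (r * c + W eta + W xi)) + e.
Proof.
move=> mN La hm.
rewrite -{1}(add0n m) big_addn.
rewrite (eq_bigr (fun i : nat => cossumq (p + 1 * (x m - p + i%:R * h)))); last first.
  by move=> i _; congr cossumq; rewrite /x natrD; ring.
have NmE : (N - m)%N.-1 = (N.-1 - m)%N by rewrite -subn1 subnAC subn1.
have e2 : (N - m)%:R = N%:R - m%:R :> R by rewrite natrB// ltnW.
have N1 : N%:R = N.-1%:R + 1 :> R by rewrite -{1}(prednK N0) natr1.
have e3 : (N.-1 - m)%:R = N.-1%:R - m%:R :> R by rewrite natrB// -ltnS prednK.
have mx : L <= x m - p -> 0 <= x m - p by move/(le_trans (ltW L0)).
apply: side_bound => //; first by rewrite expr1n.
- by rewrite subn_gt0.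
- rewrite e2 N1 /x.
  have : xi - p <= `|xi - p| by exact: ler_norm.
  move: xNl h1 Txi; move: (N.-1%:R) (m%:R) => u v; lra.
- case: hm => [m00|]; last by right.
  left; have x0m : x m = x0 by rewrite /x m00 mul0r addr0.
  rewrite x0m in La *.
  have [pe|pe] := leP (p - eta) 0; first by rewrite ler0_norm//; move: x0l La L0 hL; lra.
  by rewrite gtr0_norm//; move: pe x0r hL La L0; lra.
- rewrite NmE e3 /x.
  have hh := mx La.
  have xe : x0 + m%:R * h - p + (N.-1%:R - m%:R) * h = x0 + N.-1%:R * h - p by ring.
  rewrite xe.
  have La' : L <= x0 + N.-1%:R * h - p.
    apply: le_trans La _; rewrite lerD2r lerD2l ler_pM2r// ler_nat -ltnS prednK//.
  have [pe|pe] := leP (p - xi) 0.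
    by rewrite ler0_norm//; move: xNr' xNl La' hL L0; lra.
  by rewrite gtr0_norm//; move: xNr' xNl La' hL L0 pe; lra.
Qed.

Lemma left_part m : (0 < m)%N -> (m <= N)%N -> L <= p - x m.-1 ->
  m = N \/ p - x m.-1 <= 2 * L ->
  `|h * \sum_(0 <= i < m) cossumq (x i)| <=
  205 * (k ^+ 8 * (r * c + W xi + W eta)) + e.
Proof.
move=> m0 mN La hm.
have m1 : m%:R = m.-1%:R + 1 :> R by rewrite -{1}(prednK m0) natr1.
rewrite big_nat_rev /= add0n.
have -> : \sum_(0 <= i < m) cossumq (x (m - i.+1)) =
   \sum_(0 <= i < m) cossumq (p + -1 * (p - x m.-1 + i%:R * h)).
  rewrite !big_nat; apply: eq_bigr => i /andP[_ im]; congr cossumq.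
  by rewrite /x natrB// -(natr1 i) m1; ring.
have xm : x0 <= x m.-1 by rewrite /x lerDl mulr_ge0// ltW.
have N1 : N%:R = N.-1%:R + 1 :> R by rewrite -{1}(prednK N0) natr1.
apply: side_bound => //; first by rewrite sqrrN expr1n.
- rewrite m1 /x.
  have -> : p - (x0 + m.-1%:R * h) + (m.-1%:R + 1) * h = p - x0 + h by ring.
  have : p - eta <= `|eta - p| by rewrite distrC; exact: ler_norm.
  move: Teta h1 x0l; lra.
- case: hm => [mN'|]; last by right.
  left; rewrite mN' in La *.
  have xNr2 : xi <= x N.-1 + h by exact: xNr'.
  have xNl' : x N.-1 <= xi by exact: xNl.
  have [pe|pe] := leP (p - xi) 0; first by rewrite ler0_norm//; move: xNr2 La L0 hL; lra.
  by rewrite gtr0_norm//; move: xNl' La L0; lra.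
- have -> : p - x m.-1 + m.-1%:R * h = p - x0 by rewrite /x; ring.
  have La' : L <= p - x0 by move: La xm; lra.
  by rewrite ger0_norm; move: x0l x0r La' hL L0; lra.
Qed.

(** The grid is cut at p - L and p + L: the two outer parts are side pieces, the middle one is
    short. *)
Lemma freq_near : `|h * \sum_(0 <= i < N) cossumq (x i)| <=
  500 * (k ^+ 8 * (r * c + W eta + W xi)) + 2 * e.
Proof.
have xmono a b : (a <= b)%N -> x a <= x b.
  by move=> ab; rewrite lerD2l ler_pM2r// ler_nat.
have [|m1 [m1N m1a m1b]] := @mono_split (fun i => x i - p <= - L) N.
  by move=> i iN; apply: le_trans; rewrite lerD2r xmono.
have [|m2 [m2N m2a m2b]] := @mono_split (fun i => x i - p < L) N.
  by move=> i iN; apply: le_lt_trans; rewrite lerD2r xmono.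
have m12 : (m1 <= m2)%N.
  rewrite leqNgt; apply/negP => m21.
  have := m1a _ m21; have := m2b m2; rewrite leqnn (leq_trans m21 m1N) -leNgt => /(_ isT).
  by move: L0; lra.
have w1 := end_weight_ge0 eta; have w2 := end_weight_ge0 xi.
have rc : 0 <= r * c by rewrite mulr_ge0 ?(ltW r0).
set B := k ^+ 8 * (r * c + W eta + W xi).
have B0 : 0 <= B by rewrite mulr_ge0// !addr_ge0.
have rcB : k * (r * c) <= B.
  apply: ler_pM; rewrite ?(ltW k0)//.
    by rewrite -{1}(expr1 k) ler_weXn2l.
  by rewrite -addrA lerDl addr_ge0.
have rcB1 : r * c <= B.
  by apply: le_trans rcB; rewrite ler_peMl.
have A1 : `|h * \sum_(0 <= i < m1) cossumq (x i)| <= 205 * B + e.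
  have [->|m10] := posnP m1.
    by rewrite big_geq// mulr0 normr0; move: B0 e0; lra.
  have := left_part m10 m1N; rewrite /B addrAC; apply.
    by have := m1a m1.-1; rewrite prednK// leqnn => /(_ isT); lra.
  have [->|m1N'] := eqVneq m1 N; first by left.
  right; have := m1b m1; rewrite leqnn ltn_neqAle m1N' m1N => /(_ isT); rewrite -ltNge.
  have -> : x m1 = x m1.-1 + h by rewrite /x -{1}(prednK m10) -natr1; ring.
  by move: hL; lra.
have A3 : `|h * \sum_(m2 <= i < N) cossumq (x i)| <= 205 * B + e.
  have [->|m2N'] := eqVneq m2 N.
    by rewrite big_geq// mulr0 normr0; move: B0 e0; lra.
  have m2lt : (m2 < N)%N by rewrite ltn_neqAle m2N' m2N.
  apply: right_part => //.
    by have := m2b m2; rewrite leqnn m2lt -leNgt => /(_ isT).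
  have [->|m20] := posnP m2; first by left.
  right; have := m2a m2.-1; rewrite prednK// leqnn => /(_ isT).
  have -> : x m2 = x m2.-1 + h by rewrite /x -{1}(prednK m20) -natr1; ring.
  by move: hL; lra.
have A2 : `|h * \sum_(m1 <= i < m2) cossumq (x i)| <= 6 * B.
  rewrite normrM gtr0_norm//.
  have [e12|lt12] := eqVneq m1 m2; first by rewrite e12 big_geq// normr0 mulr0; move: B0; lra.
  have {}lt12 : (m1 < m2)%N by rewrite ltn_neqAle lt12.
  (* In the stationary zone every inner sum is at most Q (1 + k) c, and the zone has length at most
     3 L; Q L = r. *)
  apply: (@le_trans _ _ (h * \sum_(m1 <= i < m2) Q%:R * ((1 + k) * c))).
    rewrite ler_pM2l//; apply: le_trans (ler_norm_sum _ _ _) _.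
    rewrite !big_nat; apply: ler_sum => i /andP[i1 i2].
    apply: le_trans (sum_qcos_cut _ _) _; rewrite ler_pM2l//.
    apply: cutinv_close => //; first exact: ltW.
    have /andP[u1 u2] := curve_U cv j1 pE (x i).
    rewrite -/U in u1 u2.
    have u0 : 0 <= U (x i) - U p.
      by apply: le_trans u1; rewrite mulr_ge0 ?sqr_ge0// divr_ge0 ?ltW.
    rewrite ger0_norm//; apply: le_trans u2 _; rewrite ler_pdivlMr//.
    have iN := leq_trans i2 m2N.
    have := m1b i; rewrite i1 iN -ltNge => /(_ isT) l1.
    have l2 := m2a _ i2.
    have s2 : (x i - p) ^+ 2 <= L ^+ 2 by move: l1 l2 L0; nra.
    have : j%:R * k * (x i - p) ^+ 2 * Q%:R <= j%:R * k * L ^+ 2 * Q%:R.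
      by rewrite ler_pM2r// ler_pM2l// mulr_gt0.
    have -> : j%:R * k * L ^+ 2 * Q%:R = k * (j%:R * Q%:R * L ^+ 2) by ring.
    by rewrite crit_len_sq mulr1.
  rewrite big_const_nat iter_addr addr0 -(mulr_natr (Q%:R * ((1 + k) * c))).
  have len : h * (m2 - m1)%:R <= 3 * L.
    have l1 := m1b m1; rewrite leqnn (leq_trans lt12 m2N) -ltNge in l1.
    have l2 := m2a m2.-1; rewrite (ltn_predK lt12) leqnn in l2.
    have {}l1 := l1 isT; have {}l2 := l2 isT.
    have m21 : m2%:R = m2.-1%:R + 1 :> R by rewrite -{1}(ltn_predK lt12) natr1.
    rewrite natrB// m21.
    move: l1 l2; rewrite /x; move: (m2.-1%:R) (m1%:R) => u v l1 l2.
    have : (u - v) * h < 2 * L by move: l1 l2; lra.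
    by move: hL; lra.
  have -> : h * (Q%:R * ((1 + k) * c) * (m2 - m1)%:R) =
    (h * (m2 - m1)%:R) * (Q%:R * ((1 + k) * c)) by ring.
  have q0 : 0 <= Q%:R * ((1 + k) * c).
    by apply: mulr_ge0; [exact: ltW|apply: mulr_ge0 => //; move: k0; lra].
  apply: le_trans (ler_wpM2r q0 len) _.
  have -> : 3 * L * (Q%:R * ((1 + k) * c)) = 3 * (r * c + k * (r * c)) by rewrite rE; ring.
  by move: rcB rcB1; lra.
rewrite (@big_cat_nat _ _ _ m1)//= (@big_cat_nat _ _ _ m2 m1)//= !mulrDr.
apply: le_trans (ler_normD _ _) _.
apply: le_trans (lerD A1 (ler_normD _ _)) _.
by move: A2 A3 B0; lra.
Qed.

(** With the critical point at distance at least 1 from the interval there is no stationary zone,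
    and [far_triv] leaves just boundary terms. Thus the expensive term r * c arises for few
    frequencies. *)
Lemma freq_far : p <= eta - 1 \/ xi + 1 <= p ->
  `|h * \sum_(0 <= i < N) cossumq (x i)| <= 6 * (k ^+ 8 * (W eta + W xi)) + e.
Proof.
have w1 := end_weight_ge0 eta; have w2 := end_weight_ge0 xi.
have z1 : 0 <= k ^+ 8 * W eta by exact: mulr_ge0.
have z2 : 0 <= k ^+ 8 * W xi by exact: mulr_ge0.
have Ll1 := crit_len_le1.
have N1 : N%:R = N.-1%:R + 1 :> R by rewrite -{1}(prednK N0) natr1.
case=> hp.
  rewrite (eq_bigr (fun i : nat => cossumq (p + 1 * (x0 - p + i%:R * h)))); last first.
    by move=> i _; congr cossumq; rewrite /x; ring.
  have := @side_far 1 (x0 - p) eta N.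
  rewrite expr1n => /(_ erefl) => H; apply: le_trans (H _ _ _ _) _ => //.
  - by move: x0l hp Ll1; lra.
  - have : xi - p <= `|xi - p| by exact: ler_norm.
    by rewrite N1; move: xNl h1 Txi; move: (N.-1%:R) => u; lra.
  - by rewrite ler0_norm; move: x0l hp; lra.
  by rewrite mulrDr; move: z1 z2; lra.
rewrite big_nat_rev /= add0n.
have -> : \sum_(0 <= i < N) cossumq (x (N - i.+1)) =
   \sum_(0 <= i < N) cossumq (p + -1 * (p - x N.-1 + i%:R * h)).
  rewrite !big_nat; apply: eq_bigr => i /andP[_ im]; congr cossumq.
  by rewrite /x natrB// -(natr1 i) N1; ring.
have xN : x N.-1 <= xi by exact: xNl.
have := @side_far (-1) (p - x N.-1) xi N.
rewrite sqrrN expr1n => /(_ erefl) => H; apply: le_trans (H _ _ _ _) _ => //.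
- by move: xN hp Ll1; lra.
- rewrite N1 /x.
  have -> : p - (x0 + N.-1%:R * h) + (N.-1%:R + 1) * h = p - x0 + h by ring.
  have : p - eta <= `|eta - p| by rewrite distrC; exact: ler_norm.
  by move: Teta h1 x0l; lra.
- by rewrite ger0_norm; move: xN hp; lra.
by rewrite mulrDr; move: z1 z2; lra.
Qed.

End Frequency.

(** * Discrete Poisson summation with a Fejer kernel *)

Section Poisson.
Variable R : realType.

Lemma sum_near_nat_le2 (n : nat) (c : R) :
  \sum_(0 <= a < n) ((`|a%:R - c| <= 1 / 2)%R)%:R <= 2 :> R.
Proof.
have pick (t : nat) : \sum_(0 <= a < n) (a == t)%:R <= 1 :> R.
  rewrite big_mkord; have [xJ|Jx] := ltnP t n.
    by rewrite (bigD1 (Ordinal xJ))//= eqxx big1 ?addr0// => j; rewrite -val_eqE /= => /negbTE ->.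
  by rewrite big1// => j _; rewrite (_ : (_ == _) = false)//; have := ltn_ord j; lia.
have [[t0 ht0]|no] := pselect (exists t : nat, `|t%:R - c| <= 1 / 2); last first.
  rewrite big1// => a _; have [h|//] := boolP (`|a%:R - c| <= 1 / 2)%R.
  by exfalso; apply: no; exists a.
have exP : exists t : nat, `|t%:R - c| <= 1 / 2 by exists t0.
case: (ex_minnP exP) => t ht tmin.
apply: (@le_trans _ _ (\sum_(0 <= a < n) ((a == t)%:R + (a == t.+1)%:R))); last first.
  by rewrite big_split /= (_ : 2 = 1 + 1)//; apply: lerD; exact: pick.
apply: ler_sum => a _; have [ha|//] := boolP (`|a%:R - c| <= 1 / 2); last by rewrite addr_ge0.
have ta := tmin _ ha.
have ta1 : (a <= t.+1)%N.
  rewrite -(ler_nat R) -natr1; move: ha ht; rewrite !ler_norml => /andP[_ +] /andP[+ _].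
  by move: (a%:R) (t%:R) => u v; lra.
have [->|an] := eqVneq a t; first by rewrite lerDl.
have -> : (a == t.+1) = true by apply/eqP; lia.
by rewrite add0r.
Qed.

Lemma big_nat_mul_split (m n : nat) (F : nat -> R) :
  \sum_(0 <= i < n * m) F i = \sum_(0 <= a < n) \sum_(0 <= r < m) F (a * m + r)%N.
Proof.
elim: n => [|n IH]; first by rewrite mul0n !big_geq.
rewrite big_nat_recr//= -IH mulSn addnC (@big_cat_nat _ _ _ (n * m))//= ?leq_addr//.
congr (_ + _); rewrite -{1}(add0n (n * m)%N) big_addn addKn.
by apply: eq_bigr => r _; rewrite addnC.
Qed.

Variables (q m2 K B : nat) (b0 : int) (eta xi Lam : R) (phi : R -> R).
Let m := (2 * m2)%N.
Let M := (q * m)%N.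
Hypotheses (q1 : (0 < q)%N) (m20 : (0 < m2)%N) (K0 : (0 < K)%N) (Km : (K <= m)%N).
Hypotheses (be : b0%:~R + 1 <= eta) (xB : xi < b0%:~R + B%:R) (Lam0 : 0 <= Lam).
Hypothesis phi1 : forall x, `|phi x| <= 1.
Hypothesis phiL : forall x y, eta <= x <= xi -> eta <= y <= xi ->
  `|phi x - phi y| <= Lam * `|x - y|.

Let x (i : nat) : R := b0%:~R + i%:R / M%:R.
Let ins (i : nat) := (eta < x i <= xi).
Let ph (i : nat) : R := if ins i then phi (x i) else 0.
(** The Fejer kernel as a probability on the m mesh points of one cell, centred at r = m2; the cell
    around a/q has length 1/q. *)
Let pr (r : nat) : R := fejer K ((r%:R - m2%:R) / m%:R) / K%:R / m%:R.

Let q0 : 0 < q%:R :> R. Proof. by rewrite ltr0n. Qed.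
Let m20r : 0 < m2%:R :> R. Proof. by rewrite ltr0n. Qed.
Let mE : m%:R = 2 * m2%:R :> R. Proof. by rewrite natrM. Qed.
Let m0 : 0 < m%:R :> R. Proof. by rewrite mE mulr_gt0. Qed.
Let ME : M%:R = q%:R * m%:R :> R. Proof. by rewrite natrM. Qed.
Let M0 : 0 < M%:R :> R. Proof. by rewrite ME mulr_gt0. Qed.
Let K0r : 0 < K%:R :> R. Proof. by rewrite ltr0n. Qed.

Let pr0 r : 0 <= pr r.
Proof. by rewrite !divr_ge0 ?fejer_ge0. Qed.

Let pr1 : \sum_(0 <= r < m) pr r = 1.
Proof.
rewrite -!mulr_suml big_mkord.
have -> : \sum_(i < m) fejer K ((i%:R - m2%:R) / m%:R) = \sum_(i < m) fejer K (m2%:R / m%:R - i%:R / m%:R) :> R.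
  apply: eq_bigr => i _; rewrite !fejer_coefE; apply: eq_bigr => l _.
  by rewrite -cosN; congr (_ * cos _); ring.
have := @cospoly_mesh R K m (fejer_coef R K) (m2%:R / m%:R) Km K0.
rewrite /cospoly; under [in X in X -> _]eq_bigr do rewrite -fejer_coefE.
move=> ->; rewrite /fejer_coef eqxx mulfK ?mulfV// gt_eqF//.
Qed.

(** The second moment of [pr] is at most 1/K; the bound |y| <= 1/s + s y^2 with s = sqrt K passes to
    the first moment. *)
Let prd : \sum_(0 <= r < m) pr r * `|(r%:R - m2%:R) / m%:R| <= 2 / Num.sqrt K%:R.
Proof.
have s0 : 0 < Num.sqrt (K%:R : R) by rewrite sqrtr_gt0.
have sK : Num.sqrt (K%:R : R) ^+ 2 = K%:R by rewrite sqr_sqrtr// ltW.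
set s := Num.sqrt _ in s0 sK *.
apply: (@le_trans _ _ (\sum_(0 <= r < m) (pr r * s^-1 + s / (K%:R * m%:R)))).
  rewrite !big_nat; apply: ler_sum => r /andP[_ rm].
  set y := (r%:R - m2%:R) / m%:R.
  have y2 : `|y| <= 1 / 2.
    rewrite /y normrM [X in _ * X]gtr0_norm ?invr_gt0// ler_pdivrMr// mE ler_norml.
    have : r%:R + 1 <= m%:R :> R by rewrite natr1 ler_nat.
    have := ler0n R r; rewrite mE; move=> ? ?; apply/andP; split; lra.
  have dy : dist_int y = `|y|.
    apply/le_anti/andP; split.
      by apply: le_trans (dist_int_le _ 0) _; rewrite subr0.
    have [n ->] := dist_int_ex y.
    have [->|n0] := eqVneq n 0; first by rewrite subr0.
    have := @int_leq1_dist R n 0 n0; rewrite subr0 => n1.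
    have := lerB_dist n%:~R y; rewrite distrC; lra.
  have F0 : 0 <= pr r by exact: pr0.
  have amgm : `|y| <= s^-1 + s * `|y| ^+ 2.
    rewrite -(ler_pM2l s0) mulrDr mulfV ?gt_eqF// mulrA.
    have : 0 <= (s * `|y|) ^+ 2 - s * `|y| + 1.
      have := sqr_ge0 (s * `|y| - 1 / 2); nra.
    by lra.
  apply: le_trans (ler_wpM2l F0 amgm) _; rewrite mulrDr lerD2l.
  have Fd := fejer_dist K y; rewrite dy in Fd.
  have -> : pr r * (s * `|y| ^+ 2) = (s / (K%:R * m%:R)) * (fejer K y * `|y| ^+ 2).
    by rewrite /pr -/y invfM; ring.
  by rewrite ler_piMr// divr_ge0 ?mulr_ge0// ltW.
rewrite big_split /= -mulr_suml pr1 mul1r big_const_nat iter_addr addr0 subn0 -(mulr_natr (s / _)).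
have -> : s / (K%:R * m%:R) * m%:R = s / K%:R by rewrite invfM mulrA divfK// gt_eqF.
have -> : s / K%:R = s^-1 by rewrite -sK; field; rewrite gt_eqF.
by rewrite mulrDl mul1r.
Qed.

Let ph1 i : `|ph i| <= 1.
Proof. by rewrite /ph; case: ifP => _; rewrite ?normr0. Qed.

Let xa a r : (m2 <= a * m + r)%N ->
  x (a * m + r - m2) = x (a * m) + (r%:R - m2%:R) / m%:R / q%:R.
Proof.
move=> h; rewrite /x natrB// natrD ME; field; rewrite !gt_eqF//.
Qed.

(** A cell clear of both ends lies wholly inside or outside the interval, and there the Lipschitz
    bound and [prd] apply. A cell near an end is estimated by 2. *)
Let cell a : `|ph (a * m) - \sum_(0 <= r < m) pr r * ph (a * m + r - m2)| <=
  Lam / q%:R * (2 / Num.sqrt K%:R) +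
  2 * (((`|a%:R - q%:R * (eta - b0%:~R)| <= 1 / 2)%R)%:R + ((`|a%:R - q%:R * (xi - b0%:~R)| <= 1 / 2)%R)%:R).
Proof.
have xE : x (a * m) = b0%:~R + a%:R / q%:R.
  by rewrite /x natrM ME; field; rewrite !gt_eqF.
have L0 : 0 <= Lam / q%:R * (2 / Num.sqrt K%:R).
  by rewrite mulr_ge0// divr_ge0// ltW.
have triv : `|ph (a * m) - \sum_(0 <= r < m) pr r * ph (a * m + r - m2)| <= 2.
  apply: le_trans (ler_normB _ _) _; rewrite (_ : 2 = 1 + 1)//; apply: lerD => //.
  apply: le_trans (ler_norm_sum _ _ _) _; rewrite -pr1; apply: ler_sum => r _.
  by rewrite normrM (ger0_norm (pr0 r)) ler_piMr.
have step (r : nat) : (r < m)%N -> `|(r%:R - m2%:R) / m%:R / q%:R| <= 1 / (2 * q%:R) :> R.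
  move=> rm; rewrite normrM [X in _ * X]gtr0_norm ?invr_gt0// ler_pdivrMr//.
  have -> : 1 / (2 * q%:R) * q%:R = 1 / 2 :> R by field; rewrite gt_eqF.
  rewrite normrM [X in _ * X]gtr0_norm ?invr_gt0// ler_pdivrMr// mE ler_norml.
  have : r%:R + 1 <= m%:R :> R by rewrite natr1 ler_nat.
  have := ler0n R r; rewrite mE; move=> ? ?; apply/andP; split; lra.
have [near1|far1] := boolP (`|a%:R - q%:R * (eta - b0%:~R)| <= 1 / 2)%R.
  rewrite (_ : true%:R = 1 :> R)//; apply: le_trans triv _.
  have := ler0n R (`|a%:R - q%:R * (xi - b0%:~R)| <= 1 / 2)%R.
  by move: L0; set w := _%:R; set z := _ * _; lra.
have [near2|far2] := boolP (`|a%:R - q%:R * (xi - b0%:~R)| <= 1 / 2)%R.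
  rewrite (_ : false%:R = 0 :> R)// (_ : true%:R = 1 :> R)//; apply: le_trans triv _.
  by move: L0; set z := _ * _; lra.
rewrite (_ : false%:R = 0 :> R)// addr0 mulr0 addr0.
set X := x (a * m) in xE *.
have hq : 1 / (2 * q%:R) * q%:R = 1 / 2 :> R by field; rewrite gt_eqF.
have Xq : (X - b0%:~R) * q%:R = a%:R by rewrite xE addrAC subrr add0r divfK// gt_eqF.
(* the whole cell lies on one side of each end point *)
have sideP v : ~~ (`|a%:R - q%:R * (v - b0%:~R)| <= 1 / 2) ->
   v < X - 1 / (2 * q%:R) \/ X + 1 / (2 * q%:R) < v.
  rewrite -ltNge -Xq.
  have -> : (X - b0%:~R) * q%:R - q%:R * (v - b0%:~R) = q%:R * (X - v) by ring.
  rewrite normrM (gtr0_norm q0) -hq mulrC ltr_pM2l//.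
  have [Xv|Xv] := leP (X - v) 0; first by rewrite ler0_norm// => ?; right; lra.
  by rewrite gtr0_norm// => ?; left; lra.
have [eX|eX] := sideP _ far1; last first.
  have out i : x i <= X + 1 / (2 * q%:R) -> ph i = 0.
    by move=> h; rewrite /ph /ins (_ : (eta < x i) = false)//; apply/negbTE; rewrite -leNgt; lra.
  rewrite (out (a * m)%N); last by rewrite -/X lerDl divr_ge0// mulr_ge0// ltW.
  rewrite big_nat big1 ?subrr ?normr0// => r /andP[_ rm].
  have [h|h] := leqP m2 (a * m + r).
    rewrite out ?mulr0// xa// lerD2l; apply: le_trans (ler_norm _) _; exact: step.
  have -> : (a * m + r - m2 = 0)%N by apply/eqP; rewrite subn_eq0 ltnW.
  rewrite /ph /ins /x mul0r addr0 (_ : (eta < _) = false) ?mulr0//.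
  by apply/negbTE; rewrite -leNgt; apply: le_trans be; rewrite lerDl.
have cellpos r : (r < m)%N -> (m2 <= a * m + r)%N.
  move=> rm; have a0 : (0 < a)%N.
    rewrite -(ltr_nat R); have qX : (eta - b0%:~R) * q%:R < (X - b0%:~R) * q%:R.
      by rewrite ltr_pM2r//; have : 0 <= 1 / (2 * q%:R) :> R by [rewrite divr_ge0// mulr_ge0// ltW]; lra.
    rewrite -Xq; apply: lt_trans qX; apply: mulr_gt0 => //.
    by rewrite subr_gt0; apply: lt_le_trans be; rewrite ltrDl ltr01.
  rewrite (leq_trans _ (leq_addr r (a * m)))// (leq_trans _ (leq_pmull m a0))//.
  by rewrite /m leq_pmull.
have [xX|xX] := sideP _ far2.
  have out i : X - 1 / (2 * q%:R) <= x i -> ph i = 0.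
    by move=> h; rewrite /ph /ins (_ : (x i <= xi) = false) ?andbF//; apply/negbTE; rewrite -ltNge; lra.
  rewrite (out (a * m)%N); last by rewrite -/X gerBl divr_ge0// mulr_ge0// ltW.
  rewrite big_nat big1 ?subrr ?normr0// => r /andP[_ rm].
  rewrite out ?mulr0// xa ?cellpos// lerD2l.
  by have := step _ rm; rewrite ler_norml => /andP[].
have inside r : (r < m)%N -> ph (a * m + r - m2) = phi (x (a * m + r - m2)) /\
    eta <= x (a * m + r - m2) <= xi.
  move=> rm; have := step _ rm; rewrite ler_norml => /andP[s1 s2].
  have xx := xa (cellpos _ rm).
  by rewrite /ph /ins xx -/X; move: s1 s2; set w := _ / _ / _ => s1 s2;
    have -> : (eta < X + w <= xi) by [apply/andP; split; lra]; split => //; apply/andP; split; lra.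
have Xin : eta < X <= xi.
  by have : 0 <= 1 / (2 * q%:R) :> R by [rewrite divr_ge0// mulr_ge0// ltW]; move=> ?; apply/andP; split; lra.
have -> : ph (a * m) = \sum_(0 <= r < m) pr r * phi X.
  by rewrite -mulr_suml pr1 mul1r /ph /ins -/X Xin.
rewrite -sumrB; apply: le_trans (ler_norm_sum _ _ _) _.
apply: le_trans (ler_wpM2l _ prd); last by rewrite divr_ge0// ltW.
rewrite mulr_sumr !big_nat; apply: ler_sum => r /andP[_ rm].
have [-> xin] := inside _ rm.
rewrite -mulrBr normrM (ger0_norm (pr0 r)).
rewrite [X in _ <= X]mulrCA; apply: ler_wpM2l => //.
apply: le_trans (phiL _ xin) _; first by move/andP: Xin => [? ?]; apply/andP; split; lra.
rewrite xa ?cellpos// -/X opprD addrA subrr sub0r normrN.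
by rewrite -[X in _ <= X]mulrA ler_wpM2l// [X in X <= _]normrM mulrC [X in X * _]gtr0_norm ?invr_gt0.
Qed.

(** Summing [cell] over a: each end spoils at most two cells, hence 4 cells and an error of 8, while
    the Lipschitz errors add up over at most B q + 1 cells. *)
Lemma poisson_fejer :
  `|\sum_(0 <= a < B * q) ph (a * m) -
    m%:R^-1 * \sum_(0 <= i < B * M) ph i * (fejer K (i%:R / m%:R) / K%:R)| <=
  8 + (B%:R + 1) * Lam * (2 / Num.sqrt K%:R).
Proof.
have ph0 i : (i <= m2)%N -> ph i = 0.
  move=> im; rewrite /ph /ins (_ : (eta < x i) = false)//; apply/negbTE; rewrite -leNgt.
  apply: le_trans be; rewrite /x lerD2l ler_pdivrMr// mul1r ler_nat.
  apply: leq_trans im _; rewrite /M /m; apply: leq_trans (leq_pmull _ q1); exact: leq_pmull.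
have phB i : (B * M <= i)%N -> ph i = 0.
  move=> Bi; rewrite /ph /ins (_ : (x i <= xi) = false) ?andbF//; apply/negbTE; rewrite -ltNge.
  apply: lt_le_trans xB _; rewrite /x lerD2l ler_pdivlMr// -natrM ler_nat//.
have -> : \sum_(0 <= a < B * q) ph (a * m) = \sum_(0 <= a < (B * q).+1) ph (a * m).
  by rewrite [RHS]big_nat_recr//= [ph (B * q * m)]phB ?addr0// /M mulnA.
(* The mesh is regrouped into cells centred at the a/q by shifting indices by m2. Indices truncated
   to 0 and the overhanging ends are harmless because [ph] vanishes there. *)
pose H i := ph i * (fejer K (i%:R / m%:R) / K%:R).
have -> : \sum_(0 <= i < B * M) ph i * (fejer K (i%:R / m%:R) / K%:R) =
    \sum_(0 <= a < (B * q).+1) \sum_(0 <= r < m) H (a * m + r - m2)%N.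
  rewrite -(big_nat_mul_split m (B * q).+1 (fun i => H (i - m2)%N)).
  have BM : ((B * q).+1 * m = B * M + m2 + m2)%N by rewrite /M /m; clear; nia.
  rewrite BM [RHS](@big_cat_nat _ _ _ (B * M + m2))//= ?leq_addr//.
  rewrite [X in _ = _ + X]big_nat [X in _ = _ + X]big1 ?addr0; last first.
    by move=> i /andP[h _]; rewrite /H phB ?mul0r// -(leq_add2r m2) subnK// (leq_trans (leq_addl _ _) h).
  rewrite [RHS](@big_cat_nat _ _ _ m2)//= ?leq_addl//.
  rewrite [X in _ = X + _]big_nat [X in _ = X + _]big1 ?add0r; last first.
    by move=> i /andP[_ h]; rewrite /H ph0 ?mul0r// (leq_trans (leq_subr _ _))// ltnW.
  rewrite -[X in _ = \sum_(X <= _ < _) _](add0n m2) big_addn addnK.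
  by apply: eq_bigr => i _; rewrite addnK.
rewrite mulr_sumr -sumrB; apply: le_trans (ler_norm_sum _ _ _) _.
pose w1 (a : nat) : R := ((`|a%:R - q%:R * (eta - b0%:~R)| <= 1 / 2)%R)%:R.
pose w2 (a : nat) : R := ((`|a%:R - q%:R * (xi - b0%:~R)| <= 1 / 2)%R)%:R.
pose cst : R := Lam / q%:R * (2 / Num.sqrt K%:R).
apply: (@le_trans _ _ (\sum_(0 <= a < (B * q).+1) (cst + 2 * (w1 a + w2 a)))).
  apply: ler_sum => a _; apply: le_trans (cell a).
  rewrite le_eqVlt; apply/orP; left; apply/eqP; congr `|_ - _|.
  rewrite mulr_sumr; apply: eq_bigr => r _; rewrite /H.
  have [h|h] := leqP m2 (a * m + r); last first.
    by rewrite ph0 ?mul0r ?mulr0// (leq_trans (leq_subr _ _))// ltnW.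
  suff -> : fejer K ((a * m + r - m2)%:R / m%:R) = fejer K ((r%:R - m2%:R) / m%:R) :> R.
    by rewrite /pr; ring.
  have -> : (a * m + r - m2)%:R / m%:R = (r%:R - m2%:R) / m%:R + a%:R :> R.
    by rewrite natrB// natrD natrM; field; rewrite gt_eqF.
  rewrite !fejer_coefE; apply: eq_bigr => l _; congr (_ * _).
  have -> : 2 * pi * l%:R * ((r%:R - m2%:R) / m%:R + a%:R) =
     2 * pi * l%:R * ((r%:R - m2%:R) / m%:R) + (pi *+ 2) *+ (l * a) :> R.
    have -> : pi *+ 2 *+ (l * a) = 2 * pi * (l * a)%:R :> R.
      by rewrite -(mulr_natr (pi *+ 2)) -(mulr_natl pi).
    by rewrite natrM; ring.
  by have := periodicn (@cosD2pi R) (l * a); apply.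
rewrite big_split /= -[X in _ + X <= _]mulr_sumr big_split /= [X in X <= _]addrC.
have n1 : \sum_(0 <= a < (B * q).+1) w1 a <= 2 := sum_near_nat_le2 (B * q).+1 (q%:R * (eta - b0%:~R)).
have n2 : \sum_(0 <= a < (B * q).+1) w2 a <= 2 := sum_near_nat_le2 (B * q).+1 (q%:R * (xi - b0%:~R)).
apply: lerD; first by move: n1 n2; lra.
rewrite big_const_nat iter_addr addr0 subn0 -(mulr_natr cst) -natr1 natrM /cst.
have s0 : 0 < Num.sqrt (K%:R : R) by rewrite sqrtr_gt0.
have -> : Lam / q%:R * (2 / Num.sqrt K%:R) * (B%:R * q%:R + 1) =
   (B%:R + q%:R^-1) * (Lam * (2 / Num.sqrt K%:R)).
  by field; rewrite !gt_eqF.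
rewrite -[X in _ <= X]mulrA; apply: ler_wpM2r.
  by rewrite mulr_ge0// divr_ge0// ltW.
by rewrite lerD2l invf_le1// ler1n.
Qed.

End Poisson.

(** * Integers in intervals and harmonic sums *)

Section IntervalSums.
Variable R : realType.

Definition zseq (a b : R) : seq int :=
  if Num.floor b - Num.floor a is Posz n then
    [seq Num.floor a + 1 + Posz i | i <- iota 0 n] else [::].

Lemma mem_zseq a b z : (z \in zseq a b) = (a < z%:~R <= b).
Proof.
have -> : (a < z%:~R <= b) = (Num.floor a < z <= Num.floor b).
  by rewrite -floor_lt_int -floor_ge_int.
rewrite /zseq; case E : (Num.floor b - Num.floor a) => [n|n].
  apply/mapP/idP => [[i]|zab].
    by rewrite mem_iota => hi ->; lia.
  exists (absz ((z : int) - Num.floor a - 1)%R); last by lia.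
  by rewrite mem_iota; lia.
by rewrite in_nil; lia.
Qed.

Lemma zseq_uniq a b : uniq (zseq a b).
Proof.
rewrite /zseq; case: (_ - _) => // n.
by rewrite map_inj_uniq ?iota_uniq// => i j; lia.
Qed.

Lemma sum_zseq a b (c : int) (n : nat) (psi : int -> R) :
  c%:~R <= a -> b < c%:~R + n%:R ->
  \sum_(z <- zseq a b) psi z =
  \sum_(0 <= i < n) (if a < (c + Posz i)%:~R <= b then psi (c + Posz i) else 0).
Proof.
move=> ca bn; rewrite -big_mkcond /=.
rewrite -(big_map (fun i => c + Posz i) (fun z => a < z%:~R <= b) psi) -[RHS]big_filter.
apply: perm_big; apply: uniq_perm; first exact: zseq_uniq.
  by rewrite filter_uniq// map_inj_uniq ?iota_uniq// => i j; lia.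
move=> z; rewrite mem_zseq mem_filter; have [/andP[az zb]|//] := boolP (a < z%:~R <= b).
symmetry; apply/mapP; exists (absz (z - c)%R); last first.
  have : c%:~R < z%:~R :> R by apply: le_lt_trans ca az.
  by rewrite ltr_int; lia.
have h1 : c%:~R < z%:~R :> R by apply: le_lt_trans ca az.
have h2 : z%:~R < (c + Posz n)%:~R :> R by rewrite intrD; apply: le_lt_trans zb bn.
by rewrite mem_index_iota; rewrite !ltr_int in h1 h2; lia.
Qed.

Lemma ler_sum_seq (T : eqType) (s1 s2 : seq T) (P : pred T) (psi : T -> R) :
  uniq s1 -> (forall z, z \in s1 -> P z -> z \in s2) ->
  (forall z, z \in s2 -> 0 <= psi z) ->
  \sum_(z <- s1 | P z) psi z <= \sum_(z <- s2) psi z.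
Proof.
move=> u1 sub psi0; rewrite -big_filter.
have u : uniq (seq.filter P s1) by rewrite filter_uniq.
have {}sub : {subset seq.filter P s1 <= s2} by move=> z; rewrite mem_filter => /andP[Pz /sub]; exact.
elim: (seq.filter P s1) s2 u sub psi0 => [|x s IH] s2 /=.
  by move=> _ _ h; rewrite big_nil big_seq sumr_ge0.
move=> /andP[xs us] sub psi0; rewrite big_cons.
have xs2 : x \in s2 by apply: sub; rewrite mem_head.
rewrite (perm_big _ (perm_to_rem xs2)) big_cons lerD2l; apply: IH => //.
  move=> z zs; have zs2 : z \in s2 by apply: sub; rewrite in_cons zs orbT.
  have : z \in x :: rem x s2 by rewrite -(perm_mem (perm_to_rem xs2)).
  by rewrite in_cons => /predU1P[zx|//]; rewrite -zx zs in xs.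
by move=> z /mem_rem; exact: psi0.
Qed.

Lemma harmonic_le_ln n : \sum_(0 <= i < n) i.+1%:R^-1 <= 1 + ln n%:R :> R.
Proof.
case: n => [|n]; first by rewrite big_geq// ln0// addr0.
elim: n => [|n IH]; first by rewrite big_nat1 invr1 ln1 addr0.
rewrite big_nat_recr//=.
have n1 : (0 : R) < n.+1%:R by rewrite ltr0n.
have n2 : (0 : R) < n.+2%:R by rewrite ltr0n.
have h : ln (n.+1%:R / n.+2%:R) <= - n.+2%:R^-1 :> R.
  have -> : n.+1%:R / n.+2%:R = 1 + (- n.+2%:R^-1) :> R.
    have e : n.+2%:R = n.+1%:R + 1 :> R by rewrite natr1.
    rewrite e in n2 *; move: (n.+1%:R) n2 => v n2.
    by field; rewrite gt_eqF.
  by apply: le_ln1Dx; rewrite ltrNl opprK invf_lt1// ltr1n.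
rewrite lnM ?posrE ?invr_gt0// lnV ?posrE// in h.
move: IH h; move: (ln n.+1%:R) (ln n.+2%:R) (\sum_(0 <= i < n.+1) _) (n.+2%:R^-1) => u v w x; lra.
Qed.

(** At most two l lie within 1/2 of y. For the others, |l - y| is comparable with 1 + |l - t| for a
    fixed integer t near y, and harmonic sums on both sides of t remain. *)
Lemma sum_recip_dist (s0 y : R) K : 0 < s0 ->
  \sum_(0 <= l < K) (Num.max s0 `|l%:R - y|)^-1 <= 2 / s0 + 10 * (1 + ln K.+1%:R).
Proof.
move=> s00.
have [t tK tl] : exists2 t : nat, (t <= K)%N & forall l : nat, (l < K)%N ->
    1 / 2 < `|l%:R - y| -> (maxn (l - t) (t - l)).+1%:R <= 5 * `|l%:R - y|.
  have mx (l t : nat) : (maxn (l - t) (t - l)).+1%:R = `|l%:R - t%:R| + 1 :> R.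
    rewrite -natr1; congr (_ + _); have [lt|tl] := leqP l t.
      by rewrite distrC -natrB// normr_nat; congr _%:R; lia.
    by rewrite -natrB ?(ltnW tl)// normr_nat; congr _%:R; lia.
  have [y0|y0] := ltP y 0.
    exists 0%N => // l _ h; rewrite mx subr0 normr_nat.
    have l0 : 0 <= l%:R :> R by [].
    by rewrite ger0_norm in h *; lra.
  have [yK|yK] := ltP y K%:R; last first.
    exists K => // l lK h; rewrite mx.
    have l0 : l%:R <= K%:R :> R by rewrite ler_nat ltnW.
    have e1 : `|l%:R - K%:R| = K%:R - l%:R :> R by rewrite ler0_norm ?opprB// subr_le0.
    have e2 : `|l%:R - y| = y - l%:R by rewrite ler0_norm ?opprB// subr_le0; lra.
    by rewrite e2 in h *; rewrite e1; lra.
  have /andP[t1 t2] := truncn_itv y0.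
  exists (Num.truncn y).
    by rewrite -(ler_nat R); apply: le_trans t1 (ltW yK).
  move=> l lK h; rewrite mx.
  have := ler_distD y l%:R (Num.truncn y)%:R.
  have : `|y - (Num.truncn y)%:R| <= 1.
    by rewrite -natr1 in t2; rewrite ger0_norm; lra.
  by lra.
apply: (@le_trans _ _ (\sum_(0 <= l < K) (((`|l%:R - y| <= 1 / 2)%R)%:R / s0
   + 5 / (maxn (l - t) (t - l)).+1%:R))).
  apply: ler_sum_nat => l lK.
  have m0 : 0 < Num.max s0 `|l%:R - y| by rewrite lt_max s00.
  have [h|h] := leP `|l%:R - y| (1 / 2).
    rewrite mul1r ler_wpDr ?divr_ge0 ?ler0n//.
    by rewrite lef_pV2 ?posrE// le_max lexx.
  rewrite mul0r add0r.
  have n0 : 0 < `|l%:R - y| by apply: lt_trans h; lra.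
  apply: (@le_trans _ _ `|l%:R - y|^-1).
    by rewrite lef_pV2 ?posrE// le_max lexx orbT.
  rewrite -[leLHS]div1r ler_pdivrMr// mulrAC ler_pdivlMr ?ltr0n// mul1r.
  by apply: tl => //; rewrite ltnS in lK *; case/andP: lK.
rewrite big_split /= -mulr_suml -mulr_sumr; apply: lerD.
  by rewrite ler_pM2r ?invr_gt0//; exact: sum_near_nat_le2.
have -> : 10 * (1 + ln K.+1%:R) = 5 * ((1 + ln K.+1%:R) + (1 + ln K.+1%:R)) :> R by ring.
rewrite ler_pM2l// (big_cat_nat _ tK)//=.
have mono n : (n <= K.+1)%N -> \sum_(0 <= i < n) i.+1%:R^-1 <= 1 + ln K.+1%:R :> R.
  move=> nK; apply: le_trans (harmonic_le_ln _).
  by rewrite [leRHS](big_cat_nat _ nK)//= lerDl sumr_ge0.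
apply: lerD.
  rewrite big_nat_rev /= add0n.
  apply: le_trans (mono t.+1 _); last by rewrite ltnS.
  rewrite big_nat_recl//= ler_wpDl ?invr_ge0//; apply: ler_sum_nat => i /andP[_ it].
  by rewrite lef_pV2 ?posrE ?ltr0n// ler_nat; lia.
rewrite -{1}(add0n t) big_addn.
apply: le_trans (mono (K - t)%N _); last by lia.
by apply: ler_sum_nat => i _; rewrite lef_pV2 ?posrE ?ltr0n// ler_nat; lia.
Qed.

End IntervalSums.

(** * Summation over all frequencies *)

Section Frequencies.
Variable R : realType.

(** Grid points in a half-open interval form a block of consecutive ones; this puts the sum in the
    shape required for a single frequency. *)
Lemma grid_sum (eta xi c h : R) (n : nat) (psi : R -> R) :
  0 < h -> c <= eta -> xi <= c + n%:R * h ->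
  let s := \sum_(0 <= i < n) (if eta < c + i%:R * h <= xi then psi (c + i%:R * h) else 0) in
  s = 0 \/ exists x0 N, [/\ eta <= x0 <= eta + h, (0 < N)%N,
     x0 + N.-1%:R * h <= xi <= x0 + N%:R * h & s = \sum_(0 <= i < N) psi (x0 + i%:R * h)].
Proof.
move=> h0 ce xn s; pose x (i : nat) := c + i%:R * h.
have xS i : x i.+1 = x i + h by rewrite /x -natr1 mulrDl mul1r addrA.
have split v : exists m : nat, [/\ (m <= n)%N, forall i : nat, (i < m)%N -> x i <= v
    & forall i : nat, (m <= i < n)%N -> v < x i].
  have [|m [m1 m2 m3]] := @mono_split (fun i => x i <= v) n.
    by move=> i _; rewrite xS; lra.
  by exists m; split => // i /m3; rewrite -ltNge.
have [i0 [i0n i0l i0r]] := split eta; have [i1 [i1n i1l i1r]] := split xi.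
have [i01|i01] := leqP i1 i0.
  left; rewrite /s big_nat big1// => i /andP[_ iN].
  case: ifP => // /andP[ei xi'].
  have [ii|ii] := ltnP i i0; first by have := i0l _ ii; rewrite leNgt ei.
  have : xi < x i by apply: i1r; rewrite iN (leq_trans i01).
  by rewrite ltNge xi'.
right; exists (x i0), (i1 - i0)%N.
have N0 : (0 < i1 - i0)%N by rewrite subn_gt0.
have xadd (i : nat) : x i0 + i%:R * h = x (i0 + i)%N by rewrite /x natrD; ring.
have ex : eta < x i0 by apply: i0r; rewrite leqnn (leq_trans i01).
have sE : s = \sum_(0 <= i < i1 - i0) psi (x i0 + i%:R * h).
  rewrite /s (big_cat_nat (leq0n i0) i0n)//= [X in X + _ = _]big_nat [X in X + _ = _]big1 ?add0r; last first.
    by move=> i /andP[_ ii]; rewrite ltNge i0l.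
  rewrite (big_cat_nat (ltnW i01) i1n)//= [X in _ + X = _]big_nat [X in _ + X = _]big1 ?addr0; last first.
    by move=> i /i1r ii; rewrite (leNgt _ xi) ii andbF.
  rewrite -{1}(add0n i0) big_addn; apply: eq_big_nat => i /andP[_ ii].
  rewrite addnC xadd -/(x _) i0r ?i1l//; first by lia.
  by apply/andP; split; [exact: leq_addr|]; lia.
split => //.
  rewrite (ltW ex) /=; case: i0 {sE} i0l {i0r} i0n i01 N0 xadd ex => [|i0] i0l *.
    by rewrite /x mul0r addr0; lra.
  by rewrite xS lerD2r i0l.
apply/andP; split; first by rewrite xadd i1l//; lia.
rewrite xadd subnKC ?(ltnW i01)//.
have [i1N|i1N] := ltnP i1 n; first by apply/ltW/i1r; rewrite leqnn.
by rewrite (_ : i1 = n) //; lia.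
Qed.

Variables (k : R) (f g F G : R -> R) (Q j : nat).
Hypotheses (cv : curve k f g F G) (Q0 : (0 < Q)%N) (j0 : (0 < j)%N).
Variables (eta xi T e h c : R) (n : nat).
Hypotheses (exi : eta < xi) (h0 : 0 < h) (e0 : 0 < e) (e1 : e <= 1).
Hypotheses (hT : h * (16 * j%:R * k ^+ 2 * Q%:R ^+ 3 * (T + 1) ^+ 2) <= e)
  (h1 : h <= 1) (hL : h <= crit_len R Q j).
Hypotheses (ce : c <= eta) (xn : xi <= c + n%:R * h).

Definition freq_sum (l : int) : R :=
  h * \sum_(0 <= i < n) (if eta < c + i%:R * h <= xi then
    \sum_(1 <= q < Q.+1) q%:R * cos (2 * pi * q%:R *
       (j%:R * f (c + i%:R * h) - l%:~R * (c + i%:R * h))) else 0).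

(** The dual curve enters here: the phase of frequency l is stationary at p = G(l/j), and by the
    Legendre identity its critical value is -j F(l/j). *)
Lemma freq_sum_le (l : int) (p := G (l%:~R / j%:R)) :
  `|eta - p| + 2 <= T -> `|xi - p| + 2 <= T ->
  `|freq_sum l| <= 500 * (k ^+ 8 *
     ((if eta - 1 < p < xi + 1 then Num.sqrt (Q%:R / j%:R) * cutinv Q%:R (j%:R * F (l%:~R / j%:R)) else 0)
      + end_weight Q j p eta + end_weight Q j p xi)) + 2 * e.
Proof.
move=> Te Tx.
have j0r : j%:R != 0 :> R by rewrite pnatr_eq0 -lt0n.
have pE : j%:R * g p = l%:~R by rewrite /p (curve_GK cv) mulrC divfK.
have k80 : 0 <= k ^+ 8 by rewrite exprn_ge0// ltW// (curve_k_gt0 cv).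
have we := end_weight_ge0 p Q0 j0 eta; have wx := end_weight_ge0 p Q0 j0 xi.
have cutE : cutinv Q%:R (j%:R * f p - l%:~R * p) = cutinv Q%:R (j%:R * F (l%:~R / j%:R)).
  have -> : j%:R * F (l%:~R / j%:R) = - (j%:R * f p - l%:~R * p).
    rewrite -[l%:~R / j%:R](curve_GK cv) -/p (curve_legendre cv) -pE; ring.
  by rewrite /cutinv dist_intN.
have sc0 : 0 <= Num.sqrt (Q%:R / j%:R) * cutinv Q%:R (j%:R * F (l%:~R / j%:R)).
  by rewrite mulr_ge0 ?sqrtr_ge0 ?cutinv_ge0.
pose psi x := \sum_(1 <= q < Q.+1) q%:R * cos (2 * pi * q%:R * (j%:R * f x - l%:~R * x)).
have := grid_sum psi h0 ce xn; rewrite /freq_sum /=.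
case=> [->|[x0 [N [/andP[x1 x2] N0 /andP[N1 N2] ->]]]].
  set A := (X in 500 * (_ * X)); have A0 : 0 <= A by rewrite !addr_ge0//; case: ifP.
  rewrite mulr0 normr0; have := mulr_ge0 k80 A0; move: (k ^+ 8 * A) e0 => z; lra.
case: ifP => near.
  by have := freq_near cv Q0 j0 h0 h1 pE e0 e1 hT Te Tx x1 x2 N0 N1 N2 hL; rewrite cutE.
have far : p <= eta - 1 \/ xi + 1 <= p.
  by move/negbT: near; rewrite negb_and -!leNgt => /orP.
apply: (le_trans (freq_far cv Q0 j0 h0 h1 pE hT Te Tx x1 N0 N1 far)).
rewrite add0r; have := mulr_ge0 k80 (addr_ge0 we wx).
by move: (k ^+ 8 * _) e0 => z; lra.
Qed.

Let k0 : 0 < k. Proof. exact: curve_k_gt0 cv. Qed.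
Let j0r : 0 < j%:R :> R. Proof. by rewrite ltr0n. Qed.
Let L0 : 0 < crit_len R Q j. Proof. exact: crit_len_gt0. Qed.

(** As g is 2k-Lipschitz, |p - v| is at least |l - j g(v)| / (2 k j), a distance from the integer l
    to a point that does not depend on l. *)
Lemma end_weight_le (l : int) v : end_weight Q j (G (l%:~R / j%:R)) v <=
  2 * k * Q%:R / Num.max (2 * k * j%:R * crit_len R Q j) `|l%:~R - j%:R * g v|.
Proof.
set p := G _; rewrite /end_weight.
have pE : j%:R * g p = l%:~R by rewrite /p (curve_GK cv) mulrC divfK// gt_eqF.
have kj : 0 < 2 * k * j%:R by rewrite !mulr_gt0.
have gp : `|l%:~R - j%:R * g v| <= 2 * k * j%:R * `|p - v|.
  rewrite -pE -mulrBr normrM (gtr0_norm j0r).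
  have -> : 2 * k * j%:R * `|p - v| = j%:R * (2 * k * `|p - v|) by ring.
  rewrite ler_pM2l//; have [pv|pv] := leP p v.
    have /andP[g1 g2] := curve_g_incr cv pv.
    rewrite distrC (distrC p) !ger0_norm ?subr_ge0// ?(curve_g_le cv)//.
  have /andP[g1 g2] := curve_g_incr cv (ltW pv).
  by rewrite !ger0_norm ?subr_ge0// ?(curve_g_le cv) ?(ltW pv).
have m0 : 0 < Num.max (2 * k * j%:R * crit_len R Q j) `|l%:~R - j%:R * g v|.
  by rewrite lt_max mulr_gt0.
have m1 : 0 < Num.max (crit_len R Q j) `|p - v| by rewrite lt_max L0.
rewrite ler_pdivrMr ?mulr_gt0// mulrAC ler_pdivlMr//.
have -> : 2 * k * Q%:R * (j%:R * Num.max (crit_len R Q j) `|p - v|) =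
  Q%:R * (2 * k * j%:R * Num.max (crit_len R Q j) `|p - v|) by ring.
rewrite ler_pM2l ?ltr0n// ge_max ler_pM2l// le_max lexx /=.
apply: le_trans gp _; rewrite ler_pM2l// le_max lexx orbT//.
Qed.

Lemma crit_len_sqrt : (j%:R * crit_len R Q j)^-1 = Num.sqrt (Q%:R / j%:R).
Proof.
have Q0r : 0 < Q%:R :> R by rewrite ltr0n.
rewrite -[LHS]gtr0_norm ?invr_gt0 ?mulr_gt0// -sqrtr_sqr; congr Num.sqrt.
have e2 := crit_len_sq R Q0 j0.
rewrite exprVn exprMn; apply: (@mulfI _ (j%:R * Q%:R)); first by rewrite mulf_neq0 ?gt_eqF.
have -> : j%:R * Q%:R * (Q%:R / j%:R) = Q%:R ^+ 2 :> R by field; rewrite gt_eqF.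
have n0 : j%:R ^+ 2 * crit_len R Q j ^+ 2 != 0 by rewrite mulf_neq0 ?expf_neq0 ?gt_eqF.
by apply: (mulIf n0); rewrite divfK// -[LHS]mulr1 -[X in _ * X = _]e2; ring.
Qed.

(** By [sum_recip_dist]: the two frequencies nearest to j g(v) cost at most Q sqrt(Q/j) each, the
    others a harmonic sum. *)
Lemma sum_end_weight (s : nat -> int) v K :
  (forall l, s l = Posz l) \/ (forall l, s l = - Posz l) ->
  \sum_(0 <= l < K) end_weight Q j (G ((s l)%:~R / j%:R)) v <=
  2 * Q%:R * Num.sqrt (Q%:R / j%:R) + 20 * k * Q%:R * (1 + ln K.+1%:R).
Proof.
move=> hs; pose s0 := 2 * k * j%:R * crit_len R Q j.
have s00 : 0 < s0 by rewrite !mulr_gt0.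
have [y hy] : exists y, forall l, `|(s l)%:~R - j%:R * g v| = `|l%:R - y|.
  case: hs => hs; [exists (j%:R * g v)|exists (- (j%:R * g v))] => l; rewrite hs ?intrN ?pmulrn//.
  by rewrite -normrN opprB opprK addrC opprK.
apply: (@le_trans _ _ (2 * k * Q%:R * (2 / s0 + 10 * (1 + ln K.+1%:R)))).
  apply: (le_trans _ (ler_wpM2l _ (sum_recip_dist y K s00))); last by rewrite !mulr_ge0 ?(ltW k0).
  rewrite mulr_sumr; apply: ler_sum => l _.
  by apply: (le_trans (end_weight_le _ _)); rewrite hy.
rewrite mulrDr; apply: lerD; last by rewrite le_eqVlt; apply/orP; left; apply/eqP; ring.
rewrite -crit_len_sqrt le_eqVlt; apply/orP; left; apply/eqP; rewrite /s0.
by field; rewrite !gt_eqF.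
Qed.

(** G is increasing, so a critical point in (eta - 1, xi + 1) forces l/j into the image of that
    interval under g. *)
Lemma sum_near (s : nat -> int) K : injective s ->
  \sum_(0 <= l < K) (if eta - 1 < G ((s l)%:~R / j%:R) < xi + 1 then
      Num.sqrt (Q%:R / j%:R) * cutinv Q%:R (j%:R * F ((s l)%:~R / j%:R)) else 0) <=
  Num.sqrt (Q%:R / j%:R) * \sum_(l <- zseq (j%:R * g (eta - 1)) (j%:R * g (xi + 1)))
      cutinv Q%:R (j%:R * F (l%:~R / j%:R)).
Proof.
move=> sI; rewrite mulr_sumr -big_mkcond /=.
rewrite -(big_map s (fun l : int => eta - 1 < G (l%:~R / j%:R) < xi + 1) (fun l : int =>
   Num.sqrt (Q%:R / j%:R) * cutinv Q%:R (j%:R * F (l%:~R / j%:R)))).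
have glt x y : x < y -> g x < g y by move=> xy; rewrite ltNge (curve_g_le cv) -ltNge.
apply: ler_sum_seq; first by rewrite map_inj_uniq ?iota_uniq.
  move=> l _ /andP[l1 l2]; rewrite mem_zseq.
  have := glt _ _ l1; have := glt _ _ l2; rewrite (curve_GK cv).
  rewrite ltr_pdivrMr// ltr_pdivlMr// => a b; rewrite mulrC b /= mulrC ltW//.
by move=> l _; rewrite mulr_ge0 ?sqrtr_ge0 ?cutinv_ge0.
Qed.

Lemma sum_freq_sum (s : nat -> int) K : injective s ->
  (forall l, s l = Posz l) \/ (forall l, s l = - Posz l) ->
  (forall l, (l < K)%N -> `|G ((s l)%:~R / j%:R)| + `|eta| + `|xi| + 2 <= T) ->
  \sum_(0 <= l < K) `|freq_sum (s l)| <= 500 * k ^+ 8 *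
     (Num.sqrt (Q%:R / j%:R) * (\sum_(l <- zseq (j%:R * g (eta - 1)) (j%:R * g (xi + 1)))
      cutinv Q%:R (j%:R * F (l%:~R / j%:R)))
      + 2 * (2 * Q%:R * Num.sqrt (Q%:R / j%:R) + 20 * k * Q%:R * (1 + ln K.+1%:R))) + 2 * e * K%:R.
Proof.
move=> sI sE hG; pose r : R := Num.sqrt (Q%:R / j%:R).
apply: (@le_trans _ _ (\sum_(0 <= l < K) (500 * k ^+ 8 * ((if eta - 1 < G ((s l)%:~R / j%:R) < xi + 1 then
       r * cutinv Q%:R (j%:R * F ((s l)%:~R / j%:R)) else 0)
      + end_weight Q j (G ((s l)%:~R / j%:R)) eta + end_weight Q j (G ((s l)%:~R / j%:R)) xi) + 2 * e))).
  apply: ler_sum_nat => l /andP[_ lK]; rewrite -[500 * _ * _]mulrA.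
  have n1 := normr_ge0 eta; have n2 := normr_ge0 xi.
  have gT := hG _ lK.
  apply: freq_sum_le.
    by apply: (le_trans (lerD (ler_normB _ _) (lexx _))); move: gT n1 n2; lra.
  by apply: (le_trans (lerD (ler_normB _ _) (lexx _))); move: gT n1 n2; lra.
rewrite big_split /= -mulr_sumr; apply: lerD; last first.
  by rewrite big_const_nat subn0 iter_addr_0 -[_ *+ K]mulr_natr.
have k80 : 0 <= 500 * k ^+ 8 by have := exprn_ge0 8 (ltW k0); move: (k ^+ 8) => z; lra.
apply: (ler_wpM2l k80); rewrite !big_split /= -addrA; apply: lerD; first exact: sum_near.
have := sum_end_weight eta K sE; have := sum_end_weight xi K sE.
by move=> a b; rewrite mulr_natl mulr2n; apply: lerD.
Qed.

End Frequencies.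

(** * The exponential sum over the heights *)

Section ExponentialSum.
Variable R : realType.

Definition lattice_pts (eta xi : R) (Q : nat) : seq (int * nat) :=
  [seq (a, q) | q <- index_iota 1 Q.+1, a <- zseq (eta * q%:R) (xi * q%:R)].

Definition height (f : R -> R) (p : int * nat) : R := p.2%:R * f (p.1%:~R / p.2%:R).

Lemma cossum_heights (eta xi : R) (f : R -> R) Q j :
  cossum [seq height f p | p <- lattice_pts eta xi Q] j =
  \sum_(1 <= q < Q.+1) \sum_(a <- zseq (eta * q%:R) (xi * q%:R))
     cos (2 * pi * j%:R * (q%:R * f (a%:~R / q%:R))).
Proof. by rewrite /cossum big_map big_allpairs_dep. Qed.

Lemma cos_int_shift (x : R) (m : int) : cos (x + 2 * pi * m%:~R) = cos x :> R.
Proof.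
have H n (y : R) : cos (y + 2 * pi * n%:R) = cos y.
  have -> : 2 * pi * n%:R = pi *+ 2 *+ n :> R by rewrite -(mulr_natr (pi *+ 2) n) -(mulr_natr pi 2); ring.
  exact: (periodicn (@cosD2pi R) n y).
case: m => n; first exact: H.
by rewrite -(H n.+1 (_ + _)) NegzE mulrNz; congr cos; rewrite -pmulrn; ring.
Qed.

Variables (k : R) (f g F G : R -> R) (Q j : nat).
Hypotheses (cv : curve k f g F G) (Q2 : (1 < Q)%N) (j0 : (0 < j)%N) (jQ : (j <= Q)%N).
Variables (eta xi Lam : R).
Hypotheses (exi : eta < xi) (xiL : xi <= eta + Lam) (gn : `|g eta| <= 1).

Let Q0 : (0 < Q)%N. Proof. exact: ltnW. Qed.
Let k0 : 0 < k. Proof. exact: curve_k_gt0 cv. Qed.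
Let Lam0 : 0 < Lam. Proof. by move: exi xiL; lra. Qed.
Let jr : 1 <= j%:R :> R. Proof. by rewrite ler1n. Qed.
Let jQr : j%:R <= Q%:R :> R. Proof. by rewrite ler_nat. Qed.

Let f_lip x y : eta <= x <= xi -> eta <= y <= xi -> `|f x - f y| <= (1 + 3 * k * Lam) * `|x - y|.
Proof.
wlog xy : x y / x <= y.
  move=> wl hx hy; have [xy|xy] := leP x y; first exact: wl.
  by rewrite distrC (distrC x); apply: wl => //; rewrite ltW.
move=> /andP[x1 x2] /andP[y1 y2]; rewrite distrC (distrC x).
have /andP[g1 g2] := curve_g_incr cv x1.
have /andP[f1 f2] := curve_f cv x y.
have d0 : 0 <= y - x by rewrite subr_ge0.
have dL : y - x <= Lam by move: xiL; lra.
have xL : x - eta <= Lam by move: xiL; lra.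
have gx0 : 0 <= g x - g eta by rewrite subr_ge0 (curve_g_le cv).
have gx1 : g x - g eta <= 2 * k * Lam by apply: (le_trans g2); rewrite ler_wpM2l// mulr_ge0// ltW.
have gx : `|g x| <= 1 + 2 * k * Lam by move: gn; rewrite !ler_norml; lra.
have q1 : k * (y - x) ^+ 2 <= k * Lam * (y - x) by rewrite -mulrA ler_pM2l// expr2 ler_wpM2r.
have q0 : 0 <= (y - x) ^+ 2 / k by rewrite divr_ge0 ?sqr_ge0// ltW.
rewrite (ger0_norm d0).
have gd : `|g x * (y - x)| <= (1 + 2 * k * Lam) * (y - x) by rewrite normrM (ger0_norm d0) ler_wpM2r.
have -> : f y - f x = (f y - f x - g x * (y - x)) + g x * (y - x) by ring.
apply: (le_trans (ler_normD _ _)).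
have : `|f y - f x - g x * (y - x)| <= k * Lam * (y - x).
  by rewrite ler_norml (le_trans f2 q1) andbT; lra.
by move: gd; set z := `|_|; set w := `|_|; lra.
Qed.

Lemma cos_fun_lip (q : nat) x y : (q <= Q)%N -> eta <= x <= xi -> eta <= y <= xi ->
  `|cos (2 * pi * j%:R * (q%:R * f x)) - cos (2 * pi * j%:R * (q%:R * f y))|
     <= 8 * Q%:R ^+ 2 * (1 + 3 * k * Lam) * `|x - y|.
Proof.
move=> qQ hx hy; apply: le_trans (cos_lip _ _) _.
have fl := f_lip hx hy; move: fl; set d := 1 + _; set w := `|x - y| => fl.
have -> : 2 * pi * j%:R * (q%:R * f x) - 2 * pi * j%:R * (q%:R * f y) =
  (2 * pi) * (j%:R * q%:R) * (f x - f y) by ring.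
rewrite -(mulrA _ d) normrM; apply: ler_pM => //.
have p0 := pi_ge0 R; have p4 : pi <= 4 :> R by have := pihalf_lt2 R; rewrite ltr_pdivrMr//; lra.
have q0 : 0 <= q%:R :> R by [].
have qr : q%:R <= Q%:R :> R by rewrite ler_nat.
rewrite ger0_norm; last by rewrite !mulr_ge0.
by apply: ler_pM; rewrite ?mulr_ge0//; [lra|rewrite expr2; apply: ler_pM].
Qed.

(* The discrete Poisson summation: the fractions a/q lie on the mesh of step
   1/M and the Fejer kernel picks them out of it. *)
Lemma poisson_expansion (c : int) (B M1 K : nat) (M := (2 * Q`! * M1)%N) (h := M%:R^-1) :
  (0 < M1)%N -> (0 < K)%N -> (K <= 2 * M1)%N ->
  c%:~R + 1 <= eta -> xi < c%:~R + B%:R ->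
  `|cossum [seq height f p | p <- lattice_pts eta xi Q] j -
    \sum_(l < K) fejer_coef R K l / (2 * K%:R) *
      (freq_sum f Q j eta xi h c%:~R (B * M) (Posz l) + freq_sum f Q j eta xi h c%:~R (B * M) (- Posz l))|
  <= Q%:R * (8 + (B%:R + 1) * (8 * Q%:R ^+ 2 * (1 + 3 * k * Lam)) * (2 / Num.sqrt K%:R)).
Proof.
move=> M10 K0 KM ce xB.
have M0 : 0 < M%:R :> R by rewrite ltr0n !muln_gt0 fact_gt0.
pose x (i : nat) : R := c%:~R + i%:R * h.
pose ins i := eta < x i <= xi.
pose ps q x := cos (2 * pi * j%:R * (q%:R * f x)) : R.
(* Every q <= Q divides Q!, so a single mesh of step 1/M contains all fractions a/q, with 2 (m2 q)
   mesh steps between neighbours. *)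
pose m2 q := (Q`! %/ q * M1)%N.
have mE q : (0 < q <= Q)%N -> (q * (2 * m2 q) = M)%N.
  move=> qQ; have /divnK qd : (q %| Q`!)%N by apply: dvdn_fact.
  by rewrite /M /m2 -[in RHS]qd; ring.
have mh q : (0 < q <= Q)%N -> (2 * m2 q)%:R^-1 = q%:R * h.
  move=> /[dup]/andP[q0 _] qQ; rewrite /h -(mE _ qQ) (natrM R q) invfM mulrA divff ?mul1r//.
  by rewrite pnatr_eq0 -lt0n.
pose S q := (2 * m2 q)%:R^-1 * \sum_(0 <= i < B * M) (if ins i then ps q (x i) else 0) *
     (fejer K (i%:R / (2 * m2 q)%:R) / K%:R).
have eS : \sum_(1 <= q < Q.+1) S q = \sum_(l < K) fejer_coef R K l / (2 * K%:R) *
      (freq_sum f Q j eta xi h c%:~R (B * M) (Posz l) + freq_sum f Q j eta xi h c%:~R (B * M) (- Posz l)).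
  pose A q (l : int) i := cos (2 * pi * q%:R * (j%:R * f (x i) - l%:~R * x i)).
  pose T q l i : R := fejer_coef R K l / (2 * K%:R) * h *
     (if ins i then q%:R * (A q (Posz l) i + A q (- Posz l) i) else 0).
  transitivity (\sum_(1 <= q < Q.+1) \sum_(0 <= i < B * M) \sum_(l < K) T q l i).
    apply: eq_big_nat => q; rewrite ltnS => qQ; rewrite /S mulr_sumr; apply: eq_bigr => i _.
    rewrite /T; case: ifP => _; last by rewrite big1 ?mul0r ?mulr0// => l _; rewrite mulr0.
    rewrite fejer_coefE mulr_suml !mulr_sumr; apply: eq_bigr => l _.
    rewrite (mh _ qQ).
    (* The grid starts at the integer c, and moving its origin to 0 changes the phase by 2 pi l q
       c. *)
    have -> : cos (2 * pi * l%:R * (i%:R * (q%:R * h))) = cos (2 * pi * q%:R * (l%:R * x i)).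
      rewrite -[LHS](cos_int_shift _ (Posz l * Posz q * c)); congr cos.
      by rewrite !intrM -!pmulrn /x; ring.
    have -> : A q (Posz l) i + A q (- Posz l) i = 2 * (ps q (x i) * cos (2 * pi * q%:R * (l%:R * x i))).
      have -> : ps q (x i) = cos (2 * pi * q%:R * (j%:R * f (x i))) by rewrite /ps; congr cos; ring.
      rewrite /A intrN -pmulrn.
      have -> : 2 * pi * q%:R * (j%:R * f (x i) - l%:R * x i) =
        2 * pi * q%:R * (j%:R * f (x i)) - 2 * pi * q%:R * (l%:R * x i) by ring.
      have -> : 2 * pi * q%:R * (j%:R * f (x i) - - l%:R * x i) =
        2 * pi * q%:R * (j%:R * f (x i)) + 2 * pi * q%:R * (l%:R * x i) by ring.
      by rewrite cosB cosD; ring.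
    by field; rewrite pnatr_eq0 -lt0n.
  rewrite exchange_big /=; under eq_bigr do rewrite exchange_big /=.
  rewrite exchange_big /=; apply: eq_bigr => l _.
  rewrite /freq_sum -mulrDr -big_split /= mulrA mulr_sumr; apply: eq_bigr => i _.
  rewrite -/(x i) -/(ins i) /T -mulr_sumr; congr (_ * _).
  case: ifP => _; last by rewrite big1 // addr0.
  by rewrite -big_split /=; apply: eq_bigr => q _; rewrite mulrDr.
rewrite -eS cossum_heights -sumrB.
apply: le_trans (ler_norm_sum _ _ _) _.
apply: (@le_trans _ _ (\sum_(1 <= q < Q.+1) (8 + (B%:R + 1) * (8 * Q%:R ^+ 2 * (1 + 3 * k * Lam)) * (2 / Num.sqrt K%:R)))); last first.
  by set z := 8 + _; rewrite big_const_nat subSS subn0 iter_addr_0 -[z *+ Q]mulr_natl.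
apply: ler_sum_nat => q; rewrite ltnS => /[dup]/andP[q0 qQ'] qQ.
have q0r : 0 < q%:R :> R by rewrite ltr0n.
have m20 : (0 < m2 q)%N by rewrite muln_gt0 M10 divn_gt0// dvdn_leq ?fact_gt0// dvdn_fact.
have KmM : (K <= 2 * m2 q)%N.
  apply: leq_trans KM _; rewrite leq_mul2l /= /m2 -{1}[M1]mul1n leq_mul2r divn_gt0//.
  by rewrite dvdn_leq ?fact_gt0 ?dvdn_fact ?orbT.
have kL : 0 <= 8 * Q%:R ^+ 2 * (1 + 3 * k * Lam).
  by rewrite mulr_ge0 ?mulr_ge0 ?sqr_ge0// addr_ge0// !mulr_ge0// ltW.
have ps1 y : `|ps q y| <= 1 by rewrite ler_norml cos_geN1 cos_le1.
have := poisson_fejer q0 m20 K0 KmM ce xB kL ps1 (fun x y => @cos_fun_lip q x y qQ').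
rewrite (mE _ qQ) -/h -/(S q); congr (`|_ - _| <= _).
rewrite (@sum_zseq _ _ _ (c * Posz q) (B * q)).
- apply: eq_big_nat => a _.
  have e : (c * q + a)%:~R = (c%:~R + a%:R / q%:R) * q%:R :> R.
    by rewrite intrD intrM -!pmulrn; field; rewrite gt_eqF.
  have -> : (a * (2 * m2 q))%:R / M%:R = a%:R / q%:R :> R.
    rewrite -(mE _ qQ); move: (m2 q) m20 => v v0; rewrite !natrM; field.
    by rewrite !pnatr_eq0 -!lt0n v0 q0.
  by rewrite e ltr_pM2r// ler_pM2r// mulfK ?gt_eqF.
- by rewrite intrM -pmulrn ler_pM2r//; move: ce; lra.
- by rewrite intrM natrM -pmulrn -mulrDl ltr_pM2r.
Qed.

Definition expsum_const (k Lam : R) : R :=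
  32 * (Lam + 5) * (1 + 3 * k * Lam) + 20 + 1000 * k ^+ 8 * (4 + 280 * k).

Lemma ln2_ge_half : 1 / 2 <= ln 2 :> R.
Proof.
have : ln (1 + (- (1 / 2))) <= - (1 / 2) :> R by apply: le_ln1Dx; lra.
have -> : 1 + (- (1 / 2)) = 2^-1 :> R by field.
by rewrite lnV ?posrE//; lra.
Qed.

Lemma ln_nat_ge_half (n : nat) : (1 < n)%N -> 1 / 2 <= ln n%:R :> R.
Proof.
by move=> n1; apply: (le_trans ln2_ge_half); rewrite ler_ln ?posrE ?ltr0n ?ler_nat// ltnW.
Qed.

Lemma le_mul_ln (n : nat) : (1 < n)%N -> n%:R <= 2 * (n%:R * ln n%:R) :> R.
Proof.
move=> /ln_nat_ge_half h; have n0 : 0 <= n%:R :> R by [].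
by rewrite mulrCA -[leLHS]mulr1 ler_wpM2l//; lra.
Qed.

Lemma ln_pow4 (n : nat) : (1 < n)%N -> ln (n ^ 4).+1%:R <= 5 * ln n%:R :> R.
Proof.
move=> n1; have n0 : (0 < n)%N by apply: ltnW.
have : ln (n ^ 4).+1%:R <= ln (n ^ 5)%:R :> R.
  rewrite ler_ln ?posrE ?ltr0n ?expn_gt0 ?n0// ler_nat (expnS n 4).
  have : (0 < n ^ 4)%N by rewrite expn_gt0 n0.
  by move: (n ^ 4)%N n1 => v; nia.
by rewrite natrX lnXn ?ltr0n// -[_ *+ 5]mulr_natl.
Qed.

Lemma expsum_arith (c w K8 a b d : R) : 0 <= c -> 0 <= w -> 0 <= K8 -> 0 <= a -> 0 <= b -> 1 <= d ->
  2 * d * (8 + w) + 2 * (K8 * (a + 2 * (2 * b + 140 * c * d)) + 2) <=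
  (2 * w + 20 + 2 * K8 * (4 + 280 * c)) * (a + b + d).
Proof.
move=> c0 w0 K0 a0 b0 d1.
have h1 := mulr_ge0 w0 a0; have h2 := mulr_ge0 w0 b0.
have h3 := mulr_ge0 K0 a0; have h4 := mulr_ge0 K0 b0.
have h5 := mulr_ge0 (mulr_ge0 K0 c0) a0; have h6 := mulr_ge0 (mulr_ge0 K0 c0) b0.
have h7 : 0 <= K8 * d by rewrite mulr_ge0// (le_trans _ d1).
by lra.
Qed.

(** Poisson expansion, then the bound for every frequency below K and its opposite. The assumption
    |g eta| <= 1 makes the Lipschitz constant of f on the interval depend on k and Lam alone. *)
Lemma expsum_normalized :
  `|cossum [seq height f p | p <- lattice_pts eta xi Q] j| <=
  expsum_const k Lam * (Num.sqrt (Q%:R / j%:R) *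
     (\sum_(l <- zseq (j%:R * g (eta - 1)) (j%:R * g (xi + 1))) cutinv Q%:R (j%:R * F (l%:~R / j%:R)))
     + Q%:R * Num.sqrt (Q%:R / j%:R) + Q%:R * ln Q%:R).
Proof.
pose k8 := 500 * k ^+ 8.
have k80 : 0 <= k8 by have := exprn_ge0 8 (ltW k0); rewrite /k8; move: (k ^+ 8) => z; lra.
(* With K = Q^4, the factor 2 / sqrt K cancels the Q^2 in the Lipschitz constant, while log K is
   still O(log Q). *)
pose K := (Q ^ 4)%N; pose c := Num.floor eta - 1; pose B := absz (Num.floor xi - Num.floor eta + 3).
have K0 : (0 < K)%N by rewrite expn_gt0 Q0.
have Kr : 0 < K%:R :> R by rewrite ltr0n.
have fl : Num.floor eta <= Num.floor xi by rewrite le_floor// ltW.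
have BE : B%:R = (Num.floor xi)%:~R - (Num.floor eta)%:~R + 3 :> R.
  rewrite /B natr_absz ger0_norm; last by lia.
  by rewrite intrD intrB.
have cE : c%:~R = (Num.floor eta)%:~R - 1 :> R by rewrite /c intrB.
have fe1 := floor_le eta; have fe2 := floorD1_gt eta.
have fx1 := floor_le xi; have fx2 := floorD1_gt xi.
rewrite intrD1 in fe2; rewrite intrD1 in fx2.
have ce : c%:~R + 1 <= eta by move: cE fe1; lra.
have xB : xi < c%:~R + B%:R by move: cE BE fx2; lra.
have BL : B%:R + 1 <= Lam + 5 by move: BE xiL fx1 fe2; lra.
(* A bound for the distance from the interval to every critical point that occurs. No uniformity is
   required: it affects just the mesh size, which is chosen afterwards. *)
pose T := \sum_(0 <= l < K) (`|G ((Posz l)%:~R / j%:R)| + `|G ((- Posz l)%:~R / j%:R)|) + `|eta| + `|xi| + 2.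
have Tl (l : nat) : (l < K)%N -> `|G ((Posz l)%:~R / j%:R)| + `|G ((- Posz l)%:~R / j%:R)| + `|eta| + `|xi| + 2 <= T.
  move=> lK; rewrite /T !lerD2r big_mkord (bigD1 (Ordinal lK))//= lerDl.
  by apply: sumr_ge0 => i _; rewrite addr_ge0.
have T0 : 0 <= T by rewrite !addr_ge0// sumr_ge0// => i _; rewrite addr_ge0.
pose e : R := K%:R^-1.
have e0 : 0 < e by rewrite invr_gt0.
have e1 : e <= 1 by rewrite invf_le1// ler1n.
pose X1 := 16 * j%:R * k ^+ 2 * Q%:R ^+ 3 * (T + 1) ^+ 2.
have X10 : 0 <= X1 by rewrite /X1 mulr_ge0 ?sqr_ge0// mulr_ge0 ?exprn_ge0// mulr_ge0 ?sqr_ge0// mulr_ge0.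
pose X2 := Num.sqrt (j%:R * Q%:R) : R.
have X20 : 0 < X2 by rewrite sqrtr_gt0 mulr_gt0 ?ltr0n.
pose X := X1 * K%:R + X2 + K%:R + 1.
have X1K : 0 <= X1 * K%:R by rewrite mulr_ge0 ?(ltW Kr).
have XM : X < (Num.bound X)%:R by apply: archi_boundP; rewrite !addr_ge0// ltW.
(* Fine enough for the three smallness conditions on h: [hT], h <= 1, and h below the stationary
   radius. *)
pose M1 := Num.bound X; rewrite -/M1 in XM.
have M1K : K%:R <= M1%:R :> R by move: XM X1K X20; rewrite /X; lra.
have M10 : (0 < M1)%N by rewrite ler_nat in M1K; apply: leq_trans M1K.
have KM : (K <= 2 * M1)%N by rewrite ler_nat in M1K; apply: leq_trans M1K _; rewrite leq_pmull.
pose M := (2 * Q`! * M1)%N; pose h : R := M%:R^-1.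
have M1M : M1%:R <= M%:R :> R by rewrite ler_nat leq_pmull// muln_gt0 fact_gt0.
have M0 : 0 < M%:R :> R by apply: lt_le_trans M1M; rewrite ltr0n.
have h0 : 0 < h by rewrite invr_gt0.
have hle z : z <= X -> z * h <= 1.
  by move=> zX; rewrite ler_pdivrMr// mul1r (le_trans zX)// (le_trans _ M1M)// ltW.
have hT : h * (16 * j%:R * k ^+ 2 * Q%:R ^+ 3 * (T + 1) ^+ 2) <= e.
  rewrite -/X1 -(@ler_pM2r _ K%:R)// mulVf ?gt_eqF//.
  rewrite mulrAC -mulrA [h * _]mulrC -mulrA mulrCA mulrA; apply: hle.
  by rewrite /X; move: X20 Kr; lra.
have h1 : h <= 1 by rewrite -[h]mul1r; apply: hle; rewrite /X; move: X20 Kr X1K; lra.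
have hL : h <= crit_len R Q j.
  rewrite /crit_len -/X2 -(ler_pM2l X20) mulfV ?gt_eqF//.
  by apply: hle; rewrite /X; move: X1K Kr; lra.
have xn : xi <= c%:~R + (B * M)%:R * h by rewrite natrM mulfK ?gt_eqF// ltW.
have ce' : c%:~R <= eta by move: ce; lra.
pose E := freq_sum f Q j eta xi h c%:~R (B * M).
set s := Num.sqrt (Q%:R / j%:R); set Z := \sum_(l <- _) _.
have s0 : 0 <= s by rewrite sqrtr_ge0.
have Z0 : 0 <= Z by apply: sumr_ge0 => l _; rewrite cutinv_ge0.
pose H : R := 1 + ln K.+1%:R.
pose V := 2 * Q%:R * s + 20 * k * Q%:R * H.
have lnQ := ln_nat_ge_half Q2.
have Qr : 2 <= Q%:R :> R by rewrite ler_nat.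
have side (sg : nat -> int) : injective sg -> (forall l, sg l = Posz l) \/ (forall l, sg l = - Posz l) ->
    \sum_(0 <= l < K) `|E (sg l)| <= k8 * (s * Z + 2 * V) + 2.
  move=> sI sE.
  have e2 : 2 * e * K%:R = 2 :> R by rewrite -mulrA mulVf ?gt_eqF// mulr1.
  have := sum_freq_sum (K := K) cv Q0 j0 h0 e0 e1 hT h1 hL ce' xn sI sE; rewrite e2; apply => l /Tl.
  by apply: le_trans; rewrite !lerD2r; case: sE => ->; rewrite (lerDl, lerDr).
have HL : H <= 7 * ln Q%:R.
  by have := ln_pow4 Q2; rewrite -/K /H; move: (ln K.+1%:R) lnQ => v; lra.
have sq : Num.sqrt K%:R = Q%:R ^+ 2 :> R.
  by rewrite /K natrX -[4%N]/(2 * 2)%N exprM sqrtr_sqr ger0_norm// sqr_ge0.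
have pos := poisson_expansion M10 K0 KM ce xB; rewrite -/M -/h -/E in pos.
have sumb : `|\sum_(l < K) fejer_coef R K l / (2 * K%:R) * (E (Posz l) + E (- Posz l))| <=
    2 * (k8 * (s * Z + 2 * V) + 2).
  apply: le_trans (ler_norm_sum _ _ _) _.
  apply: (@le_trans _ _ (\sum_(0 <= l < K) (`|E (Posz l)| + `|E (- Posz l)|))).
    rewrite big_mkord; apply: ler_sum => l _; rewrite normrM.
    have c1 : `|fejer_coef R K l / (2 * K%:R)| <= 1.
      rewrite ger0_norm ?divr_ge0 ?fejer_coef_ge0 ?mulr_ge0 ?(ltW Kr)//.
      by rewrite ler_pdivrMr ?mulr_gt0// mul1r fejer_coef_le.
    rewrite -[leRHS]mul1r; apply: ler_pM => //; exact: ler_normD.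
  rewrite big_split /= [2 * _]mulrDl !mul1r; apply: lerD.
    by apply: side; [move=> a b []|left].
  by apply: side; [by move=> a b /oppr_inj []|right].
have e8 : (B%:R + 1) * (8 * Q%:R ^+ 2 * (1 + 3 * k * Lam)) * (2 / Q%:R ^+ 2) =
   (B%:R + 1) * (16 * (1 + 3 * k * Lam)) by field; rewrite gt_eqF// ltr0n.
rewrite sq e8 in pos.
have kL : 0 <= 1 + 3 * k * Lam by rewrite addr_ge0// !mulr_ge0// ltW.
have pb : Q%:R * (8 + (B%:R + 1) * (16 * (1 + 3 * k * Lam))) <=
   (2 * (Q%:R * ln Q%:R)) * (8 + (Lam + 5) * (16 * (1 + 3 * k * Lam))).
  apply: ler_pM; rewrite ?addr_ge0 ?mulr_ge0//.
    exact: le_mul_ln.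
  by rewrite lerD2l ler_wpM2r// mulr_ge0.
have sZ : 0 <= s * Z by rewrite mulr_ge0.
have QL1 : 1 <= Q%:R * ln Q%:R :> R.
  by rewrite -(@ler_pM2l _ 2)// mulr1; apply: le_trans Qr (le_mul_ln Q2).
have Qs : 0 <= Q%:R * s by rewrite mulr_ge0.
have VL : V <= 2 * (Q%:R * s) + 140 * k * (Q%:R * ln Q%:R).
  rewrite /V; apply: lerD; first by rewrite mulrA.
  have -> : 140 * k * (Q%:R * ln Q%:R) = 20 * k * Q%:R * (7 * ln Q%:R) by ring.
  by rewrite ler_wpM2l// !mulr_ge0// ltW.
apply: (@le_trans _ _ ((2 * (Q%:R * ln Q%:R)) * (8 + (Lam + 5) * (16 * (1 + 3 * k * Lam)))
   + 2 * (k8 * (s * Z + 2 * (2 * (Q%:R * s) + 140 * k * (Q%:R * ln Q%:R))) + 2))).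
  rewrite -[X in `|X|](subrK (\sum_(l < K) fejer_coef R K l / (2 * K%:R) * (E (Posz l) + E (- Posz l)))).
  apply: le_trans (ler_normD _ _) _; apply: lerD; first exact: le_trans pos pb.
  apply: (le_trans sumb); rewrite ler_pM2l// lerD2r ler_wpM2l// lerD2l ler_pM2l//.
have -> : expsum_const k Lam = 2 * (Lam + 5) * (16 * (1 + 3 * k * Lam)) + 20 + 2 * k8 * (4 + 280 * k).
  by rewrite /expsum_const /k8; ring.
set w := (Lam + 5) * (16 * (1 + 3 * k * Lam)).
have w0 : 0 <= w by rewrite mulr_ge0 ?mulr_ge0// addr_ge0// ltW.
have -> : 2 * (Lam + 5) * (16 * (1 + 3 * k * Lam)) = 2 * w by rewrite /w; ring.
exact: (expsum_arith (ltW k0) w0 k80 sZ Qs QL1).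
Qed.

End ExponentialSum.

(** * Invariance under integral shears *)

Section Shear.
Variable R : realType.

Lemma curve_shear (k : R) f g F G (n : R) : curve k f g F G ->
  curve k (fun x => f x - n * x) (fun x => g x - n) (fun s => F (s + n)) (fun s => G (s + n)).
Proof.
case=> k1 hf hF gK GK leg; split => //.
- move=> x y; have := hf x y.
  by have -> : f y - n * y - (f x - n * x) - (g x - n) * (y - x) = f y - f x - g x * (y - x) by ring.
- move=> x y; have := hF (x + n) (y + n).
  by have -> : y + n - (x + n) = y - x by ring.
- by move=> x; rewrite subrK.
- by move=> x; rewrite GK addrK.
- by move=> x; rewrite subrK leg; ring.
Qed.

Lemma zseq_shift (a b : R) (c : int) :
  perm_eq (zseq (a + c%:~R) (b + c%:~R)) [seq z + c | z <- zseq a b].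
Proof.
apply: uniq_perm; first exact: zseq_uniq.
  by rewrite map_inj_uniq ?zseq_uniq//; exact: addIr.
move=> z; rewrite mem_zseq; apply/idP/mapP => [h|[w + ->]].
  by exists (z - c); rewrite ?subrK// mem_zseq intrB; move: h; lra.
by rewrite mem_zseq intrD; lra.
Qed.

(** Replacing f(x) by f(x) - n x changes the height q f(a/q) by the integer n a. *)
Lemma cossum_shear (f : R -> R) (n : int) (eta xi : R) (Q j : nat) :
  cossum [seq height (fun x => f x - n%:~R * x) p | p <- lattice_pts eta xi Q] j =
  cossum [seq height f p | p <- lattice_pts eta xi Q] j.
Proof.
rewrite !cossum_heights; apply: eq_big_nat => q /andP[q0 _]; apply: eq_bigr => a _.
have q0r : q%:R != 0 :> R by rewrite pnatr_eq0 -lt0n.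
rewrite -[LHS](cos_int_shift _ (Posz j * n * a)); congr cos.
by rewrite !intrM -pmulrn; field.
Qed.

(** Shearing by the integer part of g(eta) achieves the normalisation; on the dual side it
    translates the frequencies by j n. *)
Lemma expsum_bound (k : R) (f g F G : R -> R) (Q j : nat) (eta xi Lam : R) : curve k f g F G ->
  (1 < Q)%N -> (0 < j)%N -> (j <= Q)%N -> eta < xi -> xi <= eta + Lam ->
  `|cossum [seq height f p | p <- lattice_pts eta xi Q] j| <=
  expsum_const k Lam * (Num.sqrt (Q%:R / j%:R) *
     (\sum_(l <- zseq (j%:R * g (eta - 1)) (j%:R * g (xi + 1))) cutinv Q%:R (j%:R * F (l%:~R / j%:R)))
     + Q%:R * Num.sqrt (Q%:R / j%:R) + Q%:R * ln Q%:R).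
Proof.
move=> cv Q2 j0 jQ exi xiL; pose n := Num.floor (g eta).
have gn : `|g eta - n%:~R| <= 1.
  have := floor_le (g eta); have := floorD1_gt (g eta); rewrite intrD1 -/n => h1 h2.
  by rewrite ger0_norm; lra.
have := expsum_normalized (curve_shear n%:~R cv) Q2 j0 jQ exi xiL gn.
rewrite cossum_shear; congr (_ <= _ * (_ * _ + _ + _)).
have j0r : j%:R != 0 :> R by rewrite pnatr_eq0 -lt0n.
have e y : j%:R * g y = j%:R * (g y - n%:~R) + (Posz j * n)%:~R.
  by rewrite intrM -pmulrn; ring.
rewrite [in RHS]e [in RHS](e (xi + 1)) (perm_big _ (zseq_shift _ _ _)) big_map.
apply: eq_bigr => l _; congr (cutinv _ (_ * F _)).
by rewrite intrD intrM -pmulrn; field.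
Qed.

End Shear.

(** * Counting by fibres and by spacing *)

Section Counting.
Variable R : realType.

Lemma sum_fibers (T : eqType) (s : seq T) (c : T -> nat) (M : nat) (w : T -> R) :
  (forall p, p \in s -> (c p < M)%N) ->
  \sum_(p <- s) w p = \sum_(0 <= i < M) \sum_(p <- s | c p == i) w p.
Proof.
move=> cM; under [RHS]eq_bigr do rewrite big_mkcond /=.
rewrite exchange_big /=; rewrite [LHS]big_seq [RHS]big_seq; apply: eq_bigr => p /cM cp.
rewrite -big_mkcond /= big_mkord (bigD1 (Ordinal cp)) /=; last by rewrite eqxx.
by rewrite big1 ?addr0// => i /andP[/eqP e /eqP ne]; case: ne; apply: val_inj.
Qed.

Lemma sum1_sizeR (T : Type) (s : seq T) : \sum_(p <- s) 1 = (size s)%:R :> R.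
Proof. by rewrite big_const_seq count_predT iter_addr_0. Qed.

Lemma sum_undup (T U : eqType) (s : seq T) (h : T -> U) (w : T -> R) :
  \sum_(p <- s) w p = \sum_(v <- undup (map h s)) \sum_(p <- s | h p == v) w p.
Proof.
under [RHS]eq_bigr do rewrite big_mkcond /=.
rewrite exchange_big /=; rewrite [LHS]big_seq [RHS]big_seq; apply: eq_bigr => p ps.
have hp : h p \in undup (map h s) by rewrite mem_undup map_f.
rewrite (perm_big _ (perm_to_rem hp)) big_cons eqxx /= big_seq big1 ?addr0// => v.
rewrite (rem_filter _ (undup_uniq _)) mem_filter => /andP[/= + _].
by rewrite eq_sym => /negbTE ->.
Qed.

Lemma size_fibers2 (T : eqType) (s : seq T) (c : T -> nat) (M : nat) : uniq s ->
  (forall p, p \in s -> (c p < M)%N) ->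
  (forall p1 p2 p3, p1 \in s -> p2 \in s -> p3 \in s ->
     p1 != p2 -> p1 != p3 -> p2 != p3 -> c p1 = c p2 -> c p1 = c p3 -> False) ->
  (size s)%:R <= 2 * M%:R :> R.
Proof.
move=> us cM h3; rewrite -sum1_sizeR (sum_fibers _ cM).
apply: (@le_trans _ _ (\sum_(0 <= i < M) 2)); last first.
  by rewrite big_const_nat subn0 iter_addr_0 -[leLHS]mulr_natr.
apply: ler_sum => i _; rewrite -big_filter sum1_sizeR ler_nat.
have : uniq (seq.filter (fun p => c p == i) s) by rewrite filter_uniq.
have sub p : p \in seq.filter (fun p => c p == i) s -> c p = i /\ p \in s.
  by rewrite mem_filter => /andP[/eqP].
case: (seq.filter _ s) sub => [//|p1 [//|p2 [//|p3 r]]] sub.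
rewrite /= !in_cons !negb_or => /andP[/and3P[n12 n13 _] /andP[/andP[n23 _] _]].
have [c1 s1] := sub p1 (mem_head _ _).
have [c2 s2] : c p2 = i /\ p2 \in s by apply: sub; rewrite !in_cons eqxx orbT.
have [c3 s3] : c p3 = i /\ p3 \in s by apply: sub; rewrite !in_cons eqxx !orbT.
by case: (h3 p1 p2 p3) => //; rewrite c1.
Qed.

Lemma spaced_count (T : eqType) (s : seq T) (x : T -> R) (A B d : R) : uniq s ->
  0 < d -> A <= B -> (forall p, p \in s -> A <= x p <= B) ->
  (forall p p', p \in s -> p' \in s -> p != p' -> d <= `|x p - x p'|) ->
  (size s)%:R <= (B - A) / d + 1.
Proof.
move=> us d0 AB xAB sp.
pose c p := Num.truncn ((x p - A) / d).
have c1 p : p \in s -> (c p)%:R <= (x p - A) / d < (c p)%:R + 1.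
  by move=> /xAB /andP[h _]; rewrite natr1; apply: truncn_itv; rewrite divr_ge0 ?(ltW d0) ?subr_ge0.
pose M := (Num.truncn ((B - A) / d)).+1.
have cM p : p \in s -> (c p < M)%N.
  move=> /xAB /andP[_ h]; rewrite ltnS; apply: le_truncn.
  by rewrite ler_pM2r ?invr_gt0// lerD2r.
have uc : uniq (map c s).
  rewrite map_inj_in_uniq// => p p' ps ps' e; apply/eqP; apply: contraT => ne.
  have := sp _ _ ps ps' ne; have := c1 _ ps; have := c1 _ ps'; rewrite e.
  move: (c p')%:R => z; rewrite !ler_pdivlMr// !ltr_pdivrMr// => /andP[h1 h2] /andP[h3 h4].
  by rewrite ler_normr => /orP[]; lra.
have : (size (map c s) <= size (iota 0 M))%N.
  by apply: uniq_leq_size => // i /mapP[p ps ->]; rewrite mem_iota add0n /= cM.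
rewrite size_map size_iota -(ler_nat R) => /le_trans; apply.
by rewrite -natr1 lerD2r truncn_le// divr_ge0 ?(ltW d0) ?subr_ge0.
Qed.

End Counting.

(** * Rational points and rational lines as integer triples *)

Section Triples.

(** A triple (a, q, b) stands for the point (a/q, b/q) and also, dually, for the line y = (a/q) x -
    b/q. *)
Definition pt := (int * nat * int)%type.
(** The point u lies on the line v: b/q + b'/q' = (a/q)(a'/q') with denominators cleared. The
    relation is symmetric, which expresses the duality. *)
Definition incid (u v : pt) := (Posz u.1.2 * v.2 + u.2 * Posz v.1.2 == u.1.1 * v.1.1).
Definition prim (u : pt) := gcdz (Posz u.1.2) (gcdz u.1.1 u.2) == 1.
Definition cross (u v : pt) : int := Posz u.1.2 * v.1.1 - u.1.1 * Posz v.1.2.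

Lemma incidC u v : incid u v = incid v u.
Proof. by rewrite /incid; congr (_ == _); ring. Qed.

Definition det3 (u v w : pt) : int := cross u v * w.2 +
  (u.1.1 * v.2 - u.2 * v.1.1) * Posz w.1.2 + (u.2 * Posz v.1.2 - Posz u.1.2 * v.2) * w.1.1.

Lemma prim_dvdz (u : pt) (d X : int) : prim u ->
  (d %| Posz u.1.2 * X)%Z -> (d %| u.1.1 * X)%Z -> (d %| u.2 * X)%Z -> (d %| X)%Z.
Proof.
move=> /eqP pu h1 h2 h3.
have [a [b ab]] := Bezoutz u.1.1 u.2; have [a' [b' ab']] := Bezoutz (Posz u.1.2) (gcdz u.1.1 u.2).
rewrite pu -ab in ab'.
have -> : X = a' * (Posz u.1.2 * X) + b' * a * (u.1.1 * X) + b' * b * (u.2 * X).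
  by rewrite -[LHS]mul1r -ab'; ring.
by rewrite !rpredD// dvdz_mull.
Qed.

(** Multiplying [cross u v] by any coordinate of w gives a multiple of the denominator of w, and w
    is primitive. Hence points on a line of large denominator are widely spaced. *)
Lemma incid_cross (u v w : pt) : prim w -> incid u w -> incid v w ->
  (Posz w.1.2 %| cross u v)%Z.
Proof.
move=> pw /eqP uw /eqP vw; apply: (prim_dvdz pw); first exact: dvdz_mulr.
  have -> : w.1.1 * cross u v = Posz u.1.2 * (v.1.1 * w.1.1) - Posz v.1.2 * (u.1.1 * w.1.1).
    by rewrite /cross; ring.
  rewrite -uw -vw.
  have -> : Posz u.1.2 * (Posz v.1.2 * w.2 + v.2 * Posz w.1.2) -
     Posz v.1.2 * (Posz u.1.2 * w.2 + u.2 * Posz w.1.2) =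
     Posz w.1.2 * (Posz u.1.2 * v.2 - Posz v.1.2 * u.2) by ring.
  exact: dvdz_mulr.
have -> : w.2 * cross u v = v.1.1 * (Posz u.1.2 * w.2) - u.1.1 * (Posz v.1.2 * w.2).
  by rewrite /cross; ring.
have -> : Posz u.1.2 * w.2 = u.1.1 * w.1.1 - u.2 * Posz w.1.2 by rewrite -uw addrK.
have -> : Posz v.1.2 * w.2 = v.1.1 * w.1.1 - v.2 * Posz w.1.2 by rewrite -vw addrK.
have -> : v.1.1 * (u.1.1 * w.1.1 - u.2 * Posz w.1.2) - u.1.1 * (v.1.1 * w.1.1 - v.2 * Posz w.1.2) =
  Posz w.1.2 * (u.1.1 * v.2 - v.1.1 * u.2) by ring.
exact: dvdz_mulr.
Qed.

(** The line through two points is given by their vector product, divided by its content and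
    oriented so that the denominator is positive. *)
Lemma plane_ex (u v : pt) : cross u v != 0 ->
  exists w : pt, [/\ prim w, (0 < w.1.2)%N, incid u w & incid v w].
Proof.
wlog c0 : u v / 0 < cross u v.
  move=> wl; rewrite neq_lt => /orP[c0|c0]; last by apply: wl; rewrite ?gt_eqF.
  have e : cross v u = - cross u v by rewrite /cross; ring.
  have [||w [pw w0 vw uw]] := wl v u; first by rewrite e oppr_gt0.
    by rewrite e oppr_eq0 lt_eqF.
  by exists w.
move=> _; pose j := cross u v; pose k := Posz u.1.2 * v.2 - u.2 * Posz v.1.2.
pose m := u.1.1 * v.2 - u.2 * v.1.1; pose D := gcdz j (gcdz k m).
have D0 : 0 < D by rewrite lt_neqAle /= andbT eq_sym gcdz_eq0 negb_and gt_eqF.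
have jD : (D %| j)%Z by exact: dvdz_gcdl.
have kD : (D %| k)%Z by apply: dvdz_trans (dvdz_gcdr _ _) (dvdz_gcdl _ _).
have mD : (D %| m)%Z by apply: dvdz_trans (dvdz_gcdr _ _) (dvdz_gcdr _ _).
have j'0 : 0 < (j %/ D)%Z.
  by rewrite -(pmulr_lgt0 _ D0) divzK.
have jE : Posz `|(j %/ D)%Z|%N = (j %/ D)%Z by rewrite gez0_abs// ltW.
exists ((k %/ D)%Z, `|(j %/ D)%Z|%N, (m %/ D)%Z); split => /=.
- apply/eqP; apply: (mulIf (lt0r_neq0 D0)); rewrite /= jE mul1r.
  have DE x y : gcdz x y * D = gcdz (x * D) (y * D) by rewrite -mulz_gcdl gez0_abs// ltW.
  by rewrite !DE !divzK.
- by rewrite -ltz_nat jE.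
- rewrite /incid /= jE; apply/eqP; apply: (mulIf (lt0r_neq0 D0)).
  by rewrite mulrDl -!mulrA !divzK// /j /k /m /cross; ring.
- rewrite /incid /= jE; apply/eqP; apply: (mulIf (lt0r_neq0 D0)).
  by rewrite mulrDl -!mulrA !divzK// /j /k /m /cross; ring.
Qed.

Lemma det3_incid (u v w z : pt) : (0 < z.1.2)%N -> cross u v != 0 -> det3 u v w = 0 ->
  incid u z -> incid v z -> incid w z.
Proof.
move=> z0 c0 d0 /eqP uz /eqP vz; apply/eqP; apply: (mulfI c0).
rewrite mulrDr; apply/eqP; rewrite -subr_eq0; apply/eqP.
have -> : cross u v * (Posz w.1.2 * z.2) = (v.1.1 * (Posz u.1.2 * z.2) - u.1.1 * (Posz v.1.2 * z.2)) * Posz w.1.2.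
  by rewrite /cross; ring.
have -> : cross u v * (w.1.1 * z.1.1) = (Posz u.1.2 * (v.1.1 * z.1.1) - Posz v.1.2 * (u.1.1 * z.1.1)) * w.1.1.
  by rewrite /cross; ring.
have -> : Posz u.1.2 * z.2 = u.1.1 * z.1.1 - u.2 * Posz z.1.2 by rewrite -uz addrK.
have -> : Posz v.1.2 * z.2 = v.1.1 * z.1.1 - v.2 * Posz z.1.2 by rewrite -vz addrK.
have -> : v.1.1 * (u.1.1 * z.1.1 - u.2 * Posz z.1.2) - u.1.1 * (v.1.1 * z.1.1 - v.2 * Posz z.1.2) =
  (u.1.1 * v.2 - v.1.1 * u.2) * Posz z.1.2 by ring.
rewrite -uz -vz.
have -> : 0 = det3 u v w * Posz z.1.2 by rewrite d0 mul0r.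
by rewrite /det3 /cross; ring.
Qed.

Lemma prim_eq (u v : pt) : prim u -> prim v -> (0 < u.1.2)%N -> (0 < v.1.2)%N ->
  cross u v = 0 -> u.2 * Posz v.1.2 = v.2 * Posz u.1.2 -> u = v.
Proof.
have dv (x y : pt) : prim x -> cross x y = 0 -> x.2 * Posz y.1.2 = y.2 * Posz x.1.2 ->
    (x.1.2 %| y.1.2)%N.
  move=> px c e; suff : (Posz x.1.2 %| Posz y.1.2)%Z by [].
  apply: (prim_dvdz px); first exact: dvdz_mulr.
    have -> : x.1.1 * Posz y.1.2 = Posz x.1.2 * y.1.1 - cross x y by rewrite /cross; ring.
    by rewrite c subr0 dvdz_mulr.
  by rewrite e dvdz_mull.
move=> pu pv u0 v0 c e.
have c' : cross v u = 0 by rewrite -[RHS]oppr0 -c /cross; ring.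
have den : u.1.2 = v.1.2.
  by apply/eqP; rewrite eqn_dvd dv// dv.
case: u v {pu pv c'} u0 v0 c e den => [[a q] b] [[a' q'] b'] /= u0 v0 c e den; subst q'.
have q0 : Posz q != 0 by rewrite eqz_nat -lt0n.
have -> : b = b' by apply: (mulIf q0).
congr (_, _, _); apply: (mulfI q0); apply/eqP; rewrite eq_sym -subr_eq0; apply/eqP.
by rewrite -c /cross /=; ring.
Qed.

End Triples.

(** * Rational points very close to a curve *)

Section GoodPoints.
Variable R : realType.

Definition absc (p : pt) : R := p.1.1%:~R / p.1.2%:R.

Definition good (f : R -> R) (x0 : R) (n : nat) (d : R) (p : pt) : Prop :=
  [/\ (2 ^ n < 2 * p.1.2)%N, (p.1.2 <= 2 ^ n)%N, x0 <= absc p <= x0 + 1,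
      `|p.2%:~R - p.1.2%:R * f (absc p)| <= d & prim p].

Lemma absc_diff (p p' : pt) : (0 < p.1.2)%N -> (0 < p'.1.2)%N ->
  absc p' - absc p = (cross p p')%:~R / (p.1.2%:R * p'.1.2%:R).
Proof.
move=> q0 q0'; rewrite /cross intrB !intrM -!pmulrn /absc.
by field; rewrite !pnatr_eq0 -!lt0n q0 q0'.
Qed.

Variables (k : R) (f g F G : R -> R) (x0 d : R) (n : nat).
Hypothesis cv : curve k f g F G.
Let Q : R := 2 ^+ n.
Hypothesis dQ : 64 * k ^+ 3 * (d * Q) <= 1.

Let k1 : 1 <= k. Proof. exact: curve_k1 cv. Qed.
Let k0 : 0 < k. Proof. exact: curve_k_gt0 cv. Qed.
Let Q1 : 1 <= Q. Proof. by rewrite exprn_ege1// ler1n. Qed.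
Let Q0 : 0 < Q. Proof. exact: lt_le_trans Q1. Qed.
Let good := good f x0 n d.
Let E := 2 * d / Q.

Lemma good_den p : good p -> [/\ (0 < p.1.2)%N, Q < 2 * p.1.2%:R & p.1.2%:R <= Q].
Proof.
case=> h1 h2 _ _ _; split; first by lia.
  by rewrite /Q -natrX -natrM ltr_nat.
by rewrite /Q -natrX ler_nat.
Qed.

Lemma good_d0 p : good p -> 0 <= d.
Proof. by case=> _ _ _ h _; apply: le_trans h. Qed.

Let dQk p : good p -> 64 * (d * Q) <= 1 /\ 64 * (k * (d * Q)) <= 1.
Proof.
move=> /good_d0 d0; have z0 : 0 <= d * Q by rewrite mulr_ge0 ?(ltW Q0).
have k2 : 1 <= k ^+ 2 by rewrite exprn_ege1.
have kk : k <= k ^+ 3 by rewrite exprS ler_peMr// ltW.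
have k3 : 1 <= k ^+ 3 by rewrite exprn_ege1.
have h1 : d * Q <= k ^+ 3 * (d * Q) by rewrite ler_peMl.
have h2 : k * (d * Q) <= k ^+ 3 * (d * Q) by rewrite ler_wpM2r.
by move: dQ; rewrite -mulrA; split; lra.
Qed.

Lemma good_err p : good p -> `|p.2%:~R / p.1.2%:R - f (absc p)| <= E.
Proof.
move=> gp; have [q0 q1 q2] := good_den gp; have d0 := good_d0 gp.
have q0r : 0 < p.1.2%:R :> R by rewrite ltr0n.
case: gp => _ _ _ h _.
have -> : p.2%:~R / p.1.2%:R - f (absc p) = (p.2%:~R - p.1.2%:R * f (absc p)) / p.1.2%:R.
  by field; rewrite gt_eqF.
rewrite normrM normfV (gtr0_norm q0r) ler_pdivrMr//; apply: (le_trans h).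
rewrite /E mulrAC ler_pdivlMr//.
have -> : 2 * d * p.1.2%:R = d * (2 * p.1.2%:R) by ring.
by rewrite ler_wpM2l// ltW.
Qed.

(** Two primitive points with a common abscissa would have ordinates differing by at least 1/(q q'),
    whereas both are within d of the curve after multiplication by q, and d Q is small. *)
Lemma good_cross p p' : good p -> good p' -> p != p' -> cross p p' != 0.
Proof.
move=> gp gp' ne; apply/eqP => c0; move/eqP: ne; apply.
have [q0 _ q2] := good_den gp; have [q0' _ q2'] := good_den gp'; have d0 := good_d0 gp.
have xx : absc p' = absc p by apply/eqP; rewrite -subr_eq0 absc_diff// c0 mul0r.
have [_ _ _ h pp] := gp; have [_ _ _ h' pp'] := gp'.
apply: (prim_eq pp pp' q0 q0' c0); apply/eqP; apply: contraT => /(int_leq1_dist R).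
rewrite !intrM -!pmulrn; rewrite xx in h'.
have -> : p.2%:~R * p'.1.2%:R - p'.2%:~R * p.1.2%:R =
  p'.1.2%:R * (p.2%:~R - p.1.2%:R * f (absc p)) - p.1.2%:R * (p'.2%:~R - p'.1.2%:R * f (absc p)) :> R.
  ring.
have [dQ1 _] := dQk gp.
have b1 : `|p'.1.2%:R * (p.2%:~R - p.1.2%:R * f (absc p))| <= Q * d by rewrite normrM normr_nat ler_pM.
have b2 : `|p.1.2%:R * (p'.2%:~R - p'.1.2%:R * f (absc p))| <= Q * d by rewrite normrM normr_nat ler_pM.
move=> /le_trans /(_ (ler_normB _ _)); move: b1 b2 dQ1.
by rewrite [d * Q]mulrC; move: (`|_|) (`|_|) (Q * d) => z1 z2 z3; lra.
Qed.

Lemma good_sep p p' (j : nat) : good p -> good p' -> p != p' -> (0 < j)%N ->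
  (Posz j %| cross p p')%Z -> j%:R / Q ^+ 2 <= `|absc p - absc p'|.
Proof.
move=> gp gp' ne j0 jc; have c0 := good_cross gp gp' ne.
have [q0 _ q2] := good_den gp; have [q0' _ q2'] := good_den gp'.
rewrite distrC absc_diff// normrM normfV normrM !normr_nat.
have jle : j%:R <= `|(cross p p')%:~R| :> R.
  rewrite -intr_norm -[j%:R]/(Posz j)%:~R ler_int.
  by rewrite -abszE lez_nat; apply: dvdn_leq => //; rewrite absz_gt0.
have q0r : 0 < p.1.2%:R :> R by rewrite ltr0n.
have q0r' : 0 < p'.1.2%:R :> R by rewrite ltr0n.
apply: ler_pM => //; first by rewrite invr_ge0 sqr_ge0.
by rewrite lef_pV2 ?posrE ?mulr_gt0 ?exprn_gt0// expr2 ler_pM// ltW.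
Qed.

(** The determinant is an integer. On an arc of length of order 1/(k Q), curvature and the errors of
    the ordinates keep it below 1 in absolute value. *)
Lemma good_det p1 p2 p3 (l := (4 * k * Q)^-1) : good p1 -> good p2 -> good p3 ->
  `|absc p2 - absc p1| <= l -> `|absc p3 - absc p1| <= l -> det3 p1 p2 p3 = 0.
Proof.
move=> g1 g2 g3; set d2 := absc p2 - absc p1; set d3 := absc p3 - absc p1 => h2 h3.
have [q1 _ q1Q] := good_den g1; have [q2 _ q2Q] := good_den g2; have [q3 _ q3Q] := good_den g3.
have e1 := good_err g1; have e2 := good_err g2; have e3 := good_err g3.
have d0 := good_d0 g1; have [dQ1 _] := dQk g1.
have l0 : 0 < l by rewrite invr_gt0 !mulr_gt0.
pose y (p : pt) : R := p.2%:~R / p.1.2%:R; pose er p := y p - f (absc p).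
pose r p := f (absc p) - f (absc p1) - g (absc p1) * (absc p - absc p1).
have dE : (det3 p1 p2 p3)%:~R = p1.1.2%:R * p2.1.2%:R * p3.1.2%:R *
   (d2 * (y p3 - y p1) - d3 * (y p2 - y p1)).
  rewrite /det3 /cross /d2 /d3 /y /absc !(intrD, intrB, intrM) -!pmulrn.
  by field; rewrite !pnatr_eq0 -!lt0n q1 q2 q3.
have rl p : `|absc p - absc p1| <= l -> `|r p| <= k * l ^+ 2.
  move=> h; have /andP[r1 r2] := curve_f cv (absc p1) (absc p); rewrite -/(r p) in r1 r2.
  rewrite ger0_norm; last by apply: le_trans r1; rewrite divr_ge0 ?sqr_ge0// ltW.
  by apply: (le_trans r2); rewrite ler_pM2l// -real_normK ?num_real// ler_pXn2r ?nnegrE// ltW.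
have E0 : 0 <= E by rewrite divr_ge0 ?mulr_ge0 ?(ltW Q0).
have val : `|d2 * (y p3 - y p1) - d3 * (y p2 - y p1)| <= 2 * (l * (k * l ^+ 2 + 2 * E)).
  have -> : d2 * (y p3 - y p1) - d3 * (y p2 - y p1) =
     d2 * (r p3 + (er p3 - er p1)) - d3 * (r p2 + (er p2 - er p1)).
    by rewrite /r /er -/d2 -/d3; ring.
  have b p : `|absc p - absc p1| <= l -> `|er p| <= E -> `|r p + (er p - er p1)| <= k * l ^+ 2 + 2 * E.
    move=> hp ep; apply: (le_trans (ler_normD _ _)); apply: lerD; first exact: rl.
    by apply: (le_trans (ler_normB _ _)); rewrite mulr_natl mulr2n lerD.
  apply: (le_trans (ler_normB _ _)); rewrite !normrM mulr_natl mulr2n.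
  by apply: lerD; apply: ler_pM => //; apply: b.
have Q3 : Q ^+ 3 * (2 * (l * (k * l ^+ 2 + 2 * E))) = (32 * k ^+ 2)^-1 + 2 * (d * Q) / k.
  by rewrite /l /E; field; rewrite !gt_eqF.
have lt1 : `|(det3 p1 p2 p3)%:~R| < 1 :> R.
  rewrite dE normrM; apply: (@le_lt_trans _ _ (Q ^+ 3 * (2 * (l * (k * l ^+ 2 + 2 * E))))).
    apply: ler_pM => //; rewrite !normrM !normr_nat -natrM -natrM.
    rewrite !natrM [Q ^+ 3]exprSr expr2.
    by apply: ler_pM; rewrite ?mulr_ge0//; apply: ler_pM.
  rewrite Q3.
  have k2 : (32 * k ^+ 2)^-1 <= 32^-1.
    by rewrite lef_pV2 ?posrE ?mulr_gt0 ?exprn_gt0// ler_peMr// exprn_ege1.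
  have dk : 2 * (d * Q) / k <= 2 * (d * Q).
    by rewrite ler_pdivrMr// ler_peMr// !mulr_ge0 ?(ltW Q0).
  by move: k2 dk dQ1; move: ((32 * k ^+ 2)^-1) (2 * (d * Q) / k) (d * Q) => a b c; lra.
apply/eqP; apply: contraT => /(int_leq1_dist R); rewrite subr0 => h.
by move: (le_lt_trans h lt1); rewrite ltxx.
Qed.

Section Plane.
Variable w : pt.
Hypotheses (pw : prim w) (w0 : (0 < w.1.2)%N).
Let t := G (absc w).
Let j : R := w.1.2%:R.
Let U x := f x - absc w * x.

Let j0 : 0 < j. Proof. by rewrite ltr0n. Qed.
Let gt : g t = absc w. Proof. exact: curve_GK cv _. Qed.

Lemma plane_val p : good p -> incid p w -> U (absc p) = f (absc p) - p.2%:~R / p.1.2%:R - w.2%:~R / j.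
Proof.
move=> /good_den[q0 _ _] /eqP /(congr1 (fun z : int => z%:~R : R)).
rewrite intrD !intrM -!pmulrn -/j => e.
have q0r : p.1.2%:R != 0 :> R by rewrite pnatr_eq0 -lt0n.
have j0' : j != 0 by rewrite gt_eqF.
rewrite /U -addrA; congr (_ + _); apply: (mulIf (mulf_neq0 q0r j0')).
have -> : - (absc w * absc p) * (p.1.2%:R * j) = - (p.1.1%:~R * w.1.1%:~R).
  by rewrite /absc -/j; field; rewrite ?q0r ?j0'.
by rewrite -e; field; apply/andP.
Qed.

(** Going from x to x' away from the minimum t of U, the quadratic remainder and the slope at x both
    contribute with the same sign. *)
Lemma plane_taylor x x' : 0 <= (x - t) * (x' - x) ->
  (x' - x) ^+ 2 / k + 2 / k * ((x - t) * (x' - x)) <= U x' - U x.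
Proof.
move=> h; have /andP[f1 _] := curve_f cv x x'.
have ik : 0 < 2 / k by rewrite divr_gt0.
suff : 2 / k * ((x - t) * (x' - x)) <= (g x - absc w) * (x' - x).
  by move: f1; rewrite /U; lra.
rewrite mulrA; case: (ltgtP x t) h => [xt|tx|->]; last by rewrite -gt !subrr !mulr0 !mul0r.
- rewrite nmulr_rge0 ?subr_lt0// => h.
  have /andP[g1 _] := curve_g_incr cv (ltW xt); rewrite gt in g1.
  by rewrite -[leLHS]mulrNN -[leRHS]mulrNN ler_wpM2r ?oppr_ge0//; lra.
- rewrite pmulr_rge0 ?subr_gt0// => h.
  have /andP[g1 _] := curve_g_incr cv (ltW tx); rewrite gt in g1.
  by rewrite ler_wpM2r.
Qed.

Lemma plane_min x : 0 <= U x - U t <= k * (x - t) ^+ 2.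
Proof.
have /andP[f1 f2] := curve_f cv t x; rewrite gt in f1 f2.
have -> : U x - U t = f x - f t - absc w * (x - t) by rewrite /U; ring.
by rewrite f2 andbT; apply: le_trans f1; rewrite divr_ge0 ?sqr_ge0// ltW.
Qed.

(** Along the line, U = f minus its slope term equals -w.2/j up to E, so U takes nearly the same
    value at x and x'. By [plane_taylor] this makes x and x' close to each other, while divisibility
    keeps them j/Q^2 apart; this bounds j. The product of |x - t| with the gap is small too, so x is
    near t and w.2/j is near -U(t) = F(absc w): the line is a rational point near the dual curve,
    with an error quadratic in d Q. *)
Lemma plane_near p p' : good p -> good p' -> p != p' -> incid p w -> incid p' w ->
  0 <= (absc p - t) * (absc p' - absc p) ->
  [/\ (absc p - absc p') ^+ 2 <= 4 * k * d / Q, j / Q ^+ 2 <= `|absc p - absc p'|,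
    j ^+ 2 <= 4 * k * d * Q ^+ 3, x0 - 1 <= t <= x0 + 2 &
    `|w.2%:~R - j * F (absc w)| <= 12 * k ^+ 3 * (d * Q) ^+ 2 / j].
Proof.
move=> gp gp' ne pw1 pw2 h.
have d0 := good_d0 gp; have [_ dQ2] := dQk gp.
set x := absc p in h *; set x' := absc p' in h *.
have sep : j / Q ^+ 2 <= `|x - x'| by apply: good_sep => //; exact: incid_cross pw pw1 pw2.
have U1 := plane_val gp pw1; have U2 := plane_val gp' pw2.
have e1 := good_err gp; have e2 := good_err gp'; rewrite -/x -/x' in U1 U2 e1 e2.
have UU : U x' - U x <= 2 * E.
  rewrite U1 U2; move: e1 e2; rewrite !ler_norml.
  by move: (f x) (f x') (_ / p.1.2%:R) (_ / p'.1.2%:R) (w.2%:~R / j) => z1 z2 z3 z4 z5; lra.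
have ta := plane_taylor h.
have sq0 : 0 <= (x' - x) ^+ 2 / k by rewrite divr_ge0 ?sqr_ge0 ?(ltW k0).
have hk : 0 <= 2 / k * ((x - t) * (x' - x)) by rewrite mulr_ge0 ?divr_ge0 ?(ltW k0).
have w1 : (x - x') ^+ 2 <= 4 * k * d / Q.
  have : (x' - x) ^+ 2 / k <= 2 * E by move: UU ta hk; lra.
  rewrite ler_pdivrMr//.
  have -> : (x' - x) ^+ 2 = (x - x') ^+ 2 by ring.
  by congr (_ <= _); rewrite /E; ring.
have w2 : `|x - t| * `|x - x'| <= 2 * k * d / Q.
  have : 2 / k * ((x - t) * (x' - x)) <= 2 * E by move: UU ta sq0; lra.
  rewrite -(distrC x') -normrM ger0_norm// mulrAC ler_pdivrMr//.
  have -> : 2 * k * d / Q = k * E by rewrite /E; ring.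
  by rewrite -mulrA ler_pM2l// [E * k]mulrC.
have jQ0 : 0 < j / Q ^+ 2 by rewrite divr_gt0 ?exprn_gt0.
have j2 : j ^+ 2 <= 4 * k * d * Q ^+ 3.
  have : (j / Q ^+ 2) ^+ 2 <= 4 * k * d / Q.
    by apply: le_trans w1; rewrite -(real_normK (num_real (x - x'))) ler_pXn2r ?nnegrE ?(ltW jQ0).
  have -> : (j / Q ^+ 2) ^+ 2 = j ^+ 2 / Q ^+ 4 by field; rewrite gt_eqF.
  rewrite ler_pdivrMr ?exprn_gt0// => /le_trans; apply.
  by rewrite le_eqVlt; apply/orP; left; apply/eqP; field; rewrite gt_eqF.
have xt : `|x - t| <= 2 * k * d * Q / j.
  rewrite ler_pdivlMr//.
  have : `|x - t| * (j / Q ^+ 2) <= 2 * k * d / Q by apply: le_trans w2; rewrite ler_wpM2l.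
  rewrite mulrA ler_pdivrMr ?exprn_gt0// => /le_trans; apply.
  by rewrite le_eqVlt; apply/orP; left; apply/eqP; field; rewrite gt_eqF.
have j1 : 1 <= j by rewrite ler1n.
have xt1 : `|x - t| <= 1.
  apply: (le_trans xt); rewrite ler_pdivrMr// mul1r; apply: le_trans j1.
  by move: dQ2; rewrite -!mulrA; move: (k * (d * Q)) => z; lra.
split => //.
  case: gp => _ _ /andP[xa xb] _ _; rewrite -/x in xa xb.
  by move: xt1; rewrite ler_norml => /andP[t1 t2]; apply/andP; split; lra.
have FE : F (absc w) = t * absc w - f t by rewrite -gt (curve_legendre cv).
have -> : w.2%:~R - j * F (absc w) = j * (w.2%:~R / j + U t).
  by rewrite FE /U; field; rewrite gt_eqF.
have /andP[m1 m2] := plane_min x.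
have b : `|w.2%:~R / j + U t| <= E + k * (x - t) ^+ 2.
  move: e1 m1 m2; rewrite U1 !ler_norml; move: (k * _) (w.2%:~R / j) (f x) (_ / p.1.2%:R) (U t) => z1 z2 z3 z4 z5.
  by lra.
rewrite normrM (gtr0_norm j0).
have xt2 : (x - t) ^+ 2 <= (2 * k * d * Q / j) ^+ 2.
  have c0 : 0 <= 2 * k * d * Q / j by apply: le_trans xt.
  by rewrite -(real_normK (num_real (x - t))) ler_pXn2r ?nnegrE.
apply: (@le_trans _ _ (j * (E + k * (2 * k * d * Q / j) ^+ 2))).
  by rewrite ler_pM2l//; apply: (le_trans b); rewrite lerD2l ler_pM2l.
have jE : j * E <= 8 * k * (d * Q) ^+ 2 / j.
  rewrite ler_pdivlMr// /E.
  have -> : j * (2 * d / Q) * j = 2 * d / Q * j ^+ 2 by ring.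
  have -> : 8 * k * (d * Q) ^+ 2 = 2 * d / Q * (4 * k * d * Q ^+ 3) by field; rewrite gt_eqF.
  by rewrite ler_wpM2l// divr_ge0 ?mulr_ge0 ?(ltW Q0).
have k3 : k <= k ^+ 3 by rewrite exprS ler_peMr ?(ltW k0)// exprn_ege1.
have k8 : 8 * k * (d * Q) ^+ 2 / j <= 8 * k ^+ 3 * (d * Q) ^+ 2 / j.
  by rewrite ler_pM2r ?invr_gt0// ler_wpM2r ?sqr_ge0// ler_pM2l.
have -> : j * (E + k * (2 * k * d * Q / j) ^+ 2) = j * E + 4 * k ^+ 3 * (d * Q) ^+ 2 / j.
  by field; rewrite gt_eqF.
have -> : 12 * k ^+ 3 * (d * Q) ^+ 2 / j = 8 * k ^+ 3 * (d * Q) ^+ 2 / j + 4 * k ^+ 3 * (d * Q) ^+ 2 / j by ring.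
by rewrite lerD2r; apply: le_trans k8.
Qed.

Lemma plane_pair p p' : good p -> good p' -> p != p' -> incid p w -> incid p' w ->
  (t <= absc p) = (t <= absc p') ->
  [/\ (absc p - absc p') ^+ 2 <= 4 * k * d / Q, j / Q ^+ 2 <= `|absc p - absc p'|,
    j ^+ 2 <= 4 * k * d * Q ^+ 3, x0 - 1 <= t <= x0 + 2 &
    `|w.2%:~R - j * F (absc w)| <= 12 * k ^+ 3 * (d * Q) ^+ 2 / j].
Proof.
move=> gp gp' ne pw1 pw2 side.
have [h|h] := leP 0 ((absc p - t) * (absc p' - absc p)); first exact: plane_near.
have h' : 0 <= (absc p' - t) * (absc p - absc p').
  have [a|a] := leP t (absc p).
    have b : t <= absc p' by rewrite -side.
    apply: mulr_ge0; first by rewrite subr_ge0.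
    rewrite leNgt; apply/negP => c; move: h; rewrite ltNge mulr_ge0 ?subr_ge0//.
    by rewrite subr_lt0 in c; rewrite ltW.
  have b : absc p' < t by rewrite ltNge -side -ltNge.
  apply: mulr_le0; first by rewrite subr_le0 ltW.
  rewrite leNgt; apply/negP => c; move: h; rewrite ltNge mulr_le0 ?subr_le0 ?(ltW a)//.
  by rewrite subr_gt0 in c; rewrite ltW.
have ne' : p' != p by rewrite eq_sym.
have [a b c e r] := plane_near gp' gp ne' pw2 pw1 h'; split => //.
  by have -> : (absc p - absc p') ^+ 2 = (absc p' - absc p) ^+ 2 by ring.
by rewrite distrC.
Qed.

End Plane.
End GoodPoints.

(** * The inductive step: from a curve to its dual *)

Section Induction.
Variable R : realType.

(** Uniform over all curves of constant k, so that it can be applied to the dual. The saving sg^(2n)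
    in the smallness of d later provides a factor sg^n against the number n of dyadic scales. *)
Definition prim_count (k sg K : R) (n : nat) := forall (f g F G : R -> R) (x0 d : R) (s : seq pt),
  curve k f g F G -> 64 * k ^+ 3 * (d * 2 ^+ n) <= sg ^+ (2 * n) -> uniq s ->
  (forall p, p \in s -> good f x0 n d p) -> (size s)%:R <= K * 2 ^+ n.

Lemma up_log2_dyadic j : (0 < j)%N -> (2 ^ up_log 2 j < 2 * j)%N /\ (j <= 2 ^ up_log 2 j)%N.
Proof.
move=> j0; split; last exact: up_logP.
case: j j0 => [//|[|j]] _; first by rewrite up_log1.
have h := @up_log_gtn 2 j.+2 isT isT.
have u0 : (0 < up_log 2 j.+2)%N by rewrite up_log_gt0.
by rewrite -(prednK u0) expnS ltn_mul2l.
Qed.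

Variables (k sg : R) (f g F G : R -> R) (x0 d : R) (n : nat) (s : seq pt).
Hypotheses (cv : curve k f g F G) (sg0 : 0 < sg) (sg1 : sg <= 1).
Hypothesis dn : 64 * k ^+ 3 * (d * 2 ^+ n) <= sg ^+ (2 * n).
Hypotheses (us : uniq s) (gs : forall p, p \in s -> good f x0 n d p).

Let Q : R := 2 ^+ n.
Let k1 : 1 <= k. Proof. exact: curve_k1 cv. Qed.
Let k0 : 0 < k. Proof. exact: curve_k_gt0 cv. Qed.
Let Q1 : 1 <= Q. Proof. by rewrite exprn_ege1// ler1n. Qed.
Let Q0 : 0 < Q. Proof. exact: lt_le_trans Q1. Qed.
Let dQ : 64 * k ^+ 3 * (d * Q) <= 1.
Proof. by apply: le_trans dn _; rewrite exprn_ile1// ltW. Qed.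

Let critp (w : pt) : R := G (absc R w).
Definition partner (p p' w : pt) := [/\ p' \in s, p != p', prim w & (0 < w.1.2)%N] /\
  [/\ incid p w, incid p' w & (critp w <= absc R p) = (critp w <= absc R p')].
Definition paired (p : pt) := `[< exists p' w, partner p p' w >].

(** Three good points in a cell of length 1/(4 k Q) are collinear by [good_det], and two of them lie
    on the same side of the tangency abscissa, hence are partners. So each of the roughly 4 k Q
    cells holds at most two unpaired points. *)
Lemma unpaired_count : (size [seq p <- s | ~~ paired p])%:R <= 10 * k * Q.
Proof.
pose c (p : pt) := Num.truncn ((absc R p - x0) * (4 * k * Q)).
have kQ : 0 < 4 * k * Q by rewrite !mulr_gt0.
pose M := (Num.truncn (4 * k * Q)).+1.
have cb p : good f x0 n d p -> (c p)%:R <= (absc R p - x0) * (4 * k * Q) < (c p)%:R + 1.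
  by case=> _ _ /andP[h _] _ _; rewrite natr1; apply: truncn_itv; rewrite mulr_ge0 ?(ltW kQ)// subr_ge0.
have cell p p' : good f x0 n d p -> good f x0 n d p' -> c p = c p' -> `|absc R p' - absc R p| <= (4 * k * Q)^-1.
  move=> /cb h /cb h' e; rewrite -e in h'.
  rewrite -[_^-1]mul1r ler_pdivlMr// -{1}(gtr0_norm kQ) -normrM.
  have -> : (absc R p' - absc R p) * (4 * k * Q) = (absc R p' - x0) * (4 * k * Q) - (absc R p - x0) * (4 * k * Q) by ring.
  move: h h'; move: (_ * (4 * k * Q)) (_ * (4 * k * Q)) => z1 z2 h h'.
  by rewrite ler_norml; lra.
apply: (@le_trans _ _ (2 * M%:R)); last first.
  have : (Num.truncn (4 * k * Q))%:R <= 4 * k * Q by rewrite truncn_le ltW.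
  have : 1 <= k * Q by apply: mulr_ege1.
  have -> : M%:R = (Num.truncn (4 * k * Q))%:R + 1 :> R by rewrite natr1.
  move: ((Num.truncn _)%:R : R) => z2; rewrite -!mulrA; move: (k * Q) => z1; lra.
apply: (@size_fibers2 _ _ _ c); first by rewrite filter_uniq.
  move=> p; rewrite mem_filter => /andP[_ /gs[_ _ /andP[h1 h2] _ _]].
  by rewrite ltnS le_truncn// ler_piMl ?(ltW kQ)//; lra.
move=> p1 p2 p3; rewrite !mem_filter => /andP[u1 s1] /andP[u2 s2] /andP[u3 s3] n12 n13 n23 c12 c13.
have [g1 g2 g3] := And3 (gs s1) (gs s2) (gs s3).
have x12 := good_cross cv dQ g1 g2 n12.
have [w [pw w0 i1 i2]] := plane_ex x12.
have det0 := good_det cv dQ g1 g2 g3 (cell _ _ g1 g2 c12) (cell _ _ g1 g3 c13).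
have i3 := det3_incid w0 x12 det0 i1 i2.
have [side12|ns12] := eqVneq (critp w <= absc R p1) (critp w <= absc R p2).
  by move/negP: u1; apply; apply/asboolP; exists p2, w; split.
have [side13|ns13] := eqVneq (critp w <= absc R p1) (critp w <= absc R p3).
  by move/negP: u1; apply; apply/asboolP; exists p3, w; split.
move/negP: u2; apply; apply/asboolP; exists p3, w; split; split => //.
by move: ns12 ns13; do 3!case: (_ <= _).
Qed.

Let S := [seq p <- s | paired p].

Variable nu : pt -> pt.
Hypothesis nuP : forall p, p \in S -> exists p', partner p p' (nu p).

Let nu_facts p : p \in S -> let w := nu p in let j : R := w.1.2%:R in
  [/\ prim w, (0 < w.1.2)%N, incid p w & good f x0 n d p] /\
  [/\ j ^+ 2 <= 4 * k * d * Q ^+ 3, x0 - 1 <= critp w <= x0 + 2 &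
    `|w.2%:~R - j * F (absc R w)| <= 12 * k ^+ 3 * (d * Q) ^+ 2 / j].
Proof.
move=> /[dup] pS /nuP[p' [[p's ne pw w0] [i1 i2 sd]]].
have gp : good f x0 n d p by apply: gs; move: pS; rewrite mem_filter => /andP[].
have [_ _ h1 h2 h3] := plane_pair cv dQ pw w0 gp (gs p's) ne i1 i2 sd.
by split; split.
Qed.

(** Points on one side of the line v lie within W = sqrt(4 k d / Q) of each other and are j/Q^2
    apart, where j is the denominator of v. *)
Lemma side_count (v : pt) (b : bool) :
  (size [seq p <- S | (nu p == v) && ((critp v <= absc R p) == b)])%:R <= 3 / 4 * (sg ^+ n * Q) / v.1.2%:R.
Proof.
set L := [seq p <- S | _].
have LP p : p \in L -> [/\ p \in S, nu p = v & (critp v <= absc R p) = b].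
  by rewrite mem_filter => /andP[/andP[/eqP-> /eqP->] ->].
case EL : L => [|p0 L'].
  by rewrite mulr0n divr_ge0// mulr_ge0// mulr_ge0 ?exprn_ge0 ?(ltW Q0)// ltW.
rewrite -EL; have p0L : p0 \in L by rewrite EL mem_head.
have [p0S nu0 sd0] := LP _ p0L.
have [[pw w0 i0 g0] [j2 _ _]] := nu_facts p0S; rewrite nu0 in pw w0 i0 j2.
set j : R := v.1.2%:R in j2 *.
have j0 : 0 < j by rewrite ltr0n.
have d0 := good_d0 g0.
pose W := Num.sqrt (4 * k * d / Q).
have W0 : 0 <= W by rewrite sqrtr_ge0.
have W2 : W ^+ 2 = 4 * k * d / Q by rewrite sqr_sqrtr// divr_ge0 ?mulr_ge0 ?(ltW k0) ?(ltW Q0).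
have WQ : W * Q ^+ 2 <= sg ^+ n * Q / 4.
  have r0 : 0 <= sg ^+ n * Q / 4 by rewrite divr_ge0 ?mulr_ge0 ?exprn_ge0 ?(ltW Q0)// ltW.
  rewrite -(@ler_pXn2r _ 2) ?nnegrE ?r0 ?mulr_ge0 ?(ltW Q0)//.
  rewrite exprMn W2.
  have -> : 4 * k * d / Q * (Q ^+ 2) ^+ 2 = 4 * k * (d * Q) * Q ^+ 2 by field; rewrite gt_eqF.
  have -> : (sg ^+ n * Q / 4) ^+ 2 = sg ^+ (2 * n) / 16 * Q ^+ 2.
    by rewrite mulnC exprM; field.
  rewrite ler_wpM2r ?sqr_ge0//.
  have kk : k <= k ^+ 3 by rewrite exprS ler_peMr ?(ltW k0)// exprn_ege1.
  have : k * (d * Q) <= k ^+ 3 * (d * Q) by rewrite ler_wpM2r// mulr_ge0 ?(ltW Q0).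
  by move: dn; rewrite -/Q; move: (sg ^+ (2 * n)) (k ^+ 3) => z z2; lra.
have jW : j <= W * Q ^+ 2.
  rewrite -(@ler_pXn2r _ 2) ?nnegrE ?mulr_ge0 ?(ltW Q0) ?(ltW j0)//.
  apply: (le_trans j2); rewrite exprMn W2.
  by rewrite le_eqVlt; apply/orP; left; apply/eqP; field; rewrite gt_eqF.
have jQ : 0 < j / Q ^+ 2 by rewrite divr_gt0 ?exprn_gt0.
have close p : p \in L -> `|absc R p - absc R p0| <= W.
  move=> pL; have [-> |ne] := eqVneq p p0; first by rewrite subrr normr0.
  have [pS nup sd] := LP _ pL; have [[_ _ i1 g1] _] := nu_facts pS; rewrite nup in i1.
  have sde : (G (absc R v) <= absc R p) = (G (absc R v) <= absc R p0) by rewrite sd0.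
  have [h _ _ _ _] := plane_pair cv dQ pw w0 g1 g0 ne i1 i0 sde.
  rewrite -(@ler_pXn2r _ 2) ?nnegrE//.
  by rewrite real_normK ?num_real// W2.
have := @spaced_count R _ L (absc R) (absc R p0 - W) (absc R p0 + W) (j / Q ^+ 2).
move=> /(_ _ jQ) h; apply: le_trans (h _ _ _ _) _.
- by rewrite filter_uniq// filter_uniq.
- by move: W0; lra.
- by move=> p /close; rewrite ler_norml; lra.
- move=> p p' pL p'L ne.
  have [pS nup sd] := LP _ pL; have [[_ _ i1 g1] _] := nu_facts pS; rewrite nup in i1.
  have [pS' nup' sd'] := LP _ p'L; have [[_ _ i1' g1'] _] := nu_facts pS'; rewrite nup' in i1'.
  exact: (good_sep cv dQ g1 g1' ne w0 (incid_cross pw i1 i1')).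
have -> : (absc R p0 + W - (absc R p0 - W)) / (j / Q ^+ 2) + 1 = (2 * (W * Q ^+ 2) + j) / j.
  by field; rewrite !gt_eqF.
by rewrite ler_pM2r ?invr_gt0//; lra.
Qed.

(** The lines used are grouped by dyadic denominator 2^i with i < n and by unit cells of the slope.
    In each group they are good points for the dual curve, so there are at most K 2^i of them, each
    carrying O(sg^n Q / 2^i) points. Every scale thus contributes O(K sg^n Q). *)
Lemma paired_count (K : R) : 0 <= K -> (forall i, (i < n)%N -> prim_count k sg K i) ->
  (size S)%:R <= 3 * (6 * k + 1) * (n%:R * sg ^+ n) * (K * Q).
Proof.
move=> K0 IH; pose V := undup (map nu S).
have VP v : v \in V -> exists2 p, p \in S & v = nu p.
  by rewrite mem_undup => /mapP.
rewrite -(sum1_sizeR R) (sum_undup _ nu) -/V.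
have sgn : 0 <= sg ^+ n by rewrite exprn_ge0// ltW.
(* Bound for the points carried by v on both sides; rounding the denominator up to a power of 2
   makes it constant on each scale. *)
pose w (v : pt) : R := 3 * (sg ^+ n * Q) / 2 ^+ up_log 2 v.1.2.
apply: (@le_trans _ _ (\sum_(v <- V) w v)).
  rewrite big_seq [leRHS]big_seq; apply: ler_sum => v /VP[p pS vE].
  have [[_ v0 _ _] _] := nu_facts pS; rewrite -vE in v0.
  have v0r : 0 < v.1.2%:R :> R by rewrite ltr0n.
  rewrite (bigID (fun p => (critp v <= absc R p) == true)) /= -[X in X + _]big_filter -[X in _ + X]big_filter !sum1_sizeR.
  have a1 := side_count v true; have a2 := side_count v false.
  have -> : [seq p <- S | (nu p == v) && ((critp v <= absc R p) != true)] =
     [seq p <- S | (nu p == v) && ((critp v <= absc R p) == false)].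
    by apply: eq_filter => q; case: (critp v <= _).
  apply: (le_trans (lerD a1 a2)).
  have -> : 3 / 4 * (sg ^+ n * Q) / v.1.2%:R + 3 / 4 * (sg ^+ n * Q) / v.1.2%:R =
     3 * (sg ^+ n * Q) * (2 * v.1.2%:R)^-1 by field; rewrite gt_eqF.
  rewrite /w ler_wpM2l ?mulr_ge0 ?(ltW Q0)//.
  rewrite lef_pV2 ?posrE ?mulr_gt0 ?exprn_gt0//.
  rewrite -natrX -natrM ler_nat ltnW//.
  by have [] := up_log2_dyadic v0.
have in_n v : v \in V -> (up_log 2 v.1.2 < n)%N.
  move=> /VP[p pS vE]; have [[_ v0 _ gp] [j2 _ _]] := nu_facts pS; rewrite -vE in v0 j2.
  have [u1 _] := up_log2_dyadic v0; rewrite -(ltn_exp2l _ _ (isT : (1 < 2)%N)).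
  apply: (leq_trans u1); rewrite -(ler_nat R) natrM natrX -/Q.
  rewrite -(@ler_pXn2r _ 2) ?nnegrE ?mulr_ge0 ?(ltW Q0)// exprMn.
  have d0 := good_d0 gp.
  have kk : k <= k ^+ 3 by rewrite exprS ler_peMr ?(ltW k0)// exprn_ege1.
  have c1 : 64 * (k * (d * Q)) <= 1.
    apply: le_trans dQ; rewrite -mulrA ler_pM2l// ler_wpM2r// mulr_ge0 ?(ltW Q0)//.
  apply: (le_trans (ler_wpM2l _ j2)); first by rewrite sqr_ge0.
  have -> : 2 ^+ 2 * (4 * k * d * Q ^+ 3) = 16 * (k * (d * Q)) * Q ^+ 2 :> R by ring.
  rewrite ler_piMl ?sqr_ge0//.
  by move: c1; move: (k * (d * Q)) => z; lra.
rewrite (sum_fibers _ in_n).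
pose x1 := g (x0 - 1).
pose r (v : pt) := Num.truncn (absc R v - x1).
pose M := (Num.truncn (6 * k)).+1.
have k60 : 0 <= 6 * k by rewrite mulr_ge0// ltW.
have rv v : v \in V -> x1 <= absc R v <= x1 + 6 * k.
  move=> /VP[p pS vE]; have [_ [_ /andP[t1 t2] _]] := nu_facts pS; rewrite -vE in t1 t2.
  have gt : g (critp v) = absc R v by exact: curve_GK cv _.
  have x03 : x0 - 1 <= x0 + 2 by lra.
  rewrite -gt /x1 (curve_g_le cv) t1 /=.
  have /andP[_ h] := curve_g_incr cv t1.
  have h2 : 2 * k * (critp v - (x0 - 1)) <= 2 * k * 3 by rewrite ler_pM2l ?mulr_gt0//; lra.
  by move: h h2; lra.
have rM v : v \in V -> (r v < M)%N.
  by move=> /rv/andP[h1 h2]; rewrite ltnS le_truncn// lerBlDl.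
apply: (@le_trans _ _ (\sum_(0 <= i < n) M%:R * (3 * (sg ^+ n * Q) * K))).
  apply: ler_sum_nat => i /andP[_ iN]; rewrite -big_filter.
  rewrite (@sum_fibers R _ _ r M); last by move=> v; rewrite mem_filter => /andP[_ /rM].
  apply: (@le_trans _ _ (\sum_(0 <= l < M) 3 * (sg ^+ n * Q) * K)); last first.
    by rewrite big_const_nat subn0 iter_addr_0 -[_ *+ M]mulr_natl.
  apply: ler_sum => l _; rewrite -big_filter.
  set L := seq.filter _ _.
  have LP v : v \in L -> [/\ r v = l, up_log 2 v.1.2 = i & v \in V].
    by rewrite !mem_filter => /andP[/eqP -> /andP[/eqP -> ->]].
  have -> : \sum_(v <- L) w v = (size L)%:R * (3 * (sg ^+ n * Q) / 2 ^+ i).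
    rewrite -(sum1_sizeR R) mulr_suml big_seq [RHS]big_seq; apply: eq_bigr => v /LP[_ e _].
    by rewrite mul1r /w e.
  have i0 : (0 : R) < 2 ^+ i by rewrite exprn_gt0.
  suff : (size L)%:R <= K * 2 ^+ i.
    have c0 : 0 <= 3 * (sg ^+ n * Q) / 2 ^+ i by rewrite divr_ge0 ?mulr_ge0 ?(ltW Q0) ?(ltW i0).
    move=> /(ler_wpM2r c0) /le_trans; apply.
    by rewrite le_eqVlt; apply/orP; left; apply/eqP; field; rewrite gt_eqF.
  have [->|[v0 v0L]] : L = [::] \/ exists v, v \in L.
    by case: (L) => [|v0 L']; [left|right; exists v0; rewrite mem_head].
    by rewrite mulr_ge0// ltW.
  have d0 : 0 <= d.
    by have [_ _ /VP[p pS _]] := LP _ v0L; have [[_ _ _ gp] _] := nu_facts pS; exact: good_d0 gp.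
  have k30 : 0 < k ^+ 3 by rewrite exprn_gt0.
  (* A line is within 12 k^3 (d Q)^2 / j of the dual curve and 2^i < 2 j. The error is quadratic in
     d Q, so the smallness condition at scale i < n holds with room to spare. *)
  apply: (IH i iN F G f g (x1 + l%:R) (24 * k ^+ 3 * (d * Q) ^+ 2 / 2 ^+ i)).
  - exact: curve_dual cv.
  - rewrite divfK ?gt_eqF//.
    have dQ0 : 0 <= k ^+ 3 * (d * Q) by exact: mulr_ge0 (ltW k30) (mulr_ge0 d0 (ltW Q0)).
    have sq : (64 * (k ^+ 3 * (d * Q))) ^+ 2 <= sg ^+ (2 * i).
      apply: (@le_trans _ _ ((sg ^+ (2 * n)) ^+ 2)).
        rewrite ler_pXn2r//; first by rewrite mulrA.
          by rewrite nnegrE mulr_ge0.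
        by rewrite nnegrE exprn_ge0// ltW.
      rewrite -exprM; apply: (ler_wiXn2l (ltW sg0) sg1).
      by rewrite -mulnA leq_mul2l /= (leq_trans (ltnW iN))// leq_pmulr.
    apply: le_trans sq.
    have -> : (64 * (k ^+ 3 * (d * Q))) ^+ 2 = 64 * 64 * (k ^+ 3 * (d * Q)) ^+ 2 by ring.
    have -> : 64 * k ^+ 3 * (24 * k ^+ 3 * (d * Q) ^+ 2) = 64 * 24 * (k ^+ 3 * (d * Q)) ^+ 2 by ring.
    by have := sqr_ge0 (k ^+ 3 * (d * Q)); move: ((k ^+ 3 * (d * Q)) ^+ 2) => z; lra.
  - by rewrite !filter_uniq// undup_uniq.
  move=> v /LP[rvl ui vV]; have [p pS vE] := VP _ vV.
  have [[pw w0 _ _] [_ _ h]] := nu_facts pS; rewrite -vE in pw w0 h.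
  have [u1 u2] := up_log2_dyadic w0; rewrite ui in u1 u2.
  split => //.
    have /andP[a1 a2] := rv _ vV.
    have /truncn_itv : 0 <= absc R v - x1 by rewrite subr_ge0.
    rewrite -/(r v) rvl -natr1 => /andP[b1 b2].
    by apply/andP; split; lra.
  apply: (le_trans h); have w0r : 0 < v.1.2%:R :> R by rewrite ltr0n.
  have -> : 12 * k ^+ 3 * (d * Q) ^+ 2 / v.1.2%:R = 24 * k ^+ 3 * (d * Q) ^+ 2 * (2 * v.1.2%:R)^-1.
    by field; rewrite gt_eqF.
  have c0 : 0 <= 24 * k ^+ 3 * (d * Q) ^+ 2.
    by rewrite -mulrA; have := mulr_ge0 (ltW k30) (sqr_ge0 (d * Q)); move: (k ^+ 3 * _) => z; lra.
  apply: (ler_wpM2l c0); rewrite lef_pV2 ?posrE ?mulr_gt0//.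
  by rewrite -natrX -natrM ler_nat ltnW.
rewrite big_const_nat subn0 iter_addr_0 -[_ *+ n]mulr_natl.
have M1 : M%:R <= 6 * k + 1 by rewrite /M -natr1 lerD2r truncn_le.
have -> : n%:R * (M%:R * (3 * (sg ^+ n * Q) * K)) = M%:R * (3 * (n%:R * sg ^+ n) * (K * Q)) by ring.
have -> : 3 * (6 * k + 1) * (n%:R * sg ^+ n) * (K * Q) = (6 * k + 1) * (3 * (n%:R * sg ^+ n) * (K * Q)) by ring.
by rewrite ler_wpM2r// !mulr_ge0 ?(ltW Q0).
Qed.

End Induction.

(** * The count of primitive points *)

Section PrimitiveCount.
Variable R : realType.

Lemma bernoulli_le (h : R) n : 0 <= h -> 1 + n%:R * h <= (1 + h) ^+ n.
Proof.
move=> h0; elim: n => [|n IH]; first by rewrite expr0 mul0r addr0.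
rewrite exprS; apply: le_trans (ler_wpM2l _ IH); last by lra.
have : 0 <= n%:R * h * h by rewrite !mulr_ge0.
by rewrite -natr1; move: (n%:R : R) => z; lra.
Qed.

(** Bernoulli's inequality for t = sqrt sg bounds n t^n, and squaring it bounds n sg^n by a constant
    over n. *)
Lemma geom_small (c sg : R) : 0 < sg -> sg < 1 ->
  exists n0 : nat, forall n, (n0 <= n)%N -> c * (n%:R * sg ^+ n) <= 1 / 2.
Proof.
move=> s0 s1; pose t := Num.sqrt sg.
have t0 : 0 < t by rewrite sqrtr_gt0.
have t2 : t ^+ 2 = sg by rewrite sqr_sqrtr// ltW.
have t1 : t < 1 by rewrite -(@ltr_pXn2r _ 2) ?nnegrE ?(ltW t0)// t2 expr1n.
pose h := t^-1 - 1.
have h0 : 0 < h by rewrite subr_gt0 invf_gt1.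
exists (Num.truncn (2 * `|c| / h ^+ 2)).+1 => n nn.
have n0 : 0 < n%:R :> R by rewrite ltr0n; apply: leq_trans nn.
have cn : 2 * `|c| / h ^+ 2 <= n%:R.
  by apply: le_trans (ltW (truncnS_gt _)) _; rewrite ler_nat.
have b : n%:R * h * t ^+ n <= 1.
  have : n%:R * h <= (t^-1) ^+ n.
    have -> : t^-1 = 1 + h by rewrite /h addrC subrK.
    by apply: le_trans (bernoulli_le n (ltW h0)); rewrite lerDr.
  rewrite exprVn => /(ler_wpM2r (exprn_ge0 n (ltW t0))).
  by rewrite mulVf// expf_neq0// gt_eqF.
have b2 : (n%:R * h * t ^+ n) ^+ 2 <= 1.
  by rewrite exprn_ile1// !mulr_ge0 ?exprn_ge0 ?ltW.
have e : (n%:R * h * t ^+ n) ^+ 2 = n%:R * h ^+ 2 * (n%:R * sg ^+ n) by rewrite -t2 -exprM mulnC exprM; ring.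
have ns : n%:R * sg ^+ n <= (n%:R * h ^+ 2)^-1.
  by rewrite -[leRHS]mul1r ler_pdivlMr ?mulr_gt0 ?exprn_gt0// mulrC -e.
have ns0 : 0 <= n%:R * sg ^+ n by rewrite mulr_ge0 ?exprn_ge0// ltW.
apply: (@le_trans _ _ (`|c| * (n%:R * h ^+ 2)^-1)).
  apply: (@le_trans _ _ (`|c| * (n%:R * sg ^+ n))); first by rewrite ler_wpM2r ?ler_norm.
  by rewrite ler_wpM2l.
rewrite ler_pdivrMr ?exprn_gt0// in cn.
rewrite ler_pdivrMr ?mulr_gt0 ?exprn_gt0//; move: cn; set z := n%:R * _; lra.
Qed.

Lemma prim_count_small (k sg : R) n : 1 <= k -> 0 < sg -> sg <= 1 -> prim_count k sg (2 * 2 ^+ n) n.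
Proof.
move=> k1 sg0 sg1 f g F G x0 d s cv dn us gs.
have dQ : 64 * k ^+ 3 * (d * 2 ^+ n) <= 1 by apply: le_trans dn _; rewrite exprn_ile1// ltW.
pose Q : R := 2 ^+ n; have Q1 : 1 <= Q by rewrite exprn_ege1// ler1n.
have Q0 : 0 < Q by apply: lt_le_trans Q1.
have := @spaced_count R _ s (absc R) x0 (x0 + 1) (1 / Q ^+ 2) us.
rewrite divr_gt0 ?exprn_gt0// lerDl ler01 => /(_ isT isT) h.
apply: le_trans (h _ _) _.
- by move=> p /gs[].
- move=> p p' ps ps' ne; apply: (good_sep cv dQ (gs _ ps) (gs _ ps') ne (isT : (0 < 1)%N)).
  exact: dvd1z.
- have -> : (x0 + 1 - x0) / (1 / Q ^+ 2) = Q ^+ 2 by field; rewrite gt_eqF.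
  rewrite -/Q.
  have : 1 <= Q ^+ 2 by rewrite exprn_ege1.
  by rewrite -mulrA -expr2; lra.
Qed.

(** Strong induction on n. From n0 on, n sg^n is so small that the paired points use up at most half
    of K 2^n, and K >= 20 k leaves the other half for the unpaired ones. Below n0 the spacing 1/Q^2
    suffices. *)
Lemma prim_count_ex (k sg : R) : 1 <= k -> 0 < sg -> sg < 1 ->
  exists2 K : R, 0 < K & forall n, prim_count k sg K n.
Proof.
move=> k1 sg0 sg1; have k0 : 0 < k by apply: lt_le_trans k1.
have [n0 hn0] := geom_small (3 * (6 * k + 1)) sg0 sg1.
pose K := 20 * k + 2 * 2 ^+ n0.
have p0 : 0 < 2 ^+ n0 :> R by rewrite exprn_gt0.
have K0 : 0 < K by rewrite addr_gt0// mulr_gt0.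
exists K => // n; elim/ltn_ind: n => n IH f g F G x0 d s cv dn us gs.
have Q0 : 0 < 2 ^+ n :> R by rewrite exprn_gt0.
have [nn|nn] := ltnP n n0.
  apply: (le_trans (prim_count_small k1 sg0 (ltW sg1) cv dn us gs)).
  rewrite ler_wpM2r ?(ltW Q0)// /K ler_wpDl ?mulr_ge0 ?(ltW k0)// ler_pM2l//.
  by rewrite ler_weXn2l ?ler1n// ltnW.
have [nu nuP] : exists nu : pt -> pt, forall p, p \in [seq p <- s | paired G s p] ->
    exists p', partner G s p p' (nu p).
  have /choice[nu h] : forall p : pt, exists w : pt, p \in [seq p <- s | paired G s p] ->
      exists p', partner G s p p' w.
    move=> p; have [|] := boolP (p \in [seq p <- s | paired G s p]); last by exists p.
    by rewrite mem_filter => /andP[/asboolP[p' [w hw]] _]; exists w => _; exists p'.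
  by exists nu.
have a1 := unpaired_count cv sg0 (ltW sg1) dn us gs.
have a2 := paired_count cv sg0 (ltW sg1) dn us gs nuP (ltW K0) IH.
have a3 : 3 * (6 * k + 1) * (n%:R * sg ^+ n) * (K * 2 ^+ n) <= 1 / 2 * (K * 2 ^+ n).
  by rewrite ler_wpM2r ?mulr_ge0 ?(ltW K0) ?(ltW Q0)// hn0.
have -> : (size s)%:R = (size [seq p <- s | paired G s p])%:R + (size [seq p <- s | ~~ paired G s p])%:R :> R.
  by rewrite !size_filter -natrD count_predC.
have a4 : 0 <= 2 * 2 ^+ n0 * 2 ^+ n :> R by rewrite !mulr_ge0 ?(ltW p0) ?(ltW Q0).
apply: (le_trans (lerD (le_trans a2 a3) a1)); rewrite /K; move: a4.
by move: (2 * 2 ^+ n0) (2 ^+ n) => z4 z5; lra.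
Qed.

End PrimitiveCount.

(** * From primitive points to all fractions *)

Section AllCount.
Variable R : realType.

Definition close_pair (f : R -> R) (x0 : R) (H : nat) (D : R) (p : int * nat) : Prop :=
  [/\ (0 < p.2)%N, (p.2 <= H)%N, x0 <= p.1%:~R / p.2%:R <= x0 + 1 & dist_int (height f p) <= D].

Lemma sum_pow2_lt (X : R) M : 0 <= X ->
  \sum_(0 <= m < M) (if 2 ^+ m < X then 2 ^+ m else 0) <= 2 * X.
Proof.
move=> X0; elim: M => [|M IH]; first by rewrite big_geq// mulr_ge0.
rewrite big_nat_recr//=; case: ifP => MX; last by rewrite addr0.
have : \sum_(0 <= m < M) (if 2 ^+ m < X then 2 ^+ m else 0) <= 2 ^+ M :> R.
  apply: (@le_trans _ _ (\sum_(0 <= m < M) 2 ^+ m)).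
    by apply: ler_sum => m _; case: ifP => // _; rewrite exprn_ge0.
  elim: M {IH MX} => [|M IH]; first by rewrite big_geq// expr0.
  by rewrite big_nat_recr//= exprS mulr_natl mulr2n lerD2r.
by move: MX; move: (2 ^+ M) (\sum_(_ <= _ < _) _) => a b; lra.
Qed.

(** Let b be the integer nearest to the height. Dividing (a, q, b) by its content T gives a
    primitive good point of denominator at most H/T, with an error no larger. Dyadic scales sum
    geometrically to O(H/T), and the sum over T gives the logarithm. *)
Lemma close_count (k sg K : R) (f g F G : R -> R) (x0 : R) (H : nat) (D : R) (s : seq (int * nat)) : curve k f g F G -> 0 < K ->
  (forall n, prim_count k sg K n) -> 0 <= D ->
  (forall n, (2 ^ n < 2 * H)%N -> 64 * k ^+ 3 * (D * 2 ^+ n) <= sg ^+ (2 * n)) ->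
  uniq s -> (forall p, p \in s -> close_pair f x0 H D p) ->
  (size s)%:R <= 4 * K * H%:R * (1 + ln H%:R).
Proof.
move=> cv K0 hK D0 hD us ns.
have /choice[b bP] : forall p : int * nat, exists m : int, dist_int (height f p) = `|height f p - m%:~R|.
  by move=> p; exact: dist_int_ex.
pose T p := gcdn p.2 (gcdn (absz p.1) (absz (b p))).
pose pr (p : int * nat) : pt := ((p.1 %/ Posz (T p))%Z, (p.2 %/ T p)%N, (b p %/ Posz (T p))%Z).
have TE p : Posz (T p) = gcdz (Posz p.2) (gcdz p.1 (b p)) by [].
have div p : [/\ (Posz (T p) %| p.1)%Z, (T p %| p.2)%N & (Posz (T p) %| b p)%Z].
  rewrite TE; split; last 2 first.
  - exact: dvdn_gcdl.
  - exact: dvdz_trans (dvdz_gcdr _ _) (dvdz_gcdr _ _).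
  - exact: dvdz_trans (dvdz_gcdr _ _) (dvdz_gcdl _ _).
have T0 p : p \in s -> (0 < T p)%N by move=> /ns[q0 _ _ _]; rewrite gcdn_gt0 q0.
have TH p : p \in s -> (T p < H.+1)%N.
  move=> /ns[q0 qH _ _]; rewrite ltnS; apply: leq_trans qH; apply: dvdn_leq => //.
  by have [] := div p.
have pE p : [/\ p.1 = (pr p).1.1 * Posz (T p), p.2 = ((pr p).1.2 * T p)%N & b p = (pr p).2 * Posz (T p)].
  by have [d1 d2 d3] := div p; rewrite /pr /= !divzK// divnK.
have den0 p : p \in s -> (0 < (pr p).1.2)%N.
  move=> ps; have [q0 _ _ _] := ns _ ps; have [_ e _] := pE p.
  by move: q0; rewrite e muln_gt0 => /andP[].
have prP p : p \in s -> good f x0 (up_log 2 (pr p).1.2) D (pr p).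
  move=> ps; have [q0 qH hx hb] := ns _ ps; have [e1 e2 e3] := pE p.
  have [u1 u2] := up_log2_dyadic (den0 _ ps).
  have t0 := T0 _ ps; have tr : 0 < (T p)%:R :> R by rewrite ltr0n.
  have dr : 0 < (pr p).1.2%:R :> R by rewrite ltr0n den0.
  have xE : p.1%:~R / p.2%:R = absc R (pr p).
    by rewrite e1 e2 natrM intrM -pmulrn /absc; field; rewrite !gt_eqF.
  split=> //; first by rewrite -xE.
    rewrite bP /height xE e2 e3 natrM intrM -pmulrn in hb.
    have -> : (pr p).2%:~R - (pr p).1.2%:R * f (absc R (pr p)) =
      - (((pr p).1.2%:R * (T p)%:R * f (absc R (pr p)) - (pr p).2%:~R * (T p)%:R) / (T p)%:R).
      by field; rewrite gt_eqF.
    rewrite normrN normrM normfV (gtr0_norm tr) ler_pdivrMr//.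
    by apply: (le_trans hb); rewrite ler_peMr// ler1n.
  apply/eqP; have Tz : Posz (T p) != 0 by rewrite eqz_nat -lt0n.
  apply: (mulIf Tz); rewrite mul1r.
  have DE x y : gcdz x y * Posz (T p) = gcdz (x * Posz (T p)) (y * Posz (T p)) by rewrite -mulz_gcdl.
  by rewrite !DE -e1 -e3 -PoszM -e2 -TE.
rewrite -(sum1_sizeR R) (@sum_fibers R _ _ T H.+1)//.
rewrite big_nat_recl//= big1_seq ?add0r; last first.
  by move=> p /andP[/eqP e /T0]; rewrite e.
apply: (@le_trans _ _ (\sum_(0 <= i < H) 4 * K * H%:R * i.+1%:R^-1)); last first.
  by rewrite -mulr_sumr ler_wpM2l ?mulr_ge0 ?(ltW K0)//; exact: harmonic_le_ln.
apply: ler_sum => i _; rewrite -big_filter; set L := seq.filter _ _.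
have LP p : p \in L -> T p = i.+1 /\ p \in s by rewrite mem_filter => /andP[/eqP].
pose M := H.+1.
rewrite (@sum_fibers R _ _ (fun p => up_log 2 (pr p).1.2) M); last first.
  move=> p /LP[_ ps]; rewrite ltnS; apply: up_log_min => //.
  have [_ qH _ _] := ns _ ps; have [_ e _] := pE p.
  apply: leq_trans (ltnW (ltn_expl H (isT : (1 < 2)%N))).
  by apply: leq_trans qH; rewrite e leq_pmulr// T0.
pose X : R := 2 * H%:R / i.+1%:R.
have i0 : 0 < i.+1%:R :> R by rewrite ltr0n.
have X0 : 0 <= X by rewrite divr_ge0 ?mulr_ge0.
apply: (@le_trans _ _ (\sum_(0 <= m < M) K * (if 2 ^+ m < X then 2 ^+ m else 0))); last first.
  rewrite -mulr_sumr; have := ler_wpM2l (ltW K0) (sum_pow2_lt M X0).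
  by move=> /le_trans; apply; rewrite le_eqVlt; apply/orP; left; apply/eqP; rewrite /X; field; rewrite gt_eqF.
apply: ler_sum => m _; rewrite -big_filter sum1_sizeR; set L' := seq.filter _ _.
have LP' p : p \in L' -> [/\ T p = i.+1, p \in s & up_log 2 (pr p).1.2 = m].
  by rewrite mem_filter => /andP[/eqP e /LP[]].
have [->|[p0 p0L]] : L' = [::] \/ exists p, p \in L'.
  by case: (L') => [|v0 r]; [left|right; exists v0; rewrite mem_head].
  by rewrite mulr_ge0 ?(ltW K0)//; case: ifP => // _; rewrite exprn_ge0.
have mi : (2 ^ m * i.+1 < 2 * H)%N.
  have [t0 ps um] := LP' _ p0L; have [_ qH _ _] := ns _ ps; have [_ e _] := pE p0.
  have [u1 _] := up_log2_dyadic (den0 _ ps); rewrite um in u1; rewrite e t0 in qH.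
  by move: u1 qH; move: ((pr p0).1.2) => v; nia.
have -> : 2 ^+ m < X.
  by rewrite /X ltr_pdivlMr// -natrX -!natrM ltr_nat.
rewrite -(size_map pr); apply: (hK m f g F G x0 D (map pr L') cv).
- by apply: hD; apply: leq_ltn_trans mi; rewrite leq_pmulr.
- rewrite map_inj_in_uniq ?filter_uniq// => p p' /LP'[tp _ _] /LP'[tp' _ _] e.
  have [e1 e2 _] := pE p; have [e1' e2' _] := pE p'.
  by rewrite [p]surjective_pairing [p']surjective_pairing e1 e2 e1' e2' tp tp' e.
- by move=> v /mapP[p /LP'[_ ps um] ->]; rewrite -um; exact: prP.
Qed.

End AllCount.

(** * Partial summation and dyadic decomposition of the weight *)

Section Weights.
Variable R : realType.

Lemma sum_invsqrt L : \sum_(0 <= i < L) (Num.sqrt i.+1%:R)^-1 <= 2 * Num.sqrt L%:R :> R.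
Proof.
elim: L => [|n IH]; first by rewrite big_geq// mulr_ge0 ?sqrtr_ge0.
rewrite big_nat_recr//=.
set a := Num.sqrt n%:R in IH *; set b := Num.sqrt n.+1%:R.
have b0 : 0 < b by rewrite sqrtr_gt0 ltr0n.
have a0 : 0 <= a by rewrite sqrtr_ge0.
have ab : b ^+ 2 = a ^+ 2 + 1 by rewrite !sqr_sqrtr// natr1.
have ab' : a <= b by rewrite ler_wsqrtr// ler_nat.
suff : b^-1 <= 2 * (b - a) by move: IH; move: (\sum_(_ <= _ < _) _) => z; lra.
by rewrite -[b^-1]mul1r ler_pdivrMr//; nra.
Qed.

(** Partial summation: the partial sums of w are dominated by those of the constant B. *)
Lemma abel_sqrt (w : nat -> R) (B : R) L : 0 <= B ->
  (forall h, (h <= L)%N -> \sum_(1 <= l < h.+1) w l <= B * h%:R) ->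
  \sum_(1 <= l < L.+1) w l / Num.sqrt l%:R <= 2 * B * Num.sqrt L%:R.
Proof.
move=> B0 hw; pose a n : R := \sum_(1 <= l < n.+1) w l.
have aS i : a i.+1 - a i = w i.+1 by rewrite /a big_nat_recr//= addrAC subrr add0r.
have := @abel_majorize R (fun i => (Num.sqrt i.+1%:R)^-1) a (fun i => B * i%:R) 0 L (leq0n _).
have s0 i : 0 < Num.sqrt i.+1%:R :> R by rewrite sqrtr_gt0 ltr0n.
have a0 : a 0%N = 0 by rewrite /a big_geq.
rewrite /= mulr0 a0 subrr mulr0 addr0 => maj.
rewrite big_add1 /=.
have -> : \sum_(0 <= i < L) w i.+1 / Num.sqrt i.+1%:R = \sum_(0 <= i < L) (Num.sqrt i.+1%:R)^-1 * (a i.+1 - a i).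
  by apply: eq_bigr => i _; rewrite aS mulrC.
apply: (le_trans (maj _ _ _)).
- by move=> i _; rewrite invr_ge0 ltW.
- by move=> i _; rewrite lef_pV2 ?posrE// ler_wsqrtr// ler_nat.
- exact: hw.
have -> : \sum_(0 <= i < L) (Num.sqrt i.+1%:R)^-1 * (B * i.+1%:R - B * i%:R) = B * \sum_(0 <= i < L) (Num.sqrt i.+1%:R)^-1.
  by rewrite mulr_sumr; apply: eq_bigr => i _; rewrite -natr1; ring.
by rewrite -mulrA mulrCA ler_wpM2l//; exact: sum_invsqrt.
Qed.

(** The least r with ||u|| <= 2^r/Q already provides the bound, since then 1/||u|| < 2 Q / 2^r,
    unless r = 0, where Q is enough. *)
Lemma dyadic_cutinv (Q Rn : nat) (u : R) : (0 < Q)%N -> (Q <= 2 ^ Rn)%N ->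
  cutinv Q%:R u <= \sum_(0 <= r < Rn.+1) 2 * Q%:R / 2 ^+ r * (dist_int u <= 2 ^+ r / Q%:R)%R%:R.
Proof.
move=> Q0 QR; have Qr : 0 < Q%:R :> R by rewrite ltr0n.
have p0 r : 0 < 2 ^+ r :> R by rewrite exprn_gt0.
have ex : exists r, dist_int u <= 2 ^+ r / Q%:R.
  exists Rn; apply: le_trans (dist_int_le_half u) _; rewrite ler_pdivlMr//.
  have : Q%:R <= 2 ^+ Rn :> R by rewrite -natrX ler_nat.
  by move: (p0 Rn); move: (2 ^+ Rn) => z; lra.
case: (ex_minnP ex) => r hr rmin.
have rR : (r <= Rn)%N.
  apply: rmin; apply: le_trans (dist_int_le_half u) _; rewrite ler_pdivlMr//.
  have : Q%:R <= 2 ^+ Rn :> R by rewrite -natrX ler_nat.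
  by move: (p0 Rn); move: (2 ^+ Rn) => z; lra.
rewrite big_mkord (bigD1 (Ordinal (rR : (r < Rn.+1)%N)))//= hr mulr1.
rewrite ler_wpDr//; first by apply: sumr_ge0 => i _; rewrite mulr_ge0 ?divr_ge0 ?mulr_ge0 ?(ltW (p0 _)).
case: r hr rmin rR => [|r] hr rmin rR.
  by rewrite expr0 divr1; apply: le_trans (cutinv_le _ (ltW Qr)) _; rewrite ler_peMl// ler1n.
have lt : 2 ^+ r / Q%:R < dist_int u by rewrite ltNge; apply/negP => /rmin; rewrite ltnn.
have := cutinv_dist Q%:R u; have c0 : 0 <= cutinv Q%:R u by exact: cutinv_ge0.
move=> h; have : cutinv Q%:R u * (2 ^+ r / Q%:R) <= 1 by apply: le_trans h; rewrite ler_wpM2l// ltW.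
rewrite mulrA ler_pdivrMr// mul1r exprS.
rewrite -ler_pdivlMr// => /le_trans; apply.
by rewrite le_eqVlt; apply/orP; left; apply/eqP; field; rewrite gt_eqF.
Qed.

End Weights.

(** * Fractions in an interval *)

Section LatticePoints.
Variable R : realType.

Lemma mem_lattice_pts (eta xi : R) Q (p : int * nat) : p \in lattice_pts eta xi Q =
  [&& (0 < p.2)%N, (p.2 <= Q)%N & eta * p.2%:R < p.1%:~R <= xi * p.2%:R].
Proof.
apply/allpairsPdep/idP => [[q [a [+ + ->]]]|/and3P[h1 h2 h3]] /=.
  by rewrite mem_index_iota ltnS mem_zseq => /andP[-> ->].
exists p.2, p.1; split; last by case: p {h1 h2 h3}.
  by rewrite mem_index_iota h1 ltnS.
by rewrite mem_zseq.
Qed.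

Lemma lattice_pts_uniq (eta xi : R) Q : uniq (lattice_pts eta xi Q).
Proof.
apply: allpairs_uniq_dep; first exact: iota_uniq.
  by move=> q _; exact: zseq_uniq.
by move=> [q a] [q' a'] _ _ /= [-> ->].
Qed.

Lemma size_zseq (a b : R) : a <= b -> `|(size (zseq a b))%:R - (b - a)| <= 1.
Proof.
move=> ab; have fab : Num.floor a <= Num.floor b by exact: le_floor.
have a1 := floor_le a; have a2 := floorD1_gt a; have b1 := floor_le b; have b2 := floorD1_gt b.
rewrite intrD1 in a2; rewrite intrD1 in b2.
have -> : (size (zseq a b))%:R = (Num.floor b)%:~R - (Num.floor a)%:~R :> R.
  rewrite /zseq -intrB; case: (_ - _) (subr_ge0 (Num.floor a) (Num.floor b)) => [n|n] h.
    by rewrite size_map size_iota pmulrn.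
  by move: h; rewrite fab => /idP.
by rewrite ler_norml; apply/andP; split; lra.
Qed.

Lemma size_lattice_pts (eta xi : R) Q : eta <= xi ->
  `|(size (lattice_pts eta xi Q))%:R - (xi - eta) * Q%:R ^+ 2 / 2| <= (xi - eta + 1) * Q%:R.
Proof.
move=> ex; rewrite size_allpairs_dep sumnE big_map natr_sum.
have e : \sum_(1 <= q < Q.+1) q%:R = Q%:R * (Q%:R + 1) / 2 :> R.
  elim: Q => [|n IH]; first by rewrite big_geq// mul0r mul0r.
  by rewrite big_nat_recr//= IH -natr1; field.
have -> : (xi - eta) * Q%:R ^+ 2 / 2 = \sum_(1 <= q < Q.+1) (xi - eta) * q%:R - (xi - eta) * Q%:R / 2.
  by rewrite -mulr_sumr e; field.
rewrite opprB addrCA -sumrB addrC; apply: (le_trans (ler_normD _ _)).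
have xe : 0 <= (xi - eta) * Q%:R by rewrite mulr_ge0 ?subr_ge0.
have -> : `|(xi - eta) * Q%:R / 2| = (xi - eta) * Q%:R / 2 by rewrite ger0_norm ?divr_ge0.
have h : `|\sum_(1 <= q < Q.+1) ((size (zseq (eta * q%:R) (xi * q%:R)))%:R - (xi - eta) * q%:R)| <= Q%:R.
  apply: (le_trans (ler_norm_sum _ _ _)).
  apply: (@le_trans _ _ (\sum_(1 <= q < Q.+1) 1)); last first.
    by rewrite big_const_nat subSS subn0 iter_addr_0.
  apply: ler_sum => q _; rewrite mulrBl; apply: size_zseq.
  by rewrite ler_wpM2r.
by rewrite (mulrDl (xi - eta)) mul1r; move: xe h; set z := _ * Q%:R; set y := `|_|; lra.
Qed.

Lemma cell_count (F : R -> R) (y0 y1 : R) (M h : nat) (D N : R) : y1 - y0 < M%:R ->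
  (forall x0 s, uniq s -> (forall p, p \in s -> close_pair F x0 h D p) -> (size s)%:R <= N) ->
  (size [seq p <- lattice_pts y0 y1 h | dist_int (height F p) <= D])%:R <= M%:R * N.
Proof.
move=> yM hN; set L := seq.filter _ _.
have LP p : p \in L -> [/\ dist_int (height F p) <= D, (0 < p.2)%N, (p.2 <= h)%N & y0 < p.1%:~R / p.2%:R <= y1].
  rewrite mem_filter mem_lattice_pts => /andP[-> /and3P[q0 qh]] h3; split=> //.
  by rewrite ltr_pdivlMr ?ltr0n// ler_pdivrMr ?ltr0n.
pose c (p : int * nat) := Num.truncn (p.1%:~R / p.2%:R - y0 : R).
have cM p : p \in L -> (c p < M)%N.
  move=> /LP[_ _ _ /andP[a b]]; rewrite truncn_lt_nat; last by rewrite subr_ge0 ltW.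
  by apply: le_lt_trans yM; rewrite lerD2r.
rewrite -(sum1_sizeR R) (sum_fibers _ cM).
apply: (@le_trans _ _ (\sum_(0 <= i < M) N)); last by rewrite big_const_nat subn0 iter_addr_0 -[_ *+ M]mulr_natl.
apply: ler_sum => i _; rewrite -big_filter sum1_sizeR; apply: (hN (y0 + i%:R)).
  by rewrite !filter_uniq// lattice_pts_uniq.
move=> p; rewrite mem_filter => /andP[/eqP ci /LP[d q0 qh /andP[a b]]]; split=> //.
have /truncn_itv : 0 <= p.1%:~R / p.2%:R - y0 by rewrite subr_ge0 ltW.
by rewrite -/(c p) ci -natr1 => /andP[u v]; apply/andP; split; lra.
Qed.

(** With sg = 2^(-c/2), the condition of [prim_count] reads d 2^n << 2^(-cn), that is, d (2^n)^(1+c)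
    << 1; it suffices to have it at the largest scale. *)
Lemma small_count (k c : R) : 1 <= k -> 0 < c -> exists2 K : R, 0 < K &
  forall f g F G (x0 : R) (H : nat) (D : R) (s : seq (int * nat)), curve k f g F G -> 0 <= D ->
  64 * k ^+ 3 * (D * (2 * H%:R) `^ (1 + c)) <= 1 -> uniq s ->
  (forall p, p \in s -> close_pair f x0 H D p) -> (size s)%:R <= K * H%:R * (1 + ln H%:R).
Proof.
move=> k1 c0; pose sg : R := 2 `^ (- (c / 2)).
have sg0 : 0 < sg by rewrite powR_gt0.
have sg1 : sg < 1.
  rewrite /sg powRN invf_lt1 ?powR_gt0//.
  have := @gt0_ltr_powR R (c / 2) _ 1 2; rewrite powR1 !nnegrE; apply; rewrite ?divr_gt0//.
  by rewrite ltr1n.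
have [K K0 hK] := prim_count_ex k1 sg0 sg1.
exists (4 * K); first by rewrite mulr_gt0.
move=> f g F G x0 H D s cv D0 hD us ns; apply: (close_count cv K0 hK D0 _ us ns) => n nH.
have k30 : 0 <= 64 * k ^+ 3.
  by have : 0 <= k ^+ 3; [rewrite exprn_ge0// (le_trans _ k1)|move: (k ^+ 3) => z; lra].
have n0 : 0 < 2 ^+ n :> R by rewrite exprn_gt0.
have e : sg ^+ (2 * n) * (2 ^+ n) `^ c = 1.
  rewrite -powR_mulrn ?(ltW sg0)// /sg -powRrM -(@powR_mulrn _ 2 n)// -powRrM -powRD; last first.
    by apply/implyP.
  by rewrite natrM; have -> : - (c / 2) * (2 * n%:R) + n%:R * c = 0; [field|rewrite powRr0].
have cp : 0 < (2 ^+ n) `^ c :> R by rewrite powR_gt0.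
rewrite -(ler_pM2r cp) e; apply: le_trans hD.
have -> : 64 * k ^+ 3 * (D * 2 ^+ n) * (2 ^+ n) `^ c = 64 * k ^+ 3 * (D * (2 ^+ n) `^ (1 + c)).
  rewrite powRD; last by rewrite (gt_eqF n0) implybT.
  by rewrite powRr1 ?(ltW n0)//; ring.
rewrite ler_wpM2l// ler_wpM2l// ge0_ler_powR ?nnegrE ?mulr_ge0 ?(ltW n0)//; first by lra.
by rewrite -natrX -natrM ler_nat ltnW.
Qed.

End LatticePoints.

(** * The total weight of the dual fractions *)

Section WeightSum.
Variable R : realType.

Definition pair_bound (k A e : R) (H : nat) := forall (f g F G : R -> R) (x0 D : R) (s : seq (int * nat)),
  curve k f g F G -> 0 <= D -> uniq s -> (forall p, p \in s -> close_pair f x0 H D p) ->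
  (size s)%:R <= A * (D * H%:R ^+ 2 + H%:R `^ e).

Lemma sum_half_pow (q : R) n : 0 <= q -> \sum_(0 <= r < n) q / 2 ^+ r <= 2 * q.
Proof.
move=> q0; suff : \sum_(0 <= r < n) q / 2 ^+ r = 2 * q - 2 * q / 2 ^+ n.
  by move=> ->; rewrite lerBlDr lerDl divr_ge0 ?mulr_ge0 ?exprn_ge0.
elim: n => [|n IH]; first by rewrite big_geq// expr0 divr1 subrr.
rewrite big_nat_recr//= IH exprS.
have : 2 ^+ n != 0 :> R by rewrite expf_neq0.
by move: (2 ^+ n) => z z0; field.
Qed.

Lemma sum_half_pow_lt (q Y : R) n : 0 <= q -> 0 <= Y ->
  \sum_(0 <= r < n) (if q / 2 ^+ r < Y then q / 2 ^+ r else 0) <= 2 * Y.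
Proof.
move=> + Y0; elim: n q => [|n IH] q q0; first by rewrite big_geq// mulr_ge0.
have [qY|qY] := ltP q Y.
  apply: (@le_trans _ _ (\sum_(0 <= r < n.+1) q / 2 ^+ r)).
    by apply: ler_sum => r _; case: ifP => // _; rewrite divr_ge0 ?exprn_ge0.
  by apply: le_trans (sum_half_pow _ q0) _; rewrite ler_pM2l// ltW.
rewrite big_nat_recl//= expr0 divr1 ltNge qY /= add0r.
have h := IH (q / 2) ltac:(by rewrite divr_ge0).
apply: le_trans h; apply: ler_sum => r _.
by rewrite exprS invfM mulrA.
Qed.

Lemma up_log2_le_ln Q : (1 < Q)%N -> (up_log 2 Q).+1%:R <= 6 * ln Q%:R :> R.
Proof.
move=> Q1; have Q0 : (0 < Q)%N by apply: ltnW.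
have h := @up_log_gtn 2 Q isT Q1; have u0 : (0 < up_log 2 Q)%N by rewrite up_log_gt0.
have lq := ln_nat_ge_half R Q1.
have : ln (2 ^+ (up_log 2 Q).-1) <= ln Q%:R :> R.
  by rewrite ler_ln ?posrE ?exprn_gt0 ?ltr0n// -natrX ler_nat ltnW.
rewrite lnXn// -[_ *+ _]mulr_natl.
have -> : (up_log 2 Q).+1 = ((up_log 2 Q).-1 + 2)%N by rewrite addn2 prednK.
rewrite natrD; have z0 : 0 <= (up_log 2 Q).-1%:R :> R by [].
have l2 := ln2_ge_half R; have := ler_wpM2l z0 l2.
by move: z0 lq; move: ((up_log 2 Q).-1%:R : R) (ln Q%:R) (ln 2) => a b d; lra.
Qed.

Lemma weight_sum (k gam c : R) (M : nat) : 1 <= k -> 0 <= gam -> 0 < c ->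
  exists2 C : R, 0 < C & forall (A : R) (f g F G : R -> R) (y0 y1 : R) (Q h : nat),
    0 <= A -> curve k f g F G -> y1 - y0 < M%:R -> (1 < Q)%N -> (0 < h <= Q)%N ->
    pair_bound k A (1 + gam) h ->
    \sum_(p <- lattice_pts y0 y1 h) cutinv Q%:R (height F p) <=
    C * (Q%:R * h%:R * ln Q%:R + A * h%:R ^+ 2 * ln Q%:R + A * h%:R `^ (2 + gam + c)).
Proof.
move=> k1 gam0 c0; have [K K0 hK] := small_count k1 c0.
have k30 : 0 < k ^+ 3 by rewrite exprn_gt0// (lt_le_trans _ k1).
pose m : R := M%:R; have m0 : 0 <= m by [].
pose t2 : R := 2 `^ (1 + c); have t20 : 0 < t2 by rewrite powR_gt0.
exists (12 * m * K + 12 * m + 4 * m * (64 * k ^+ 3 * t2) + 1).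
  have kt0 : 0 <= 64 * k ^+ 3 * t2.
    by have := mulr_ge0 (ltW k30) (ltW t20); rewrite -mulrA; move: (k ^+ 3 * _) => z; lra.
  have h1 : 0 <= 12 * m * K by rewrite mulr_ge0 ?(ltW K0)// mulr_ge0.
  have h2 : 0 <= 12 * m by rewrite mulr_ge0.
  have h3 : 0 <= 4 * m * (64 * k ^+ 3 * t2) by rewrite mulr_ge0// mulr_ge0.
  by apply: ltr_wpDl => //; rewrite addr_ge0 ?addr_ge0.
move=> A f g F G y0 y1 Q h A0 cv yM Q1 /andP[h0 hQ] pb.
have Q0 : (0 < Q)%N by apply: ltnW.
have Qr : 0 < Q%:R :> R by rewrite ltr0n.
have hr : 0 < h%:R :> R by rewrite ltr0n.
have lq := ln_nat_ge_half R Q1.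
have lh : ln h%:R <= ln Q%:R :> R by rewrite ler_ln ?posrE// ler_nat.
have lh0 : 0 <= ln h%:R :> R by rewrite ln_ge0// ler1n.
pose Rn := up_log 2 Q; have QR : (Q <= 2 ^ Rn)%N by exact: up_logP.
pose Y : R := 64 * k ^+ 3 * (2 * h%:R) `^ (1 + c).
have kk0 : 0 <= 64 * k ^+ 3 by have := ltW k30; move: (k ^+ 3) => z; lra.
have Y0 : 0 <= Y by rewrite mulr_ge0 ?powR_ge0.
pose he : R := h%:R `^ (1 + gam); have he0 : 0 <= he by rewrite powR_ge0.
pose n r : R := (size [seq p <- lattice_pts y0 y1 h | dist_int (height F p) <= 2 ^+ r / Q%:R])%:R.
have p0 r : 0 < 2 ^+ r :> R by rewrite exprn_gt0.
have D0 r : 0 <= 2 ^+ r / Q%:R :> R by rewrite divr_ge0 ?(ltW (p0 _)) ?(ltW Qr).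
have cvd := curve_dual cv.
apply: (@le_trans _ _ (\sum_(0 <= r < Rn.+1) 2 * Q%:R / 2 ^+ r * n r)).
  apply: (@le_trans _ _ (\sum_(p <- lattice_pts y0 y1 h) \sum_(0 <= r < Rn.+1)
      2 * Q%:R / 2 ^+ r * (dist_int (height F p) <= 2 ^+ r / Q%:R)%R%:R)).
    by apply: ler_sum => p _; exact: dyadic_cutinv.
  rewrite exchange_big /=; apply: ler_sum => r _; rewrite -mulr_sumr.
  rewrite ler_wpM2l ?divr_ge0 ?mulr_ge0 ?(ltW (p0 _)) ?(ltW Qr)//.
  rewrite /n -(sum1_sizeR R) big_filter [leRHS]big_mkcond /=; apply: ler_sum => p _.
  by case: (dist_int _ <= _).
apply: (@le_trans _ _ (\sum_(0 <= r < Rn.+1) (2 * m * K * h%:R * (1 + ln h%:R) * (Q%:R / 2 ^+ r)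
   + 2 * m * A * h%:R ^+ 2 + 2 * m * A * he * (if Q%:R / 2 ^+ r < Y then Q%:R / 2 ^+ r else 0)))).
  apply: ler_sum => r _.
  have q0 : 0 <= 2 * Q%:R / 2 ^+ r :> R by rewrite divr_ge0 ?mulr_ge0 ?(ltW (p0 _)).
  have t1 : 0 <= 2 * m * K * h%:R * (1 + ln h%:R) * (Q%:R / 2 ^+ r).
    by rewrite !mulr_ge0 ?(ltW K0) ?invr_ge0 ?(ltW (p0 _))// addr_ge0.
  have t3 : 0 <= 2 * m * A * h%:R ^+ 2 by rewrite !mulr_ge0.
  (* Where [small_count] does not apply, 2^r/Q is large, which means Q/2^r < Y. *)
  have [small|large] := leP (64 * k ^+ 3 * (2 ^+ r / Q%:R * (2 * h%:R) `^ (1 + c))) 1.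
    have : n r <= m * (K * h%:R * (1 + ln h%:R)).
      by apply: (cell_count yM) => x0 s us ns; exact: (hK F G f g x0 h _ s cvd (D0 r) small us ns).
    move=> /(ler_wpM2l q0) /le_trans; apply; rewrite -addrA ler_wpDr//.
      by rewrite addr_ge0// !mulr_ge0//; case: ifP => // _; rewrite divr_ge0 ?(ltW (p0 _)).
    by rewrite le_eqVlt; apply/orP; left; apply/eqP; ring.
  have -> : Q%:R / 2 ^+ r < Y.
    rewrite ltr_pdivrMr//; move: large.
    have -> : 64 * k ^+ 3 * (2 ^+ r / Q%:R * (2 * h%:R) `^ (1 + c)) = Y * 2 ^+ r / Q%:R by rewrite /Y; ring.
    by rewrite ltr_pdivlMr// mul1r.
  have : n r <= m * (A * (2 ^+ r / Q%:R * h%:R ^+ 2 + he)).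
    by apply: (cell_count yM) => x0 s us ns; exact: (pb F G f g x0 _ s cvd (D0 r) us ns).
  move=> /(ler_wpM2l q0) /le_trans; apply; rewrite -addrA ler_wpDl//.
  rewrite le_eqVlt; apply/orP; left; apply/eqP.
  have := p0 r; move: (2 ^+ r) => z z0; field.
  by rewrite !gt_eqF.
rewrite !big_split /= -[X in X + _ + _]mulr_sumr -[X in _ + _ + X]mulr_sumr.
have -> : \sum_(0 <= i < Rn.+1) 2 * m * A * h%:R ^+ 2 = Rn.+1%:R * (2 * m * A * h%:R ^+ 2).
  by rewrite big_const_nat subn0 iter_addr_0 -[LHS]mulr_natl.
have s1 := sum_half_pow Rn.+1 (ltW Qr); have s3 := sum_half_pow_lt Rn.+1 (ltW Qr) Y0.
have RL := up_log2_le_ln Q1; rewrite -/Rn in RL.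
have YE : he * Y = 64 * k ^+ 3 * t2 * h%:R `^ (2 + gam + c).
  have -> : 2 + gam + c = (1 + gam) + (1 + c) by ring.
  rewrite powRD; last by rewrite (gt_eqF hr) implybT.
  by rewrite /Y powRM//; rewrite /he /t2; ring.
set X1 := Q%:R * h%:R * ln Q%:R; set X2 := A * h%:R ^+ 2 * ln Q%:R; set X3 := A * h%:R `^ (2 + gam + c).
have X10 : 0 <= X1 by rewrite !mulr_ge0// (le_trans _ lq).
have X20 : 0 <= X2 by rewrite !mulr_ge0// (le_trans _ lq).
have X30 : 0 <= X3 by rewrite !mulr_ge0// powR_ge0.
have b1 : 2 * m * K * h%:R * (1 + ln h%:R) * (\sum_(0 <= r < Rn.+1) Q%:R / 2 ^+ r) <= 12 * m * K * X1.
  apply: (@le_trans _ _ (2 * m * K * h%:R * (3 * ln Q%:R) * (2 * Q%:R))).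
    apply: ler_pM => //.
    - by rewrite !mulr_ge0 ?(ltW K0)// addr_ge0.
    - by apply: sumr_ge0 => r _; rewrite divr_ge0 ?(ltW (p0 _)).
    by rewrite ler_wpM2l ?mulr_ge0 ?(ltW K0)//; lra.
  by rewrite le_eqVlt; apply/orP; left; apply/eqP; rewrite /X1; ring.
have b2 : Rn.+1%:R * (2 * m * A * h%:R ^+ 2) <= 12 * m * X2.
  apply: (@le_trans _ _ (6 * ln Q%:R * (2 * m * A * h%:R ^+ 2))); first by rewrite ler_wpM2r// !mulr_ge0.
  by rewrite le_eqVlt; apply/orP; left; apply/eqP; rewrite /X2; ring.
have b3 : 2 * m * A * he * (\sum_(0 <= r < Rn.+1) (if Q%:R / 2 ^+ r < Y then Q%:R / 2 ^+ r else 0))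
   <= 4 * m * (64 * k ^+ 3 * t2) * X3.
  apply: (@le_trans _ _ (2 * m * A * he * (2 * Y))); first by rewrite ler_wpM2l// !mulr_ge0.
  have -> : 2 * m * A * he * (2 * Y) = 4 * m * A * (he * Y) by ring.
  by rewrite YE le_eqVlt; apply/orP; left; apply/eqP; rewrite /X3; ring.
apply: (le_trans (lerD (lerD b1 b2) b3)).
set u1 := 12 * m * K; set u2 := 12 * m; set u3 := 4 * m * _.
have u10 : 0 <= u1 by rewrite !mulr_ge0 ?(ltW K0).
have u20 : 0 <= u2 by rewrite mulr_ge0.
have u30 : 0 <= u3 by apply: mulr_ge0; [exact: mulr_ge0|exact: mulr_ge0 kk0 (ltW t20)].
have m1 := mulr_ge0 u10 X20; have m2 := mulr_ge0 u10 X30; have m3 := mulr_ge0 u20 X10.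
have m4 := mulr_ge0 u20 X30; have m5 := mulr_ge0 u30 X10; have m6 := mulr_ge0 u30 X20.
move: m1 m2 m3 m4 m5 m6 X10 X20 X30; clearbody u1 u2 u3 X1 X2 X3; move: u1 u2 u3 X1 X2 X3 {b1 b2 b3 u10 u20 u30}.
by move=> a1 a2 a3 z1 z2 z3; lra.
Qed.

End WeightSum.

(** * Discrepancy of the heights along a curve *)

Section CurveDiscrepancy.
Variable R : realType.

Lemma expsum_const_gt0 (k Lam : R) : 1 <= k -> 0 < Lam -> 0 < expsum_const k Lam.
Proof.
move=> k1 L0; have k0 : 0 < k by apply: lt_le_trans k1.
have h1 : 0 < (Lam + 5) * (1 + 3 * k * Lam) by rewrite mulr_gt0 ?addr_gt0 ?mulr_gt0.
have h2 : 0 < k ^+ 8 * (4 + 280 * k) by apply: mulr_gt0; [exact: exprn_gt0|lra].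
rewrite /expsum_const; move: h1 h2.
have -> : 32 * (Lam + 5) * (1 + 3 * k * Lam) = 32 * ((Lam + 5) * (1 + 3 * k * Lam)) by ring.
have -> : 1000 * k ^+ 8 * (4 + 280 * k) = 1000 * (k ^+ 8 * (4 + 280 * k)) by ring.
by move: (_ * (1 + _)) (k ^+ 8 * _) => a b; lra.
Qed.

Variables (k : R) (f g F G : R -> R) (Q : nat) (eta xi Lam B : R).
Hypotheses (cv : curve k f g F G) (Q1 : (1 < Q)%N) (exi : eta < xi) (xiL : xi <= eta + Lam).
Hypothesis (B0 : 0 <= B).

Let k1 : 1 <= k. Proof. exact: curve_k1 cv. Qed.
Let Lam0 : 0 < Lam. Proof. by move: exi xiL; lra. Qed.
Let CE0 := expsum_const_gt0 k1 Lam0.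

(** Exchanging the roles of l and j, the weights of all exponential sums up to L form a sum over
    dual fractions. The linear bound in h on it is combined with the factors 1 / sqrt l by partial
    summation. *)
Lemma expsum_total L : (L <= Q)%N ->
  (forall h, (0 < h <= L)%N ->
    \sum_(p <- lattice_pts (g (eta - 1)) (g (xi + 1)) h) cutinv Q%:R (height F p) <= B * h%:R) ->
  \sum_(1 <= l < L.+1) `|cossum [seq height f p | p <- lattice_pts eta xi Q] l| <=
  expsum_const k Lam * (2 * B * Num.sqrt Q%:R * Num.sqrt L%:R
    + 2 * Q%:R * Num.sqrt Q%:R * Num.sqrt L%:R + L%:R * (Q%:R * ln Q%:R)).
Proof.
move=> LQ hW.
pose w l : R := \sum_(m <- zseq (l%:R * g (eta - 1)) (l%:R * g (xi + 1))) cutinv Q%:R (l%:R * F (m%:~R / l%:R)).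
have wE h : \sum_(1 <= l < h.+1) w l =
   \sum_(p <- lattice_pts (g (eta - 1)) (g (xi + 1)) h) cutinv Q%:R (height F p).
  rewrite /lattice_pts big_allpairs_dep; apply: eq_bigr => l _.
  by rewrite /w ![l%:R * g _]mulrC.
have sQ0 : 0 <= Num.sqrt Q%:R :> R by rewrite sqrtr_ge0.
apply: (@le_trans _ _ (\sum_(1 <= l < L.+1) expsum_const k Lam *
   (Num.sqrt Q%:R * (w l / Num.sqrt l%:R) + Q%:R * Num.sqrt Q%:R * (Num.sqrt l%:R)^-1 + Q%:R * ln Q%:R))).
  apply: ler_sum_nat => l; rewrite ltnS => /andP[l0 lL].
  have := expsum_bound cv Q1 l0 (leq_trans lL LQ) exi xiL.
  rewrite -/(w l) (_ : Num.sqrt (Q%:R / l%:R) = Num.sqrt Q%:R / Num.sqrt l%:R :> R); last first.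
    by rewrite sqrtrM// sqrtrV.
  move=> /le_trans; apply; rewrite ler_pM2l// lerD2r.
  by rewrite le_eqVlt; apply/orP; left; apply/eqP; ring.
rewrite -mulr_sumr ler_pM2l// !big_split /= -[X in X + _ + _]mulr_sumr -[X in _ + X + _]mulr_sumr.
have a1 : \sum_(1 <= l < L.+1) w l / Num.sqrt l%:R <= 2 * B * Num.sqrt L%:R.
  apply: abel_sqrt => // h hL; rewrite wE; case: h hL => [|h] hL; last exact: hW.
  by rewrite mulr0 /lattice_pts /index_iota /= big_nil.
have a2 : \sum_(1 <= l < L.+1) (Num.sqrt l%:R)^-1 <= 2 * Num.sqrt L%:R :> R.
  by rewrite big_add1 /=; exact: sum_invsqrt.
apply: lerD; last by rewrite big_const_nat subSS subn0 iter_addr_0 -[leLHS]mulr_natl.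
apply: lerD.
  apply: (le_trans (ler_wpM2l sQ0 a1)).
  by rewrite le_eqVlt; apply/orP; left; apply/eqP; ring.
have a3 : 0 <= Q%:R * Num.sqrt Q%:R :> R by rewrite mulr_ge0.
apply: (le_trans (ler_wpM2l a3 a2)).
by rewrite le_eqVlt; apply/orP; left; apply/eqP; ring.
Qed.

Lemma curve_discrepancy (J : nat) (d : R) (P := (size (lattice_pts eta xi Q))%:R : R) :
  (0 < J)%N -> ((2 * J).-1 <= Q)%N -> J%:R^-1 <= d -> d < 2^-1 ->
  (forall h, (0 < h <= (2 * J).-1)%N ->
    \sum_(p <- lattice_pts (g (eta - 1)) (g (xi + 1)) h) cutinv Q%:R (height F p) <= B * h%:R) ->
  `|(count (fun p => dist_int (height f p) < d) (lattice_pts eta xi Q))%:R - 2 * d * P| <=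
  discrepancy_const R * (P / J%:R + d * (expsum_const k Lam * (2 * B * Num.sqrt Q%:R * Num.sqrt (2 * J%:R)
    + 2 * Q%:R * Num.sqrt Q%:R * Num.sqrt (2 * J%:R) + 2 * J%:R * (Q%:R * ln Q%:R)))).
Proof.
move=> J0 JQ Jd d2 hW; pose ys := [seq height f p | p <- lattice_pts eta xi Q].
have := discrepancy_bound ys J0 Jd d2.
rewrite /ys count_map size_map -/P => /le_trans; apply.
have dc : 0 <= discrepancy_const R.
  by rewrite /discrepancy_const; have := exprn_ge0 4 (pi_ge0 R); move: (pi ^+ 4) => z; lra.
have d0 : 0 <= d by apply: le_trans Jd; rewrite invr_ge0.
apply: (ler_wpM2l dc); rewrite lerD2l ler_wpM2l//.
have J2 : (0 < 2 * J)%N by rewrite muln_gt0.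
have := expsum_total JQ hW; rewrite prednK// => /le_trans; apply.
rewrite ler_pM2l//.
have LJ : (2 * J).-1%:R <= 2 * J%:R :> R by rewrite -natrM ler_nat leq_pred.
have sL : Num.sqrt (2 * J).-1%:R <= Num.sqrt (2 * J%:R) :> R by rewrite ler_wsqrtr.
have lq := ln_nat_ge_half R Q1.
by rewrite !lerD// ?ler_wpM2l ?ler_wpM2r ?mulr_ge0 ?sqrtr_ge0// (le_trans _ lq).
Qed.

End CurveDiscrepancy.

(** * Bootstrapping the count of fractions near a curve *)

Section PairBound.
Variable R : realType.

Lemma powRDp (a r s : R) : 0 < a -> a `^ (r + s) = a `^ r * a `^ s.
Proof. by move=> a0; apply: powRD; rewrite (gt_eqF a0) implybT. Qed.

Lemma ln_le_powR (x e : R) : 0 < x -> 0 < e -> ln x <= e^-1 * x `^ e.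
Proof.
move=> x0 e0; rewrite mulrC ler_pdivlMr// mulrC -ln_powR.
have p0 : 0 < x `^ e by rewrite powR_gt0.
have -> : x `^ e = 1 + (x `^ e - 1) by rewrite addrC subrK.
have h : -1 < x `^ e - 1 by lra.
by apply: le_trans (le_ln1Dx h) _; lra.
Qed.

Lemma powR_large (e Z : R) : 0 < e -> 0 <= Z ->
  exists n0 : nat, forall x : R, n0%:R <= x -> Z <= x `^ e.
Proof.
move=> e0 Z0; exists (Num.truncn (Z `^ e^-1)).+1 => x nx.
have zx : Z `^ e^-1 <= x by apply: le_trans nx; rewrite ltW// truncnS_gt.
have -> : Z = (Z `^ e^-1) `^ e by rewrite -powRrM mulVf ?gt_eqF// powRr1.
by rewrite ge0_ler_powR ?nnegrE ?powR_ge0 ?(ltW e0)// (le_trans _ zx)// powR_ge0.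
Qed.

Lemma close_sub (f : R -> R) (x0 D d : R) H (s : seq (int * nat)) : D < d -> uniq s ->
  (forall p, p \in s -> close_pair f x0 H D p) ->
  (size s <= count (fun p => dist_int (height f p) < d)%R (lattice_pts (x0 - 1) (x0 + 1) H))%N.
Proof.
move=> Dd us ns; rewrite -size_filter; apply: uniq_leq_size => // p /ns[q0 qH /andP[a b] h].
rewrite mem_filter mem_lattice_pts q0 qH (le_lt_trans h Dd) /=.
have qr : 0 < p.2%:R :> R by rewrite ltr0n.
rewrite -ltr_pdivlMr// -ler_pdivrMr// b andbT; lra.
Qed.

Lemma size_unit_pts (x0 : R) H : (size (lattice_pts (x0 - 1) (x0 + 1) H))%:R <= 4 * H%:R ^+ 2 :> R.
Proof.
have : x0 - 1 <= x0 + 1 by lra.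
move=> /(size_lattice_pts H); have -> : x0 + 1 - (x0 - 1) = 2 by ring.
have : H%:R <= H%:R ^+ 2 :> R by rewrite -natrX ler_nat; case: H => // H; rewrite -mulnn leq_pmulr.
by rewrite ler_norml => h /andP[_]; lra.
Qed.

(** Here X is the scale H and l its logarithm. Since 1/D <= X^(1-g), one has s/D <= X^(1-g/2); with
    c = g/4 the worst exponent is 1 - g/2 + (1-g)(5g/4), below 1 + 3g/4. The logarithms are absorbed
    in X^(g/8), and s X l is split by the arithmetic-geometric mean inequality. *)
Lemma mid_terms (X D l g c W A : R) (L0 := 8 / g)
    (B := W * (X * l + A * (2 / D) * l + A * (2 / D) `^ (1 + g + c))) : 1 <= X -> 0 < D -> 0 < g -> g < 1 -> c = g / 4 ->
  0 <= W -> 0 <= A -> 0 <= l -> l <= L0 * X `^ (g / 8) -> X `^ (g - 1) <= D ->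
  Num.sqrt (X * D) * B <= W * (X ^+ 2 * D + (L0 ^+ 2 + A * (2 * L0 + 8)) * X `^ (1 + 3 * g / 4)).
Proof.
move=> X1 D0 g0 g1 cE W0 A0 l0 lX XD.
have X0 : 0 < X by apply: lt_le_trans X1.
have L00 : 0 < L0 by rewrite divr_gt0.
set Y := X `^ (1 + 3 * g / 4).
have Y0 : 0 <= Y by rewrite powR_ge0.
pose s := Num.sqrt (X * D); have s0 : 0 <= s by rewrite sqrtr_ge0.
have s2 : s ^+ 2 = X * D by rewrite sqr_sqrtr// mulr_ge0 ?ltW.
have iD : D^-1 <= X `^ (1 - g).
  have -> : 1 - g = - (g - 1) by ring.
  by rewrite powRN lef_pV2 ?posrE// powR_gt0.
have a1 : s * (X * l) <= X ^+ 2 * D + L0 ^+ 2 * Y.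
  have h : s * (X * l) <= X ^+ 2 * D + X * l ^+ 2.
    have -> : X ^+ 2 * D = X * s ^+ 2 by rewrite s2; ring.
    have := sqr_ge0 (s - l); have := mulr_ge0 s0 l0.
    rewrite mulrCA -mulrDr ler_pM2l// sqrrB; set z := s * l; lra.
  apply: (le_trans h); rewrite lerD2l.
  have : l ^+ 2 <= (L0 * X `^ (g / 8)) ^+ 2.
    by rewrite ler_pXn2r ?nnegrE// mulr_ge0 ?powR_ge0// ltW.
  move=> /(ler_wpM2l (ltW X0)) /le_trans; apply.
  have -> : X * (L0 * X `^ (g / 8)) ^+ 2 = L0 ^+ 2 * X `^ (1 + g / 8 + g / 8).
    by rewrite !powRDp// powRr1 ?(ltW X0)//; ring.
  by rewrite ler_wpM2l ?sqr_ge0// ler_powR//; lra.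
have sD : s / D <= X `^ (1 - g / 2).
  rewrite -(@ler_pXn2r _ 2) ?nnegrE ?divr_ge0 ?powR_ge0 ?(ltW D0)//.
  rewrite exprMn s2 exprVn.
  have -> : X * D / D ^+ 2 = X * D^-1 by field; rewrite gt_eqF.
  have -> : (X `^ (1 - g / 2)) ^+ 2 = X * X `^ (1 - g).
    rewrite -powR_mulrn ?powR_ge0// -powRrM.
    have -> : (1 - g / 2) * 2 = 1 + (1 - g) by field.
    by rewrite powRDp// powRr1// ltW.
  by rewrite ler_pM2l.
have a2 : s * (A * (2 / D) * l) <= A * (2 * L0) * Y.
  have -> : s * (A * (2 / D) * l) = 2 * A * (s / D * l) by ring.
  have : s / D * l <= X `^ (1 - g / 2) * (L0 * X `^ (g / 8)) by rewrite ler_pM ?divr_ge0 ?(ltW D0).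
  have c0 : 0 <= 2 * A by rewrite mulr_ge0.
  move=> /(ler_wpM2l c0) /le_trans; apply.
  have -> : 2 * A * (X `^ (1 - g / 2) * (L0 * X `^ (g / 8))) = A * (2 * L0) * X `^ (1 - g / 2 + g / 8).
    by rewrite [X in _ = _ * X]powRDp//; ring.
  apply: ler_wpM2l; first by rewrite mulr_ge0// mulr_ge0// ltW.
  by apply: ler_powR => //; lra.
have a3 : s * (A * (2 / D) `^ (1 + g + c)) <= A * 8 * Y.
  have D2 : 0 < 2 / D by rewrite divr_gt0.
  have i0 : 0 < D^-1 by rewrite invr_gt0.
  have -> : (2 / D) `^ (1 + g + c) = 2 `^ (1 + g + c) * (D^-1 * D^-1 `^ (g + c)).
    by rewrite powRM ?(ltW i0)// -addrA [in X in _ * X]powRDp// powRr1// ltW.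
  have t8 : 2 `^ (1 + g + c) <= 8 :> R.
    have -> : 8 = 2 `^ 3%:R :> R by rewrite powR_mulrn// !exprS expr0; ring.
    by rewrite ler_powR ?ler1n// cE; lra.
  have dg : D^-1 `^ (g + c) <= X `^ ((1 - g) * (g + c)).
    by rewrite powRrM ge0_ler_powR ?nnegrE ?powR_ge0 ?(ltW i0)// cE; lra.
  have -> : s * (A * (2 `^ (1 + g + c) * (D^-1 * D^-1 `^ (g + c)))) = A * (2 `^ (1 + g + c)) * (s / D * D^-1 `^ (g + c)) by ring.
  apply: ler_pM; rewrite ?mulr_ge0 ?powR_ge0 ?invr_ge0 ?(ltW D0)//; first by rewrite ler_wpM2l.
  apply: (@le_trans _ _ (X `^ (1 - g / 2) * X `^ ((1 - g) * (g + c)))).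
    by apply: ler_pM; rewrite ?powR_ge0 ?divr_ge0 ?(ltW D0).
  rewrite -powRDp// ler_powR// cE; nra.
have -> : s * B = W * (s * (X * l) + s * (A * (2 / D) * l) + s * (A * (2 / D) `^ (1 + g + c))) by rewrite /B; ring.
rewrite ler_wpM2l//; move: a1 a2 a3; move: (s * _) (s * _) (s * _) (X ^+ 2 * D) => z1 z2 z3 z4.
lra.
Qed.

Lemma discrepancy_const_ge0 : 0 <= discrepancy_const R.
Proof.
by rewrite /discrepancy_const; have := exprn_ge0 4 (pi_ge0 R); move: (pi ^+ 4) => z; lra.
Qed.

Lemma mid_arith (z y a b w q A : R) : 0 <= z -> 0 <= y -> 0 <= a -> 0 <= b -> 0 <= w -> 0 <= q ->
  16 * z + a * (8 * z + b * (8 * (w * (z + (q ^+ 2 + A * (2 * q + 8)) * y)) + 8 * (z + y) + 4 * (q * y))) <=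
  (8 * (2 + a) + a * b * (8 * w * (1 + q ^+ 2) + 16 + 4 * q)) * z +
  (8 * (2 + a) + a * b * (8 * w * (1 + q ^+ 2) + 16 + 4 * q) + a * b * (8 * w * (2 * q + 8)) * A) * y.
Proof.
move=> z0 y0 a0 b0 w0 q0; have ab := mulr_ge0 a0 b0; have abw := mulr_ge0 ab w0.
have u1 := mulr_ge0 ab z0; have u2 := mulr_ge0 ab y0; have u3 := mulr_ge0 abw z0; have u4 := mulr_ge0 abw y0.
have u5 := mulr_ge0 (mulr_ge0 abw (sqr_ge0 q)) z0.
have u6 := mulr_ge0 (mulr_ge0 ab q0) z0; have u7 := mulr_ge0 a0 y0.
lra.
Qed.

Lemma mid_real (X D l J P N B Y W L0 E Dc A : R) (sq := Num.sqrt (X * D)) :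
  1 <= X -> 0 < D -> 0 < J -> J^-1 <= 2 * D -> 2 * J <= 2 / D -> 0 <= P -> P <= 4 * X ^+ 2 ->
  0 <= Dc -> 0 < E -> 0 <= W -> 0 <= L0 -> 0 <= A -> 0 <= l -> 0 <= B -> X <= Y -> X * l <= L0 * Y ->
  sq * B <= W * (X ^+ 2 * D + (L0 ^+ 2 + A * (2 * L0 + 8)) * Y) ->
  N - 2 * (2 * D) * P <= Dc * (P / J + 2 * D * (E * (2 * B * Num.sqrt X * Num.sqrt (2 * J)
    + 2 * X * Num.sqrt X * Num.sqrt (2 * J) + 2 * J * (X * l)))) ->
  N <= (8 * (2 + Dc) + Dc * E * (8 * W * (1 + L0 ^+ 2) + 16 + 4 * L0)) * (D * X ^+ 2) +
  (8 * (2 + Dc) + Dc * E * (8 * W * (1 + L0 ^+ 2) + 16 + 4 * L0) + Dc * E * (8 * W * (2 * L0 + 8)) * A) * Y.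
Proof.
move=> X1 D0 J0 Jd JD P0 PX Dc0 E0 W0 L00 A0 l0 B0 XY Xl mt hN.
have X0 : 0 < X by apply: lt_le_trans X1.
have D2 : 0 < 2 / D by rewrite divr_gt0.
have sq0 : 0 <= sq by rewrite sqrtr_ge0.
have c2 : 0 <= 2 * D by rewrite mulr_ge0// ltW.
have PJ : P / J <= 8 * (D * X ^+ 2).
  have -> : 8 * (D * X ^+ 2) = 4 * X ^+ 2 * (2 * D) by ring.
  by apply: ler_pM; rewrite ?invr_ge0 ?(ltW J0).
have dP : 2 * (2 * D) * P <= 16 * (D * X ^+ 2).
  have -> : 16 * (D * X ^+ 2) = 2 * (2 * D) * (4 * X ^+ 2) by ring.
  by rewrite ler_wpM2l// mulr_ge0.
have ds : 2 * D * (Num.sqrt X * Num.sqrt (2 * J)) <= 4 * sq.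
  rewrite -sqrtrM ?(ltW X0)//.
  have : Num.sqrt (X * (2 * J)) <= Num.sqrt (X * (2 / D)) by rewrite ler_wsqrtr// ler_pM2l.
  have -> : X * (2 / D) = (2 / D ^+ 2) * (X * D) by field; rewrite gt_eqF.
  rewrite [Num.sqrt (2 / D ^+ 2 * _)]sqrtrM; last by rewrite divr_ge0// exprn_ge0// ltW.
  rewrite -/sq => h.
  have s2 : Num.sqrt (2 / D ^+ 2) <= 2 / D.
    rewrite -[leRHS]ger0_norm ?(ltW D2)// -sqrtr_sqr ler_wsqrtr// expr_div_n.
    by rewrite ler_wpM2r ?invr_ge0 ?exprn_ge0 ?(ltW D0)// expr2; lra.
  apply: (le_trans (ler_wpM2l c2 h)).
  have -> : 4 * sq = 2 * D * (2 / D * sq) by field; rewrite gt_eqF.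
  by rewrite ler_wpM2l// ler_wpM2r.
have Xs : X * sq <= X ^+ 2 * D + Y.
  have s2 : sq ^+ 2 = X * D by rewrite sqr_sqrtr// mulr_ge0 ?ltW.
  have : sq <= X * D + 1 by rewrite -s2; nra.
  by move=> /(ler_wpM2l (ltW X0)); rewrite mulrDr mulr1 => /le_trans; apply; rewrite mulrA -expr2 lerD2l.
have Y0 : 0 <= Y by apply: le_trans XY; rewrite ltW.
have Jl : 2 * D * (2 * J * (X * l)) <= 4 * (L0 * Y).
  have -> : 4 * (L0 * Y) = 2 * D * (2 / D * (L0 * Y)) by field; rewrite gt_eqF.
  by apply: (ler_wpM2l c2); apply: ler_pM => //; rewrite mulr_ge0// ltW.
have R1 : 2 * D * (E * (2 * B * Num.sqrt X * Num.sqrt (2 * J) + 2 * X * Num.sqrt X * Num.sqrt (2 * J)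
      + 2 * J * (X * l))) <= E * (8 * (sq * B) + 8 * (X * sq) + 4 * (L0 * Y)).
  have -> : 2 * D * (E * (2 * B * Num.sqrt X * Num.sqrt (2 * J) + 2 * X * Num.sqrt X * Num.sqrt (2 * J)
      + 2 * J * (X * l))) = E * ((2 * B + 2 * X) * (2 * D * (Num.sqrt X * Num.sqrt (2 * J)))
      + 2 * D * (2 * J * (X * l))) by ring.
  rewrite ler_pM2l//; apply: lerD => //.
  have -> : 8 * (sq * B) + 8 * (X * sq) = (2 * B + 2 * X) * (4 * sq) by ring.
  by rewrite ler_wpM2l// addr_ge0// mulr_ge0// ltW.
have R2 : E * (8 * (sq * B) + 8 * (X * sq) + 4 * (L0 * Y)) <=
   E * (8 * (W * (X ^+ 2 * D + (L0 ^+ 2 + A * (2 * L0 + 8)) * Y)) + 8 * (X ^+ 2 * D + Y) + 4 * (L0 * Y)).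
  by rewrite ler_pM2l// lerD2r; apply: lerD; rewrite ler_pM2l.
have N2 := ler_wpM2l Dc0 (lerD PJ (le_trans R1 R2)).
have N1 := lerD (le_trans hN N2) dP; rewrite subrK addrC in N1.
apply: (le_trans N1); rewrite [X ^+ 2 * D]mulrC.
by apply: mid_arith => //; rewrite ?mulr_ge0 ?sqr_ge0// ltW.
Qed.

(** One round of the bootstrap: from the exponent 1 + gam at all smaller scales to 1 + 3 gam / 4 at
    scale H, through the discrepancy bound for the curve and [weight_sum] for its dual. *)
Lemma mid_count (k gam : R) : 1 <= k -> 0 < gam -> gam < 1 ->
  exists C1 C2 : R, exists2 H1 : nat, 0 <= C1 /\ 0 <= C2 &
  forall A (H : nat) f g F G (x0 D : R) (s : seq (int * nat)), 0 <= A -> (H1 <= H)%N ->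
    (forall h, (h < H)%N -> pair_bound k A (1 + gam) h) -> curve k f g F G ->
    H%:R `^ (gam - 1) <= D -> D <= 1 / 8 -> uniq s -> (forall p, p \in s -> close_pair f x0 H D p) ->
    (size s)%:R <= C1 * (D * H%:R ^+ 2) + (C1 + C2 * A) * H%:R `^ (1 + 3 * gam / 4).
Proof.
move=> k1 gam0 gam1; have k0 : 0 < k by apply: lt_le_trans k1.
pose c := gam / 4; have c0 : 0 < c by rewrite divr_gt0.
pose M := (Num.truncn (8 * k)).+1.
have [W W0 hW] := weight_sum M k1 (ltW gam0) c0.
pose L0 := 8 / gam; have L00 : 0 < L0 by rewrite divr_gt0.
pose E := expsum_const k 2; have E0 : 0 < E by apply: expsum_const_gt0.
pose Dc := discrepancy_const R; have Dc0 : 0 <= Dc by exact: discrepancy_const_ge0.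
have DE : 0 <= Dc * E by rewrite mulr_ge0// ltW.
have [n0 hn0] := powR_large gam0 (ler0n R 2).
pose C1 := 8 * (2 + Dc) + Dc * E * (8 * W * (1 + L0 ^+ 2) + 16 + 4 * L0).
pose C2 := Dc * E * (8 * W * (2 * L0 + 8)).
have W8 : 0 <= 8 * W by rewrite mulr_ge0// ltW.
exists C1, C2; exists (maxn n0 2).
  have L2 := sqr_ge0 L0; have L1 := ltW L00.
  split; last by rewrite mulr_ge0// mulr_ge0//; lra.
  have z1 := mulr_ge0 W8 (addr_ge0 ler01 L2).
  by rewrite /C1 addr_ge0//; [lra|rewrite mulr_ge0//; lra].
move=> A H f g F G x0 D s A0; rewrite geq_max => /andP[Hn0 H2] IH cv XD D8 us ns.
have H0 : (0 < H)%N by apply: ltnW.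
pose X : R := H%:R; rewrite -/X in XD *.
have X0 : 0 < X by rewrite ltr0n.
have X1 : 1 <= X by rewrite ler1n.
have D0 : 0 < D by apply: lt_le_trans XD; rewrite powR_gt0.
pose l := ln X; have lh : 1 / 2 <= l by exact: ln_nat_ge_half.
have l0 : 0 <= l by lra.
have lX : l <= L0 * X `^ (gam / 8).
  have g8 : 0 < gam / 8 by rewrite divr_gt0.
  by apply: le_trans (ln_le_powR X0 g8) _; rewrite invf_div.
(* J is about 1/(2D), so that the discrepancy bound applies with d = 2D, while the dual denominators
   stay below 2J <= 2/D and hence below H, within reach of the induction hypothesis. *)
pose J := (Num.truncn (2 * D)^-1).+1.
have i2D : 0 < (2 * D)^-1 by rewrite invr_gt0 mulr_gt0.
have J0 : (0 < J)%N by [].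
have Jd : J%:R^-1 <= 2 * D.
  rewrite -[leRHS]invrK lef_pV2 ?posrE// ?ltr0n// ltW// truncnS_gt//.
have JD : 2 * J%:R <= 2 / D.
  rewrite ler_pM2l//; have := truncn_le (2 * D)^-1; rewrite (ltW i2D) => h.
  have e : (2 * D)^-1 = D^-1 / 2 by field; rewrite gt_eqF.
  have JE : J%:R = (Num.truncn (2 * D)^-1)%:R + 1 :> R by rewrite natr1.
  have D1 : 8 <= D^-1 by rewrite -[8]invrK lef_pV2 ?posrE//; lra.
  move: h; rewrite JE; move: ((Num.truncn (2 * D)^-1)%:R : R) => t; rewrite e => h; lra.
have JH : (2 * J <= H)%N.
  rewrite -(ler_nat R) natrM -/X; apply: (le_trans JD).
  have iD : D^-1 <= X `^ (1 - gam).
    have -> : 1 - gam = - (gam - 1) by ring.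
    by rewrite powRN lef_pV2 ?posrE// powR_gt0.
  have : 2 <= X `^ gam by apply: hn0; rewrite ler_nat.
  have e : X `^ (1 - gam) * X `^ gam = X by rewrite -powRDp// subrK powRr1// ltW.
  have p0 : 0 <= X `^ (1 - gam) by rewrite powR_ge0.
  by move: iD p0 e; move: (X `^ (1 - gam)) (X `^ gam) (D^-1) => a b d; nra.
pose B := W * (X * l + A * (2 / D) * l + A * (2 / D) `^ (1 + gam + c)).
have D2 : 0 < 2 / D by rewrite divr_gt0.
have B0 : 0 <= B.
  apply: mulr_ge0 (ltW W0) _; apply: addr_ge0; last by rewrite mulr_ge0// powR_ge0.
  by apply: addr_ge0; [exact: mulr_ge0 (ltW X0) l0|exact: mulr_ge0 (mulr_ge0 A0 (ltW D2)) l0].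
have exi : x0 - 1 < x0 + 1 by lra.
have xiL : x0 + 1 <= x0 - 1 + 2 by lra.
have yM : g (x0 + 1 + 1) - g (x0 - 1 - 1) < M%:R.
  have xx : x0 - 1 - 1 <= x0 + 1 + 1 by lra.
  have /andP[_ h] := curve_g_incr cv xx; apply: le_lt_trans (truncnS_gt (8 * k)).
  by apply: (le_trans h); rewrite le_eqVlt; apply/orP; left; apply/eqP; ring.
have hB h : (0 < h <= (2 * J).-1)%N ->
    \sum_(p <- lattice_pts (g (x0 - 1 - 1)) (g (x0 + 1 + 1)) h) cutinv X (height F p) <= B * h%:R.
  move=> /andP[h0 hJ]; have J2 : (0 < 2 * J)%N by rewrite muln_gt0.
  have hJ2 : (h < 2 * J)%N by rewrite -(prednK J2) ltnS.
  have hH : (h < H)%N by apply: leq_trans JH.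
  have hr : 0 < h%:R :> R by rewrite ltr0n.
  have hD : h%:R <= 2 / D.
    by apply: le_trans JD; rewrite -natrM ler_nat ltnW.
  have hh : (0 < h <= H)%N by rewrite h0 ltnW.
  apply: (le_trans (hW A f g F G _ _ H h A0 cv yM H2 hh (IH _ hH))).
  rewrite -/X -/l /B -[leRHS]mulrA ler_pM2l// 2!(mulrDl _ _ h%:R).
  have -> : A * h%:R `^ (2 + gam + c) = A * h%:R `^ (1 + gam + c) * h%:R.
    have -> : 2 + gam + c = 1 + gam + c + 1 by ring.
    by rewrite powRDp// powRr1 ?(ltW hr)// mulrA.
  apply: lerD; last first.
    by rewrite ler_wpM2r// ler_wpM2l// ge0_ler_powR ?nnegrE ?(ltW D2)//; lra.
  apply: lerD; first by rewrite mulrAC.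
  have -> : A * h%:R ^+ 2 * l = A * h%:R * l * h%:R by ring.
  by rewrite ler_wpM2r// ler_wpM2r// ler_wpM2l.
have JQ : ((2 * J).-1 <= H)%N by apply: leq_trans (leq_pred _) JH.
have d2 : 2 * D < 2^-1 by lra.
have := curve_discrepancy cv H2 exi xiL B0 J0 JQ Jd d2 hB.
have Dd : D < 2 * D by lra.
have := close_sub Dd us ns; rewrite -(ler_nat R).
have := size_unit_pts x0 H; rewrite -/X -/Dc -/E -/l.
set P := (size (lattice_pts _ _ _))%:R => PX.
move=> sN; rewrite ler_norml => /andP[_ hN]; apply: (le_trans sN).
have mt := mid_terms X1 D0 gam0 gam1 (erefl : c = gam / 4) (ltW W0) A0 l0 lX XD.
rewrite -/B -/L0 in mt; set Y := X `^ (1 + 3 * gam / 4) in mt *.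
have XY : X <= Y by rewrite -{1}[X]powRr1 ?(ltW X0)// ler_powR//; lra.
have Xl : X * l <= L0 * Y.
  apply: (le_trans (ler_wpM2l (ltW X0) lX)).
  have -> : X * (L0 * X `^ (gam / 8)) = L0 * X `^ (1 + gam / 8) by rewrite powRDp// powRr1 ?(ltW X0)//; ring.
  by rewrite ler_pM2l// ler_powR//; lra.
have J0r : 0 < J%:R :> R by rewrite ltr0n.
have P0 : 0 <= P by [].
exact: (mid_real X1 D0 J0r Jd JD P0 PX Dc0 E0 (ltW W0) (ltW L00) A0 l0 B0 XY Xl mt hN).
Qed.

(** Strong induction on H through [mid_count]. Small H and D > 1/8 are covered by the trivial count
    4 H^2. *)
Lemma pair_bound_ex (k gam : R) : 1 <= k -> 0 < gam -> gam < 1 ->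
  exists2 A : R, 0 < A & forall H, pair_bound k A (1 + gam) H.
Proof.
move=> k1 gam0 gam1; have [C1 [C2 [H1 [C10 C20] mid]]] := mid_count k1 gam0 gam1.
have g4 : 0 < gam / 4 by rewrite divr_gt0.
have g1 : 0 < 1 - gam by rewrite subr_gt0.
have C24 : 0 <= 4 * C2 by rewrite mulr_ge0.
have [n2 h2] := powR_large g4 C24; have [n3 h3] := powR_large g1 (ler0n R 8).
pose H3 := maxn (maxn H1 1) (maxn n2 n3).
pose A : R := 32 + 4 * C1 + 4 * H3%:R.
have H30 : 0 <= H3%:R :> R by [].
have A0 : 0 < A by rewrite /A; lra.
exists A => // H; elim/ltn_ind: H => H IH f g F G x0 D s cv D0 us ns.
have triv : (size s)%:R <= 4 * H%:R ^+ 2 :> R.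
  have Dd : D < D + 1 by lra.
  apply: le_trans (size_unit_pts x0 H); rewrite ler_nat.
  exact: leq_trans (close_sub Dd us ns) (count_size _ _).
have [HH3|HH3] := ltnP H H3.
  apply: (le_trans triv); case: H IH ns triv HH3 => [|H] _ _ _ HH3.
    by rewrite expr0n /= !mulr0 add0r mulr_ge0 ?powR_ge0// ltW.
  set X : R := H.+1%:R; have X1 : 1 <= X by rewrite ler1n.
  have X2 : X ^+ 2 <= H3%:R * X by rewrite expr2 ler_pM2r ?(lt_le_trans _ X1)// ler_nat ltnW.
  have XX : X <= X `^ (1 + gam) by rewrite le1r_powR//; lra.
  have DX : 0 <= D * X ^+ 2 by rewrite mulr_ge0 ?sqr_ge0.
  have h : H3%:R * X <= H3%:R * X `^ (1 + gam) by rewrite ler_wpM2l.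
  apply: (@le_trans _ _ (A * X `^ (1 + gam))); last by rewrite ler_pM2l// lerDr.
  have p0 : 0 <= X `^ (1 + gam) by rewrite powR_ge0.
  have c1p := mulr_ge0 C10 p0.
  by rewrite /A; move: X2 h c1p p0; move: (X ^+ 2) (X `^ _) => a b; lra.
move: HH3; rewrite !geq_max => /andP[/andP[HH1 Hp] /andP[Hn2 Hn3]].
set X : R := H%:R in triv *; have X1 : 1 <= X by rewrite ler1n.
have X0 : 0 < X by apply: lt_le_trans X1.
set Z := X `^ (1 + gam); have Z0 : 0 <= Z by rewrite powR_ge0.
(* For H >= n2, the gain H^(gam/4) is at least 4 C2, so that a quarter of A pays for the recursive
   term and another quarter for C1. *)
have midA D' : X `^ (gam - 1) <= D' -> D' <= 1 / 8 -> (forall p, p \in s -> close_pair f x0 H D' p) ->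
    (size s)%:R <= A / 4 * (D' * X ^+ 2) + A / 2 * Z.
  move=> D1 D8 ns'; apply: (le_trans (mid A H f g F G x0 D' s (ltW A0) HH1 IH cv D1 D8 us ns')).
  rewrite -/X; set Y := X `^ (1 + 3 * gam / 4).
  have YZ : Y <= Z by rewrite ler_powR//; lra.
  have ZE : Z = Y * X `^ (gam / 4) by rewrite -powRDp//; congr (_ `^ _); field.
  have Y0 : 0 <= Y by rewrite powR_ge0.
  have C2Y : 4 * C2 * Y <= Z by rewrite ZE mulrC ler_wpM2l// h2// ler_nat.
  have AC : A * (4 * C2 * Y) <= A * Z by rewrite ler_pM2l.
  have D'0 : 0 <= D' * X ^+ 2 by rewrite mulr_ge0 ?sqr_ge0// (le_trans _ D1)// powR_ge0.
  have C1A : 4 * C1 <= A by rewrite /A; lra.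
  have u1 := ler_wpM2r D'0 C1A; have u2 := ler_wpM2l C10 YZ; have u3 := ler_wpM2r Z0 C1A.
  by move: u1 u2 u3 AC; move: (D' * _) => z; lra.
have [D8|D8] := leP D (1 / 8); last first.
  apply: (le_trans triv).
  have DX : X ^+ 2 / 8 <= D * X ^+ 2 by rewrite mulrC -div1r ler_wpM2r ?sqr_ge0// ltW.
  have AA : 32 <= A by rewrite /A; lra.
  have DX0 : 0 <= D * X ^+ 2 by apply: le_trans DX; rewrite divr_ge0 ?sqr_ge0.
  have u1 := ler_wpM2r DX0 AA; have u2 : 0 <= A * Z by rewrite mulr_ge0// ltW.
  by rewrite mulrDr; move: u1 u2 DX; move: (D * X ^+ 2) => e; lra.
have [D1|D1] := leP (X `^ (gam - 1)) D.
  apply: (le_trans (midA D D1 D8 ns)).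
  have u1 : 0 <= A * (D * X ^+ 2) by rewrite mulr_ge0 ?(ltW A0)// mulr_ge0 ?sqr_ge0.
  have u2 : 0 <= A * Z by rewrite mulr_ge0// ltW.
  by move: u1 u2; move: (D * X ^+ 2) => z; lra.
(* For smaller D the count is monotone in D, and D' = H^(gam-1) makes D' H^2 equal to H^(1+gam). *)
have e1 : X `^ (gam - 1) <= 1 / 8.
  have -> : gam - 1 = - (1 - gam) by ring.
  by rewrite powRN div1r lef_pV2 ?posrE ?powR_gt0// h3// ler_nat.
have ns' : forall p, p \in s -> close_pair f x0 H (X `^ (gam - 1)) p.
  by move=> p /ns[a b d e]; split=> //; apply: le_trans e (ltW D1).
apply: (le_trans (midA _ (lexx _) e1 ns')).
have -> : X `^ (gam - 1) * X ^+ 2 = Z.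
  rewrite -(powR_mulrn 2 (ltW X0)) -powRDp//; congr (_ `^ _).
  by rewrite /=; ring.
have u1 : 0 <= A * (D * X ^+ 2) by rewrite mulr_ge0 ?(ltW A0)// mulr_ge0 ?sqr_ge0.
have u2 : 0 <= A * Z by rewrite mulr_ge0// ltW.
by move: u1 u2; move: (D * X ^+ 2) => z; lra.
Qed.

(** With gam = c1/2, the last term of [weight_sum] is h^(2+c1), and h^(1+c1) <= Q^((1-c1)(1+c1)) <=
    Q. The logarithm multiplies just Q h and h^2. *)
Lemma weight_linear (k Lam c1 : R) : 1 <= k -> 0 < Lam -> 0 < c1 -> c1 < 1 ->
  exists2 C : R, 0 < C & forall (f g F G : R -> R) (eta xi : R) (Q h : nat), curve k f g F G ->
  eta <= xi -> xi <= eta + Lam -> (1 < Q)%N -> (0 < h)%N -> h%:R <= Q%:R `^ (1 - c1) ->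
  \sum_(p <- lattice_pts (g (eta - 1)) (g (xi + 1)) h) cutinv Q%:R (height F p) <=
  C * (Q%:R * ln Q%:R) * h%:R.
Proof.
move=> k1 Lam0 c10 c11; have k0 : 0 < k by apply: lt_le_trans k1.
pose gam := c1 / 2; have gam0 : 0 < gam by rewrite divr_gt0.
have gam1 : gam < 1 by rewrite /gam; lra.
have [A A0 hA] := pair_bound_ex k1 gam0 gam1.
pose M := (Num.truncn (2 * k * (Lam + 2))).+1.
have [W W0 hW] := weight_sum M k1 (ltW gam0) gam0.
exists (W * (1 + 3 * A)); first by rewrite mulr_gt0// addr_gt0// mulr_gt0.
move=> f g F G eta xi Q h cv ex xL Q1 h0 hQ.
have Q0 : 0 < Q%:R :> R by rewrite ltr0n ltnW.
have Qr1 : 1 <= Q%:R :> R by rewrite ler1n ltnW.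
have hr : 0 < h%:R :> R by rewrite ltr0n.
have hQr : h%:R <= Q%:R :> R.
  by apply: (le_trans hQ); rewrite -[leRHS]powRr1 ?(ltW Q0)// ler_powR//; lra.
have hQn : (0 < h <= Q)%N by rewrite h0 -(ler_nat R).
have yM : g (xi + 1) - g (eta - 1) < M%:R.
  have xx : eta - 1 <= xi + 1 by lra.
  have /andP[_ u] := curve_g_incr cv xx; apply: le_lt_trans (truncnS_gt _).
  by apply: (le_trans u); rewrite ler_pM2l ?mulr_gt0//; lra.
apply: (le_trans (hW A f g F G _ _ Q h (ltW A0) cv yM Q1 hQn (hA h))).
have lq := ln_nat_ge_half R Q1; have l0 : 0 <= ln Q%:R :> R by lra.
rewrite -!mulrA ler_pM2l//.
have a2 : A * (h%:R ^+ 2 * ln Q%:R) <= A * (Q%:R * ln Q%:R * h%:R).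
  rewrite ler_pM2l// expr2 [leRHS]mulrAC.
  by rewrite ler_wpM2r// ler_wpM2r// ltW.
have a3 : A * h%:R `^ (2 + gam + gam) <= 2 * A * (Q%:R * ln Q%:R * h%:R).
  have -> : 2 + gam + gam = (1 + c1) + 1 by rewrite /gam; field.
  rewrite powRDp// powRr1 ?(ltW hr)//.
  have h1 : h%:R `^ (1 + c1) <= Q%:R :> R.
    apply: (@le_trans _ _ ((Q%:R `^ (1 - c1)) `^ (1 + c1))).
      by rewrite ge0_ler_powR ?nnegrE ?powR_ge0//; lra.
    by rewrite -powRrM -[leRHS]powRr1 ?(ltW Q0)// ler_powR//; nra.
  have h2 : Q%:R <= 2 * (Q%:R * ln Q%:R) :> R by exact: le_mul_ln.
  have -> : 2 * A * (Q%:R * ln Q%:R * h%:R) = A * (2 * (Q%:R * ln Q%:R) * h%:R) by ring.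
  by rewrite ler_pM2l// ler_wpM2r ?(ltW hr)// (le_trans h1).
have -> : (1 + 3 * A) * (Q%:R * (ln Q%:R * h%:R)) = Q%:R * ln Q%:R * h%:R + A * (Q%:R * ln Q%:R * h%:R)
   + 2 * A * (Q%:R * ln Q%:R * h%:R) by ring.
apply: lerD; last exact: a3.
apply: lerD; first by rewrite le_eqVlt; apply/orP; left; apply/eqP; ring.
by move: a2; rewrite expr2 -!mulrA.
Qed.

End PairBound.

(** * Taylor bounds from derivatives relative to an interval *)

Section Extension.
Variable R : realType.

(** Differentiability without quotients; in this form it passes to subintervals, to negatives and to
    differences with quadratics. *)
Definition diff_on (a b : R) (h h' : R -> R) := forall x, a <= x <= b -> forall e, 0 < e ->
  exists2 r, 0 < r & forall y, a <= y <= b -> `|y - x| < r ->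
    `|h y - h x - h' x * (y - x)| <= e * `|y - x|.

Lemma diff_onP (a b : R) h h' : is_derivative_on `[a, b] h h' -> diff_on a b h h'.
Proof.
move=> dh x xab e e0; have xD : `[a, b]%classic x by rewrite /= in_itv.
have /cvgrPdist_le /(_ e e0) := dh x xD.
rewrite near_withinE near_withinE => /nbhs_ballP[r /= r0 hr].
exists r => // y yab yx; have [->|ne] := eqVneq y x; first by rewrite !subrr mulr0 subrr normr0 mulr0.
have yxn : y - x != 0 by rewrite subr_eq0.
have := hr y; rewrite /ball /= distrC => /(_ yx ne); rewrite in_itv /= => /(_ yab) h1.
have -> : h y - h x - h' x * (y - x) = - ((h' x - (h y - h x) / (y - x)) * (y - x)) by field.
by rewrite normrN normrM ler_wpM2r.
Qed.

Lemma diff_on_sub (a b c d : R) h h' : diff_on a b h h' -> a <= c -> d <= b -> diff_on c d h h'.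
Proof.
move=> dh ac db x /andP[cx xd] e e0.
have [|r r0 hr] := dh x _ e e0; first by rewrite (le_trans ac)// (le_trans xd).
by exists r => // y /andP[cy yd]; apply: hr; rewrite (le_trans ac)// (le_trans yd).
Qed.

Lemma diff_onN (a b : R) h h' : diff_on a b h h' -> diff_on a b (fun x => - h x) (fun x => - h' x).
Proof.
move=> dh x xab e e0; have [r r0 hr] := dh x xab e e0; exists r => // y yab yx.
have -> : - h y - - h x - - h' x * (y - x) = - (h y - h x - h' x * (y - x)) by ring.
by rewrite normrN; exact: hr.
Qed.

Lemma diff_onB_quad (a b : R) h h' (A B C : R) : diff_on a b h h' ->
  diff_on a b (fun x => h x - (A + B * x + C * x ^+ 2)) (fun x => h' x - (B + 2 * C * x)).
Proof.
move=> dh x xab e e0; have e2 : 0 < e / 2 by rewrite divr_gt0.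
have [r r0 hr] := dh x xab _ e2.
have C1 : 0 < `|C| + 1 by rewrite ltr_wpDl.
exists (Num.min r (e / 2 / (`|C| + 1))); first by rewrite lt_min r0 divr_gt0.
move=> y yab; rewrite lt_min => /andP[yr yC].
have -> : h y - (A + B * y + C * y ^+ 2) - (h x - (A + B * x + C * x ^+ 2)) - (h' x - (B + 2 * C * x)) * (y - x)
  = (h y - h x - h' x * (y - x)) - C * (y - x) ^+ 2 by ring.
apply: (le_trans (ler_normB _ _)).
have -> : e * `|y - x| = e / 2 * `|y - x| + e / 2 * `|y - x| by field.
apply: lerD; first exact: hr.
rewrite normrM normrX expr2 mulrA ler_wpM2r//.
rewrite ltr_pdivlMr// in yC; have := normr_ge0 C; have := normr_ge0 (y - x).
by move: yC; move: (`|C|) (`|y - x|) => z1 z2; nra.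
Qed.

(** For e > 0, the supremum of the points x where h(x) - h(a) >= -e (x - a) cannot be below b, by
    differentiability there; then e tends to 0. *)
Lemma diff_on_le (a b : R) h h' : a <= b -> diff_on a b h h' ->
  (forall x, a <= x <= b -> 0 <= h' x) -> h a <= h b.
Proof.
move=> ab dh h0.
suff H e : 0 < e -> - e * (b - a) <= h b - h a.
  rewrite leNgt; apply/negP => hba.
  have ba : 0 < b - a + 1 by rewrite ltr_wpDl// subr_ge0.
  have e0 : 0 < (h a - h b) / (b - a + 1) by rewrite divr_gt0// subr_gt0.
  have := H _ e0; rewrite mulNr mulrAC lerNl opprB ler_pdivlMr//.
  by rewrite ler_pM2l ?subr_gt0//; lra.
move=> e0; pose S := [set x | a <= x <= b /\ - e * (x - a) <= h x - h a].
have aS : S a by split; rewrite ?lexx ?ab// !subrr mulr0.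
have ubS : ubound S b by move=> x [/andP[]].
have hS : has_sup S by split; [exists a|exists b].
set c := sup S.
have ac : a <= c by apply: ub_le_sup => //; exists b.
have cb : c <= b by apply: ge_sup => //; exists a.
have [|r r0 hr] := dh c _ e e0; first by rewrite ac.
have h'c : 0 <= h' c by apply: h0; rewrite ac.
have cS : S c.
  have [s [/andP[as_ sb] hs] cs] := sup_adherent r0 hS.
  have sc : s <= c by apply: ub_le_sup; [exists b|split; rewrite ?as_ ?sb].
  split; first by rewrite ac.
  have sr : `|s - c| < r by rewrite distrC ger0_norm ?subr_ge0//; rewrite -/c in cs; lra.
  have := hr s; rewrite as_ sb => /(_ isT sr).
  rewrite (ler0_norm (_ : s - c <= 0)) ?subr_le0// ler_norml => /andP[_ h1].
  have : 0 <= h' c * (c - s) by rewrite mulr_ge0// subr_ge0.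
  by move: hs h1; lra.
have [->|cb'] := eqVneq b c; first by case: cS.
have {}cb' : c < b by rewrite lt_neqAle eq_sym cb'.
pose y := Num.min (c + r / 2) b.
have cy : c < y by rewrite lt_min cb' andbT ltrDl divr_gt0.
have yb : y <= b by rewrite ge_min lexx orbT.
have yr : y - c <= r / 2 by rewrite lerBlDl ge_min lexx.
have ya : a <= y <= b by rewrite yb andbT (le_trans ac)// ltW.
have yr' : `|y - c| < r by rewrite gtr0_norm ?subr_gt0//; lra.
have := hr y ya yr'; rewrite (gtr0_norm (_ : 0 < y - c)) ?subr_gt0// ler_norml => /andP[h1 _].
have h2 : 0 <= h' c * (y - c) by rewrite mulr_ge0// subr_ge0 ltW.
have yS : S y.
  by split=> //; case: cS => _; move: h1 h2; lra.
by have := ub_le_sup (ex_intro _ b ubS) yS; rewrite -/c leNgt cy.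
Qed.

(** Subtracting the quadratic with second derivative m leaves a function with increasing derivative,
    and [diff_on_le] is applied twice. *)
Lemma taylor_lower (a b m : R) f f' f'' : diff_on a b f f' -> diff_on a b f' f'' ->
  (forall x, a <= x <= b -> m <= f'' x) ->
  forall x y, a <= x <= b -> a <= y <= b -> m / 2 * (y - x) ^+ 2 <= f y - f x - f' x * (y - x).
Proof.
move=> d1 d2 hm x y /andP[ax xb] /andP[ay yb].
have mono u v : a <= u -> u <= v -> v <= b -> m * (v - u) <= f' v - f' u.
  move=> au uv vb; have := diff_onB_quad 0 m 0 d2 => /diff_on_sub /(_ au vb) dd.
  have := diff_on_le uv dd; rewrite !mul0r !addr0 !add0r.
  have pos : forall z, u <= z <= v -> 0 <= f'' z - (m + 2 * 0 * z).
    by move=> z /andP[uz zv]; rewrite mulr0 mul0r addr0 subr_ge0 hm// (le_trans au)// (le_trans zv).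
  by move=> /(_ pos); lra.
have dq := diff_onB_quad (f x - f' x * x + m / 2 * x ^+ 2) (f' x - m * x) (m / 2) d1.
have [xy|yx] := leP x y.
  have := diff_on_le xy (diff_on_sub dq ax yb).
  have pos : forall z, x <= z <= y -> 0 <= f' z - (f' x - m * x + 2 * (m / 2) * z).
    move=> z /andP[xz zy]; have := mono _ _ ax xz (le_trans zy yb).
    by lra.
  by move=> /(_ pos); lra.
have := diff_on_le (ltW yx) (diff_onN (diff_on_sub dq ay xb)).
have pos : forall z, y <= z <= x -> 0 <= - (f' z - (f' x - m * x + 2 * (m / 2) * z)).
  move=> z /andP[yz zx]; have := mono _ _ (le_trans ay yz) zx xb.
  by lra.
by move=> /(_ pos); lra.
Qed.

End Extension.

(** * Quadratic extension to the whole line *)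

Section Clamp.
Variable R : realType.

Definition taylor_rem (f g : R -> R) x y := f y - f x - g x * (y - x).

(** For x and y on different sides of a, the two remainders through a add up to the one from x to y,
    up to (g(a) - g(x))(y - a), which the two bounds between x and a control. *)
Lemma taylor_glue (D : R -> Prop) (f g : R -> R) (c a : R) : D a ->
  (forall x y, D x -> D y -> x <= a -> y <= a -> c * (y - x) ^+ 2 <= taylor_rem f g x y) ->
  (forall x y, D x -> D y -> a <= x -> a <= y -> c * (y - x) ^+ 2 <= taylor_rem f g x y) ->
  forall x y, D x -> D y -> c * (y - x) ^+ 2 <= taylor_rem f g x y.
Proof.
move=> Da hl hr x y Dx Dy; rewrite /taylor_rem in hl hr *.
have [xa|ax] := leP x a; have [ya|ay] := leP y a.
- exact: hl.
- have h1 := hl x a Dx Da xa (lexx _); have h2 := hl a x Da Dx (lexx _) xa.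
  have h3 := hr a y Da Dy (lexx _) (ltW ay).
  have {h2} h4 : 0 <= (g a - g x - 2 * c * (a - x)) * (a - x) by lra.
  have h5 : 0 <= (g a - g x - 2 * c * (a - x)) * (y - a).
    have [->|ne] := eqVneq a x.
      by rewrite !subrr mulr0 subr0 mul0r.
    have ax0 : 0 < a - x by rewrite subr_gt0 lt_neqAle eq_sym ne.
    by rewrite (pmulr_lge0 _ ax0) in h4; rewrite mulr_ge0// subr_ge0 ltW.
  by move: h1 h3 h5; lra.
- have h1 := hr x a Dx Da (ltW ax) (lexx _); have h2 := hr a x Da Dx (lexx _) (ltW ax).
  have h3 := hl a y Da Dy (lexx _) ya.
  have {h2} h4 : 0 <= (g x - g a - 2 * c * (x - a)) * (x - a) by lra.
  have h5 : 0 <= (g x - g a - 2 * c * (x - a)) * (a - y).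
    have ax0 : 0 < x - a by rewrite subr_gt0.
    by rewrite (pmulr_lge0 _ ax0) in h4; rewrite mulr_ge0// subr_ge0.
  by move: h1 h3 h5; lra.
- by apply: hr => //; apply: ltW.
Qed.

Variables (eta xi m : R) (f f' : R -> R).
Hypothesis exi : eta < xi.

Definition clamp (x : R) := Num.max eta (Num.min x xi).
(** Outside the interval, f continues as the parabola with its first-order data at the nearer end
    and second derivative m. *)
Definition ext (x : R) := f (clamp x) + f' (clamp x) * (x - clamp x) + m / 2 * (x - clamp x) ^+ 2.
Definition ext' (x : R) := f' (clamp x) + m * (x - clamp x).

Lemma clamp_id x : eta <= x <= xi -> clamp x = x.
Proof. by move=> /andP[a b]; rewrite /clamp min_l// max_r. Qed.

Lemma clamp_l x : x <= eta -> clamp x = eta.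
Proof. by move=> a; rewrite /clamp min_l ?max_l// (le_trans a)// ltW. Qed.

Lemma clamp_r x : xi <= x -> clamp x = xi.
Proof. by move=> a; rewrite /clamp min_r// max_r// ltW. Qed.

Lemma ext_id x : eta <= x <= xi -> ext x = f x.
Proof. by move=> h; rewrite /ext (clamp_id h) subrr mulr0 expr0n /= mulr0 !addr0. Qed.

Lemma ext'_id x : eta <= x <= xi -> ext' x = f' x.
Proof. by move=> h; rewrite /ext' (clamp_id h) subrr mulr0 addr0. Qed.

Lemma ext_taylor (c1 c2 : R) : c1 <= m / 2 -> m / 2 <= c2 ->
  (forall x y, eta <= x <= xi -> eta <= y <= xi -> c1 * (y - x) ^+ 2 <= taylor_rem f f' x y <= c2 * (y - x) ^+ 2) ->
  forall x y, c1 * (y - x) ^+ 2 <= taylor_rem ext ext' x y <= c2 * (y - x) ^+ 2.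
Proof.
move=> c1m mc2 hf.
have outer x y : (x <= eta /\ y <= eta) \/ (xi <= x /\ xi <= y) -> taylor_rem ext ext' x y = m / 2 * (y - x) ^+ 2.
  case=> -[a b]; rewrite /taylor_rem /ext /ext'.
    by rewrite !clamp_l//; field.
  by rewrite !clamp_r//; field.
have inner x y : eta <= x <= xi -> eta <= y <= xi -> taylor_rem ext ext' x y = taylor_rem f f' x y.
  by move=> hx hy; rewrite /taylor_rem !ext_id// ext'_id.
have neg x y : taylor_rem (fun x => - ext x) (fun x => - ext' x) x y = - taylor_rem ext ext' x y.
  by rewrite /taylor_rem; ring.
have gen (s c : R) (e e' : R -> R) : (forall x y, taylor_rem e e' x y = s * taylor_rem ext ext' x y) ->
    c <= s * (m / 2) ->
    (forall x y, eta <= x <= xi -> eta <= y <= xi -> c * (y - x) ^+ 2 <= s * taylor_rem f f' x y) ->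
    forall x y, c * (y - x) ^+ 2 <= taylor_rem e e' x y.
  move=> es cs hs x y; apply: (@taylor_glue (fun=> True) e e' c eta) => //.
    move=> u v _ _ ue ve; rewrite es outer; last by left.
    by rewrite mulrA ler_wpM2r ?sqr_ge0.
  move=> u v _ _ ue ve; apply: (@taylor_glue (fun z => eta <= z) e e' c xi) => //; first exact: ltW.
    by move=> u' v' a b a' b'; rewrite es inner ?a ?b//; apply: hs; rewrite ?a ?b.
  move=> u' v' _ _ a' b'; rewrite es outer; last by right.
  by rewrite mulrA ler_wpM2r ?sqr_ge0.
move=> x y; apply/andP; split.
  apply: (gen 1) => [u v||u v hu hv]; rewrite ?mul1r//.
  by have /andP[] := hf _ _ hu hv.
suff : - c2 * (y - x) ^+ 2 <= taylor_rem (fun x => - ext x) (fun x => - ext' x) x y.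
  by rewrite neg mulNr lerN2.
apply: (gen (-1)).
- by move=> u v; rewrite neg mulN1r.
- by rewrite mulN1r lerN2.
- move=> u v hu hv; rewrite mulN1r mulNr lerN2.
  by have /andP[] := hf _ _ hu hv.
Qed.

End Clamp.

(** * Construction of the Legendre transform *)

Section MakeCurve.
Variable R : realType.

(** The Taylor bounds make g strictly increasing, Lipschitz and unbounded, hence invertible. The
    Taylor remainder of F from x to y is that of f from G y to G x, and |y - x| is comparable with
    |G y - G x|. *)
Lemma curve_make (k : R) (f g : R -> R) : 1 <= k ->
  (forall x y, (y - x) ^+ 2 / k <= f y - f x - g x * (y - x) <= k * (y - x) ^+ 2) ->
  exists F G, curve (4 * k ^+ 3) f g F G.
Proof.
move=> k1 hf; have k0 : 0 < k by apply: lt_le_trans k1.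
have gm x y : x <= y -> 2 / k * (y - x) <= g y - g x <= 2 * k * (y - x).
  rewrite le_eqVlt => /predU1P[->|xy]; first by rewrite !subrr !mulr0 lexx.
  have /andP[a1 a2] := hf x y; have /andP[b1 b2] := hf y x.
  have d0 : 0 < y - x by rewrite subr_gt0.
  have e1 : (x - y) ^+ 2 = (y - x) ^+ 2 by ring.
  rewrite e1 in b1 b2.
  rewrite -(ler_pM2r d0) -(ler_pM2r d0 (g y - g x)).
  have -> : 2 / k * (y - x) * (y - x) = (y - x) ^+ 2 / k + (y - x) ^+ 2 / k by rewrite expr2; field; rewrite gt_eqF.
  have -> : 2 * k * (y - x) * (y - x) = k * (y - x) ^+ 2 + k * (y - x) ^+ 2 by ring.
  by apply/andP; split; lra.
have ik : 0 < 2 / k by rewrite divr_gt0.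
have gI : injective g.
  have lt x y : x < y -> g x < g y.
    move=> xy; have /andP[h _] := gm _ _ (ltW xy); rewrite -subr_gt0; apply: lt_le_trans h.
    by rewrite mulr_gt0// subr_gt0.
  by move=> x y e; case: (ltgtP x y) => // /lt; rewrite e ltxx.
have gc : continuous g.
  move=> x; apply/cvgrPdist_le => e e0; have k2 : 0 < 2 * k by rewrite mulr_gt0.
  have ek : 0 < e / (2 * k) by rewrite divr_gt0.
  apply/nbhs_ballP; exists (e / (2 * k)) => // y /= /ltW yx.
  have gxy : `|g x - g y| <= 2 * k * `|x - y|.
    have [xy|yx'] := leP x y.
      have /andP[h1 h2] := gm _ _ xy; rewrite distrC (distrC x) !ger0_norm ?subr_ge0//.
      by rewrite -subr_ge0; apply: le_trans h1; rewrite mulr_ge0 ?(ltW ik)// subr_ge0.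
    have /andP[h1 h2] := gm _ _ (ltW yx'); rewrite !ger0_norm ?subr_ge0 ?(ltW yx')//.
    by rewrite -subr_ge0; apply: le_trans h1; rewrite mulr_ge0 ?(ltW ik)// subr_ge0 ltW.
  by apply: (le_trans gxy); rewrite mulrC -ler_pdivlMr.
have gS s : exists x, g x = s.
  pose T := k / 2 * (`|s - g 0| + 1).
  have T0 : 0 <= T by rewrite mulr_ge0 ?divr_ge0 ?(ltW k0)// addr_ge0.
  have /andP[h1 _] := gm 0 T T0; have NT : - T <= 0 by rewrite oppr_le0.
  have /andP[h2 _] := gm (- T) 0 NT.
  have e : 2 / k * T = `|s - g 0| + 1 by rewrite /T; field; rewrite gt_eqF.
  rewrite subr0 e in h1; rewrite sub0r opprK e in h2.
  have TT : - T <= T by apply: le_trans NT T0.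
  have [||x _ xs] := @IVT R g (- T) T s TT; first exact: continuous_subspaceT.
    have n1 := ler_norm (s - g 0); have n2 := ler_norm (- (s - g 0)); rewrite normrN in n2.
    have n0 := normr_ge0 (s - g 0); have gTT : g (- T) <= g T by lra.
    by rewrite min_l// max_r//; lra.
  by exists x.
have [G GK] := choice gS.
have gK : cancel g G by move=> x; apply: gI; rewrite GK.
exists (fun y => y * G y - f (G y)), G.
have k3 : 1 <= k ^+ 3 by rewrite exprn_ege1.
have kk : k <= 4 * k ^+ 3.
  have : k <= k ^+ 3 by rewrite exprS ler_peMr ?(ltW k0)// exprn_ege1.
  by move: k3; move: (k ^+ 3) => z; lra.
have k2 : 0 < 2 * k by rewrite mulr_gt0.
have K0 : 0 < 4 * k ^+ 3 by rewrite mulr_gt0// exprn_gt0.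
split=> //.
- by move: k3; move: (k ^+ 3) => z; lra.
- move=> x y; have /andP[h1 h2] := hf x y; apply/andP; split.
    by apply: le_trans h1; rewrite ler_wpM2l ?sqr_ge0// lef_pV2 ?posrE.
  by apply: (le_trans h2); rewrite ler_wpM2r ?sqr_ge0.
- move=> x y; set a := G x; set b := G y.
  have xa : x = g a by rewrite /a GK.
  have yb : y = g b by rewrite /b GK.
  have -> : y * b - f b - (x * a - f a) - a * (y - x) = f a - f b - g b * (a - b) by rewrite xa yb; ring.
  have /andP[h1 h2] := hf b a.
  have gab : `|2 / k * (b - a)| <= `|y - x| <= `|2 * k * (b - a)|.
    rewrite xa yb; have [ab|ba] := leP a b.
      have /andP[u1 u2] := gm _ _ ab.
      have d0 : 0 <= b - a by rewrite subr_ge0.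
      have g0 : 0 <= g b - g a by apply: le_trans u1; rewrite mulr_ge0 ?(ltW ik).
      have m1 := mulr_ge0 (ltW ik) d0; have m2 := mulr_ge0 (ltW k2) d0.
      by rewrite !ger0_norm// u1.
    have /andP[u1 u2] := gm _ _ (ltW ba).
    have d0 : 0 <= a - b by rewrite subr_ge0 ltW.
    have g0 : 0 <= g a - g b by apply: le_trans u1; rewrite mulr_ge0 ?(ltW ik).
    rewrite -normrN -mulrN opprB (distrC (g b)) -(normrN (2 * k * _)) -mulrN opprB.
    have m1 := mulr_ge0 (ltW ik) d0; have m2 := mulr_ge0 (ltW k2) d0.
    by rewrite !ger0_norm// u1.
  have [s1 s2] : (2 / k * (b - a)) ^+ 2 <= (y - x) ^+ 2 /\ (y - x) ^+ 2 <= (2 * k * (b - a)) ^+ 2.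
    by move: gab => /andP[g1 g2]; split; rewrite -(real_normK (num_real _)) -[leRHS](real_normK (num_real _)) ler_pXn2r ?nnegrE.
  apply/andP; split.
    apply: le_trans h1; rewrite ler_pdivrMr//; apply: (le_trans s2).
    by rewrite le_eqVlt; apply/orP; left; apply/eqP; field; rewrite gt_eqF.
  apply: (le_trans h2).
  have -> : k * (a - b) ^+ 2 = k ^+ 3 / 4 * (2 / k * (b - a)) ^+ 2 by field; rewrite gt_eqF.
  apply: ler_pM; rewrite ?sqr_ge0 ?divr_ge0 ?exprn_ge0 ?(ltW k0)//.
  by move: k3; move: (k ^+ 3) => z; lra.
- by move=> x; rewrite !gK mulrC.
Qed.

End MakeCurve.

(** * From the hypotheses on f'' to a curve *)

Section FromDerivatives.
Variable R : realType.
Variables (eta xi : R).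
Hypothesis exi : eta < xi.

Lemma const_sign (h : R -> R) (m : R) : {within `[eta, xi], continuous h} -> 0 < m ->
  (forall x, eta <= x <= xi -> m <= `|h x|) -> 0 < h eta ->
  forall x, eta <= x <= xi -> m <= h x.
Proof.
move=> hc m0 hm he x /andP[ex xx].
have [hx|hx] := leP 0 (h x); first by rewrite -(ger0_norm hx) hm// ex.
have [||c cI c0] := @IVT R h eta x 0 ex.
- apply: continuous_subspaceW hc => z /=; rewrite !in_itv /= => /andP[-> zx] /=.
  exact: le_trans xx.
- by rewrite min_r ?max_l ?(ltW hx) ?(ltW he)// ltW// (lt_trans hx).
move: cI; rewrite in_itv /= => /andP[ec cx].
by have := hm c; rewrite ec (le_trans cx)// c0 normr0 leNgt m0 => /(_ isT).
Qed.

Lemma curve_of_bounds (f f' f'' : R -> R) (m M : R) : diff_on eta xi f f' -> diff_on eta xi f' f'' ->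
  0 < m -> (forall x, eta <= x <= xi -> m <= f'' x <= M) ->
  exists k fe g F G, curve k fe g F G /\ forall x, eta <= x <= xi -> fe x = f x.
Proof.
move=> d1 d2 m0 hf.
have eI : eta <= eta <= xi by rewrite lexx ltW.
have mM : m <= M by have /andP[a b] := hf _ eI; exact: le_trans b.
have M0 : 0 < M by apply: lt_le_trans mM.
have T x y : eta <= x <= xi -> eta <= y <= xi -> m / 2 * (y - x) ^+ 2 <= taylor_rem f f' x y <= M / 2 * (y - x) ^+ 2.
  move=> hx hy; apply/andP; split.
    by apply: (taylor_lower d1 d2) => // z /hf/andP[].
  have h z : eta <= z <= xi -> - M <= - f'' z by move=> /hf/andP[_ ?]; rewrite lerN2.
  have := taylor_lower (diff_onN d1) (diff_onN d2) h hx hy.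
  by rewrite /taylor_rem; lra.
have m2 : m / 2 <= M / 2 by rewrite ler_pM2r.
have ET := ext_taylor exi (lexx (m / 2)) m2 T.
pose k := 1 + 2 / m + M.
have im : 0 < 2 / m by rewrite divr_gt0.
have k1 : 1 <= k by rewrite /k; lra.
have [|F [G cv]] := @curve_make R k (ext eta xi m f f') (ext' eta xi m f') k1.
  move=> x y; have /andP[h1 h2] := ET x y; apply/andP; split.
    apply: le_trans h1; rewrite mulrC ler_wpM2r ?sqr_ge0//.
    rewrite -[m / 2]invrK lef_pV2 ?posrE ?invr_gt0 ?divr_gt0// ?(lt_le_trans _ k1)// invf_div /k; lra.
  by apply: (le_trans h2); rewrite ler_wpM2r ?sqr_ge0// /k; lra.
exists (4 * k ^+ 3), (ext eta xi m f f'), (ext' eta xi m f'), F, G; split => // x hx.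
exact: ext_id.
Qed.

(** The Lipschitz condition bounds |f''| from above, and by the intermediate value theorem f'' keeps
    its sign. If it is negative, -f is used: its heights have the same distance to the integers. *)
Lemma curve_of_lip (f f' f'' : R -> R) (theta : R) : is_derivative_on `[eta, xi] f f' ->
  is_derivative_on `[eta, xi] f' f'' -> {within `[eta, xi], continuous f''} ->
  bounded_away_from0 `[eta, xi] f'' -> 0 < theta -> Lip theta `[eta, xi] f'' ->
  exists k fe g F G, curve k fe g F G /\
    ((forall x, eta <= x <= xi -> fe x = f x) \/ (forall x, eta <= x <= xi -> fe x = - f x)).
Proof.
move=> /diff_onP d1 /diff_onP d2 fc [m m0 hm'] t0 [C hC'].
have hm x : eta <= x <= xi -> m <= `|f'' x| by move=> hx; apply: hm'; rewrite /= in_itv.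
have hC x y : eta <= x <= xi -> eta <= y <= xi -> `|f'' x - f'' y| <= C * `|x - y| `^ theta.
  by move=> hx hy; apply: hC'; rewrite /= in_itv.
have eI : eta <= eta <= xi by rewrite lexx ltW.
pose M := `|f'' eta| + `|C| * (xi - eta) `^ theta.
have fM x : eta <= x <= xi -> `|f'' x| <= M.
  move=> hx; have := hC _ _ hx eI => h.
  have -> : f'' x = f'' eta + (f'' x - f'' eta) by ring.
  apply: (le_trans (ler_normD _ _)); rewrite lerD2l; apply: (le_trans h).
  apply: (@le_trans _ _ (`|C| * `|x - eta| `^ theta)); first by rewrite ler_wpM2r ?powR_ge0// ler_norm.
  rewrite ler_wpM2l//; apply: ge0_ler_powR; rewrite ?nnegrE ?subr_ge0 ?(ltW t0) ?(ltW exi)//.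
  by move: hx => /andP[a b]; rewrite ger0_norm ?subr_ge0// lerD2r.
have [he|he] := leP (f'' eta) 0.
  have he' : 0 < - f'' eta.
    by rewrite oppr_gt0 lt_neqAle he andbT; apply/eqP => e; have := hm _ eI; rewrite e normr0 leNgt m0.
  have fc' : {within `[eta, xi], continuous (fun x => - f'' x)} by move=> x; apply: cvgN; exact: fc.
  have hm2 x : eta <= x <= xi -> m <= `|- f'' x| by rewrite normrN; exact: hm.
  have sg := const_sign fc' m0 hm2 he'.
  have [|k [fe [g [F [G [cv fE]]]]]] := curve_of_bounds (diff_onN d1) (diff_onN d2) m0 (M := M).
    by move=> x hx; rewrite sg//= (le_trans (ler_norm _))// normrN fM.
  by exists k, fe, g, F, G; split => //; right.
have sg := const_sign fc m0 hm he.
have [|k [fe [g [F [G [cv fE]]]]]] := curve_of_bounds d1 d2 m0 (M := M).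
  by move=> x hx; rewrite sg//= (le_trans (ler_norm _))// fM.
by exists k, fe, g, F, G; split => //; left.
Qed.

End FromDerivatives.

(** * Choice of the degree of smoothing *)

Section Core.
Variable R : realType.

Lemma powR_third (x : R) : 0 < x -> (x `^ (1 / 3)) ^+ 3 = x.
Proof.
move=> x0; rewrite -powR_mulrn ?powR_ge0// -powRrM (_ : 1 / 3 * 3%:R = 1) ?powRr1 ?(ltW x0)//.
by field.
Qed.

Lemma powR_thirdn (x : R) n : x `^ (n%:R / 3) = (x `^ (1 / 3)) ^+ n.
Proof. by rewrite -powR_mulrn ?powR_ge0// -powRrM; congr (_ `^ _); field. Qed.

Lemma powR_third_inv (x : R) : 0 < x -> (x `^ (1 / 3)) ^- 2 = x^-1 `^ (2 / 3).
Proof.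
move=> x0; rewrite -(powR_inv1 (ltW x0)) -[RHS]powRrM -powR_invn ?powR_ge0// -powRrM.
by congr (_ `^ _); field.
Qed.

(** u, v, w are the cube roots of Q, delta and log Q, so that all exponents become integers. Y =
    Q^(1/3) (delta log Q)^(-2/3) equates Q^2 / J with delta Q^(3/2) log Q sqrt J; their common value
    is E. *)
Lemma core_real (u v w J P N L W E0 Dc B : R) (X := u ^+ 3) (d := v ^+ 3) (l := w ^+ 3)
    (Y := u / (v ^+ 2 * w ^+ 2)) (E := v ^+ 2 * u ^+ 5 * w ^+ 2) :
  1 <= u -> 0 < v -> v <= 1 -> 1 <= w -> w ^+ 2 <= u * v -> Y <= J -> J <= 2 * Y ->
  0 < L -> 0 <= P -> `|P - L * X ^+ 2 / 2| <= (L + 1) * X -> 0 <= Dc -> 0 < E0 -> 0 <= W -> B = W * (X * l) ->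
  `|N - 2 * d * P| <= Dc * (P / J + d * (E0 * (2 * B * Num.sqrt X * Num.sqrt (2 * J)
    + 2 * X * Num.sqrt X * Num.sqrt (2 * J) + 2 * J * (X * l)))) ->
  `|N - L * d * X ^+ 2| <= (2 * (L + 1) + Dc * (2 * L + 1 + E0 * (4 * W + 8))) * E.
Proof.
move=> u1 v0 v1 w1 wuv YJ J2Y L0 P0 hP Dc0 E00 W0 BE hN.
have u0 : 0 < u by apply: lt_le_trans u1.
have w0 : 0 < w by apply: lt_le_trans w1.
have X0 : 0 < X by rewrite exprn_gt0.
have d0 : 0 < d by rewrite exprn_gt0.
have l0 : 0 < l by rewrite exprn_gt0.
have X1 : 1 <= X by rewrite exprn_ege1.
have Y0 : 0 < Y by rewrite divr_gt0// mulr_gt0 ?exprn_gt0.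
have J0 : 0 < J by apply: lt_le_trans YJ.
have E1 : 0 < E by rewrite !mulr_gt0 ?exprn_gt0.
have uvw : 1 <= v * u * w.
  have : 1 <= w ^+ 2 by rewrite exprn_ege1.
  by move: wuv w1; rewrite [v * u]mulrC; move: (u * v) (w ^+ 2) => a b; nra.
have dX : d * X <= E.
  have -> : d * X = v ^+ 2 * u ^+ 3 * v by rewrite /d /X; ring.
  have -> : E = v ^+ 2 * u ^+ 3 * (u ^+ 2 * w ^+ 2) by rewrite /E; ring.
  rewrite ler_wpM2l ?mulr_ge0 ?exprn_ge0 ?(ltW u0) ?(ltW v0)//.
  by apply: (le_trans v1); apply: mulr_ege1; rewrite exprn_ege1.
have main : `|2 * d * P - L * d * X ^+ 2| <= 2 * (L + 1) * E.
  have -> : 2 * d * P - L * d * X ^+ 2 = 2 * d * (P - L * X ^+ 2 / 2) by field.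
  rewrite normrM (gtr0_norm (mulr_gt0 _ d0))//.
  have c0 : 0 <= 2 * d by rewrite mulr_ge0// ltW.
  apply: (le_trans (ler_wpM2l c0 hP)).
  have -> : 2 * d * ((L + 1) * X) = 2 * (L + 1) * (d * X) by ring.
  by rewrite ler_pM2l// mulr_gt0// addr_gt0.
have PX : P <= (2 * L + 1) * X ^+ 2.
  have : X <= X ^+ 2 by rewrite expr2 ler_peMr// ltW.
  move: hP; rewrite ler_norml => /andP[_]; move: (X ^+ 2) L0 => z; nra.
have PJ : P / J <= (2 * L + 1) * E.
  apply: (@le_trans _ _ ((2 * L + 1) * X ^+ 2 / Y)).
    by apply: ler_pM => //; rewrite ?invr_ge0 ?(ltW J0)// lef_pV2.
  rewrite le_eqVlt; apply/orP; left; apply/eqP; rewrite /X /Y /E; field.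
  by rewrite !gt_eqF.
have sJ : Num.sqrt X * Num.sqrt (2 * J) <= 2 * (u ^+ 2 / (v * w)).
  rewrite -sqrtrM ?(ltW X0)//.
  have r0 : 0 <= 2 * (u ^+ 2 / (v * w)) by rewrite mulr_ge0// divr_ge0 ?exprn_ge0 ?mulr_ge0 ?(ltW u0) ?(ltW v0) ?(ltW w0).
  rewrite -[leRHS](ger0_norm r0) -sqrtr_sqr ler_wsqrtr//.
  have -> : (2 * (u ^+ 2 / (v * w))) ^+ 2 = X * (2 * (2 * Y)) by rewrite /X /Y; field; rewrite !gt_eqF.
  by rewrite ler_pM2l// ler_pM2l.
have B0 : 0 <= B by rewrite BE; exact: mulr_ge0 W0 (mulr_ge0 (ltW X0) (ltW l0)).
have r1 : d * (2 * B * Num.sqrt X * Num.sqrt (2 * J)) <= 4 * W * E.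
  have -> : d * (2 * B * Num.sqrt X * Num.sqrt (2 * J)) = d * (2 * B) * (Num.sqrt X * Num.sqrt (2 * J)) by ring.
  have c0 : 0 <= d * (2 * B) by exact: mulr_ge0 (ltW d0) (mulr_ge0 (ler0n R 2) B0).
  apply: (le_trans (ler_wpM2l c0 sJ)); rewrite le_eqVlt; apply/orP; left; apply/eqP.
  by rewrite BE /X /d /l /E; field; rewrite !gt_eqF.
have r2 : d * (2 * X * Num.sqrt X * Num.sqrt (2 * J)) <= 4 * E.
  have -> : d * (2 * X * Num.sqrt X * Num.sqrt (2 * J)) = d * (2 * X) * (Num.sqrt X * Num.sqrt (2 * J)) by ring.
  have c0 : 0 <= d * (2 * X) by exact: mulr_ge0 (ltW d0) (mulr_ge0 (ler0n R 2) (ltW X0)).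
  apply: (le_trans (ler_wpM2l c0 sJ)).
  have -> : d * (2 * X) * (2 * (u ^+ 2 / (v * w))) = 4 * (v ^+ 2 * u ^+ 5 * w^-1) by rewrite /X /d; field; rewrite !gt_eqF.
  rewrite ler_pM2l// /E ler_wpM2l ?mulr_ge0 ?exprn_ge0 ?(ltW u0) ?(ltW v0)//.
  by apply: (@le_trans _ _ 1); [rewrite invf_le1|rewrite exprn_ege1].
have r3 : d * (2 * J * (X * l)) <= 4 * E.
  apply: (@le_trans _ _ (d * (2 * (2 * Y) * (X * l)))).
    by rewrite ler_pM2l// ler_pM2r ?mulr_gt0// ler_pM2l.
  have -> : d * (2 * (2 * Y) * (X * l)) = 4 * (u ^+ 4 * v * w) by rewrite /X /d /l /Y; field; rewrite !gt_eqF.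
  have -> : E = u ^+ 4 * v * w * (v * u * w) by rewrite /E; ring.
  by rewrite ler_pM2l// ler_peMr// !mulr_ge0 ?exprn_ge0 ?(ltW u0) ?(ltW v0) ?(ltW w0).
have tot : `|N - 2 * d * P| <= Dc * ((2 * L + 1 + E0 * (4 * W + 8)) * E).
  apply: (le_trans hN); rewrite ler_wpM2l// [leRHS]mulrDl; apply: lerD => //.
  rewrite [leLHS]mulrCA -[leRHS]mulrA ler_pM2l//.
  by move: r1 r2 r3; rewrite !(mulrDr d); move: (d * _) (d * _) (d * _) => z1 z2 z3; lra.
have -> : N - L * d * X ^+ 2 = (N - 2 * d * P) + (2 * d * P - L * d * X ^+ 2) by ring.
apply: (le_trans (ler_normD _ _)).
by move: tot main; set z1 := `|_|; set z2 := `|_|; lra.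
Qed.

(** With J about Y, the condition delta >= Q^(al-1) keeps the dual denominators below 2J <=
    Q^(1-al/3), where [weight_linear] applies, and gives 1/J <= delta. *)
Lemma core_bound (k : R) (f g F G : R -> R) (eta xi al : R) : curve k f g F G -> eta < xi ->
  0 < al -> al < 1 -> exists2 C : R, 0 < C & exists Q0 : nat, forall (Q : nat) (d : R), (Q0 <= Q)%N ->
  Q%:R `^ (al - 1) <= d -> d < 2^-1 ->
  `|(count (fun p => dist_int (height f p) < d) (lattice_pts eta xi Q))%:R - (xi - eta) * d * Q%:R ^+ 2| <=
  C * (d `^ (2 / 3) * Q%:R `^ (5 / 3) * ln Q%:R `^ (2 / 3)).
Proof.
move=> cv exi al0 al1; have k1 := curve_k1 cv.
have L0 : 0 < xi - eta by rewrite subr_gt0.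
pose c1 := al / 3; have c10 : 0 < c1 by rewrite divr_gt0.
have c11 : c1 < 1 by rewrite /c1; lra.
have [W W0 hW] := weight_linear k1 L0 c10 c11.
pose E0 := expsum_const k (xi - eta); have E00 : 0 < E0 by exact: expsum_const_gt0.
pose Dc := discrepancy_const R; have Dc0 : 0 <= Dc by exact: discrepancy_const_ge0.
pose C := 2 * (xi - eta + 1) + Dc * (2 * (xi - eta) + 1 + E0 * (4 * W + 8)).
have C0 : 0 < C.
  have h1 : 0 <= E0 * (4 * W + 8) by rewrite mulr_ge0 ?(ltW E00)// addr_ge0// mulr_ge0// ltW.
  have h2 : 0 <= Dc * (2 * (xi - eta) + 1 + E0 * (4 * W + 8)) by rewrite mulr_ge0//; lra.
  by rewrite /C; lra.
exists C => //.
have al2 : 0 < al / 2 by rewrite divr_gt0.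
have z16 : 0 <= 16 / al ^+ 2 by rewrite divr_ge0 ?sqr_ge0.
have [n1 hn1] := powR_large al2 z16; have [n2 hn2] := powR_large c10 (ler0n R 4).
exists (maxn (maxn n1 n2) (maxn 2 (Num.truncn (expR 1 : R)).+1)) => Q d.
rewrite !geq_max => /andP[/andP[Qn1 Qn2] /andP[Q2 Qe]] dl d2.
pose X : R := Q%:R; rewrite -/X in dl *.
have X1 : 1 <= X by rewrite ler1n ltnW.
have X0 : 0 < X by apply: lt_le_trans X1.
pose l := ln X.
have l1 : 1 <= l.
  rewrite -[1]expRK ler_ln ?posrE ?expR_gt0//; apply: le_trans (ltW (truncnS_gt _)) _.
  by rewrite ler_nat.
have l0 : 0 < l by apply: lt_le_trans l1.
have d0 : 0 < d by apply: lt_le_trans dl; rewrite powR_gt0.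
pose u := X `^ (1 / 3); pose v := d `^ (1 / 3); pose w := l `^ (1 / 3).
have u3 : u ^+ 3 = X by exact: powR_third.
have v3 : v ^+ 3 = d by exact: powR_third.
have w3 : w ^+ 3 = l by exact: powR_third.
have third0 : 0 <= 1 / 3 :> R by rewrite divr_ge0.
have u1 : 1 <= u by rewrite -[1](powRr0 X) ler_powR.
have w1 : 1 <= w by rewrite -[1](powRr0 l) ler_powR.
have v0 : 0 < v by rewrite powR_gt0.
have v1 : v <= 1.
  by rewrite -(@ler_pXn2r _ 3) ?nnegrE ?(ltW v0)// v3 expr1n; lra.
have u0 : 0 < u by apply: lt_le_trans u1.
have w0 : 0 < w by apply: lt_le_trans w1.
have wuv : w ^+ 2 <= u * v.
  rewrite -(@ler_pXn2r _ 3) ?nnegrE ?mulr_ge0 ?(ltW u0) ?(ltW v0) ?(ltW w0)//.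
  rewrite [leRHS]exprMn u3 v3 exprAC w3.
  have lX : l <= 4 / al * X `^ (al / 4).
    have a4 : 0 < al / 4 by rewrite divr_gt0.
    by have := ln_le_powR X0 a4; rewrite invf_div.
  apply: (@le_trans _ _ ((4 / al * X `^ (al / 4)) ^+ 2)).
    by rewrite ler_pXn2r ?nnegrE ?(ltW l0)// (le_trans _ lX)// ltW.
  have -> : (4 / al * X `^ (al / 4)) ^+ 2 = 16 / al ^+ 2 * X `^ (al / 2).
    have -> : al / 2 = al / 4 + al / 4 by field.
    by rewrite powRDp//; field; rewrite gt_eqF.
  apply: (@le_trans _ _ (X `^ (al / 2) * X `^ (al / 2))).
    by rewrite ler_wpM2r ?powR_ge0// hn1// ler_nat.
  rewrite -powRDp//; have -> : al / 2 + al / 2 = 1 + (al - 1) by field.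
  by rewrite powRDp// powRr1 ?(ltW X0)// ler_pM2l.
pose Y := u / (v ^+ 2 * w ^+ 2).
have vw0 : 0 < v ^+ 2 * w ^+ 2 by rewrite mulr_gt0 ?exprn_gt0.
have Y0 : 0 < Y by rewrite divr_gt0.
have Yd : d^-1 <= Y.
  rewrite /Y -[d^-1]mul1r ler_pdivrMr// mulrAC ler_pdivlMr// mul1r -v3.
  have -> : u * v ^+ 3 = v ^+ 2 * (u * v) by ring.
  by rewrite ler_pM2l ?exprn_gt0.
have Y1 : 1 <= Y by apply: le_trans Yd; rewrite invf_ge1//; lra.
pose J := (Num.truncn Y).+1.
have YJ : Y <= J%:R by rewrite ltW// truncnS_gt.
have JY : J%:R <= 2 * Y.
  have -> : J%:R = (Num.truncn Y)%:R + 1 :> R by rewrite natr1.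
  have : (Num.truncn Y)%:R <= Y by rewrite truncn_le ltW.
  by move: Y1; lra.
have J4 : 2 * J%:R <= X `^ (1 - c1).
  apply: (@le_trans _ _ (4 * Y)); first by lra.
  (* Inserting delta >= Q^(al-1) gives Y <= Q^(1 - 2 al/3) = Q^(1 - 2 c1); one factor Q^c1 absorbs
     the constant 4. *)
  have Yu : Y <= u / v ^+ 2.
    rewrite /Y ler_pM2l// lef_pV2 ?posrE ?exprn_gt0//.
    by rewrite ler_peMr ?sqr_ge0// exprn_ege1.
  have uv : u / v ^+ 2 <= X `^ (1 - c1 - c1).
    have -> : 1 - c1 - c1 = 1 / 3 + (1 - al) * (2 / 3) by rewrite /c1; field.
    rewrite powRDp// ler_pM2l// powRrM.
    have iv : v ^- 2 = (d^-1) `^ (2 / 3).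
      exact: powR_third_inv.
    rewrite iv; apply: ge0_ler_powR; rewrite ?nnegrE ?powR_ge0 ?invr_ge0 ?(ltW d0) ?divr_ge0//.
    have -> : 1 - al = - (al - 1) by ring.
    by rewrite powRN lef_pV2 ?posrE ?powR_gt0.
  apply: (@le_trans _ _ (X `^ c1 * X `^ (1 - c1 - c1))).
    apply: ler_pM => //; first exact: ltW.
      by apply: hn2; rewrite ler_nat.
    exact: le_trans Yu uv.
  by rewrite -powRDp// ler_powR//; lra.
have XX : X `^ (1 - c1) <= X by rewrite -[leRHS]powRr1 ?(ltW X0)// ler_powR//; lra.
have J0 : (0 < J)%N by [].
have JQ : ((2 * J).-1 <= Q)%N.
  apply: leq_trans (leq_pred _) _; rewrite -(ler_nat R) natrM; exact: le_trans J4 XX.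
have Jd : J%:R^-1 <= d by rewrite -[leRHS]invrK lef_pV2 ?posrE ?invr_gt0 ?ltr0n// (le_trans Yd).
have xiL : xi <= eta + (xi - eta) by rewrite addrC subrK.
pose B := W * (X * l).
have B0 : 0 <= B by exact: mulr_ge0 (ltW W0) (mulr_ge0 (ltW X0) (ltW l0)).
have hB h : (0 < h <= (2 * J).-1)%N ->
    \sum_(p <- lattice_pts (g (eta - 1)) (g (xi + 1)) h) cutinv X (height F p) <= B * h%:R.
  move=> /andP[h0 hJ]; apply: (hW f g F G eta xi Q h cv (ltW exi) xiL Q2 h0).
  apply: le_trans J4; rewrite -natrM ler_nat; apply: leq_trans hJ (leq_pred _).
have disc := curve_discrepancy cv Q2 exi xiL B0 J0 JQ Jd d2 hB.
have PB := size_lattice_pts Q (ltW exi).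
have := @core_real u v w J%:R (size (lattice_pts eta xi Q))%:R
  (count (fun p => dist_int (height f p) < d) (lattice_pts eta xi Q))%:R (xi - eta) W E0 Dc B.
rewrite u3 v3 w3 -/Y => cr.
have {cr} := cr u1 v0 v1 w1 wuv YJ JY L0 (ler0n _ _) PB Dc0 E00 (ltW W0) (erefl B) disc.
by rewrite !powR_thirdn.
Qed.

End Core.

(** * The error term in the two ranges *)

Section Final.
Variable R : realType.

Lemma count_near_curveE (eta xi : R) (f : R -> R) (Q d : R) : 0 <= Q ->
  count_near_curve eta xi f Q d =
  count (fun p => dist_int (height f p) < d) (lattice_pts eta xi (Num.truncn Q)).
Proof.
move=> Q0; rewrite -size_filter; set L := seq.filter _ _.
have uL : uniq L by rewrite filter_uniq// lattice_pts_uniq.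
rewrite /count_near_curve.
have -> : near_curve eta xi f Q d = [set` [fset p in L]%fset].
  apply/seteqP; split => [[a q]|[a q]] /=.
    case=> q1 qQ ea ax dd; rewrite /= inE mem_filter mem_lattice_pts /height /= dd q1 ea ax /=.
    by rewrite andbT truncn_ge_nat.
  rewrite /= inE mem_filter mem_lattice_pts /height /= => /andP[dd /and3P[q1 qQ /andP[ea ax]]].
  by split=> //; rewrite -truncn_ge_nat.
by rewrite set_fsetK card_fseq undup_id.
Qed.

(** The exponent e = 2/3 - 2/(5-theta) is nonnegative, and raising delta <= c T(Q) to the power e
    trades the surplus of delta for the power of Q while cancelling the logarithm. *)
Lemma threshold_case (theta c X d : R) : 0 < theta -> theta < 1 -> 0 < c -> 1 < X -> 0 < d ->
  d <= c * threshold theta X ->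
  d `^ (2 / 3) * X `^ (5 / 3) * ln X `^ (2 / 3) <=
  c `^ ((4 - 2 * theta) / (3 * (5 - theta))) *
    (d `^ (2 / (5 - theta)) * X `^ (3 * (3 - theta) / (5 - theta))).
Proof.
move=> t0 t1 c0 X1 d0 dT; have X0 : 0 < X by apply: lt_trans X1.
have l0 : 0 < ln X by rewrite ln_gt0.
have t5 : 0 < 5 - theta by lra.
have t2 : 0 < 2 - theta by lra.
pose e := (4 - 2 * theta) / (3 * (5 - theta)).
have e0 : 0 <= e by rewrite divr_ge0 ?mulr_ge0 ?(ltW t5)//; lra.
have de : d `^ (2 / 3) = d `^ (2 / (5 - theta)) * d `^ e.
  by rewrite -powRDp//; congr (_ `^ _); rewrite /e; field; rewrite gt_eqF.
have T0 : 0 < threshold theta X by rewrite mulr_gt0 ?powR_gt0.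
have dle : d `^ e <= c `^ e * (X `^ (2 * (1 - 2 * theta) / (3 * (5 - theta))) * ln X `^ (- (2 / 3))).
  apply: (@le_trans _ _ ((c * threshold theta X) `^ e)).
    by rewrite ge0_ler_powR ?nnegrE ?(ltW d0)// (mulr_ge0 (ltW c0) (ltW T0)).
  rewrite powRM ?(ltW c0) ?(ltW T0)// /threshold powRM ?powR_ge0// -!powRrM.
  rewrite le_eqVlt; apply/orP; left; apply/eqP; congr (_ * (_ `^ _ * _ `^ _)); rewrite /e; field.
    by rewrite !gt_eqF.
  by rewrite !gt_eqF.
have Xe : X `^ (3 * (3 - theta) / (5 - theta)) = X `^ (5 / 3) * X `^ (2 * (1 - 2 * theta) / (3 * (5 - theta))).
  by rewrite -powRDp//; congr (_ `^ _); field; rewrite gt_eqF.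
have ll : ln X `^ (- (2 / 3)) * ln X `^ (2 / 3) = 1 by rewrite -powRDp// addNr powRr0.
rewrite de Xe.
set A := d `^ (2 / (5 - theta)); set B := X `^ (5 / 3); set Z := X `^ _ in dle *; set l1 := ln X `^ (2 / 3) in ll *.
have -> : c `^ ((4 - 2 * theta) / (3 * (5 - theta))) * (A * (B * Z)) = A * B * l1 * (c `^ e * (Z * ln X `^ (- (2 / 3)))).
  have -> : A * B * l1 * (c `^ e * (Z * ln X `^ (- (2 / 3)))) = A * B * c `^ e * Z * (ln X `^ (- (2 / 3)) * l1) by ring.
  by rewrite ll /e; ring.
have -> : A * d `^ e * B * l1 = A * B * l1 * d `^ e by ring.
by rewrite ler_wpM2l// !mulr_ge0 ?powR_ge0.
Qed.

Lemma error_bound (eta xi : R) (f f' f'' : R -> R) (theta eps : R) : eta < xi ->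
  is_derivative_on `[eta, xi] f f' -> is_derivative_on `[eta, xi] f' f'' ->
  {within `[eta, xi], continuous f''} -> bounded_away_from0 `[eta, xi] f'' ->
  0 < theta -> theta < 1 -> Lip theta `[eta, xi] f'' -> 0 < eps ->
  exists2 C : R, 0 < C & exists2 Q0 : R, 1 < Q0 & forall Q d : R, Q0 <= Q ->
    Q `^ (- ((1 + theta) / (3 - theta)) + eps) <= d -> d < 2^-1 ->
    `|error_near_curve eta xi f Q d| <= C * (d `^ (2 / 3) * Q `^ (5 / 3) * ln Q `^ (2 / 3)).
Proof.
move=> exi d1 d2 fc fa t0 t1 fL ep0.
have [k [fe [g [F [G [cv fE]]]]]] := curve_of_lip exi d1 d2 fc fa t0 fL.
have L0 : 0 < xi - eta by rewrite subr_gt0.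
pose rho := (1 + theta) / (3 - theta).
have rho1 : rho < 1 by rewrite /rho ltr_pdivrMr; lra.
(* 1 - rho is positive because theta < 1, so the admissible delta exceed Q^(s-1) for some s > 0; the
   minimum with 1 keeps al below 1. *)
pose s := Num.min (1 - rho + eps) 1.
have s0 : 0 < s by rewrite lt_min ltr01 andbT; lra.
have s1 : s <= 1 by rewrite ge_min lexx orbT.
have sr : s - 1 <= - rho + eps.
  have : s <= 1 - rho + eps by rewrite ge_min lexx.
  by lra.
(* The other half of s pays for replacing Q by its integer part N: Q <= 2 N, and 2 <= Q^al for large
   Q. *)
pose al := s / 2; have al0 : 0 < al by rewrite divr_gt0.
have al1 : al < 1 by rewrite /al; lra.
have [C C0 [N0 hC]] := core_bound cv exi al0 al1.
have [n2 hn2] := powR_large al0 (ler0n R 2).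
exists (C + 2 * (xi - eta)); first by rewrite addr_gt0// mulr_gt0.
pose Q0 : R := N0%:R + n2%:R + expR 1 + 2.
have e1 : 0 < expR 1 :> R by rewrite expR_gt0.
have [z1 z2] : 0 <= N0%:R :> R /\ 0 <= n2%:R :> R by [].
exists Q0; first by rewrite /Q0; lra.
move=> Q d QQ dl d12.
have [QN Qn Qe Q2] : [/\ N0%:R <= Q, n2%:R <= Q, expR 1 <= Q & 2 <= Q].
  by move: QQ; rewrite /Q0; split; lra.
have Qp : 0 < Q by lra.
have Q1 : 1 <= Q by lra.
have l1 : 1 <= ln Q by rewrite -[1]expRK ler_ln ?posrE.
pose N := Num.truncn Q.
have [NQ QN1] : N%:R <= Q /\ Q < N%:R + 1.
  by have /andP[a b] := truncn_itv (ltW Qp); rewrite natr1.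
have N0N : (N0 <= N)%N by rewrite truncn_ge_nat// ltW.
have N1 : 1 <= N%:R :> R by rewrite ler1n /N -ltnS ltnS truncn_ge_nat// ltW.
have Np : 0 < N%:R :> R by apply: lt_le_trans N1.
have d0 : 0 < d by apply: lt_le_trans dl; rewrite powR_gt0.
have dN : N%:R `^ (al - 1) <= d.
  apply: le_trans dl; apply: (@le_trans _ _ (Q `^ (s - 1))); last by rewrite ler_powR.
  have QN2 : Q <= 2 * N%:R by lra.
  have -> : s - 1 = al + (al - 1) by rewrite /al; field.
  rewrite (powRDp _ _ Qp).
  have -> : al - 1 = - (1 - al) by ring.
  rewrite !powRN ler_pdivlMr ?powR_gt0//.
  have q2 : Q `^ (1 - al) <= 2 * N%:R `^ (1 - al).
    apply: (@le_trans _ _ ((2 * N%:R) `^ (1 - al))).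
      by rewrite ge0_ler_powR ?nnegrE ?mulr_ge0 ?(ltW Qp)//; lra.
    rewrite powRM// ler_wpM2r ?powR_ge0// -[leRHS]powRr1// ler_powR ?ler1n//; lra.
  have p0 : 0 < N%:R `^ (1 - al) :> R by rewrite powR_gt0.
  rewrite mulrC ler_pdivrMr//; apply: (le_trans q2).
  by rewrite ler_pM2r// hn2.
have cE : (count_near_curve eta xi f Q d)%:R =
    (count (fun p => dist_int (height fe p) < d) (lattice_pts eta xi N))%:R :> R.
  rewrite count_near_curveE ?(ltW Qp)//; congr _%:R; apply: eq_in_count => p.
  rewrite mem_lattice_pts => /and3P[q0 _ /andP[a b]].
  have q0r : 0 < p.2%:R :> R by rewrite ltr0n.
  have pI : eta <= p.1%:~R / p.2%:R <= xi by rewrite ler_pdivlMr// ler_pdivrMr// b (ltW a).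
  by rewrite /height; case: fE => -> //; rewrite mulrN dist_intN.
pose EE x := d `^ (2 / 3) * x `^ (5 / 3) * ln x `^ (2 / 3).
have hN := hC N d N0N dN d12; rewrite -/(EE _) in hN.
have EN : EE N%:R <= EE Q.
  have lN : ln N%:R <= ln Q by rewrite ler_ln.
  have lN0 : 0 <= ln N%:R :> R by rewrite ln_ge0.
  have d23 : 0 <= d `^ (2 / 3) by rewrite powR_ge0.
  rewrite /EE; apply: ler_pM; rewrite ?mulr_ge0 ?powR_ge0//.
    by rewrite ler_wpM2l// ge0_ler_powR ?nnegrE ?divr_ge0 ?(ltW Qp).
  by rewrite ge0_ler_powR ?nnegrE ?divr_ge0// (le_trans lN0).
have dQ : d * Q <= EE Q.
  rewrite /EE -[d * Q]mulr1; apply: ler_pM; rewrite ?mulr_ge0 ?(ltW d0) ?(ltW Qp)//.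
    apply: ler_pM; rewrite ?(ltW d0) ?(ltW Qp)//.
      by apply: ger1_powR; lra.
    by apply: le1r_powR => //; lra.
  by rewrite -[leLHS](powRr0 (ln Q)) ler_powR// divr_ge0.
rewrite /error_near_curve cE.
set c := (count _ _)%:R in hN *.
have -> : c - (xi - eta) * d * Q ^+ 2 = (c - (xi - eta) * d * N%:R ^+ 2) - (xi - eta) * (d * (Q ^+ 2 - N%:R ^+ 2)) by ring.
apply: (le_trans (ler_normB _ _)); rewrite [leRHS]mulrDl; apply: lerD.
  by apply: (le_trans hN); rewrite ler_pM2l.
(* Replacing N^2 by Q^2 in the main term costs O(delta Q), which is below the error term. *)
have qd : 0 <= Q ^+ 2 - N%:R ^+ 2 <= 2 * Q by rewrite subr_sqr; nra.
case/andP: qd => q1 q2.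
rewrite ger0_norm ?mulr_ge0 ?(ltW L0) ?(ltW d0)//.
apply: (@le_trans _ _ ((xi - eta) * (d * (2 * Q)))).
  by rewrite ler_pM2l// ler_pM2l.
have -> : (xi - eta) * (d * (2 * Q)) = 2 * (xi - eta) * (d * Q) by ring.
by rewrite ler_pM2l// mulr_gt0.
Qed.

End Final.

Theorem theorem2 (R : realType) (eta xi : R) (f f' f'' : R -> R)
    (theta eps : R)
    (eta_lt_xi : eta < xi)
    (f_f' : is_derivative_on `[eta, xi] f f')
    (f'_f'' : is_derivative_on `[eta, xi] f' f'')
    (f''_cont : {within `[eta, xi], continuous f''})
    (f''_away : bounded_away_from0 `[eta, xi] f'')
    (theta_gt0 : 0 < theta) (theta_lt1 : theta < 1)
    (f''_Lip : Lip theta `[eta, xi] f'')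
    (eps_gt0 : 0 < eps) :
  exists2 Q0 : R, 1 <= Q0 &
  forall c : R, 0 < c ->
  exists2 C : R, 0 < C &
  forall Q delta : R, Q0 <= Q ->
    Q `^ (- ((1 + theta) / (3 - theta)) + eps) <= delta -> delta < 2^-1 ->
    (c * threshold theta Q <= delta ->
       `|error_near_curve eta xi f Q delta|
         <= C * (delta `^ (2 / 3) * Q `^ (5 / 3) * ln Q `^ (2 / 3)))
    /\
    (delta <= c * threshold theta Q ->
       `|error_near_curve eta xi f Q delta|
         <= C * (delta `^ (2 / (5 - theta))
                 * Q `^ (3 * (3 - theta) / (5 - theta)))).
Proof.
have [C C0 [Q0 Q01 hC]] :=
  error_bound eta_lt_xi f_f' f'_f'' f''_cont f''_away theta_gt0 theta_lt1 f''_Lip eps_gt0.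
exists Q0; first exact: ltW.
(* The 1 in the constant serves large delta, and c^e serves delta at most c T(Q), where
   [threshold_case] converts the bound. *)
move=> c c0; pose e := (4 - 2 * theta) / (3 * (5 - theta)).
have ce : 0 < c `^ e by rewrite powR_gt0.
exists (C * (1 + c `^ e)); first by rewrite mulr_gt0// addr_gt0.
move=> Q delta QQ dl d2; have h := hC Q delta QQ dl d2.
have Q1 : 1 < Q by apply: lt_le_trans QQ.
have d0 : 0 < delta by apply: lt_le_trans dl; rewrite powR_gt0// (lt_trans _ Q1).
split=> [_|dT]; apply: (le_trans h); rewrite -[leRHS]mulrA ler_pM2l// [leRHS]mulrDl [X in _ <= X + _]mul1r.
  by rewrite lerDl !mulr_ge0 ?powR_ge0.
apply: (le_trans (threshold_case theta_gt0 theta_lt1 c0 Q1 d0 dT)).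
by rewrite lerDr mulr_ge0 ?powR_ge0.
Qed.
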